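(* Under conditions (i), (ii), (iii) on $a$ (see context), $\mathcal H_0$ has codimension one in $\mathcal H$ and $\mathcal H$ has codimension one in $\mathcal W$. More precisely, $\mathcal W=\mathcal H+\mathbb R\psi_0$.
   Context: $Q_1,Q_2,Q_3,Q_4$ are the four quadrants of $\mathbb R^2$ in anticlockwise order starting from the top-right one, and $B(0,1)$ is the unit disc. Let $a:(0,1]\to[0,\infty]$ be measurable such that: (i) for every $\epsilon>0$ there is $c(\epsilon)>0$ with $a(r)\ge c(\epsilon)$ and $a(r)^{-1}\ge c(\epsilon)$ for all $r\in(\epsilon,1]$; (ii) $\int_0^1 \frac{a(r)}{r}dr<\infty$ and $\int_0^1\frac{r}{a(r)}dr<\infty$; (iii) there is $K>0$ such that $\frac1{\epsilon^2}\int_0^\epsilon \frac{r}{a(r)}\int_0^r\frac{a(s)}{s}\,ds\,dr<K$ for all $\epsilon\in(0,1)$. Let $\rho(x)=a(|x|)^{-1}$ on $(Q_1\cup Q_3)\cap B(0,1)$, $\rho(x)=a(|x|)$ on $(Q_2\cup Q_4)\cap B(0,1)$, $\rho=1$ otherwise, and $\mu(dx)=\rho\,dx$. Then $\rho,\rho^{-1}\in L^1_{\rm loc}(\mathbb R^2)$. $\mathcal E(u,v)=\int_{\mathbb R^2}\nabla u\cdot\nabla v\,\rho\,dx$, $\langle\cdot,\cdot\rangle$ is the scalar product of $L^2(\mathbb R^2,\mu)$, $\mathcal E_1=\mathcal E+\langle\cdot,\cdot\rangle$, and $\mathcal W=\{u\in W^{1,1}_{\rm loc}(\mathbb R^2):\mathcal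 E_1(u,u)<\infty\}$, a Hilbert space under $\mathcal E_1$. $\mathcal H$ and $\mathcal H_0$ are the closures in $(\mathcal W,\mathcal E_1)$ of $C_0^\infty(\mathbb R^2)$ and $C_0^\infty(\mathbb R^2\setminus\{0\})$ (smooth functions with compact support). $\psi_0(x)=(1-|x|^2)_+\psi(x)$, where $\psi(x)=1$ on $Q_1$, $\psi(x)=x_2/|x|$ on $Q_2$, $\psi(x)=0$ on $Q_3$, $\psi(x)=x_1/|x|$ on $Q_4$. *)

(* Defs.v *)
From HB Require Import structures.
From mathcomp Require Import all_boot all_order all_algebra.
From mathcomp Require Import all_classical all_reals all_analysis.
From mathcomp Require Import measurable_realfun.

Set Implicit Arguments.
Unset Strict Implicit.
Unset Printing Implicit Defensive.

Import Order.TTheory GRing.Theory Num.Theory.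
Import numFieldNormedType.Exports.

Local Open Scope classical_set_scope.
Local Open Scope ring_scope.

                                                                         
                                                                               
                                                                                 
                                                                             
                         

Section codimension.
Context (K : fieldType) (E : lmodType K).
Implicit Types U V : set E.

Definition is_subspace U : Prop :=
  U 0 /\ forall (c : K) u v, U u -> U v -> U (c *: u + v).

                                                                           
                                    
Definition has_codim U V (n : nat) : Prop :=
  [/\ is_subspace U, is_subspace V, U `<=` V &
      exists e : 'I_n -> E, (forall i, V (e i)) /\
        forall v, V v ->
          exists! c : 'rV[K]_n, U (v - \sum_(i < n) c 0 i *: e i)].

End codimension.

Section plane.
Context (R : realType).
Implicit Types (x w : R * R) (u v f g : R * R -> R) (O K : set (R * R)).

                                                     
Definition leb2 := (@lebesgue_measure R \x @lebesgue_measure R)%E.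

                                                                      
Definition enorm x : R := Num.sqrt (x.1 ^+ 2 + x.2 ^+ 2).

Definition e1 : R * R := (1, 0).
Definition e2 : R * R := (0, 1).

Fixpoint Ck (k : nat) f : Prop :=
  if k is k'.+1 then
    [/\ continuous f,
        forall x, derivable f x e1 /\ derivable f x e2,
        Ck k' ('D_e1 f) & Ck k' ('D_e2 f)]
  else continuous f.

Definition supp f : set (R * R) := closure [set x | f x != 0].

                                                                    
Definition test_function O : set (R * R -> R) :=
  [set f | [/\ forall k, Ck k f, compact (supp f) & supp f `<=` O]].

Definition L1loc u : Prop :=
  measurable_fun [set: R * R] u /\
  forall K, compact K -> leb2.-integrable K (EFin \o u).

Definition is_weak_deriv w u g : Prop :=
  L1loc g /\
  forall phi, test_function setT phi ->
    (\int[leb2]_x (u x * 'D_w phi x)%:E = - \int[leb2]_x (g x * phi x)%:E)%E.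

                                                                          
Definition weak_deriv w u : R * R -> R := xget 0 (is_weak_deriv w u).

Definition W11loc u : Prop :=
  [/\ L1loc u, exists g, is_weak_deriv e1 u g & exists g, is_weak_deriv e2 u g].

                                                                              
                                                                         
                  
Definition Q1 : set (R * R) := [set x | 0 < x.1 /\ 0 <= x.2].
Definition Q2 : set (R * R) := [set x | x.1 <= 0 /\ 0 < x.2].
Definition Q3 : set (R * R) := [set x | x.1 < 0 /\ x.2 <= 0].
Definition Q4 : set (R * R) := [set x | 0 <= x.1 /\ x.2 < 0].

Definition unit_disc : set (R * R) := [set x | enorm x < 1].

Definition psi x : R :=
  if x \in Q1 then 1
  else if x \in Q2 then x.2 / enorm x
  else if x \in Q4 then x.1 / enorm x
  else 0.

Definition psi0 : R * R -> R :=
  fun x => Num.max (1 - enorm x ^+ 2) 0 * psi x.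

Section weighted_spaces.
Context (a : R -> \bar R).

Definition rho x : \bar R :=
  if x \in (Q1 `|` Q3) `&` unit_disc then ((a (enorm x))^-1)%E
  else if x \in (Q2 `|` Q4) `&` unit_disc then a (enorm x)
  else 1%E.

Definition form u v : \bar R :=
  (\int[leb2]_x ((weak_deriv e1 u x * weak_deriv e1 v x
                  + weak_deriv e2 u x * weak_deriv e2 v x)%:E * rho x))%E.

                                                               
Definition scalar_mu u v : \bar R :=
  (\int[leb2]_x ((u x * v x)%:E * rho x))%E.

Definition form1 u v : \bar R := (form u v + scalar_mu u v)%E.

Definition Wsp : set (R * R -> R) :=
  [set u | W11loc u /\ (form1 u u < +oo)%E].

Definition closureW (S : set (R * R -> R)) : set (R * R -> R) :=
  [set u | Wsp u /\ forall eps : R, 0 < eps ->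
    exists2 f, S f & (form1 (u - f)%R (u - f)%R < (eps ^+ 2)%:E)%E].

Definition Hsp : set (R * R -> R) := closureW (test_function setT).

Definition H0sp : set (R * R -> R) := closureW (test_function (~` [set 0])).

End weighted_spaces.
End plane.

(* Main.v *)
Require Import Defs.
From HB Require Import structures.
From mathcomp Require Import all_boot all_order all_algebra.
From mathcomp Require Import all_classical all_reals all_analysis.
From mathcomp Require Import measurable_realfun.
From mathcomp Require Import ring lra.

Set Implicit Arguments.
Unset Strict Implicit.
Unset Printing Implicit Defensive.

Import Order.TTheory GRing.Theory Num.Theory.
Import numFieldNormedType.Exports.

Local Open Scope classical_set_scope.
Local Open Scope ring_scope.

(** The two integrability conditions say that al/r and r/al are integrable at the origin,
    where al is the profile of the weight: rho is 1/al(|x|) on Q1 and Q3 and al(|x|) on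
    Q2 and Q4.  Since 1/r <= al/r + 1/(r al), the function 1/(r al) is then not integrable.
    This asymmetry decides everything.  In Q1 and Q3 the angular part of the energy has
    infinite weight at the origin, and a function of finite energy settles on one value
    there; in Q2 and Q4 it may turn from one value to another at finite cost.  So each u in
    W has two numbers attached to it, its traces at the origin from Q1 and from Q3, and the
    theorem says that the three spaces are
        H0 = both traces are 0,   H = the traces are equal,   W = no condition.

    Traces ([lim_at]).  On a long annulus in Q1 some arc carries little angular energy
    ([kb_large], [good_radius]), so u nearly has one value k on it ([arc_bound]).  From
    there one moves along rays, where the square of the increment is at most the integral
    of al/r times the energy of the ray ([ray_bound]).  Integrated against the weight, with
    the third condition on a, this is the Hardy inequality
        integral over Q1, |x| < e, of (u - k)^2 rho  <=  16 K e^2 (energy of u there),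
    first for smooth functions on annuli ([hardy_smooth]), then for all of W, by
    mollification away from the origin ([approx_test]) and a cluster point of the constants
    k ([hardy_weak]).  The trace k is unique because rho has mass of larger order than e^2
    ([lim_unique]), it is linear in u ([lim_comb]) and continuous in the norm of W
    ([lim_bound]), and for a test function it is the value at 0 ([lim_test]).  The traces of
    psi0 are 1 and 0 ([psi0_lim1], [psi0_limN1]).

    Density ([density]).  A function with zero traces is approximated by a cutoff, zero near
    the origin, times a bounded truncation of a mollification.  The slope 1/d of the cutoff
    is compensated by the Hardy inequality with k = 0 in Q1 and Q3.  In Q2 and Q4 the
    truncated function is bounded, and d^-2 times the mass of the weight in |x| < 2 d is at
    most a multiple of the integral of al/r over (0, 2 d), which tends to 0.

    That psi0 belongs to W is seen from its difference quotients ([weak_deriv_ae]): they are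
    bounded by a multiple of 1/|x|, which is locally integrable in the plane, and the
    gradient is bounded in Q1 and Q3, where a gradient of order 1/|x| would have infinite
    energy ([psi0_energy]).

    With traces available, H0 and H are identified ([H0P], [HP]), and the codimensions and
    the decomposition are linear algebra: a test function with value 1 at the origin spans a
    complement of H0 in H, and psi0, whose traces differ by 1, one of H in W. *)

(** * Smooth functions and a smooth step *)

Section smooth.
Context (R : realType).
Implicit Types (f g q : R * R -> R) (x y : R * R) (k n : nat).

Definition smooth f := forall k, Ck k f.

Lemma Ck_cts k f : Ck k f -> continuous f.
Proof. by case: k => [//|k] [cf _ _ _]; exact: cf. Qed.

Lemma CkS k f : Ck k.+1 f -> Ck k f.
Proof.
elim: k f => [|k IH] f; first by case.
by case=> cf df d1 d2; split; [exact: cf|exact: df|exact: (IH _ d1)|exact: (IH _ d2)].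
Qed.

Lemma smooth_cts f : smooth f -> continuous f.
Proof. by move=> /(_ 0). Qed.

Lemma smooth_D1 f : smooth f -> smooth ('D_(@e1 R) f).
Proof. move=> sf k; have [_ _ d1 d2] := sf k.+1; exact: d1. Qed.

Lemma smooth_D2 f : smooth f -> smooth ('D_(@e2 R) f).
Proof. move=> sf k; have [_ _ d1 d2] := sf k.+1; exact: d2. Qed.

Lemma smooth_d1 f x : smooth f -> derivable f x (@e1 R).
Proof. move=> /(_ 1)[_ + _ _] => /(_ x)[d1 d2]; exact: d1. Qed.

Lemma smooth_d2 f x : smooth f -> derivable f x (@e2 R).
Proof. move=> /(_ 1)[_ + _ _] => /(_ x)[d1 d2]; exact: d2. Qed.

Lemma Ck_intro k f d1 d2 : continuous f ->
  (forall x, is_derive x (@e1 R) f (d1 x)) -> (forall x, is_derive x (@e2 R) f (d2 x)) ->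
  Ck k d1 -> Ck k d2 -> Ck k.+1 f.
Proof.
move=> cf h1 h2 c1 c2; split; first exact: cf.
- by move=> x; split; [have [d _] := h1 x|have [d _] := h2 x]; exact: d.
- suff -> : 'D_(@e1 R) f = d1 by exact: c1.
  by apply/funext => x; exact: derive_val.
- suff -> : 'D_(@e2 R) f = d2 by exact: c2.
  by apply/funext => x; exact: derive_val.
Qed.

Lemma Ck_der1 k f x : Ck k.+1 f -> is_derive x (@e1 R) f ('D_(@e1 R) f x).
Proof. by case=> _ /(_ x)[+ _] _ _ => /derivableP. Qed.

Lemma Ck_der2 k f x : Ck k.+1 f -> is_derive x (@e2 R) f ('D_(@e2 R) f x).
Proof. by case=> _ /(_ x)[_ +] _ _ => /derivableP. Qed.

Lemma Ck_cst k (c : R) : Ck k (cst c : R * R -> R).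
Proof.
elim: k c => [|k IH] c; first exact: cst_continuous.
by apply: (@Ck_intro k _ (cst 0) (cst 0)); [exact: cst_continuous|exact: (IH 0)|exact: (IH 0)].
Qed.

Lemma CkD k f g : Ck k f -> Ck k g -> Ck k (f \+ g).
Proof.
elim: k f g => [|k IH] f g Cf Cg.
  by move=> x; apply: cvgD; [exact: Cf|exact: Cg].
have [_ _ f1 f2] := Cf; have [_ _ g1 g2] := Cg.
apply: (@Ck_intro k _ ('D_(@e1 R) f \+ 'D_(@e1 R) g) ('D_(@e2 R) f \+ 'D_(@e2 R) g)).
- by move=> x; apply: cvgD; [exact: (Ck_cts Cf)|exact: (Ck_cts Cg)].
- by move=> x; apply: is_deriveD; [exact: Ck_der1 Cf|exact: Ck_der1 Cg].
- by move=> x; apply: is_deriveD; [exact: Ck_der2 Cf|exact: Ck_der2 Cg].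
- exact: (IH _ _ f1 g1).
- exact: (IH _ _ f2 g2).
Qed.

Lemma CkM k f g : Ck k f -> Ck k g -> Ck k (f \* g).
Proof.
elim: k f g => [|k IH] f g Cf Cg.
  by move=> x; apply: cvgM; [exact: Cf|exact: Cg].
have [_ _ f1 f2] := Cf; have [_ _ g1 g2] := Cg.
have key v x : is_derive x v f ('D_v f x) -> is_derive x v g ('D_v g x) ->
    is_derive x v (f \* g) (((f \* 'D_v g) \+ (g \* 'D_v f)) x).
  by move=> df dg; apply: is_derive_eq.
apply: (@Ck_intro k _ ((f \* 'D_(@e1 R) g) \+ (g \* 'D_(@e1 R) f))
    ((f \* 'D_(@e2 R) g) \+ (g \* 'D_(@e2 R) f))).
- by move=> x; apply: cvgM; [exact: (Ck_cts Cf)|exact: (Ck_cts Cg)].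
- by move=> x; apply: key; [exact: Ck_der1 Cf|exact: Ck_der1 Cg].
- by move=> x; apply: key; [exact: Ck_der2 Cf|exact: Ck_der2 Cg].
- exact: (CkD (IH _ _ (CkS Cf) g1) (IH _ _ (CkS Cg) f1)).
- exact: (CkD (IH _ _ (CkS Cf) g2) (IH _ _ (CkS Cg) f2)).
Qed.

(** Directional derivatives are ordinary derivatives along a line; this is how the one-
    variable chain rule is applied in the plane. *)
Lemma is_derive_dir (V : normedModType R) (f : V -> R) (x v : V) (d : R) :
  is_derive x v f d <-> is_derive (0 : R) 1 (fun h : R => f (h *: v + x)) d.
Proof.
have E : derive (fun h : R => f (h *: v + x)) 0 1 = derive f x v.
  rewrite /derive.
  set F1 := (X in lim (X @ _)); set F2 := (X in _ = lim (X @ _)).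
  suff -> : F1 = F2 by [].
  by apply/funext => h; rewrite /F1 /F2 /= scale0r add0r addr0 [h%:A]mulr1.
split => -[D1 D2]; split.
- by have := (derivable1P f x v).1 D1.
- by rewrite E.
- by apply: (derivable1P f x v).2.
- by rewrite -E.
Qed.

Lemma is_derive_comp1 (V : normedModType R) (h : R -> R) (q : V -> R) (x v : V) (d dq : R) :
  is_derive (q x) 1 h d -> is_derive x v q dq -> is_derive x v (h \o q) (d * dq).
Proof.
move=> dh /is_derive_dir dq0; apply/is_derive_dir.
apply: (@is_derive1_comp _ h (fun h : R => q (h *: v + x))).
by rewrite scale0r add0r.
Qed.

Lemma CkV k f : (forall x, 0 < f x) -> Ck k f -> Ck k (fun x => (f x)^-1).
Proof.
move=> f0; have fn0 x : f x != 0 by rewrite gt_eqF.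
elim: k => [|k IH] Cf; first by move=> x; apply: cvgV => //; exact: Cf.
have C1 := IH (CkS Cf).
have CN h : Ck k h -> Ck k (fun x => (f x)^-1 * (f x)^-1 * (-1 * h x)).
  move=> Ch; apply: (@CkM _ (fun x => (f x)^-1 * (f x)^-1)); first exact: CkM.
  by apply: (@CkM _ (cst (-1))) => //; exact: Ck_cst.
have key v x : is_derive x v f ('D_v f x) ->
    is_derive x v (fun x => (f x)^-1) ((f x)^-1 * (f x)^-1 * (-1 * 'D_v f x)).
  move=> [df _]; split; first exact: derivableV.
  by rewrite deriveV// mulN1r mulrN -mulNr; congr (_ * _); rewrite expr2 invfM.
have [cf _ f1 f2] := Cf.
apply: (@Ck_intro k _ (fun x => (f x)^-1 * (f x)^-1 * (-1 * 'D_(@e1 R) f x)) (fun x => (f x)^-1 * (f x)^-1 * (-1 * 'D_(@e2 R) f x))); [| | |exact: (CN _ f1)|exact: (CN _ f2)].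
- by move=> x; apply: cvgV => //; exact: cf.
- by move=> x; apply: key; exact: Ck_der1 Cf.
- by move=> x; apply: key; exact: Ck_der2 Cf.
Qed.

Lemma CkZ k (c : R) f : Ck k f -> Ck k (fun x => c * f x).
Proof. by move=> Cf; apply: (@CkM _ (cst c)) => //; exact: Ck_cst. Qed.

Lemma Ck_fst k : Ck k (fst : R * R -> R).
Proof.
case: k => [|k]; first by move=> x; exact: cvg_fst.
apply: (@Ck_intro k _ (cst 1) (cst 0)); [by move=> x; exact: cvg_fst| | |exact: (@Ck_cst k 1)|exact: (@Ck_cst k 0)].
- move=> x; apply/is_derive_dir => /=.
  rewrite [X in is_derive _ _ X](_ : _ = (fun h : R => h * 1 + x.1))//.
  by apply: is_derive_eq; rewrite /= addr0 scaler0 add0r scale1r.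
- move=> x; apply/is_derive_dir => /=.
  rewrite [X in is_derive _ _ X](_ : _ = (fun h : R => h * 0 + x.1))//.
  by apply: is_derive_eq; rewrite /= addr0 scaler0 add0r scale0r.
Qed.

Lemma Ck_snd k : Ck k (snd : R * R -> R).
Proof.
case: k => [|k]; first by move=> x; exact: cvg_snd.
apply: (@Ck_intro k _ (cst 0) (cst 1)); [by move=> x; exact: cvg_snd| | |exact: (@Ck_cst k 0)|exact: (@Ck_cst k 1)].
- move=> x; apply/is_derive_dir => /=.
  rewrite [X in is_derive _ _ X](_ : _ = (fun h : R => h * 0 + x.2))//.
  by apply: is_derive_eq; rewrite /= addr0 scaler0 add0r scale0r.
- move=> x; apply/is_derive_dir => /=.
  rewrite [X in is_derive _ _ X](_ : _ = (fun h : R => h * 1 + x.2))//.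
  by apply: is_derive_eq; rewrite /= addr0 scaler0 add0r scale1r.
Qed.

Lemma Ck_affine k f (c : R) (b : R * R) : Ck k f -> Ck k (fun x => f (c *: x + b)).
Proof.
have cc (h : R * R -> R) : continuous h -> continuous (fun x => h (c *: x + b)).
  move=> ch x; apply: (@continuous_comp _ _ _ (fun x => c *: x + b) h); last exact: ch.
  by apply: cvgD; [apply: cvgZr|exact: cvg_cst].
elim: k f => [|k IH] f Cf; first exact: cc.
have [cf _ f1 f2] := Cf.
have key v x : is_derive (c *: x + b) v f ('D_v f (c *: x + b)) ->
    is_derive x v (fun x => f (c *: x + b)) (c * 'D_v f (c *: x + b)).
  move=> /is_derive_dir D; apply/is_derive_dir.
  rewrite mulrC; pose F (h : R) := f (h *: v + (c *: x + b)).
  rewrite [X in is_derive _ _ X](_ : _ = F \o (fun h : R => c * h)); last first.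
    by apply/funext => h; rewrite /F /= scalerDr scalerA addrA.
  apply: is_derive1_comp; first by rewrite mulr0.
  by have := is_deriveZ c (is_derive_id (0 : R) (1 : R)); rewrite [c *: 1]mulr1.
apply: (@Ck_intro k _ (fun x => c * 'D_(@e1 R) f (c *: x + b)) (fun x => c * 'D_(@e2 R) f (c *: x + b))); [exact: cc| | |exact: (CkZ c (IH _ f1))|exact: (CkZ c (IH _ f2))].
- by move=> x; apply: key; exact: Ck_der1 Cf.
- by move=> x; apply: key; exact: Ck_der2 Cf.
Qed.

(** [flat 0] is the usual exp(-1/s) on the positive half line. The powers of 1/s are
    there because this family is closed under differentiation, so that all of it is
    smooth by induction. *)
Definition flat n (s : R) : R := if 0 < s then s^-1 ^+ n * expR (- s^-1) else 0.

Lemma flat_ge0 n (s : R) : 0 <= flat n s.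
Proof.
rewrite /flat; case: ifPn => // s0.
by rewrite mulr_ge0 ?expR_ge0// exprn_ge0// invr_ge0 ltW.
Qed.

Lemma flat_gt0 n (s : R) : 0 < s -> 0 < flat n s.
Proof. by move=> s0; rewrite /flat s0 mulr_gt0 ?expR_gt0// exprn_gt0// invr_gt0. Qed.

Lemma flat_le0 n (s : R) : s <= 0 -> flat n s = 0.
Proof. by rewrite /flat leNgt => /negbTE ->. Qed.

(** With m = n + 2 and y = 1/s, the inequality 1 + y/m <= exp(y/m) gives y^m exp(-y) <=
    m^m. The two spare powers of s give differentiability at 0. *)
Lemma flat_le_sqr n (s : R) : flat n s <= n.+2%:R ^+ n.+2 * s ^+ 2.
Proof.
rewrite /flat; case: ifPn => s0; last by rewrite mulr_ge0 ?sqr_ge0// exprn_ge0.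
set y := s^-1; have y0 : 0 < y by rewrite invr_gt0.
have m0 : 0 < n.+2%:R :> R by [].
have e1 : (y / n.+2%:R) ^+ n.+2 <= expR y.
  have -> : expR y = expR (y / n.+2%:R) ^+ n.+2.
    by rewrite -expRM_natl mulrC divfK// gt_eqF.
  apply: lerXn2r; rewrite ?nnegrE ?expR_ge0 ?divr_ge0 ?ltW//.
  by apply: lt_le_trans (expR_ge1Dx _); rewrite ltrDr.
have -> : s ^+ 2 = y ^- 2 by rewrite -exprVn invrK.
rewrite ler_pdivlMr ?exprn_gt0// mulrAC -exprD addn2 expRN.
rewrite ler_pdivrMr ?expR_gt0//.
by rewrite mulrC -ler_pdivrMr ?exprn_gt0// -expr_div_n.
Qed.

Lemma derive0_le_sqr (f : R -> R) (C : R) : (forall s, `|f s| <= C * s ^+ 2) ->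
  is_derive (0 : R) 1 f 0.
Proof.
move=> fC; have f0 : f 0 = 0.
  by apply/eqP; rewrite -normr_le0 (le_trans (fC 0))// expr2 mul0r mulr0.
have cv : h^-1 *: ((f \o shift 0) (h *: 1) - f 0) @[h --> 0^'] --> (0 : R).
  apply/cvgr0Pnorm_le => e e0.
  near=> h.
  have h0 : h != 0 by near: h; exact: nbhs_dnbhs_neq.
  rewrite /= addr0 [h%:A]mulr1 f0 subr0 [_ *: _]mulrC normrM normfV.
  rewrite ler_pdivrMr ?normr_gt0//.
  apply: le_trans (fC h) _.
  rewrite -normr_id -[h ^+ 2]real_normK ?num_real// expr2 mulrA normr_id.
  rewrite ler_wpM2r//.
  have C0 : 0 <= `|C| + 1 by rewrite addr_ge0.
  apply: (@le_trans _ _ ((`|C| + 1) * `|h|)).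
    by rewrite ler_wpM2r// ler_wpDr// ler_norm.
  rewrite mulrC -ler_pdivlMr ?ltr_wpDl//.
  near: h; apply: dnbhs0_le; by rewrite divr_gt0// ltr_wpDl.
by split; [apply/cvg_ex; exists 0|exact: cvg_lim cv].
Unshelve. all: by end_near. Qed.

Lemma flat_derive n (s : R) :
  is_derive s 1 (flat n) (flat n.+2 s - n%:R * flat n.+1 s).
Proof.
have [s0|s0|s0] := ltgtP 0 s.
- have E : \near s, s^-1 ^+ n * expR (- s^-1) = flat n s.
    by near=> t; rewrite /flat ifT//; near: t; exact: lt_nbhsr.
  apply: (near_eq_is_derive E).
  have dV : is_derive s 1 (fun s : R => s^-1) (- s ^- 2).
    by have := @is_deriveV R id s 1 1; rewrite [_ *: 1]mulr1; apply; rewrite gt_eqF.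
  have dX := is_deriveX n dV.
  have dE : is_derive s 1 (expR \o (fun s : R => - s^-1)) (expR (- s^-1) * - (- s ^- 2)).
    exact: is_derive1_comp.
  have dM := is_deriveM dX dE.
  set D := (X in is_derive _ _ _ X).
  rewrite (_ : (fun s1 : R => _) = ((fun s : R => s^-1) ^+ n * (expR \o (fun s : R => - s^-1)))); last first.
    by apply/funext => t; rewrite !fctE.
  apply: (is_derive_eq dM); rewrite /D.
  rewrite /flat s0 opprK /GRing.scale /= fctE -exprVn; set y := s^-1; set E1 := expR _.
  by clear E dX dM D; case: n => [|n] /=; rewrite ?exprS; ring.
- have E : \near s, 0 = flat n s.
    by near=> t; rewrite flat_le0//; apply: ltW; near: t; exact: lt_nbhsl.
  rewrite !(flat_le0 _ (ltW s0)) mulr0 subr0.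
  by apply: (near_eq_is_derive E); exact: is_derive_cst.
- rewrite -s0 !(flat_le0 _ (lexx 0)) mulr0 subr0.
  apply: (@derive0_le_sqr _ (n.+2%:R ^+ n.+2)) => t.
  by rewrite ger0_norm ?flat_ge0// flat_le_sqr.
Unshelve. all: by end_near. Qed.

Lemma flat_cts n : continuous (flat n).
Proof.
move=> s; have [+ _] := flat_derive n s.
by move=> /derivable1_diffP/differentiable_continuous.
Qed.

Lemma Ck_flat k n q : Ck k q -> Ck k (flat n \o q).
Proof.
have cc j g : continuous g -> continuous (flat j \o g).
  by move=> cg x; apply: continuous_comp; [exact: cg|exact: flat_cts].
elim: k n q => [|k IH] n q Cq; first exact: cc.
have [cq _ q1 q2] := Cq.
pose d v x := (flat n.+2 (q x) - n%:R * flat n.+1 (q x)) * 'D_v q x.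
have Cd v : Ck k ('D_v q) -> Ck k (d v).
  move=> Cv; apply: (@CkM _ (fun x => flat n.+2 (q x) - n%:R * flat n.+1 (q x))) => //.
  have -> : (fun x => flat n.+2 (q x) - n%:R * flat n.+1 (q x)) =
      ((flat n.+2 \o q) \+ (fun x => - n%:R * (flat n.+1 \o q) x)).
    by apply/funext => x /=; rewrite mulNr.
  exact: (CkD (IH _ _ (CkS Cq)) (CkZ _ (IH _ _ (CkS Cq)))).
apply: (@Ck_intro k _ (d (@e1 R)) (d (@e2 R))); [exact: cc| | |exact: (Cd _ q1)|exact: (Cd _ q2)].
- by move=> x; apply: is_derive_comp1; [exact: flat_derive|exact: Ck_der1 Cq].
- by move=> x; apply: is_derive_comp1; [exact: flat_derive|exact: Ck_der2 Cq].
Qed.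

Definition step (s : R) : R := flat 0 (s - 1) / (flat 0 (s - 1) + flat 0 (2 - s)).

Lemma step_den_gt0 (s : R) : 0 < flat 0 (s - 1) + flat 0 (2 - s).
Proof.
have [s1|s1] := ltP 1 s.
  by rewrite ltr_pwDl ?flat_ge0// flat_gt0// subr_gt0.
by rewrite ltr_wpDl ?flat_ge0// flat_gt0//; lra.
Qed.

Lemma step_ge0 s : 0 <= step s.
Proof. by rewrite divr_ge0 ?flat_ge0 ?(ltW (step_den_gt0 _)). Qed.

Lemma step_le1 s : step s <= 1.
Proof. by rewrite ler_pdivrMr ?step_den_gt0// mul1r ler_wpDr ?flat_ge0. Qed.

Lemma step0 s : s <= 1 -> step s = 0.
Proof. by move=> s1; rewrite /step flat_le0 ?mul0r//; lra. Qed.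

Lemma step1 s : 2 <= s -> step s = 1.
Proof.
move=> s1; have d0 := step_den_gt0 s; rewrite /step.
by move: d0; rewrite (@flat_le0 _ (2 - s)) ?addr0 => [d0|]; [rewrite divff// gt_eqF|lra].
Qed.

Lemma Ck_step k q : Ck k q -> Ck k (step \o q).
Proof.
move=> Cq.
have C1 : Ck k (flat 0 \o (fun x => q x - 1)).
  by apply: Ck_flat; apply: (@CkD k q (cst (- 1))) => //; exact: Ck_cst.
have C2 : Ck k (flat 0 \o (fun x => 2 - q x)).
  apply: Ck_flat; rewrite (_ : (fun x => 2 - q x) = cst 2 \+ (fun x => -1 * q x)).
    by apply: CkD; [exact: Ck_cst|exact: CkZ].
  by apply/funext => x /=; rewrite mulN1r.
apply: (CkM C1).
by apply: (@CkV k ((flat 0 \o (fun x => q x - 1)) \+ (flat 0 \o (fun x => 2 - q x)))); [move=> x; exact: step_den_gt0|exact: CkD].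
Qed.

Definition nsq x : R := x.1 ^+ 2 + x.2 ^+ 2.

Lemma Ck_nsq k : Ck k nsq.
Proof.
rewrite (_ : nsq = (fst \* fst) \+ (snd \* snd)); last first.
  by apply/funext => x; rewrite /nsq !expr2.
by apply: CkD; apply: CkM; first [exact: Ck_fst|exact: Ck_snd].
Qed.

Lemma C1_MVT v f x (h : R) : continuous f -> (forall y, derivable f y v) ->
  exists2 t, `|t| <= `|h| & f (h *: v + x) - f x = h * 'D_v f (t *: v + x).
Proof.
move=> cf df; pose F (s : R) := f (s *: v + x).
have dF (s : R) : is_derive s 1 F ('D_v f (s *: v + x)).
  have /derivableP/is_derive_dir [d1 d2] := df (s *: v + x).
  have -> : F = (fun h => f (h *: v + (s *: v + x))) \o (fun t => t - s).
    by apply/funext => t /=; rewrite /F addrA -scalerDl subrK.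
  rewrite -[X in is_derive _ _ _ X]mulr1.
  apply: is_derive1_comp; rewrite ?subrr; first by split.
  by apply: is_derive_eq; rewrite subr0.
have cF : continuous F.
  by move=> s; have [+ _] := dF s => /derivable1_diffP/differentiable_continuous.
have F0 : F 0 = f x by rewrite /F scale0r add0r.
have [h0|h0] := leP 0 h.
- have [c] := @MVT_segment _ F (fun s => 'D_v f (s *: v + x)) 0 h h0 (fun s _ => dF s) (continuous_subspaceT cF).
  rewrite in_itv /= => /andP[c0 ch] E; exists c; first by rewrite !ger0_norm.
  by rewrite -F0 -/(F h) E subr0 mulrC.
- have [c] := @MVT_segment _ F (fun s => 'D_v f (s *: v + x)) h 0 (ltW h0) (fun s _ => dF s) (continuous_subspaceT cF).
  rewrite in_itv /= => /andP[c0 ch] E; exists c; first by rewrite !ler0_norm ?(ltW h0)// lerN2.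
  by rewrite -F0 -/(F h) -opprB E sub0r mulrN opprK mulrC.
Qed.

(** The mean value theorem along the first and then the second axis. Partial derivatives
    are only assumed directionally, so total differentiability has to be recovered from
    their continuity. *)
Lemma C1_increment f x : Ck 1 f -> forall e : R, 0 < e -> exists2 d : R, 0 < d &
  forall h : R * R, `|h.1| < d -> `|h.2| < d ->
  `|f (h + x) - f x - (h.1 * 'D_(@e1 R) f x + h.2 * 'D_(@e2 R) f x)|
     <= e * (`|h.1| + `|h.2|).
Proof.
move=> Cf e e0; have [cf df c1 c2] := Cf.
have /cvgrPdist_le/(_ _ e0) /nbhs_ballP[d1 /= d10 H1] := c1 x.
have /cvgrPdist_le/(_ _ e0) /nbhs_ballP[d2 /= d20 H2] := c2 x.
exists (Num.min d1 d2); first by rewrite lt_min d10.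
move=> h; rewrite !lt_min => /andP[h11 h12] /andP[h21 h22].
have [t1 t1h E1] := @C1_MVT (@e1 R) f (h.2 *: @e2 R + x) h.1 cf (fun y => (df y).1).
have [t2 t2h E2] := @C1_MVT (@e2 R) f x h.2 cf (fun y => (df y).2).
have hE : h + x = h.1 *: @e1 R + (h.2 *: @e2 R + x).
  case: h {h11 h12 h21 h22 t1h t2h E1 E2} => a b; case: x {H1 H2} => p q.
  by apply: injective_projections; rewrite /= /GRing.scale /= !(mulr1, mulr0, add0r).
have -> : f (h + x) - f x - (h.1 * 'D_(@e1 R) f x + h.2 * 'D_(@e2 R) f x) =
  h.1 * ('D_(@e1 R) f (t1 *: @e1 R + (h.2 *: @e2 R + x)) - 'D_(@e1 R) f x) +
  h.2 * ('D_(@e2 R) f (t2 *: @e2 R + x) - 'D_(@e2 R) f x).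
  by rewrite hE; lra.
apply: le_trans (ler_normD _ _) _; rewrite [e * _]mulrC mulrDl !normrM.
apply: lerD; apply: ler_wpM2l => //; rewrite distrC.
- apply: H1; split; rewrite /= /ball /= /GRing.scale /= !(mulr1, mulr0, add0r) opprD addrC subrK normrN.
  + exact: le_lt_trans t1h h11.
  + exact: h21.
- apply: H2; split; rewrite /= /ball /= /GRing.scale /= !(mulr1, mulr0, add0r) ?subrr ?normr0//.
  by rewrite opprD addrC subrK normrN; exact: le_lt_trans t2h h22.
Qed.

Lemma is_derive_curve f (p1 p2 : R -> R) (s d1 d2 : R) : Ck 1 f ->
  is_derive s 1 p1 d1 -> is_derive s 1 p2 d2 ->
  is_derive s 1 (fun t => f (p1 t, p2 t))
    (d1 * 'D_(@e1 R) f (p1 s, p2 s) + d2 * 'D_(@e2 R) f (p1 s, p2 s)).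
Proof.
move=> Cf D1 D2.
set x := (p1 s, p2 s); set A := 'D_(@e1 R) f x; set B := 'D_(@e2 R) f x.
have cp (p : R -> R) (d : R) : is_derive s 1 p d -> h^-1 * (p (h + s) - p s) @[h --> 0^'] --> d.
  move=> [dp <-]; 
  rewrite (_ : (fun h => h^-1 * (p (h + s) - p s)) = (fun h : R => h^-1 *: ((p \o shift s) (h *: 1) - p s))); last first.
    by apply/funext => h; rewrite /= [_%:A]mulr1.
  exact: dp.
have cp1 := cp _ _ D1; have cp2 := cp _ _ D2.
have cq (p : R -> R) (d : R) : h^-1 * (p (h + s) - p s) @[h --> 0^'] --> d ->
    p (h + s) - p s @[h --> 0^'] --> (0 : R).
  move=> cd; rewrite -[X in _ --> X](mul0r d).
  apply: (@cvg_trans _ ((h * (h^-1 * (p (h + s) - p s))) @[h --> 0^'])).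
    apply: near_eq_cvg; near=> h; rewrite mulrA divff ?mul1r//.
    by near: h; exact: nbhs_dnbhs_neq.
  by apply: cvgM => //; exact: nbhs_dnbhs.
have cq1 := cq _ _ cp1; have cq2 := cq _ _ cp2.
have key : h^-1 *: (((fun t => f (p1 t, p2 t)) \o shift s) (h *: 1) - f x) @[h --> 0^'] --> d1 * A + d2 * B.
  have -> : d1 * A + d2 * B = d1 * A + d2 * B + 0 by rewrite addr0.
  set E := fun h : R => h^-1 * (f (p1 (h + s), p2 (h + s)) - f x - ((p1 (h + s) - p1 s) * A + (p2 (h + s) - p2 s) * B)).
  rewrite (_ : (fun h => _) = (fun h => h^-1 * (p1 (h + s) - p1 s) * A + h^-1 * (p2 (h + s) - p2 s) * B + E h)); last first.
    apply/funext => h; rewrite /= /E [_%:A]mulr1 [LHS]/GRing.scale /=.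
    by ring.
  apply: cvgD.
    by apply: cvgD; (apply: cvgM; [by []|exact: cvg_cst]).
  apply/cvgr0Pnorm_le => e e0.
  set C := `|d1| + `|d2| + 2.
  have C0 : 0 < C by rewrite ltr_wpDl// addr_ge0.
  have eC : 0 < e / C by rewrite divr_gt0.
  have [d d0 H] := C1_increment x Cf eC.
  have /cvgr0Pnorm_lt/(_ _ d0) N1 := cq1.
  have /cvgr0Pnorm_lt/(_ _ d0) N2 := cq2.
  have /cvgrPdist_le/(_ _ ltr01) N3 := cp1.
  have /cvgrPdist_le/(_ _ ltr01) N4 := cp2.
  near=> h.
  have n1 : `|p1 (h + s) - p1 s| < d by near: h.
  have n2 : `|p2 (h + s) - p2 s| < d by near: h.
  have n3 : `|d1 - h^-1 * (p1 (h + s) - p1 s)| <= 1 by near: h.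
  have n4 : `|d2 - h^-1 * (p2 (h + s) - p2 s)| <= 1 by near: h.
  have := H (p1 (h + s) - p1 s, p2 (h + s) - p2 s) n1 n2.
  rewrite /= (_ : _ + x = (p1 (h + s), p2 (h + s))); last by rewrite /x; congr pair; rewrite /= subrK.
  move=> Hh; rewrite /E normrM.
  apply: le_trans (ler_wpM2l (normr_ge0 _) Hh) _.
  rewrite mulrCA mulrDr -!normrM -ler_pdivlMl// invf_div mulrC divfK ?gt_eqF//.
  rewrite /C; set u := h^-1 * _ in n3 *; set v := h^-1 * _ in n4 *.
  have hu : `|u| <= `|d1| + 1.
    by rewrite -[u](subKr d1); apply: le_trans (ler_normB _ _) _; rewrite lerD2l.
  have hv : `|v| <= `|d2| + 1.
    by rewrite -[v](subKr d2); apply: le_trans (ler_normB _ _) _; rewrite lerD2l.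
  rewrite [(_ - _) / h]mulrC -/u; lra.
split; first by apply/cvg_ex; exists (d1 * A + d2 * B).
exact: cvg_lim key.
Unshelve. all: by end_near. Qed.

End smooth.

(** * Change of variables and polar coordinates in the plane *)

Section measure.
Context (R : realType).
Local Open Scope ereal_scope.
Local Notation mu := (@lebesgue_measure R).
Local Notation lb2 := (@leb2 R).

Lemma lebesgue_affine (c b : R) (A : set R) : c != 0%R -> measurable A ->
  mu A = (`|c|%:E * mu ((fun x : R => c * x + b)%R @^-1` A)).
Proof.
move=> c0 mA.
have mf : measurable_fun [set: measurableTypeR R] (fun x : measurableTypeR R => (c * x + b)%R : measurableTypeR R).
  by apply: measurable_funD => //; exact: measurable_funM.
pose mf_mixin := isMeasurableFun.Build _ _ _ _ _ mf.
pose F : {mfun _ >-> _} := HB.pack (fun x : measurableTypeR R => (c * x + b)%R : measurableTypeR R) mf_mixin.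
have k0 : (0 <= `|c|)%R by [].
unshelve epose (pm := (pushforward mu F : {measure set (measurableTypeR R) -> \bar R})).
  exact: mf.
pose m := mscale (NngNum k0) pm.
rewrite (@lebesgue_measure_unique R m _ A mA)//.
move=> _ [[x y]] _ <- /=.
rewrite /m /mscale /pm /= /pushforward /=.
have [c_gt0|c_lt0] := ltP 0%R c.
- rewrite (_ : _ @^-1` _ = `](x - b) / c, (y - b) / c]%classic)%R; last first.
    by apply/seteqP; split => z /=; rewrite !in_itv /= ltr_pdivrMr// ler_pdivlMr// ltrBlDr lerBrDr mulrC.
  rewrite !lebesgue_measure_itv /= !lte_fin ltr_pM2r ?invr_gt0// ltrD2r.
  case: ifPn => _; last by rewrite mule0.
  by rewrite -!EFinD -EFinM gtr0_norm//; congr (_%:E); rewrite -mulrBl mulrC divfK//; ring.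
- have {}c_lt0 : (c < 0)%R by rewrite lt_neqAle c0.
  rewrite (_ : _ @^-1` _ = `[(y - b) / c, (x - b) / c[%classic)%R; last first.
    by apply/seteqP; split => z /=; rewrite !in_itv /= ltr_ndivlMr// ler_ndivrMr// ltrBlDr lerBrDr mulrC andbC.
  rewrite !lebesgue_measure_itv /= !lte_fin ltr_nM2r ?invr_lt0// ltrD2r.
  case: ifPn => _; last by rewrite mule0.
  by rewrite -!EFinD -EFinM ltr0_norm//; congr (_%:E); rewrite -mulrBl mulNr mulrC divfK//; ring.
Qed.

(** Lebesgue measure scales by |c| under an affine map, which is checked on intervals;
    the integral formula is the change of variables for push-forwards. *)
Lemma int1_affine (c b : R) (f : R -> \bar R) : c != 0%R ->
  measurable_fun [set: R] f -> (forall x, 0 <= f x) ->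
  \int[mu]_x f x = `|c|%:E * \int[mu]_x f (c * x + b)%R.
Proof.
move=> c0 mf f0.
have mF : measurable_fun [set: measurableTypeR R] (fun x : measurableTypeR R => (c * x + b)%R : measurableTypeR R).
  by apply: measurable_funD => //; exact: measurable_funM.
pose mf_mixin := isMeasurableFun.Build _ _ _ _ _ mF.
pose F : {mfun _ >-> _} := HB.pack (fun x : measurableTypeR R => (c * x + b)%R : measurableTypeR R) mf_mixin.
have k0 : (0 <= `|c|)%R by [].
rewrite -(@ge0_integral_pushforward _ _ _ _ _ _ mF mu setT f)//.
unshelve epose (pm := (pushforward mu F : {measure set (measurableTypeR R) -> \bar R})).
  exact: mF.
rewrite -(@ge0_integral_mscale _ _ _ pm _ measurableT (NngNum k0) f)//.
by apply: eq_measure_integral => A mA _ /=; rewrite (lebesgue_affine b c0).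
Qed.

Section tonelli.
Variable f : R * R -> \bar R.
Hypothesis mf : measurable_fun [set: R * R] f.
Hypothesis f0 : forall x, 0 <= f x.

Lemma tonelli1 : \int[lb2]_x f x = \int[mu]_x \int[mu]_y f (x, y).
Proof. exact: (@fubini_tonelli1 _ _ (measurableTypeR R) (measurableTypeR R) R mu mu f mf f0). Qed.

Lemma tonelli2 : \int[lb2]_x f x = \int[mu]_y \int[mu]_x f (x, y).
Proof. exact: (@fubini_tonelli2 _ _ (measurableTypeR R) (measurableTypeR R) R mu mu f mf f0). Qed.

Lemma tonelli_m1 : measurable_fun [set: R] (fun x => \int[mu]_y f (x, y)).
Proof. exact: (@measurable_fun_fubini_tonelli_F _ _ (measurableTypeR R) (measurableTypeR R) R mu f mf f0). Qed.

Lemma tonelli_m2 : measurable_fun [set: R] (fun y => \int[mu]_x f (x, y)).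
Proof. exact: (@measurable_fun_fubini_tonelli_G _ _ (measurableTypeR R) (measurableTypeR R) R mu f mf f0). Qed.

Lemma tonelli_s1 x : measurable_fun [set: R] (fun y => f (x, y)).
Proof. exact: (measurable_fun_pair2 x mf). Qed.

Lemma tonelli_s2 y : measurable_fun [set: R] (fun x => f (x, y)).
Proof. exact: (measurable_fun_pair1 y mf). Qed.

End tonelli.

Lemma int2_affine (c : R) (z : R * R) (f : R * R -> \bar R) : c != 0%R ->
  measurable_fun [set: R * R] f -> (forall x, 0 <= f x) ->
  \int[lb2]_x f x = (c ^+ 2)%:E * \int[lb2]_x f (c *: x + z)%R.
Proof.
move=> c0 mf f0.
have mA : measurable_fun [set: R * R] (fun x : R * R => (c *: x + z)%R).
  apply: measurable_fun_pair.
    apply: measurable_funD => //; apply: measurable_funM => //; exact: measurable_fst.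
  apply: measurable_funD => //; apply: measurable_funM => //; exact: measurable_snd.
have mfA := measurableT_comp mf mA.
rewrite (tonelli1 mf f0) (tonelli1 mfA (fun x => f0 _)).
rewrite (@int1_affine c z.1 (fun x => \int[mu]_y f (x, y)) c0 (tonelli_m1 mf f0))//; last first.
  by move=> x; apply: integral_ge0.
under eq_integral => x _.
  rewrite (@int1_affine c z.2)//; last exact: tonelli_s1.
  over.
rewrite ge0_integralZl//; last 2 first.
- exact: (tonelli_m1 mfA (fun x => f0 _)).
- by move=> x _; exact: integral_ge0.
by rewrite muleA -EFinM -normrM -expr2 ger0_norm// sqr_ge0.
Qed.

(** The Borel sets of the plane are the product sigma-algebra because an open set is a
    countable union of rational rectangles. *)
Lemma open_measurable2 (U : set (R * R)) : open U -> measurable U.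
Proof.
move=> oU.
pose B (q : rat * rat * nat) : set (R * R) :=
  ball (ratr q.1.1 : R) q.2.+1%:R^-1 `*` ball (ratr q.1.2 : R) q.2.+1%:R^-1.
pose F (n : nat) : set (R * R) := if unpickle n is Some q then
   (if `[< B q `<=` U >] then B q else set0) else set0.
have -> : U = \bigcup_n F n.
  apply/seteqP; split => [x Ux|x [n _]]; last first.
    rewrite /F; case: unpickle => [q|//]; case: ifPn => // /asboolP BU; exact: BU.
  have /nbhs_ballP[e /= e0 He] : nbhs x U by apply: open_nbhs_nbhs.
  have [n ne] : exists n, (n.+1%:R^-1 < e / 2 :> R)%R.
    near \oo => n; exists n; near: n.
    by have := @near_infty_natSinv_lt R (PosNum (divr_gt0 e0 (ltr0n _ 2))).
  have n0 : (0 < n.+1%:R^-1 :> R)%R by rewrite invr_gt0.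
  set d := (n.+1%:R^-1 : R)%R in ne n0.
  have w1 : (x.1 - d < x.1 + d)%R by lra.
  have w2 : (x.2 - d < x.2 + d)%R by lra.
  have [q1 Hq1] := @rat_in_itvoo R _ _ w1.
  have [q2 Hq2] := @rat_in_itvoo R _ _ w2.
  exists (pickle (q1, q2, n)); first exact: Logic.I.
  rewrite /F pickleK.
  move: Hq1 Hq2; rewrite !in_itv /= => /andP[a1 a2] /andP[b1 b2].
  rewrite asboolT; last first.
    move=> y [/= y1 y2]; apply: He; split; rewrite /ball /=.
      by move: y1; rewrite /ball /= -/d !ltr_distl => /andP[? ?]; lra.
    have : (`|ratr q2 - y.2| < d)%R := y2.
    by rewrite !ltr_distl => /andP[? ?]; lra.
  by split; rewrite /ball /= -/d ltr_distl; lra.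
apply: bigcupT_measurable => n; rewrite /F; case: unpickle => // q.
by case: ifPn => // _; apply: measurableX; exact: measurable_ball.
Unshelve. all: by end_near. Qed.

Lemma continuous_measurable2 (f : R * R -> R) : continuous f ->
  measurable_fun [set: R * R] f.
Proof.
move=> cf; apply: (measurability _ (RGenOInfty.measurableE R)).
move=> _ [_ [x ->] <-]; rewrite setTI; apply: open_measurable2.
by apply: open_comp => // y _; exact: cf.
Qed.

(** Polar coordinates with the slope t in place of the angle, and with r of both signs:
    then t > 0 covers the first and third quadrants and t < 0 the other two, up to a
    null set. The substitution only uses affine changes of variable in one dimension at
    a time, and the angular measure is dt / (1 + t^2). *)
Definition ray (t r : R) : R * R :=
  (r / Num.sqrt (1 + t ^+ 2), r / Num.sqrt (1 + t ^+ 2) * t)%R.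

Lemma measurable_ray : measurable_fun [set: R * R] (fun p : R * R => ray p.1 p.2).
Proof.
have cs : continuous (fun p : R * R => p.2 / Num.sqrt (1 + p.1 ^+ 2))%R.
  move=> p; have s0 : (0 < Num.sqrt (1 + p.1 ^+ 2))%R by rewrite sqrtr_gt0 ltr_pwDl// sqr_ge0.
  apply: cvgM; first exact: cvg_snd.
  apply: cvgV; first by rewrite gt_eqF.
  apply: (@continuous_comp _ _ _ (fun p : R * R => 1 + p.1 ^+ 2)%R Num.sqrt); last exact: sqrt_continuous.
  by apply: cvgD; [exact: cvg_cst|apply: cvgM; exact: cvg_fst].
apply: measurable_fun_pair; apply: continuous_measurable2 => //.
by move=> p; apply: cvgM; [exact: cs|exact: cvg_fst].
Qed.

Lemma measurable_ray2 t : measurable_fun [set: R] (ray t).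
Proof. exact: measurable_fun_pair2 measurable_ray. Qed.

(** Two affine substitutions on lines: y = x t with x fixed, then x = r / sqrt (1 + t^2)
    with t fixed, and an exchange of the integrals. *)
Theorem polar (f : R * R -> \bar R) :
  measurable_fun [set: R * R] f -> (forall x, 0 <= f x) ->
  \int[lb2]_x f x = \int[mu]_t \int[mu]_r (f (ray t r) * (`|r| / (1 + t ^+ 2))%:E).
Proof.
move=> mf f0.
have mg : measurable_fun [set: R * R] (fun p : R * R => (`|p.1|%:E * f (p.1, p.1 * p.2)%R)).
  apply: emeasurable_funM.
    by apply/measurable_EFinP; apply: measurableT_comp => //; exact: measurable_fst.
  apply: (measurableT_comp mf); apply: measurable_fun_pair; first exact: measurable_fst.
  by apply: measurable_funM; [exact: measurable_fst|exact: measurable_snd].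
have g0 (p : R * R) : 0 <= `|p.1|%:E * f (p.1, p.1 * p.2)%R by rewrite mule_ge0.
rewrite (tonelli1 mf f0).
transitivity (\int[mu]_x \int[mu]_t (`|x|%:E * f (x, x * t)%R)).
  apply: ge0_ae_eq_integral => //.
  - exact: (tonelli_m1 mf f0).
  - exact: (tonelli_m1 mg g0).
  - by move=> x _; exact: integral_ge0.
  - by move=> x _; apply: integral_ge0 => t _; exact: (g0 (x, t)).
  - exists [set 0%R]; split => //; first exact: lebesgue_measure_set1.
    move=> x /= Hx; apply: contrapT => x0; apply: Hx => _.
    rewrite (@int1_affine x 0 (fun y => f (x, y)))//; [|exact/eqP|exact: tonelli_s1].
    rewrite -ge0_integralZl//; last first.
      have := tonelli_s1 mf x => /measurableT_comp; apply.
      by apply: measurable_funD => //; exact: measurable_funM.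
    by apply: eq_integral => t _; rewrite addr0.
rewrite -(tonelli1 mg g0) (tonelli2 mg g0); apply: eq_integral => t _ /=.
have s0 : (0 < Num.sqrt (1 + t ^+ 2))%R by rewrite sqrtr_gt0 ltr_pwDl// sqr_ge0.
rewrite (@int1_affine (Num.sqrt (1 + t ^+ 2))^-1%R 0)//; first last.
- by move=> x; exact: (g0 (x, t)).
- exact: (tonelli_s2 mg).
- by rewrite invr_eq0 gt_eqF.
rewrite -ge0_integralZl//; last first.
  by move=> x _; exact: (g0 (_, t)).
  have := tonelli_s2 mg t => /measurableT_comp; apply.
  by apply: measurable_funD => //; exact: measurable_funM.
apply: eq_integral => r _.
rewrite addr0 /ray mulrC; set c := (r / _)%R.
rewrite muleA muleC; congr (_ * _)%E.
rewrite -EFinM; congr (_%:E).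
rewrite normrM !normfV (gtr0_norm s0) mulrCA -invfM -expr2 sqr_sqrtr//.
by rewrite addr_ge0// sqr_ge0.
Qed.

End measure.

(** * Continuity of translations in L1 and L2 *)

Section cauchy_schwarz.
Context d (T : measurableType d) (R : realType) (m : {measure set T -> \bar R}).
Variables (D : set T) (mD : measurable D).
Local Open Scope ereal_scope.

(** A finite form for integrals that are not known to be finite beforehand: the integral
    of the product is returned as a real number c. *)
Lemma cauchy_schwarz (f g : T -> R) (A B : R) :
  measurable_fun D f -> measurable_fun D g ->
  (forall x, D x -> 0 <= f x)%R -> (forall x, D x -> 0 <= g x)%R ->
  \int[m]_(x in D) (f x ^+ 2)%:E <= A%:E ->
  \int[m]_(x in D) (g x ^+ 2)%:E <= B%:E ->
  exists2 c : R, \int[m]_(x in D) (f x * g x)%:E = c%:E & (0 <= c /\ c ^+ 2 <= A * B)%R.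
Proof.
move=> mf mg f0 g0 fA gB.
have A0 : (0 <= A)%R by rewrite -lee_fin (le_trans _ fA)// integral_ge0// => x _; rewrite lee_fin sqr_ge0.
have B0 : (0 <= B)%R by rewrite -lee_fin (le_trans _ gB)// integral_ge0// => x _; rewrite lee_fin sqr_ge0.
have mfg : measurable_fun D (fun x => (f x * g x)%:E) by apply/measurable_EFinP; exact: measurable_funM.
have key (l : R) : (0 < l)%R -> \int[m]_(x in D) (f x * g x)%:E <= ((l * A + l^-1 * B) / 2)%:E.
  move=> l0; have l0' : (0 <= l^-1)%R by rewrite invr_ge0 ltW.
  have mf2 : measurable_fun D (fun x => (f x ^+ 2)%:E) by apply/measurable_EFinP; exact: measurable_funX.
  have mg2 : measurable_fun D (fun x => (g x ^+ 2)%:E) by apply/measurable_EFinP; exact: measurable_funX.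
  apply: (@le_trans _ _ (\int[m]_(x in D) ((l / 2)%:E * (f x ^+ 2)%:E + (l^-1 / 2)%:E * (g x ^+ 2)%:E))).
    apply: ge0_le_integral => //.
    - by move=> x Dx; rewrite lee_fin mulr_ge0 ?f0 ?g0.
    - by apply: emeasurable_funD; apply: measurable_funeM.
    - move=> x Dx; rewrite -!EFinM -EFinD lee_fin.
      have -> : (l / 2 * f x ^+ 2 + l^-1 / 2 * g x ^+ 2 = f x * g x + l^-1 / 2 * (l * f x - g x) ^+ 2)%R.
        by field; rewrite gt_eqF.
      by rewrite lerDl mulr_ge0 ?sqr_ge0// divr_ge0.
  rewrite ge0_integralD//; last 4 first.
  - by move=> x _; rewrite -EFinM lee_fin mulr_ge0 ?sqr_ge0// divr_ge0// ltW.
  - exact: measurable_funeM.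
  - by move=> x _; rewrite -EFinM lee_fin mulr_ge0 ?sqr_ge0// divr_ge0// ltW.
  - exact: measurable_funeM.
  rewrite !ge0_integralZl//; last 4 first.
  - by move=> x _; rewrite lee_fin sqr_ge0.
  - by rewrite lee_fin divr_ge0// ltW.
  - by move=> x _; rewrite lee_fin sqr_ge0.
  - by rewrite lee_fin divr_ge0// ltW.
  apply: (@le_trans _ _ ((l / 2)%:E * A%:E + (l^-1 / 2)%:E * B%:E)).
    by apply: leeD; apply: lee_wpmul2l => //; rewrite lee_fin divr_ge0// ltW.
  by rewrite -!EFinM -EFinD lee_fin mulrDl mulrAC (mulrAC _ B).
have c0 : 0 <= \int[m]_(x in D) (f x * g x)%:E.
  by apply: integral_ge0 => x Dx; rewrite lee_fin mulr_ge0 ?f0 ?g0.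
have cfin : \int[m]_(x in D) (f x * g x)%:E \is a fin_num.
  by rewrite ge0_fin_numE// (le_lt_trans (key _ ltr01))// ltry.
exists (fine (\int[m]_(x in D) (f x * g x)%:E)); first by rewrite fineK.
move: c0 key; rewrite -(fineK cfin); set c := fine _; rewrite lee_fin => c0 key.
split => //; have {}key l : (0 < l -> 2 * c <= l * A + l^-1 * B)%R.
  by move=> l0; have := key l l0; rewrite lee_fin ler_pdivlMr// mulrC.
have [c_eq0|c_neq0] := eqVneq c 0%R; first by rewrite c_eq0 expr0n mulr_ge0.
have c_gt0 : (0 < c)%R by rewrite lt_neqAle eq_sym c_neq0.
have [A_eq0|A_neq0] := eqVneq A 0%R.
  have := key ((B + 1) / c)%R; rewrite divr_gt0//; last by rewrite ltr_wpDl.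
  move=> /(_ isT); rewrite A_eq0 mulr0 add0r invf_div mulrAC ler_pdivlMr; last by rewrite ltr_wpDl.
  nra.
have A_gt0 : (0 < A)%R by rewrite lt_neqAle eq_sym A_neq0.
have := key (c / A)%R (divr_gt0 c_gt0 A_gt0).
by rewrite divfK// invf_div mulr2n mulrDl mul1r lerD2l mulrAC ler_pdivlMr.
Qed.

End cauchy_schwarz.

Section translation.
Context (R : realType).
Local Open Scope ereal_scope.
Local Notation mu := (@lebesgue_measure R).
Local Notation lb2 := (@leb2 R).

Lemma cvg0_le (u : (\bar R)^nat) (e : R) : u @ \oo --> 0 -> (0 < e)%R ->
  \forall n \near \oo, u n <= e%:E.
Proof.
move=> uc e0; apply: (uc [set x | x <= e%:E]).
rewrite /nbhs /= /ereal_nbhs /=.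
near=> r; rewrite /= lee_fin; apply: ltW; near: r; exact: lt_nbhsl.
Unshelve. all: by end_near. Qed.

Lemma le_cvg0 (u : (\bar R)^nat) : (forall n, 0 <= u n) ->
  (forall e : R, (0 < e)%R -> \forall n \near \oo, u n <= e%:E) -> u @ \oo --> 0.
Proof.
move=> u0 H; apply/fine_cvgP; split.
  have := H _ ltr01; apply: filterS => n un.
  by rewrite ge0_fin_numE// (le_lt_trans un)// ltry.
apply/cvgr0Pnorm_le => e e0; have := H _ e0; apply: filterS => n un /=.
by rewrite ger0_norm ?fine_ge0// -lee_fin fineK// ge0_fin_numE// (le_lt_trans un)// ltry.
Qed.

Lemma measurable_mem d (T : measurableType d) (E : set T) : measurable E ->
  measurable_fun [set: T] (fun x => x \in E).
Proof.
move=> mE; rewrite (_ : (fun x => _) = (fun x => 0 < \1_E x :> R)%R).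
  by apply: measurable_fun_ltr => //; exact: measurable_indic.
by apply/funext => x; rewrite indicE ltr0n lt0b.
Qed.

(** Shifts that tend to 0; the bound by 1 keeps the shifted supports in one compact set,
    for dominated convergence. *)
Definition nbh0 (h : R^nat) := (forall n, `|h n| <= 1)%R /\ h @ \oo --> (0%R : R).

Lemma ge0_integral_triangle d (T : measurableType d) (m : {measure set T -> \bar R}) (D : set T) (f g k : T -> R) :
  measurable D -> measurable_fun D f -> measurable_fun D g -> measurable_fun D k ->
  \int[m]_(x in D) `|f x - k x|%:E <= \int[m]_(x in D) `|f x - g x|%:E + \int[m]_(x in D) `|g x - k x|%:E.
Proof.
move=> mD mf mg mk.
have mB (u v : T -> R) : measurable_fun D u -> measurable_fun D v -> measurable_fun D (fun x => `|u x - v x|%:E).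
  by move=> mu0 mv; apply/measurable_EFinP; apply: measurableT_comp => //; exact: measurable_funB.
rewrite -ge0_integralD//; [|exact: mB..].
apply: ge0_le_integral => //; first exact: mB.
- by apply: emeasurable_funD; exact: mB.
- by move=> x _; rewrite -EFinD lee_fin; exact: ler_distD.
Qed.

(** A continuous function cut off to a segment is close to f in L1, and its translates
    converge to it pointwise off the two end points. *)
Lemma transl1_seq (f : R -> R) (h : R^nat) : mu.-integrable [set: R] (EFin \o f) ->
  nbh0 h -> (fun n => \int[mu]_x `|f (x + h n) - f x|%:E) @ \oo --> 0.
Proof.
move=> intf [h1 h0].
have mf : measurable_fun [set: R] f by case/integrableP : intf => /measurable_EFinP.
apply: le_cvg0 => [n|e e0]; first exact: integral_ge0.
have e8 : (0 < e / 8)%R by rewrite divr_gt0.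
have mtail (N : nat) : measurable_fun [set: R] (fun x => (`|f x| * (N%:R < `|x|)%R%:R)%:E).
  apply/measurable_EFinP; apply: measurable_funM; first exact: measurableT_comp.
  rewrite (_ : (fun x : R => _) = (fun x : R => if (N%:R < `|x|)%R then 1%R else 0%R)); last first.
    by apply/funext => x; case: ifP.
  apply: measurable_fun_ifT => //; apply: measurable_fun_ltr => //.
(* f is small in L1 outside [-N, N], and close in L1 to a continuous g on it *)
have [N HN] : exists N : nat, \int[mu]_x (`|f x| * (N%:R < `|x|)%R%:R)%:E <= (e / 8)%:E.
  have cv : (fun N : nat => \int[mu]_x (`|f x| * (N%:R < `|x|)%R%:R)%:E) @ \oo --> \int[mu]_(x in [set: R]) (cst 0 x : \bar R).
    have [] := @dominated_convergence _ _ _ mu setT measurableT (fun N x => (`|f x| * (N%:R < `|x|)%R%:R)%:E) (cst 0) (fun x => `|f x|%:E).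
    - by move=> N; exact: (mtail N).
    - exact: measurable_cst.
    - apply: aeW => x _; rewrite /=; apply: cvg_near_cst.
      near=> N; rewrite (_ : (N%:R < `|x|)%R = false) ?mulr0//.
      apply/negbTE; rewrite -leNgt; near: N.
      by exists (Num.truncn `|x|).+1 => // n /= nx; rewrite (le_trans (ltW (truncnS_gt _)))// ler_nat.
    - by move/integrable_norm: intf.
    - apply: aeW => x N _ /=; rewrite lee_fin normrM normr_id.
      by case: ltP => _; rewrite ?normr0 ?normr1 ?mulr0 ?mulr1.
    - by [].
  rewrite integral0 in cv; have [N _ H] := cvg0_le cv e8; exists N; exact: (H N (leqnn N)).
set E : set R := `[(- N%:R)%R, N%:R]%classic.
have mE : measurable E by exact: measurable_itv.
have muE : mu E < +oo by rewrite /E lebesgue_measure_itv; case: ifP => _; rewrite ?ltry// -EFinD ltry.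
have ifE : mu.-integrable E (EFin \o f) by exact: integrableS intf.
have [g_ [cg ig gf]] := @approximation_continuous_integrable R E f mE muE ifE.
have [M _ HM] := cvg0_le gf e8; have {HM} := HM M (leqnn M).
set g := g_ M => Hg.
pose G (x : R) : R := if x \in E then g x else 0%R.
have mg : measurable_fun [set: R] g := continuous_measurable_fun (cg M).
have mG : measurable_fun [set: R] G.
  apply: measurable_fun_ifT => //.
  exact: measurable_mem mE.
have inE1 x : (x \in E) = ~~ (N%:R < `|x|)%R.
  by rewrite -leNgt ler_norml mem_setE in_itv.
have fG : \int[mu]_x `|f x - G x|%:E <= (e / 4)%:E.
  rewrite [leLHS](_ : _ = \int[mu]_x ((`|f x| * (N%:R < `|x|)%R%:R)%:E + (\1_E x * `|f x - g x|)%:E)); last first.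
    apply: eq_integral => x _; rewrite -EFinD; congr (_%:E).
    rewrite indicE /G inE1; case: ltP => _ /=; rewrite ?subr0 ?mulr1 ?mul0r ?addr0//.
    by rewrite mulr0 add0r mul1r.
  have mfg : measurable_fun [set: R] (fun x => (\1_E x * `|f x - g x|)%:E).
    apply/measurable_EFinP; apply: measurable_funM; first exact: measurable_indic.
    by apply: measurableT_comp => //; exact: measurable_funB.
  rewrite ge0_integralD//; try by move=> x _; rewrite lee_fin mulr_ge0.
  2: exact: (mtail N).
  rewrite (_ : (e / 4)%:E = (e / 8)%:E + (e / 8)%:E); last by rewrite -EFinD; congr (_%:E); lra.
  apply: leeD => //; apply: le_trans Hg.
  rewrite [leRHS]integral_mkcond; apply: ge0_le_integral => //.
  - apply/(measurable_restrictT _ mE); apply: measurable_funTS.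
    by apply/measurable_EFinP; apply: measurableT_comp => //; exact: measurable_funB.
  - by move=> x _; rewrite patchE indicE; case: ifP => _; rewrite ?mul1r ?mul0r ?lee_fin.
have [C C0 gC] : exists2 C : R, (0 <= C)%R & forall x, x \in E -> (`|g x| <= C)%R.
  have cE : compact E by exact: segment_compact.
  have [C [_ HC]] := compact_bounded (continuous_compact (continuous_subspaceT (cg M)) cE).
  exists (`|C| + 1)%R; first by rewrite addr_ge0.
  move=> x xE; apply: (HC (`|C| + 1)%R); first by rewrite (le_lt_trans (ler_norm _))// ltrDl.
  by exists x => //; exact/set_mem.
have mGh n : measurable_fun [set: R] (fun x => `|G (x + h n) - G x|%:E).
  apply/measurable_EFinP; apply: measurableT_comp => //; apply: measurable_funB => //.
  by apply: (measurableT_comp mG); exact: measurable_funD.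
have GG : (fun n => \int[mu]_x `|G (x + h n) - G x|%:E) @ \oo --> 0.
  pose E1 : set R := `[(- N%:R - 1)%R, (N%:R + 1)%R]%classic.
  have cv : (fun n => \int[mu]_x `|G (x + h n) - G x|%:E) @ \oo --> \int[mu]_(x in [set: R]) (cst 0 x : \bar R).
    have [] := @dominated_convergence _ _ _ mu setT measurableT (fun n x => `|G (x + h n) - G x|%:E) (cst 0) (fun x => (2 * C * \1_E1 x)%:E).
    - exact: mGh.
    - exact: measurable_cst.
    - exists [set (- N%:R)%R; N%:R]; split.
      + exact: measurableU.
      + by apply: null_set_setU => //; exact: lebesgue_measure_set1.
      + move=> x /= Hx; apply: contrapT => xN; apply: Hx => _.
        suff cG : G y @[y --> (x : R)] --> G x.
          have : (fun n => G (x + h n)%R) @ \oo --> G x.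
            have xh : (fun n => x + h n)%R @ \oo --> (x : R).
              by rewrite -[X in _ --> X]addr0; apply: cvgD => //; exact: cvg_cst.
            exact: (cvg_comp _ _ xh cG).
          move=> cGx; apply: cvg_EFin; first exact: nearW.
          have d0 : (fun n => G (x + h n) - G x)%R @ \oo --> (0%R : R).
            by rewrite -[X in _ --> X](subrr (G x)); apply: cvgB => //; exact: cvg_cst.
          have nd := cvg_norm d0; rewrite normr0 in nd; exact: nd.
        have nc : {for (x : R), continuous (fun y : R => `|y|)%R} by exact: norm_continuous.
        have [xlt|xgt|xeq] := ltgtP `|x|%R (N%:R : R)%R.
        * have E0 : \near x, g x = G x.
            near=> y; rewrite /G inE1 ifT// -leNgt; apply: ltW; near: y.
            exact: (cvgr_lt _ nc).
          rewrite [X in _ --> X](_ : _ = g x); last by rewrite /G inE1 ifT// -leNgt ltW.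
          by apply: cvg_trans (near_eq_cvg E0) _; exact: cg.
        * have E0 : \near x, 0%R = G x.
            near=> y; rewrite /G inE1 ifF//; apply: negbF; near: y.
            exact: (cvgr_gt _ nc).
          rewrite [X in _ --> X](_ : _ = 0%R); last by rewrite /G inE1 xgt.
          by apply: cvg_trans (near_eq_cvg E0) _; exact: cvg_cst.
        * exfalso; apply: xN; move: xeq; case: (ger0P x) => _ <-; first by right.
          by left; rewrite opprK.
    - under eq_fun do rewrite EFinM.
      apply: integrableZl => //; exact: integrable_indic_itv.
    - have GC y : (`|G y| <= C)%R by rewrite /G; case: ifP => [/gC//|_]; rewrite normr0.
      apply: aeW => x n _ /=; rewrite lee_fin normr_id indicE.
      case: (boolP (x \in E1)) => xE1.
        by rewrite mulr1; apply: (le_trans (ler_normB _ _)); rewrite mulr2n mulrDl mul1r lerD.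
      have xE y : (`|y| <= 1)%R -> (x + y)%R \notin E.
        rewrite ler_norml => /andP[y1 y2]; apply: contraNN xE1; rewrite !mem_setE !in_itv /=; lra.
      by rewrite /G (negbTE (xE _ (h1 n))) -[x in x \in E]addr0 (negbTE (xE 0%R _)) ?normr0 ?ler01// subrr normr0 mulr0.
    - by [].
  by rewrite integral0 in cv.
have e4 : (0 < e / 4)%R by rewrite divr_gt0.
have := cvg0_le GG e4; apply: filterS => n Hn.
have mt (k : R -> R) : measurable_fun [set: R] k -> measurable_fun [set: R] (fun x => k (x + h n)%R).
  move=> mk; apply: (measurableT_comp mk); exact: measurable_funD.
apply: (le_trans (@ge0_integral_triangle _ _ mu setT _ (fun x => G (x + h n)%R) _ measurableT (mt _ mf) (mt _ mG) mf)).
have -> : \int[mu]_x `|f (x + h n) - G (x + h n)|%:E = \int[mu]_x `|f x - G x|%:E.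
  have mfG : measurable_fun [set: R] (fun x => `|f x - G x|%:E).
    by apply/measurable_EFinP; apply: measurableT_comp => //; exact: measurable_funB.
  rewrite [RHS](@int1_affine R 1 (h n) _ (oner_neq0 _) mfG (fun x => _))//.
  by rewrite normr1 mul1e; apply: eq_integral => x _; rewrite mul1r.
apply: (@le_trans _ _ ((e / 4)%:E + ((e / 4)%:E + (e / 4)%:E))).
  apply: leeD => //.
  apply: (le_trans (@ge0_integral_triangle _ _ mu setT _ G _ measurableT (mt _ mG) mG mf)).
  apply: leeD => //.
  by under eq_integral do rewrite distrC.
by rewrite -!EFinD lee_fin; lra.
Unshelve. all: by end_near. Qed.

Lemma aeS d (T : measurableType d) (m : {measure set T -> \bar R}) (P Q : T -> Prop) :
  (forall x, P x -> Q x) -> {ae m, forall x, P x} -> {ae m, forall x, Q x}.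
Proof. by move=> PQ; apply: filterS. Qed.

Lemma ae_int_lty d (T : measurableType d) (m : {measure set T -> \bar R}) (F : T -> \bar R) :
  measurable_fun setT F -> (forall x, 0 <= F x) -> \int[m]_x F x < +oo ->
  {ae m, forall x, F x < +oo}.
Proof.
move=> mF F0 iF.
have : m.-integrable setT F.
  by apply/integrableP; split => //; under eq_integral do rewrite gee0_abs//.
move=> /(integrable_ae measurableT); apply: filterS => x /(_ Logic.I).
by rewrite ge0_fin_numE.
Qed.

Lemma integrable_section2 (f : R * R -> R) : lb2.-integrable [set: R * R] (EFin \o f) ->
  {ae mu, forall y, mu.-integrable [set: R] (EFin \o (fun x => f (x, y)))}.
Proof.
move=> /integrableP[/measurable_EFinP mf fin].
have mA : measurable_fun [set: R * R] (fun x => `|(EFin \o f) x|).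
  by apply: measurableT_comp => //; exact/measurable_EFinP.
rewrite (tonelli2 mA)// in fin.
have := @ae_int_lty _ (measurableTypeR R) mu (fun y => \int[mu]_x `|(EFin \o f) (x, y)|) (tonelli_m2 mA (fun x => abse_ge0 _)) _ fin.
have n0 (y : R) : 0 <= \int[mu]_x `|(EFin \o f) (x, y)| by exact: integral_ge0.
move=> /(_ n0); apply: aeS => y Hy; apply/integrableP; split => //.
by apply/measurable_EFinP; exact: (measurable_fun_pair1 y mf).
Qed.

(** The one-dimensional statement on almost every horizontal line, integrated over the
    lines by dominated convergence. *)
Lemma transl2_seq1 (f : R * R -> R) (h : R^nat) : lb2.-integrable [set: R * R] (EFin \o f) ->
  nbh0 h -> (fun n => \int[lb2]_x `|f (x.1 + h n, x.2)%R - f x|%:E) @ \oo --> 0.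
Proof.
move=> intf nh.
have [mf' fin] := integrableP _ _ _ intf.
have mf : measurable_fun [set: R * R] f by apply/measurable_EFinP.
have mA : measurable_fun [set: R * R] (fun x => `|f x|%:E).
  by apply/measurable_EFinP; exact: measurableT_comp.
have mS n : measurable_fun [set: R * R] (fun x : R * R => `|f (x.1 + h n, x.2)%R - f x|%:E).
  apply/measurable_EFinP; apply: measurableT_comp => //; apply: measurable_funB => //.
  apply: (measurableT_comp mf); apply: measurable_fun_pair; last exact: measurable_snd.
  by apply: measurable_funD => //; exact: measurable_fst.
have F0 n (y : R) : 0 <= \int[mu]_x `|f (x + h n, y)%R - f (x, y)|%:E by exact: integral_ge0.
have E n : \int[lb2]_x `|f (x.1 + h n, x.2)%R - f x|%:E = \int[mu]_y \int[mu]_x `|f (x + h n, y)%R - f (x, y)|%:E.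
  by rewrite tonelli2.
have dom n y : \int[mu]_x `|f (x + h n, y)%R - f (x, y)|%:E <= 2%:E * \int[mu]_x `|f (x, y)|%:E.
  have ms : measurable_fun [set: R] (fun x => f (x, y)) by exact: measurable_fun_pair1 mf.
  have mst : measurable_fun [set: R] (fun x => f (x + h n, y)%R).
    apply: (measurableT_comp mf); apply: measurable_fun_pair; last exact: measurable_cst.
    exact: measurable_funD.
  have m1 (k : R -> R) : measurable_fun [set: R] k -> measurable_fun [set: R] (fun x => `|k x|%:E).
    by move=> mk; apply/measurable_EFinP; exact: measurableT_comp.
  apply: (@le_trans _ _ (\int[mu]_x (`|f (x + h n, y)%R|%:E + `|f (x, y)|%:E))).
    apply: ge0_le_integral => //.
    - by apply: (m1 (fun x => f (x + h n, y)%R - f (x, y))%R); exact: measurable_funB.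
    - by apply: emeasurable_funD; exact: m1.
    - by move=> x _; rewrite -EFinD lee_fin ler_normB.
  rewrite ge0_integralD//; [|exact: m1|exact: m1].
  rewrite [X in X + _](_ : _ = \int[mu]_x `|f (x, y)|%:E); last first.
    rewrite [RHS](@int1_affine R 1 (h n) _ (oner_neq0 _) (m1 _ ms) (fun x => _))//.
    by rewrite normr1 mul1e; apply: eq_integral => x _; rewrite mul1r.
  by rewrite mule_natl mule2n.
rewrite (_ : (fun n => _) = (fun n => \int[mu]_y \int[mu]_x `|f (x + h n, y)%R - f (x, y)|%:E)); last by apply/funext.
have [] := @dominated_convergence _ _ _ mu setT measurableT (fun n y => \int[mu]_x `|f (x + h n, y)%R - f (x, y)|%:E) (cst 0) (fun y => 2%:E * \int[mu]_x `|f (x, y)|%:E).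
- by move=> n; exact: (tonelli_m2 (mS n)).
- exact: measurable_cst.
- have := integrable_section2 intf; apply: aeS => y iy _.
  exact: (transl1_seq iy nh).
- apply: integrableZl => //; apply/integrableP; split; first exact: (tonelli_m2 mA).
  under eq_integral do rewrite gee0_abs ?integral_ge0//.
  by rewrite -(tonelli2 mA).
- by apply: aeW => y n _; rewrite gee0_abs.
- by rewrite integral0.
Qed.

Lemma swap_integral (f : R * R -> \bar R) : measurable_fun [set: R * R] f ->
  (forall x, 0 <= f x) -> \int[lb2]_x f x = \int[lb2]_x f (x.2, x.1).
Proof.
move=> mf f0; rewrite (tonelli1 mf f0) tonelli2//.
by apply: (measurableT_comp mf); apply: measurable_fun_pair; [exact: measurable_snd|exact: measurable_fst].
Qed.

Lemma measurable_shift (z : R * R) : measurable_fun [set: R * R] (fun x : R * R => (x + z)%R).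
Proof.
apply: measurable_fun_pair.
  by apply: measurable_funD => //; exact: measurable_fst.
by apply: measurable_funD => //; exact: measurable_snd.
Qed.

Lemma int2_shift (z : R * R) (f : R * R -> \bar R) : measurable_fun [set: R * R] f ->
  (forall x, 0 <= f x) -> \int[lb2]_x f (x + z)%R = \int[lb2]_x f x.
Proof.
move=> mf f0; rewrite [RHS](@int2_affine R 1 z f (oner_neq0 _) mf f0).
by rewrite expr1n mul1e; apply: eq_integral => x _; rewrite scale1r.
Qed.

(** A shift in the plane is a horizontal one followed by a vertical one. *)
Lemma transl2_seq (f : R * R -> R) (z : nat -> R * R) : lb2.-integrable [set: R * R] (EFin \o f) ->
  nbh0 (fst \o z) -> nbh0 (snd \o z) -> (fun n => \int[lb2]_x `|f (x + z n)%R - f x|%:E) @ \oo --> 0.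
Proof.
move=> intf n1 n2.
have mf : measurable_fun [set: R * R] f by case/integrableP : intf => /measurable_EFinP.
have mw : measurable_fun [set: R * R] (fun x : R * R => (x.2, x.1)).
  by apply: measurable_fun_pair; [exact: measurable_snd|exact: measurable_fst].
pose fw (x : R * R) := f (x.2, x.1).
have mfw : measurable_fun [set: R * R] fw by exact: measurableT_comp.
have intw : lb2.-integrable [set: R * R] (EFin \o fw).
  apply/integrableP; split; first exact/measurable_EFinP.
  rewrite -(@swap_integral (fun x => `|(f x)%:E|))//; first by case/integrableP : intf.
  by apply: measurableT_comp => //; exact/measurable_EFinP.
have c1 := transl2_seq1 intf n1; have c2 := transl2_seq1 intw n2.
apply: le_cvg0 => [n|e e0]; first exact: integral_ge0.
have e2 : (0 < e / 2)%R by rewrite divr_gt0.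
near=> n.
have mz2 : measurable_fun [set: R * R] (fun x => f (x + (0, (z n).2))%R).
  by apply: (measurableT_comp mf); exact: measurable_shift.
have mz : measurable_fun [set: R * R] (fun x => f (x + z n)%R).
  by apply: (measurableT_comp mf); exact: measurable_shift.
apply: (le_trans (@ge0_integral_triangle _ _ lb2 setT _ (fun x => f (x + (0, (z n).2))%R) _ measurableT mz mz2 mf)).
rewrite (_ : e%:E = (e / 2)%:E + (e / 2)%:E); last by rewrite -EFinD -splitr.
apply: leeD.
- have m0 : measurable_fun [set: R * R] (fun x : R * R => `|f (x.1 + (z n).1, x.2)%R - f x|%:E).
    apply/measurable_EFinP; apply: measurableT_comp => //; apply: measurable_funB => //.
    apply: (measurableT_comp mf); apply: measurable_fun_pair; last exact: measurable_snd.
    by apply: measurable_funD => //; exact: measurable_fst.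
  rewrite [leLHS](_ : _ = \int[lb2]_x `|f (x.1 + (z n).1, x.2)%R - f x|%:E); last first.
    rewrite -[RHS](int2_shift (0%R, (z n).2) m0)//; apply: eq_integral => x _ /=.
    congr (`|f _ - f _|%:E)%R.
    by apply: injective_projections; rewrite /= ?addr0.
  by near: n; exact: (cvg0_le c1 e2).
- rewrite (@swap_integral (fun x => `|f (x + (0, (z n).2))%R - f x|%:E))//; last first.
    by apply/measurable_EFinP; apply: measurableT_comp => //; exact: measurable_funB.
  rewrite [leLHS](_ : _ = \int[lb2]_x `|fw (x.1 + (z n).2, x.2)%R - fw x|%:E); last first.
    by apply: eq_integral => x _; rewrite /fw /= ; congr (`|f _ - f _|%:E)%R; apply: injective_projections; rewrite /= ?addr0.
  by near: n; exact: (cvg0_le c2 e2).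
Unshelve. all: by end_near. Qed.

Lemma transl2 (f : R * R -> R) (e : R) : lb2.-integrable [set: R * R] (EFin \o f) -> (0 < e)%R ->
  exists2 d : R, (0 < d)%R & forall z : R * R, (`|z.1| <= d)%R -> (`|z.2| <= d)%R ->
    \int[lb2]_x `|f (x + z)%R - f x|%:E <= e%:E.
Proof.
move=> intf e0; apply: contrapT => H.
have {}H (n : nat) : exists z : R * R, [/\ (`|z.1| <= n.+1%:R^-1)%R, (`|z.2| <= n.+1%:R^-1)%R &
    ~ (\int[lb2]_x `|f (x + z)%R - f x|%:E <= e%:E)].
  apply: contrapT => H1; apply: H; exists (n.+1%:R^-1)%R; first by rewrite invr_gt0.
  move=> z z1 z2; apply: contrapT => H2; apply: H1; by exists z.
have [z Hz] := choice H.
have nb (p : R * R -> R) : (forall n, `|p (z n)| <= n.+1%:R^-1)%R -> nbh0 (p \o z).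
  move=> Hp; split => [n|].
    by apply: (le_trans (Hp n)); rewrite invf_le1// ler1n.
  apply/cvgr0Pnorm_lt => r r0; near=> n; apply: (le_lt_trans (Hp n)); near: n.
  exact: (near_infty_natSinv_lt (PosNum r0)).
have cv := transl2_seq intf (nb fst (fun n => let: And3 a _ _ := Hz n in a)) (nb snd (fun n => let: And3 _ a _ := Hz n in a)).
have [n _ Hn] := cvg0_le cv e0.
by have [_ _] := Hz n; apply; exact: Hn n (leqnn n).
Unshelve. all: by end_near. Qed.

Lemma int_tail_sqr d (T : measurableType d) (m : {measure set T -> \bar R}) (g f : T -> R) (e : R) :
  measurable_fun [set: T] f -> m.-integrable [set: T] (EFin \o g) -> (0 < e)%R ->
  exists N : nat, \int[m]_x (`|g x| * (N%:R < `|f x|)%R%:R)%:E <= e%:E.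
Proof.
move=> mf ig e0; have mg : measurable_fun [set: T] g by case/integrableP : ig => /measurable_EFinP.
have mtail (N : nat) : measurable_fun [set: T] (fun x => (`|g x| * (N%:R < `|f x|)%R%:R)%:E).
  apply/measurable_EFinP; apply: measurable_funM; first exact: measurableT_comp.
  rewrite (_ : (fun x : T => _) = (fun x : T => if (N%:R < `|f x|)%R then 1%R else 0%R)); last first.
    by apply/funext => x; case: ifP.
  by apply: measurable_fun_ifT => //; apply: measurable_fun_ltr => //; exact: measurableT_comp.
have [] := @dominated_convergence _ _ _ m setT measurableT (fun N x => (`|g x| * (N%:R < `|f x|)%R%:R)%:E) (cst 0) (fun x => `|g x|%:E).
- exact: mtail.
- exact: measurable_cst.
- apply: aeW => x _; rewrite /=; apply: cvg_near_cst.
  near=> N; rewrite (_ : (N%:R < `|f x|)%R = false) ?mulr0//.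
  apply/negbTE; rewrite -leNgt; near: N.
  by exists (Num.truncn `|f x|).+1 => // n /= nx; rewrite (le_trans (ltW (truncnS_gt _)))// ler_nat.
- by move/integrable_norm: ig.
- apply: aeW => x N _ /=; rewrite lee_fin normrM normr_id.
  by case: ltP => _; rewrite ?normr0 ?normr1 ?mulr0 ?mulr1.
- move=> _ _ cv; rewrite integral0 in cv.
  by have [N _ H] := cvg0_le cv e0; exists N; exact: (H N (leqnn N)).
Unshelve. all: by end_near. Qed.

(** Cut f at height N. The part above N has small L2 norm; for the part below, the
    square is at most 2 N times the absolute value, and L1 continuity applies. *)
Lemma transl2_sqr (f : R * R -> R) (e : R) : lb2.-integrable [set: R * R] (EFin \o f) ->
  lb2.-integrable [set: R * R] (fun x => (f x ^+ 2)%:E) -> (0 < e)%R ->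
  exists2 d : R, (0 < d)%R & forall z : R * R, (`|z.1| <= d)%R -> (`|z.2| <= d)%R ->
    \int[lb2]_x ((f (x + z)%R - f x) ^+ 2)%:E <= e%:E.
Proof.
move=> if1 if2 e0.
have mf : measurable_fun [set: R * R] f by case/integrableP : if1 => /measurable_EFinP.
have e12 : (0 < e / 12)%R by rewrite divr_gt0.
have [N HN] := @int_tail_sqr _ _ lb2 (fun x => f x ^+ 2)%R f _ mf if2 e12.
pose c x := (N%:R < `|f x|)%R.
have mc : measurable_fun [set: R * R] c.
  by apply: measurable_fun_ltr => //; exact: measurableT_comp.
pose t x := if c x then f x else 0%R.
pose s x := if c x then 0%R else f x.
have mt : measurable_fun [set: R * R] t by apply: measurable_fun_ifT.
have ms : measurable_fun [set: R * R] s by apply: measurable_fun_ifT.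
have is_ : lb2.-integrable [set: R * R] (EFin \o s).
  apply: le_integrable if1 => //; first exact/measurable_EFinP.
  by move=> x _ /=; rewrite lee_fin /s; case: ifP; rewrite ?normr0.
have sN x : (`|s x| <= N%:R)%R by rewrite /s /c; case: ltP; rewrite ?normr0.
have tE : \int[lb2]_x (t x ^+ 2)%:E <= (e / 12)%:E.
  apply: le_trans HN; rewrite le_eqVlt; apply/orP; left; apply/eqP; apply: eq_integral => x _.
  by rewrite /t /c; case: ifP => _; rewrite ?mulr1 ?mulr0 ?expr0n// ger0_norm// sqr_ge0.
have e3 : (0 < e / (12 * N.+1%:R))%R by rewrite divr_gt0// mulr_gt0.
have [d d0 Hd] := transl2 is_ e3.
exists d => // z z1 z2; have {}Hd := Hd z z1 z2.
have mz (k : R * R -> R) : measurable_fun [set: R * R] k -> measurable_fun [set: R * R] (fun x => k (x + z)%R).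
  by move=> mk; apply: (measurableT_comp mk); exact: measurable_shift.
have mE2 (k : R * R -> R) : measurable_fun [set: R * R] k -> measurable_fun [set: R * R] (fun x => (k x ^+ 2)%:E).
  by move=> mk; apply/measurable_EFinP; exact: measurable_funX.
have ms1 : measurable_fun [set: R * R] (fun x => `|s (x + z)%R - s x|%:E).
  by apply/measurable_EFinP; apply: measurableT_comp => //; apply: measurable_funB => //; exact: mz.
have mt1 : measurable_fun [set: R * R] (fun x => (t (x + z)%R ^+ 2)%:E) by apply: mE2; exact: mz.
apply: (@le_trans _ _ (\int[lb2]_x ((6 * N%:R)%:E * `|s (x + z)%R - s x|%:E + (3%:E * (t (x + z)%R ^+ 2)%:E + 3%:E * (t x ^+ 2)%:E)))).
  apply: ge0_le_integral => //.
  - by move=> x _; rewrite lee_fin sqr_ge0.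
  - by apply: (mE2 (fun x => f (x + z)%R - f x)%R); apply: measurable_funB => //; exact: mz.
  - by apply: emeasurable_funD; [|apply: emeasurable_funD]; apply: measurable_funeM => //; exact: mE2.
  - move=> x _; rewrite -!EFinM -!EFinD lee_fin.
    have fE y : f y = (s y + t y)%R by rewrite /s /t; case: ifP => _; rewrite ?addr0 ?add0r.
    rewrite !fE; set a := s (x + z)%R; set b := s x; set p := t (x + z)%R; set q := t x.
    have : ((a - b) ^+ 2 <= 2 * N%:R * `|a - b|)%R.
      rewrite -real_normK ?num_real// expr2 ler_wpM2r//.
      by apply: (le_trans (ler_normB _ _)); rewrite mulr2n mulrDl mul1r lerD// sN.
    set ab := `|a - b|%R => H.
    have := sqr_ge0 ((a - b) - p); have := sqr_ge0 ((a - b) + q); have := sqr_ge0 (p + q); nra.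
rewrite ge0_integralD//; first last.
- by apply: emeasurable_funD; apply: measurable_funeM => //; exact: mE2.
- by move=> x _; rewrite -!EFinM -EFinD lee_fin addr_ge0// mulr_ge0// sqr_ge0.
- exact: measurable_funeM.
rewrite ge0_integralD//; first last.
- by apply: measurable_funeM; exact: mE2.
- by move=> x _; rewrite -EFinM lee_fin mulr_ge0// sqr_ge0.
- exact: measurable_funeM.
- by move=> x _; rewrite -EFinM lee_fin mulr_ge0// sqr_ge0.
rewrite !ge0_integralZl//; try (by move=> x _; rewrite lee_fin sqr_ge0); try exact: mE2.
rewrite (int2_shift z (mE2 _ mt) (fun x => _))//; last by move=> x; rewrite lee_fin sqr_ge0.
apply: (@le_trans _ _ ((6 * N%:R)%:E * (e / (12 * N.+1%:R))%:E + (3%:E * (e / 12)%:E + 3%:E * (e / 12)%:E))).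
  by apply: leeD; [|apply: leeD]; apply: lee_wpmul2l.
rewrite -!EFinM -!EFinD lee_fin.
have : (N%:R / N.+1%:R <= 1 :> R)%R by rewrite ler_pdivrMr// mul1r ler_nat.
set k : R := (N.+1%:R)%R; have k0 : (k != 0)%R by rewrite pnatr_eq0.
have -> : (6 * N%:R * (e / (12 * k)) = e / 2 * (N%:R / k))%R by field.
move: (N%:R / k)%R => q q1; have : (e / 2 * q <= e / 2 * 1)%R by rewrite ler_wpM2l// divr_ge0// ltW.
lra.
Qed.

End translation.

(** * Test functions, convolution and mollification *)

Section test_functions.
Context (R : realType).
Implicit Types (f g : R * R -> R) (x y z : R * R) (O : set (R * R)).
Local Notation lb2 := (@leb2 R).

(** Support in a square, in a form that is stable under products, translations and
    convolution without topology. *)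
Definition bsupp (M : R) f := forall x, f x != 0 -> `|x.1| <= M /\ `|x.2| <= M.

Lemma notsupp0 f x : ~ supp f x -> f x = 0.
Proof. by move=> H; apply/eqP; apply: contrapT => /negP fx; apply: H; exact: subset_closure. Qed.

Definition box (M : R) : set (R * R) := [set x | `|x.1| <= M /\ `|x.2| <= M].

Lemma boxE M : box M = `[- M, M]%classic `*` `[- M, M]%classic.
Proof.
apply/seteqP; split => x /=; rewrite /box /= !in_itv /= -!ler_norml; first by case.
by case.
Qed.

Lemma compact_box M : compact (box M).
Proof. by rewrite boxE; apply: compact_setX; exact: segment_compact. Qed.

Lemma closed_box M : closed (box M).
Proof. by apply: compact_closed; [exact: norm_hausdorff|exact: compact_box]. Qed.

Lemma bsupp_compact M f : bsupp M f -> compact (supp f).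
Proof.
move=> H; apply: (@subclosed_compact _ _ (box M)); [exact: closed_closure|exact: compact_box|].
by rewrite /supp ((closure_id (box M)).1 (@closed_box M)); apply: closure_subset => x /= /H.
Qed.

Lemma compact_bsupp f : compact (supp f) -> exists2 M : R, 0 <= M & bsupp M f.
Proof.
move=> /compact_bounded[M [_ H]]; exists (`|M| + 1); first by rewrite addr_ge0.
move=> x fx; have sx : supp f x by exact: subset_closure.
have /H : (`|M| + 1 > M) by rewrite (le_lt_trans (ler_norm _))// ltrDl.
move=> /(_ x sx); rewrite /= prod_normE ge_max => /andP[? ?]; split => //.
Qed.

Lemma test_smooth O f : test_function O f -> smooth f.
Proof. by case. Qed.

Lemma test_bsupp O f : test_function O f -> exists2 M : R, 0 <= M & bsupp M f.
Proof. by case=> _ cf _; exact: compact_bsupp. Qed.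

Lemma testT O f : test_function O f -> test_function setT f.
Proof. by case=> sf cf _; split. Qed.

(** For smooth functions, compact support amounts to vanishing outside a square. *)
Lemma testTP f M : smooth f -> bsupp M f -> test_function setT f.
Proof. by move=> sf bf; split => //; exact: bsupp_compact bf. Qed.

Lemma test_bounded O f : test_function O f -> exists2 C : R, 0 <= C & forall x, `|f x| <= C.
Proof.
move=> [sf cf _]; have ctf : continuous f := smooth_cts sf.
have /compact_bounded[M [_ H]] := continuous_compact (continuous_subspaceT ctf) cf.
exists (`|M| + 1); first by rewrite addr_ge0.
move=> x; have [sx|/notsupp0 ->] := pselect (supp f x); last by rewrite normr0 addr_ge0.
apply: (H (`|M| + 1)); last by exists x.
by rewrite (le_lt_trans (ler_norm _))// ltrDl.
Qed.

Lemma supp_derive v f x : ~ supp f x -> 'D_v f x = 0.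
Proof.
move=> sx; rewrite -(derive_cst (0 : R) x v); apply: near_eq_derive.
have oC : open (~` supp f) by apply: closed_openC; exact: closed_closure.
have nC : nbhs x (~` supp f) by exact: open_nbhs_nbhs.
by apply: filterS nC => y /notsupp0.
Qed.

Lemma supp_D v f : supp ('D_v f) `<=` supp f.
Proof.
rewrite ((closure_id (supp f)).1 (@closed_closure _ _)).
apply: closure_subset => x /= /eqP dx; apply: contrapT => sx; apply: dx.
exact: supp_derive.
Qed.

Lemma test_D1 O f : test_function O f -> test_function O ('D_(@e1 R) f).
Proof.
move=> [sf cf fO]; split; first exact: (smooth_D1 sf).
- by apply: (subclosed_compact _ cf); [exact: closed_closure|exact: supp_D].
- exact: subset_trans (@supp_D _ _) fO.
Qed.

Lemma test_D2 O f : test_function O f -> test_function O ('D_(@e2 R) f).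
Proof.
move=> [sf cf fO]; split; first exact: (smooth_D2 sf).
- by apply: (subclosed_compact _ cf); [exact: closed_closure|exact: supp_D].
- exact: subset_trans (@supp_D _ _) fO.
Qed.

Lemma test_sub O f g : smooth g -> test_function O f -> (forall x, g x != 0 -> f x != 0) ->
  test_function O g.
Proof.
move=> sg [sf cf fO] gf.
have gsf : supp g `<=` supp f by apply: closure_subset => x /= /gf.
by split; [exact: sg|apply: (subclosed_compact _ cf) => //; exact: closed_closure|exact: subset_trans fO].
Qed.

Lemma testM O f g : smooth g -> test_function O f -> test_function O (f \* g).
Proof.
move=> sg tf; apply: (test_sub _ tf).
  by move=> k; apply: CkM; [exact: (test_smooth tf)|exact: sg].
by move=> x; apply: contraNN => /eqP /= ->; rewrite mul0r.
Qed.

Lemma testZ O (c : R) f : test_function O f -> test_function O (fun x => c * f x).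
Proof.
move=> tf; apply: (test_sub _ tf).
  by move=> k; apply: CkZ; exact: (test_smooth tf).
by move=> x; apply: contraNN => /eqP /= ->; rewrite mulr0.
Qed.

Lemma test_refl f x : test_function setT f -> test_function setT (fun y => f (x - y)).
Proof.
move=> tf; have [M M0 bM] := test_bsupp tf.
apply: (@testTP _ (M + `|x.1| + `|x.2|)).
  move=> k; rewrite (_ : (fun y => f (x - y)) = (fun y => f ((-1 : R) *: y + x))); last first.
    by apply/funext => y; rewrite scaleN1r addrC.
  by apply: Ck_affine; exact: (test_smooth tf).
move=> y /bM[/= y1 y2]; split.
  have := ler_normB x.1 (x.1 - y.1); rewrite subKr => H.
  by have := normr_ge0 x.2; lra.
have := ler_normB x.2 (x.2 - y.2); rewrite subKr => H.
by have := normr_ge0 x.1; lra.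
Qed.

Lemma test_transl f z : test_function setT f -> test_function setT (fun x => f (z + x)).
Proof.
move=> /(test_refl z)/(test_refl 0); congr (test_function _ _).
by apply/funext => x; rewrite sub0r opprK.
Qed.

Lemma test_lip f : test_function setT f -> exists2 C : R, 0 <= C &
  forall x h, `|f (h + x) - f x| <= C * (`|h.1| + `|h.2|).
Proof.
move=> tf; have sf := test_smooth tf.
have [C1 C10 H1] := test_bounded (test_D1 tf).
have [C2 C20 H2] := test_bounded (test_D2 tf).
exists (C1 + C2); first exact: addr_ge0.
move=> x h.
have [t1 _ E1] := @C1_MVT R (@e1 R) f (h.2 *: @e2 R + x) h.1 (smooth_cts sf) (fun y => @smooth_d1 _ _ y sf).
have [t2 _ E2] := @C1_MVT R (@e2 R) f x h.2 (smooth_cts sf) (fun y => @smooth_d2 _ _ y sf).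
have -> : h + x = h.1 *: @e1 R + (h.2 *: @e2 R + x).
  by apply: injective_projections; rewrite /= /GRing.scale /= !(mulr1, mulr0, add0r).
rewrite -(subrK (f (h.2 *: @e2 R + x)) (f (_ + _))) E1 -addrA E2.
apply: (le_trans (ler_normD _ _)); rewrite !normrM mulrDr mulrDl [X in _ <= _ + X]mulrDl.
have := ler_wpM2l (normr_ge0 h.1) (H1 (t1 *: @e1 R + (h.2 *: @e2 R + x))).
have := ler_wpM2l (normr_ge0 h.2) (H2 (t2 *: @e2 R + x)).
have := mulr_ge0 C20 (normr_ge0 h.1); have := mulr_ge0 C10 (normr_ge0 h.2).
rewrite ![`|_| * C1]mulrC ![`|_| * C2]mulrC; lra.
Qed.

(** Second-order bound by the mean value theorem applied to f and to its derivative,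
    both test functions. *)
Lemma test_taylor v f : test_function setT f -> test_function setT ('D_v f) ->
  (forall y, derivable f y v) -> `|v.1| + `|v.2| <= 1 ->
  exists2 C : R, 0 <= C &
  forall x (h : R), `|f (h *: v + x) - f x - h * 'D_v f x| <= C * h ^+ 2.
Proof.
move=> tf tDf df v1; have [C C0 HC] := test_lip tDf.
exists C => // x h.
have [t th ->] := @C1_MVT R v f x h (smooth_cts (test_smooth tf)) df.
rewrite -mulrBr normrM.
apply: (le_trans (ler_wpM2l (normr_ge0 _) (HC _ _))).
rewrite /= /GRing.scale /= !normrM -mulrDr -[h ^+ 2]real_normK ?num_real// expr2.
rewrite mulrCA; apply: ler_wpM2l => //; apply: ler_wpM2l => //.
by apply: le_trans th; rewrite ler_piMr.
Qed.

End test_functions.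

Section convolution.
Context (R : realType).
Implicit Types (f g : R * R -> R) (x y z : R * R).
Local Notation lb2 := (@leb2 R).

Definition int1 f := lb2.-integrable [set: R * R] (EFin \o f).

Lemma int1_mf f : int1 f -> measurable_fun [set: R * R] f.
Proof. by move=> /integrableP[/measurable_EFinP]. Qed.

Lemma int1_le f g : measurable_fun [set: R * R] g -> (forall x, `|g x| <= `|f x|) -> int1 f -> int1 g.
Proof.
move=> mg gf; apply: le_integrable => //; first exact/measurable_EFinP.
by move=> x _ /=; rewrite lee_fin.
Qed.

Lemma int1Z f (c : R) : int1 f -> int1 (fun x => c * f x).
Proof. by move=> if_; have := @integrableZl _ _ _ lb2 setT measurableT c _ if_. Qed.

Lemma int1B f g : int1 f -> int1 g -> int1 (fun x => f x - g x).
Proof. by move=> if_ ig; have := @integrableB _ _ _ lb2 setT measurableT _ _ if_ ig. Qed.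

Lemma int1D f g : int1 f -> int1 g -> int1 (fun x => f x + g x).
Proof. by move=> if_ ig; have := @integrableD _ _ _ lb2 setT measurableT _ _ if_ ig. Qed.

Lemma int1_norm f : int1 f -> int1 (fun x => `|f x|).
Proof. by move=> /integrable_norm. Qed.

Lemma int1Mb f g (C : R) : int1 f -> measurable_fun [set: R * R] g -> (forall x, `|g x| <= C) ->
  int1 (fun x => f x * g x).
Proof.
move=> if_ mg gC; have C0 : 0 <= C := le_trans (normr_ge0 _) (gC 0).
have iC := int1Z C if_.
apply: (int1_le _ _ iC); first by apply: measurable_funM => //; exact: int1_mf.
by move=> x; rewrite normrM mulrC normrM ler_wpM2r// (le_trans (gC x))// ler_norm.
Qed.

Lemma measurable_refl x : measurable_fun [set: R * R] (fun y : R * R => x - y).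
Proof.
apply: measurable_fun_pair.
  by apply: measurable_funB => //; exact: measurable_fst.
by apply: measurable_funB => //; exact: measurable_snd.
Qed.

Definition convol f g x : R := (\int[lb2]_y (f y * g (x - y)))%R.

Lemma test_measurable O f : test_function O f -> measurable_fun [set: R * R] f.
Proof. by move=> tf; apply: continuous_measurable2; exact: smooth_cts (test_smooth tf). Qed.

Lemma int1_conv f g x : int1 f -> test_function setT g -> int1 (fun y => f y * g (x - y)).
Proof.
move=> if_ tg; have [C _ gC] := test_bounded tg.
apply: (@int1Mb _ _ C) => //.
by apply: test_measurable (test_refl x tg).
Qed.

Lemma le_Rint f g : int1 f -> measurable_fun [set: R * R] g -> (forall x, `|g x| <= f x) ->
  `|(\int[lb2]_x g x)%R| <= (\int[lb2]_x f x)%R.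
Proof.
move=> if_ mg gf.
have ig : int1 g by apply: (int1_le mg _ if_) => x; apply: (le_trans (gf x)); exact: ler_norm.
apply: (le_trans (le_normr_Rintegral _ _)) => //.
apply: le_Rintegral => //.
exact: integrable_norm.
Qed.

Lemma convB f g x (h : R * R -> R) : int1 f -> test_function setT g ->
  test_function setT h -> forall x', convol f g x - convol f h x' =
    (\int[lb2]_y (f y * (g (x - y) - h (x' - y))))%R.
Proof.
move=> if_ tg th x'; rewrite /convol -RintegralB//; [|exact: int1_conv..].
by apply: eq_Rintegral => y _; rewrite mulrBr.
Qed.

Lemma conv_continuous f g : int1 f -> test_function setT g -> continuous (convol f g).
Proof.
move=> if_ tg x; have [C C0 HC] := test_lip tg.
set F : R := (\int[lb2]_y `|f y|)%R.
have F0 : 0 <= F by apply: Rintegral_ge0.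
have key (h : R * R) : `|convol f g (h + x) - convol f g x| <= C * (`|h.1| + `|h.2|) * F.
  rewrite convB// /F -RintegralZl//; last exact: integrable_norm.
  apply: le_Rint.
  - by apply: int1Z; exact: int1_norm.
  - apply: measurable_funM; first exact: int1_mf.
    by apply: measurable_funB; apply: test_measurable (test_refl _ tg).
  - move=> y; rewrite normrM mulrC ler_wpM2r//.
    by rewrite -addrA; exact: HC.
have K0 : 0 < C * F * 2 + 1 by rewrite ltr_wpDl// !mulr_ge0.
suff P (e : R) : 0 < e -> nbhs (x : R * R) (fun y : R * R => `|convol f g x - convol f g y| <= e).
  by apply/cvgrPdist_le => e e0; exact: P.
move=> e0; apply/nbhs_ballP; exists (e / (C * F * 2 + 1)); first by rewrite /= divr_gt0.
move=> y yd /=.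
rewrite distrC -(subrK x y); apply: (le_trans (key _)).
have [/= b1 b2] := yd; rewrite /ball /= in b1 b2.
rewrite distrC in b1; rewrite distrC in b2.
set D := e / _ in b1 b2 *.
have -> : e = D * (C * F * 2 + 1) by rewrite divfK// gt_eqF.
have D0 : 0 <= D by rewrite divr_ge0 ?ltW.
apply: (@le_trans _ _ (C * (D + D) * F)).
  by rewrite ler_wpM2r// ler_wpM2l// lerD ?ltW.
by clear b1 b2; have := mulr_ge0 C0 F0; nra.
Qed.

Lemma is_derive_le_sqr (F : R * R -> R) (x v : R * R) (d K : R) :
  (forall h : R, `|F (h *: v + x) - F x - h * d| <= K * h ^+ 2) -> is_derive x v F d.
Proof.
move=> H; apply/is_derive_dir.
rewrite (_ : (fun h : R => _) = (fun h => F (h *: v + x) - F x - h * d) \+ ((cst (F x)) \+ (fun h => h * d))); last first.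
  by apply/funext => h /=; ring.
have D1 := derive0_le_sqr H.
have D2 : is_derive (0 : R) 1 (fun h => h * d) d.
  have := is_deriveM (is_derive_id (0 : R) (1 : R)) (is_derive_cst d (0 : R) (1 : R)).
  by rewrite scaler0 add0r [_ *: 1]mulr1.
have := is_deriveD D1 (is_deriveD (is_derive_cst (F x) (0 : R) (1 : R)) D2).
by rewrite !add0r.
Qed.

(** [test_taylor] holds uniformly, so it may be integrated against an integrable f. *)
Lemma conv_derive f g v x : int1 f -> test_function setT g -> test_function setT ('D_v g) ->
  (forall y, derivable g y v) -> `|v.1| + `|v.2| <= 1 ->
  is_derive x v (convol f g) (convol f ('D_v g) x).
Proof.
move=> if_ tg tDg dg v1; have [C C0 HC] := test_taylor tg tDg dg v1.
set F : R := (\int[lb2]_y `|f y|)%R.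
apply: (@is_derive_le_sqr _ _ _ _ (C * F)) => h.
have -> : convol f g (h *: v + x) - convol f g x - h * convol f ('D_v g) x =
    (\int[lb2]_y (f y * (g (h *: v + x - y) - g (x - y) - h * 'D_v g (x - y))))%R.
  have i1 := int1_conv (h *: v + x) if_ tg; have i2 := int1_conv x if_ tg.
  have i3 := int1Z h (int1_conv x if_ tDg).
  rewrite /convol -(RintegralZl _ measurableT (int1_conv x if_ tDg)).
  rewrite -RintegralB// -RintegralB//; last exact: (int1B i1 i2).
  by apply: eq_Rintegral => y _; ring.
rewrite mulrAC /F -RintegralZl//; last exact: integrable_norm.
apply: le_Rint.
- by apply: int1Z; exact: int1_norm.
- apply: measurable_funM; first exact: int1_mf.
  apply: measurable_funB; first by apply: measurable_funB; apply: test_measurable (test_refl _ tg).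
  by apply: measurable_funM => //; apply: test_measurable (test_refl _ tDg).
- move=> y; rewrite normrM mulrC ler_wpM2r//.
  by have := HC (x - y) h; rewrite addrA.
Qed.

Lemma conv_smooth f g : int1 f -> test_function setT g -> smooth (convol f g).
Proof.
move=> if_ tg k; elim: k g tg => [|k IH] g tg; first exact: conv_continuous.
have sg := test_smooth tg.
apply: (@Ck_intro R k _ (convol f ('D_(@e1 R) g)) (convol f ('D_(@e2 R) g))).
- exact: conv_continuous.
- move=> x; apply: conv_derive => //; first exact: test_D1.
    by move=> y; exact: smooth_d1.
  by rewrite /= normr1 normr0 addr0.
- move=> x; apply: conv_derive => //; first exact: test_D2.
    by move=> y; exact: smooth_d2.
  by rewrite /= normr1 normr0 add0r.
- exact: (IH _ (test_D1 tg)).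
- exact: (IH _ (test_D2 tg)).
Qed.

Lemma conv_bsupp f g M d : bsupp M f -> bsupp d g -> bsupp (M + d) (convol f g).
Proof.
move=> bf bg x cx; apply: contrapT => xb.
move/eqP : cx; apply; rewrite /convol.
have E y : f y * g (x - y) = 0.
  apply/eqP; apply: contrapT => /negP; rewrite mulf_eq0 negb_or => /andP[/bf[f1 f2] /bg[/= g1 g2]].
  apply: xb; split.
    by rewrite -(subrK y.1 x.1) (le_trans (ler_normD _ _))// addrC lerD.
  by rewrite -(subrK y.2 x.2) (le_trans (ler_normD _ _))// addrC lerD.
under eq_Rintegral do rewrite E.
by rewrite /Rintegral integral0.
Qed.

(** * Mollifiers *)

Definition mollifier (d : R) (eta : R * R -> R) :=
  [/\ test_function setT eta, forall x, 0 <= eta x, (\int[lb2]_x (eta x)%:E = 1)%E & bsupp d eta].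

Lemma lb2_box (M : R) : 0 <= M -> lb2 (box M) = ((2 * M) ^+ 2)%:E.
Proof.
move=> M0; rewrite boxE /leb2 product_measure1E//= !lebesgue_measure_itv /= lte_fin.
have [M1|M1] := eqVneq M 0.
  by rewrite M1 oppr0 ltxx mule0 mulr0 expr0n.
rewrite ifT; last by rewrite gtrN// lt_neqAle eq_sym M1.
by rewrite -EFinD -EFinM; congr (_%:E); ring.
Qed.

Lemma measurable_box (M : R) : measurable (box M).
Proof. by rewrite boxE; apply: measurableX. Qed.

Lemma int1_test f : test_function setT f -> int1 f.
Proof.
move=> tf; have [M M0 bM] := test_bsupp tf; have [C C0 HC] := test_bounded tf.
apply/integrableP; split; first by apply/measurable_EFinP; exact: test_measurable tf.
apply: (@le_lt_trans _ _ (\int[lb2]_x (C * \1_(box M) x)%:E)%E).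
  apply: ge0_le_integral => //.
  - by apply: measurableT_comp => //; apply/measurable_EFinP; exact: test_measurable tf.
  - by apply/measurable_EFinP; apply: measurable_funM => //; apply: measurable_indic; exact: measurable_box.
  - move=> x _; rewrite lee_fin indicE.
    have [fx|fx] := eqVneq (f x) 0; first by rewrite fx normr0 mulr_ge0.
    by rewrite mem_set ?mulr1//; exact: bM.
under eq_integral do rewrite EFinM.
have mi : measurable_fun [set: R * R] (fun x => (\1_(box M) x)%:E : \bar R).
  by apply/measurable_EFinP; apply: measurable_indic; exact: measurable_box.
rewrite ge0_integralZl//.
rewrite integral_indic ?setIT//; last exact: measurable_box.
by rewrite (_ : _ (box M) = ((2 * M) ^+ 2)%:E) -?EFinM ?ltry//; exact: lb2_box.
Qed.

(** The normalised bump exp(-1/(1 - |x|^2/d^2)). *)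
Lemma mollifier_ex (d : R) : 0 < d -> exists eta, mollifier d eta.
Proof.
move=> d0.
pose b x : R := flat 0 (1 - d ^- 2 * nsq x).
have sb : smooth b.
  move=> k; apply: (@Ck_flat R k 0 (fun x => 1 - d ^- 2 * nsq x)).
  rewrite (_ : (fun x => _) = cst 1 \+ (fun x => - d ^- 2 * nsq x)); last first.
    by apply/funext => x /=; rewrite mulNr.
  by apply: CkD; [exact: Ck_cst|apply: CkZ; exact: Ck_nsq].
have b0 x : 0 <= b x by exact: flat_ge0.
have bb : bsupp d b.
  move=> x bx; have nx : nsq x < d ^+ 2.
    rewrite ltNge; apply/negP => nx; move/eqP : bx; apply.
    by rewrite /b flat_le0// subr_le0 mulrC ler_pdivlMr ?mul1r// exprn_gt0.
  have le1 (t : R) : t ^+ 2 <= nsq x -> `|t| <= d.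
    move=> tx; rewrite -ler_sqr ?nnegrE ?(ltW d0)//.
    by rewrite real_normK ?num_real// ltW// (le_lt_trans tx).
  by split; apply: le1; rewrite /nsq ?lerDl ?lerDr sqr_ge0.
have tb := testTP sb bb.
have ib := int1_test tb.
pose Z : \bar R := (\int[lb2]_x (b x)%:E)%E.
have Zfin : Z \is a fin_num by exact: (integrable_fin_num measurableT ib).
have Z0 : (0 <= Z)%E by apply: integral_ge0 => x _; rewrite lee_fin.
have mb := test_measurable tb.
have Zgt0 : 0 < fine Z.
  rewrite lt_neqAle fine_ge0// andbT; apply/eqP => Zeq.
  have ZE : (\int[lb2]_x `|(b x)%:E| = 0)%E.
    by under eq_integral do rewrite gee0_abs ?lee_fin//; rewrite -[LHS](fineK Zfin) -Zeq.
  have mbE : measurable_fun [set: R * R] (EFin \o b) by exact/measurable_EFinP.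
  have [N [mN N0 HN]] := (ae_eq_integral_abs lb2 measurableT mbE).1 ZE.
  have sub : box (d / 2) `<=` N.
    move=> x [x1 x2]; apply: HN => /= /(_ Logic.I) [bx0].
    suff : 0 < b x by rewrite bx0 ltxx.
    apply: flat_gt0; rewrite subr_gt0 mulrC ltr_pdivrMr ?exprn_gt0// mul1r.
    have h1 : x.1 ^+ 2 <= (d / 2) ^+ 2 by rewrite -[x.1 ^+ 2]real_normK ?num_real// ler_sqr ?nnegrE// divr_ge0// ltW.
    have h2 : x.2 ^+ 2 <= (d / 2) ^+ 2 by rewrite -[x.2 ^+ 2]real_normK ?num_real// ler_sqr ?nnegrE// divr_ge0// ltW.
    rewrite /nsq; nra.
  have : (lb2 (box (d / 2)) <= 0)%E.
    by rewrite -N0; apply: le_measure => //; rewrite inE//; exact: measurable_box.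
  rewrite lb2_box; last by rewrite divr_ge0// ltW.
  rewrite lee_fin leNgt => /negP; apply.
  by rewrite exprn_gt0// mulr_gt0// divr_gt0.
exists (fun x => (fine Z)^-1 * b x); split.
- exact: testZ.
- by move=> x; rewrite mulr_ge0// invr_ge0 ltW.
- under eq_integral do rewrite EFinM.
  rewrite ge0_integralZl//; last 3 first.
  + exact/measurable_EFinP.
  + by move=> x _; rewrite lee_fin.
  + by rewrite lee_fin invr_ge0 ltW.
  by rewrite -/Z -(fineK Zfin) -EFinM mulVf// gt_eqF.
- by move=> x /eqP cx; apply: bb; apply/eqP => bx; apply: cx; rewrite bx mulr0.
Qed.

Lemma int2_refl x (g : R * R -> \bar R) : measurable_fun [set: R * R] g ->
  (forall y, 0 <= g y)%E -> (\int[lb2]_y g (x - y)%R = \int[lb2]_y g y)%E.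
Proof.
move=> mg g0; rewrite [RHS](@int2_affine R (-1) x g _ mg g0) ?oppr_eq0 ?oner_eq0//.
by rewrite sqrrN expr1n mul1e; apply: eq_integral => y _; rewrite scaleN1r addrC.
Qed.

Lemma conv_sub f d eta x : mollifier d eta -> int1 f ->
  convol f eta x - f x = (\int[lb2]_y ((f y - f x) * eta (x - y)))%R.
Proof.
move=> [te e0 e1 _] if_.
have E1 : (\int[lb2]_y eta (x - y))%R = 1.
  rewrite /Rintegral (@int2_refl x (fun y => (eta y)%:E)) ?e1//.
  by apply/measurable_EFinP; exact: test_measurable te.
have ie : int1 (fun y => eta (x - y)) by apply: int1_test; exact: test_refl.
rewrite -[X in _ - X]mulr1 -[X in _ - f x * X]E1 -RintegralZl// /convol -RintegralB//.
- by apply: eq_Rintegral => y _; rewrite mulrBl.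
- exact: int1_conv.
- exact: int1Z.
Qed.

Lemma conv_sub_le f d eta x : mollifier d eta -> int1 f ->
  (`|convol f eta x - f x|%:E <= \int[lb2]_z (`|f (x - z) - f x| * eta z)%:E)%E.
Proof.
move=> me if_; have [te e0 e1 _] := me.
have mf := int1_mf if_; have met := test_measurable te.
have ie : int1 (fun y => eta (x - y)) by apply: int1_test; exact: test_refl.
have ifx : int1 (fun y => (f y - f x) * eta (x - y)).
  rewrite (_ : (fun y => _) = (fun y => f y * eta (x - y) - f x * eta (x - y))); last first.
    by apply/funext => y; rewrite mulrBl.
  by apply: int1B; [exact: int1_conv|exact: int1Z].
rewrite (conv_sub x me if_).
have -> : (`|(\int[lb2]_y ((f y - f x) * eta (x - y)))%R|%:E = `|\int[lb2]_y ((f y - f x) * eta (x - y))%:E|)%E.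
  by rewrite -abse_EFin /Rintegral fineK//; exact: (integrable_fin_num measurableT ifx).
apply: (le_trans (le_abse_integral _ _ _)) => //; first by case/integrableP : ifx.
rewrite -(@int2_refl x (fun z => (`|f (x - z) - f x| * eta z)%:E)).
- rewrite le_eqVlt; apply/orP; left; apply/eqP; apply: eq_integral => y _ /=.
  by rewrite subKr normrM (ger0_norm (e0 _)).
- apply/measurable_EFinP; apply: measurable_funM => //; apply: measurableT_comp => //.
  by apply: measurable_funB => //; apply: (measurableT_comp mf); exact: measurable_refl.
- by move=> y; rewrite lee_fin mulr_ge0.
Qed.

(** Jensen's inequality for the probability density [eta], by Cauchy-Schwarz with sqrt
    [eta]. *)
Lemma conv_sub_sqr_le f d eta x : mollifier d eta -> int1 f ->
  (((convol f eta x - f x) ^+ 2)%:E <= \int[lb2]_z ((f (x - z) - f x) ^+ 2 * eta z)%:E)%E.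
Proof.
move=> me if_; have [te e0 e1 _] := me.
have mf := int1_mf if_; have met := test_measurable te.
set I := (\int[lb2]_z _)%E.
have [->|If] := eqVneq I +oo%E; first by rewrite leey.
have I0 : (0 <= I)%E by apply: integral_ge0 => z _; rewrite lee_fin mulr_ge0// sqr_ge0.
have Ifin : I \is a fin_num by rewrite ge0_fin_numE// ltey.
have msf : measurable_fun [set: R * R] (fun z => `|f (x - z) - f x|).
  apply: measurableT_comp => //; apply: measurable_funB => //.
  by apply: (measurableT_comp mf); exact: measurable_refl.
have mse : measurable_fun [set: R * R] (fun z => Num.sqrt (eta z)).
  by apply: (measurableT_comp (continuous_measurable_fun (@sqrt_continuous R))).
have [] := @cauchy_schwarz _ _ R lb2 setT measurableT (fun z => `|f (x - z) - f x| * Num.sqrt (eta z)) (fun z => Num.sqrt (eta z)) (fine I) 1.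
- exact: measurable_funM.
- by [].
- by move=> z _; rewrite mulr_ge0// sqrtr_ge0.
- by move=> z _; rewrite sqrtr_ge0.
- rewrite fineK// le_eqVlt; apply/orP; left; apply/eqP; apply: eq_integral => z _.
  by rewrite exprMn sqr_sqrtr// real_normK ?num_real.
- rewrite -e1 le_eqVlt; apply/orP; left; apply/eqP; apply: eq_integral => z _.
  by rewrite sqr_sqrtr.
move=> c cE [c0 cI].
have := conv_sub_le x me if_.
rewrite [X in (_ <= X)%E](_ : _ = c%:E); last first.
  by rewrite -cE; apply: eq_integral => z _; rewrite -mulrA -expr2 sqr_sqrtr.
rewrite lee_fin -(fineK Ifin) lee_fin => H.
rewrite mulr1 in cI; apply: le_trans cI.
by rewrite -[X in X <= _]real_normK ?num_real// ler_sqr ?nnegrE.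
Qed.

Lemma lb2_sigma_finite : sigma_finite [set: R * R] lb2.
Proof.
exists (fun n => box (n%:R : R)).
  apply/esym/seteqP; split => // x _.
  exists (maxn (Num.truncn `|x.1|).+1 (Num.truncn `|x.2|).+1) => //.
  split; apply: (le_trans (ltW (truncnS_gt _))); rewrite ler_nat; [exact: leq_maxl|exact: leq_maxr].
move=> n; split; first exact: measurable_box.
by rewrite lb2_box// ltry.
Qed.

Lemma tonelli4 (F : (R * R) * (R * R) -> \bar R) :
  measurable_fun [set: (R * R) * (R * R)] F -> (forall p, 0 <= F p)%E ->
  measurable_fun [set: R * R] (fun y => \int[lb2]_x F (x, y))%E /\
  (\int[lb2]_x \int[lb2]_y F (x, y) = \int[lb2]_y \int[lb2]_x F (x, y))%E.
Proof.
move=> mF F0.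
pose pm := (@lebesgue_measure R \x @lebesgue_measure R)%E.
pose mix := @Measure_isSigmaFinite.Build _ (measurableTypeR R * measurableTypeR R)%type R pm lb2_sigma_finite.
pose m : {sigma_finite_measure set (measurableTypeR R * measurableTypeR R)%type -> \bar R} :=
  HB.pack (@lebesgue_measure R \x @lebesgue_measure R)%E mix.
split; first exact: (@measurable_fun_fubini_tonelli_G _ _ _ _ R m F mF F0).
exact: (@fubini_tonelli _ _ _ _ R m m F mF F0).
Qed.

(** If all small translates of f are close to f in the sense of [phi], so is their
    average. With [phi] the absolute value or the square this covers the L1 and L2
    theorems at once. *)
Lemma avg_transl (phi : R -> R) f d eta (e : R) : 0 <= e -> mollifier d eta -> measurable_fun [set: R] phi ->
  (forall s, 0 <= phi s) -> measurable_fun [set: R * R] f ->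
  (forall z : R * R, `|z.1| <= d -> `|z.2| <= d -> (\int[lb2]_x (phi (f (x + z) - f x))%:E <= e%:E)%E) ->
  (\int[lb2]_x \int[lb2]_z (phi (f (x - z) - f x) * eta z)%:E <= e%:E)%E.
Proof.
move=> ege0 [te e0 e1 bd] mphi phi0 mf H.
have met := test_measurable te.
have mF : measurable_fun [set: (R * R) * (R * R)] (fun p : (R * R) * (R * R) => (phi (f (p.1 - p.2) - f p.1) * eta p.2)%:E).
  apply/measurable_EFinP; apply: measurable_funM; last by apply: (measurableT_comp met); exact: measurable_snd.
  apply: (measurableT_comp mphi); apply: measurable_funB; last by apply: (measurableT_comp mf); exact: measurable_fst.
  apply: (measurableT_comp mf); apply: measurable_fun_pair; apply: measurable_funB.
  - by apply: measurableT_comp; [exact: measurable_fst|exact: measurable_fst].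
  - by apply: measurableT_comp; [exact: measurable_fst|exact: measurable_snd].
  - by apply: measurableT_comp; [exact: measurable_snd|exact: measurable_fst].
  - by apply: measurableT_comp; [exact: measurable_snd|exact: measurable_snd].
have F0 (p : (R * R) * (R * R)) : (0 <= (phi (f (p.1 - p.2) - f p.1) * eta p.2)%:E)%E.
  by rewrite lee_fin mulr_ge0.
have -> : (\int[lb2]_x \int[lb2]_z (phi (f (x - z) - f x) * eta z)%:E =
    \int[lb2]_z \int[lb2]_x (phi (f (x - z) - f x) * eta z)%:E)%E.
  exact: (tonelli4 mF F0).2.
have sE z : (\int[lb2]_x (phi (f (x - z) - f x) * eta z)%:E <= e%:E * (eta z)%:E)%E.
  under eq_integral do rewrite mulrC EFinM.
  have mpf : measurable_fun [set: R * R] (fun x => (phi (f (x - z) - f x))%:E).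
    apply/measurable_EFinP; apply: (measurableT_comp mphi); apply: measurable_funB => //.
    by apply: (measurableT_comp mf); exact: (measurable_shift (- z)).
  rewrite ge0_integralZl//; last by rewrite lee_fin.
  have [ez|ez] := eqVneq (eta z) 0; first by rewrite ez mul0e mule0.
  rewrite muleC; apply: lee_wpmul2r; first by rewrite lee_fin.
  by have [z1 z2] := bd z ez; apply: H; rewrite /= normrN.
  by move=> x _; rewrite lee_fin.
apply: (@le_trans _ _ (\int[lb2]_z (e%:E * (eta z)%:E))%E).
  apply: ge0_le_integral => //.
  - by move=> z _; apply: integral_ge0 => x _; exact: (F0 (x, z)).
  - exact: (tonelli4 mF F0).1.
  - by apply: measurable_funeM; exact/measurable_EFinP.
rewrite ge0_integralZl ?e1 ?mule1//.
- exact/measurable_EFinP.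
- by move=> x _; rewrite lee_fin.
Qed.

Definition int2 f := lb2.-integrable [set: R * R] (fun x => (f x ^+ 2)%:E).

Lemma mollify_L1 f (e : R) : int1 f -> 0 < e -> exists2 d0 : R, 0 < d0 &
  forall d eta, d <= d0 -> mollifier d eta -> (\int[lb2]_x `|convol f eta x - f x|%:E <= e%:E)%E.
Proof.
move=> if_ e0; have [d0 d00 H] := transl2 if_ e0; exists d0 => // d eta dd0 me.
have [te _ _ _] := me; have mf := int1_mf if_.
have mcf : measurable_fun [set: R * R] (convol f eta).
  by apply: continuous_measurable2; exact: conv_continuous.
apply: (@le_trans _ _ (\int[lb2]_x \int[lb2]_z (`|f (x - z) - f x| * eta z)%:E)%E).
  apply: ge0_le_integral => //.
  - by apply/measurable_EFinP; apply: measurableT_comp => //; exact: measurable_funB.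
  - have [] := @tonelli4 (fun p => (`|f (p.2 - p.1) - f p.2| * eta p.1)%:E) _ _ => //.
    + apply/measurable_EFinP; apply: measurable_funM; last by apply: (measurableT_comp (test_measurable te)); exact: measurable_fst.
      apply: measurableT_comp => //; apply: measurable_funB; last by apply: (measurableT_comp mf); exact: measurable_snd.
      apply: (measurableT_comp mf); apply: measurable_fun_pair; apply: measurable_funB.
      * by apply: measurableT_comp; [exact: measurable_fst|exact: measurable_snd].
      * by apply: measurableT_comp; [exact: measurable_fst|exact: measurable_fst].
      * by apply: measurableT_comp; [exact: measurable_snd|exact: measurable_snd].
      * by apply: measurableT_comp; [exact: measurable_snd|exact: measurable_fst].
    + by move=> p; rewrite lee_fin mulr_ge0//; case: me.
  - by move=> x _; exact: (conv_sub_le x me if_).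
apply: (@avg_transl Num.norm f d eta e) => //; first exact: ltW.
by move=> z z1 z2; apply: H; exact: le_trans dd0.
Qed.

Lemma mollify_L2 f (e : R) : int1 f -> int2 f -> 0 < e -> exists2 d0 : R, 0 < d0 &
  forall d eta, d <= d0 -> mollifier d eta -> (\int[lb2]_x ((convol f eta x - f x) ^+ 2)%:E <= e%:E)%E.
Proof.
move=> if_ if2 e0; have [d0 d00 H] := transl2_sqr if_ if2 e0; exists d0 => // d eta dd0 me.
have [te _ _ _] := me; have mf := int1_mf if_.
have mcf : measurable_fun [set: R * R] (convol f eta).
  by apply: continuous_measurable2; exact: conv_continuous.
apply: (@le_trans _ _ (\int[lb2]_x \int[lb2]_z ((f (x - z) - f x) ^+ 2 * eta z)%:E)%E).
  apply: ge0_le_integral => //.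
  - by move=> x _; rewrite lee_fin sqr_ge0.
  - by apply/measurable_EFinP; apply: measurable_funX; exact: measurable_funB.
  - have [] := @tonelli4 (fun p => ((f (p.2 - p.1) - f p.2) ^+ 2 * eta p.1)%:E) _ _ => //.
    + apply/measurable_EFinP; apply: measurable_funM; last by apply: (measurableT_comp (test_measurable te)); exact: measurable_fst.
      apply: measurable_funX; apply: measurable_funB; last by apply: (measurableT_comp mf); exact: measurable_snd.
      apply: (measurableT_comp mf); apply: measurable_fun_pair; apply: measurable_funB.
      * by apply: measurableT_comp; [exact: measurable_fst|exact: measurable_snd].
      * by apply: measurableT_comp; [exact: measurable_fst|exact: measurable_fst].
      * by apply: measurableT_comp; [exact: measurable_snd|exact: measurable_snd].
      * by apply: measurableT_comp; [exact: measurable_snd|exact: measurable_fst].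
    + by move=> p; rewrite lee_fin mulr_ge0 ?sqr_ge0//; case: me.
  - by move=> x _; exact: (conv_sub_sqr_le x me if_).
apply: (@avg_transl (fun s => s ^+ 2) f d eta e) => //; first exact: ltW.
- by move=> s; exact: sqr_ge0.
- by move=> z z1 z2; apply: H; exact: le_trans dd0.
Qed.

End convolution.

(** * Weak derivatives *)

Section weak_derivatives.
Context (R : realType).
Implicit Types (f g u v : R * R -> R) (x y z w : R * R).
Local Notation lb2 := (@leb2 R).
Local Notation testT := (test_function [set: R * R]).

Lemma compact_measurable2 (K : set (R * R)) : compact K -> measurable K.
Proof.
move=> cK; have cl : closed K by apply: compact_closed => //; exact: norm_hausdorff.
rewrite -(setCK K); apply: measurableC; apply: open_measurable2.
by rewrite openC.
Qed.

Lemma L1loc_box u (M : R) : L1loc u -> int1 (fun x => u x * \1_(box M) x).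
Proof.
move=> [mu iu]; have mb := @measurable_box R M.
have := (@integrable_mkcond _ _ _ lb2 _ (EFin \o u) mb).1 (iu _ (@compact_box R M)).
rewrite /int1; have -> // : ((EFin \o u) \_ (box M)) = EFin \o (fun x => u x * \1_(box M) x).
apply/funext => x /=.
by rewrite patchE indicE; case: ifP => _ /=; rewrite ?mulr1 ?mulr0.
Qed.

Lemma L1loc_int1 u : int1 u -> L1loc u.
Proof.
move=> iu; split; first exact: int1_mf.
move=> K cK; apply: integrableS iu => //; exact: compact_measurable2.
Qed.

Lemma L1loc_test u phi : L1loc u -> testT phi -> int1 (fun x => u x * phi x).
Proof.
move=> lu tp; have [M M0 bM] := test_bsupp tp; have [C C0 HC] := test_bounded tp.
have -> : (fun x => u x * phi x) = (fun x => u x * \1_(box M) x * phi x).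
  apply/funext => x; rewrite -mulrA; congr (_ * _); rewrite indicE.
  have [->|px] := eqVneq (phi x) 0; first by rewrite mulr0.
  by rewrite mem_set ?mul1r//; exact: bM.
by apply: (@int1Mb _ _ _ C) => //; [exact: L1loc_box|exact: test_measurable tp].
Qed.

Lemma L1locD u v (c : R) : L1loc u -> L1loc v -> L1loc (c *: u + v).
Proof.
move=> [mu iu] [mv iv]; split.
  by apply: measurable_funD => //; exact: measurable_funM.
move=> K cK; have mK := compact_measurable2 cK.
have i1 := @integrableZl _ _ _ lb2 K mK c _ (iu _ cK).
exact: (@integrableD _ _ _ lb2 K mK _ _ i1 (iv _ cK)).
Qed.

Lemma int_eq_int1 f g : int1 f -> int1 g ->
  (\int[lb2]_x (f x)%:E = - \int[lb2]_x (g x)%:E)%E <-> (\int[lb2]_x (f x))%R = - (\int[lb2]_x g x)%R.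
Proof.
move=> if_ ig; have ff := integrable_fin_num measurableT if_; have fg := integrable_fin_num measurableT ig.
rewrite /Rintegral; split => [->|H]; first by rewrite fineN.
by rewrite -(fineK ff) -(fineK fg) -EFinN; congr (_%:E).
Qed.

(** All mollifications of g restricted to a large square vanish inside a smaller one,
    and they converge to g in L1. *)
Lemma weak_deriv_uniq0 g : L1loc g ->
  (forall phi, testT phi -> (\int[lb2]_x (g x * phi x))%R = 0) -> {ae lb2, forall x, g x = 0}.
Proof.
move=> lg H.
have key (n : nat) : {ae lb2, forall x, box (n%:R : R) x -> g x = 0}.
  pose gn x := g x * \1_(box (n%:R + 1 : R)) x.
  have ig : int1 gn by exact: L1loc_box.
  have mgn := int1_mf ig.
  have mb : measurable_fun [set: R * R] (fun x => \1_(box (n%:R : R)) x : R) by apply: measurable_indic; exact: measurable_box.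
  have mF : measurable_fun [set: R * R] (fun x => (gn x * \1_(box n%:R) x)%:E).
    by apply/measurable_EFinP; exact: measurable_funM.
  have : (\int[lb2]_x `|(gn x * \1_(box n%:R) x)%:E| = 0)%E.
    apply/eqP; rewrite eq_le integral_ge0// andbT; apply/lee_addgt0Pr => e e0; rewrite add0e.
    have [d0 d00 Hd] := mollify_L1 ig e0.
    pose d := Num.min d0 1; have dp : 0 < d by rewrite lt_min d00 ltr01.
    have [eta me] := mollifier_ex dp; have [te eta0 _ bd] := me.
    have dd0 : d <= d0 by rewrite ge_min lexx.
    apply: le_trans (Hd d eta dd0 me).
    apply: ge0_le_integral => //; first exact: measurableT_comp.
    - apply/measurable_EFinP; apply: measurableT_comp => //; apply: measurable_funB => //.
      by apply: continuous_measurable2; exact: conv_continuous.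
    - move=> x _; rewrite lee_fin indicE; case: (boolP (x \in box n%:R)) => [/set_mem[x1 x2]|_]; last by rewrite mulr0 normr0.
      rewrite mulr1 (_ : convol gn eta x = 0) ?sub0r ?normrN//.
      rewrite -(H _ (test_refl x te)); apply: eq_Rintegral => y _; rewrite /gn -mulrA; congr (_ * _).
      have [->|ey] := eqVneq (eta (x - y)) 0; first by rewrite mulr0.
      rewrite indicE mem_set ?mul1r//; have [/= y1 y2] := bd _ ey.
      have d1 : d <= 1 by rewrite ge_min lexx orbT.
      have tri (p q r : R) : `|p| <= r -> `|p - q| <= d -> `|q| <= r + 1.
        move=> pr pq; rewrite (_ : q = p - (p - q)); last by ring.
        by rewrite (le_trans (ler_normB _ _))// lerD//; exact: le_trans d1.
      by split; [exact: tri x1 y1|exact: tri x2 y2].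
  move=> /(ae_eq_integral_abs lb2 measurableT mF).1; apply: aeS => x /(_ Logic.I) E bx.
  move: E; rewrite /gn /= !indicE (mem_set bx) mulr1 mem_set ?mulr1; first by move=> [].
  by case: bx => b1 b2; split; apply: ler_wpDr.
have := (ae_foralln key); apply: aeS => x Hx.
apply: (Hx (maxn (Num.truncn `|x.1|).+1 (Num.truncn `|x.2|).+1)).
split; apply: (le_trans (ltW (truncnS_gt _))); rewrite ler_nat; [exact: leq_maxl|exact: leq_maxr].
Qed.

Lemma weak_deriv_uniq w u g h : is_weak_deriv w u g -> is_weak_deriv w u h ->
  {ae lb2, forall x, g x = h x}.
Proof.
move=> [lg Hg] [lh Hh].
have lgh : L1loc ((-1) *: h + g) by exact: L1locD.
have : {ae lb2, forall x, ((-1) *: h + g) x = 0}.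
  apply: weak_deriv_uniq0 => // phi tp.
  have i1 := L1loc_test lg tp; have i2 := L1loc_test lh tp.
  rewrite (_ : (fun x => _) = (fun x => g x * phi x - h x * phi x)); last first.
    apply/funext => x; change ((- 1 * h x + g x) * phi x = g x * phi x - h x * phi x); ring.
  rewrite RintegralB//; apply/eqP; rewrite subr_eq0; apply/eqP.
  have := Hg _ tp; rewrite (Hh _ tp) => /eqP; rewrite eqe_opp => /eqP E.
  by rewrite /Rintegral E.
by apply: aeS => x E; have {E}: - 1 * h x + g x = 0 by []; lra.
Qed.

Lemma weak_derivP w u : (exists g, is_weak_deriv w u g) -> is_weak_deriv w u (weak_deriv w u).
Proof. by move=> [g Hg]; exact: (xgetPex 0 (ex_intro _ g Hg)). Qed.

(** [weak_deriv] picks one weak derivative by choice; every other one agrees with it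
    almost everywhere, so energies may be computed with any of them. *)
Lemma weak_derivE w u g : is_weak_deriv w u g -> {ae lb2, forall x, weak_deriv w u x = g x}.
Proof. by move=> Hg; apply: (@weak_deriv_uniq w u) => //; apply: weak_derivP; exists g. Qed.

Lemma is_weak_derivD w u v g h (c : R) :
  (forall phi, testT phi -> testT ('D_w phi)) ->
  L1loc u -> L1loc v -> is_weak_deriv w u g -> is_weak_deriv w v h ->
  is_weak_deriv w (c *: u + v) (c *: g + h).
Proof.
move=> tD lu lv [lg Hg] [lh Hh]; split; first exact: L1locD.
move=> phi tp; have tDp := tD _ tp.
have iu := L1loc_test lu tDp; have iv := L1loc_test lv tDp.
have ig := L1loc_test lg tp; have ih := L1loc_test lh tp.
apply/int_eq_int1; [by apply: L1loc_test => //; exact: L1locD..|].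
have E1 := (int_eq_int1 iu ig).1 (Hg _ tp); have E2 := (int_eq_int1 iv ih).1 (Hh _ tp).
have dec (a b k : R * R -> R) : int1 (fun x => a x * k x) -> int1 (fun x => b x * k x) ->
    (\int[lb2]_x ((c *: a + b) x * k x))%R = c * (\int[lb2]_x (a x * k x))%R + (\int[lb2]_x (b x * k x))%R.
  move=> ia ib; rewrite -RintegralZl// -RintegralD//; last exact: int1Z.
  by apply: eq_Rintegral => x _; rewrite /= mulrDl mulrA.
by rewrite !dec// E1 E2 mulrN opprD.
Qed.

Lemma int1_indic_box (M : R) : int1 (fun x => \1_(box M) x : R).
Proof.
apply/integrableP; split.
  by apply/measurable_EFinP; apply: measurable_indic; exact: measurable_box.
under eq_integral do rewrite /= ger0_norm ?indicE//; under eq_integral do rewrite -indicE.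
rewrite integral_indic ?setIT//; last exact: measurable_box.
apply: (@le_lt_trans _ _ (lb2 (box `|M|))).
  apply: le_measure; rewrite ?inE; [exact: measurable_box..|].
  by move=> x [? ?]; split; apply: le_trans (ler_norm M).
by rewrite lb2_box// ltry.
Qed.

Lemma Rint_shift (z : R * R) f : int1 f -> (\int[lb2]_x f (x + z))%R = (\int[lb2]_x f x)%R.
Proof.
move=> if_; have mf := int1_mf if_; rewrite /Rintegral; congr fine.
have me : measurable_fun [set: R * R] (EFin \o f) by apply/measurable_EFinP.
have E1 := @int2_shift R z ((EFin \o f)^\+)%E (measurable_funepos me) (fun=> funepos_ge0 _ _).
have E2 := @int2_shift R z ((EFin \o f)^\-)%E (measurable_funeneg me) (fun=> funeneg_ge0 _ _).
rewrite integralE [RHS]integralE -E1 -E2; congr (_ - _)%E; apply: eq_integral => x _.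
  by rewrite unlock.
by rewrite unlock.
Qed.

(** The only directions for which Ck, and hence test functions, provide derivatives. *)
Definition axis w := w = @e1 R \/ w = @e2 R.

Lemma axis1 : axis (@e1 R). Proof. by left. Qed.
Lemma axis2 : axis (@e2 R). Proof. by right. Qed.

Lemma axis_test w O f : axis w -> test_function O f -> test_function O ('D_w f).
Proof. by move=> [->|->] tf; [exact: test_D1|exact: test_D2]. Qed.

Lemma axis_derivable w f x : axis w -> smooth f -> derivable f x w.
Proof. by move=> [->|->] sf; [exact: (@smooth_d1 R f x sf)|exact: (@smooth_d2 R f x sf)]. Qed.

Arguments axis_derivable {w f} x.
Lemma axis_norm w : axis w -> `|w.1| + `|w.2| <= 1.
Proof. by move=> [->|->] /=; rewrite normr0 normr1 ?addr0 ?add0r. Qed.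

(** The Taylor bound with a fixed compact support for the remainder, hence integrable.
    *)
Lemma test_taylor_box (v : R * R) f : axis v -> testT f ->
  exists C M : R, [/\ 0 <= C, 0 <= M & forall x (h : R), `|h| <= 1 ->
    `|f (h *: v + x) - f x - h * 'D_v f x| <= C * h ^+ 2 * \1_(box M) x].
Proof.
move=> av tf; have [C C0 HC] := test_taylor tf (axis_test av tf) (fun y => axis_derivable y av (test_smooth tf)) (axis_norm av).
have [M M0 bM] := test_bsupp tf; exists C, (M + 1); split => //; first exact: addr_ge0.
move=> x h h1; rewrite indicE; case: (boolP (x \in box (M + 1))) => [_|xb]; first by rewrite mulr1.
have xb' : ~ box (M + 1) x by move=> /mem_set; apply/negP.
have f0 : f x = 0.
  by apply/eqP/negPn/negP => /bM[? ?]; apply: xb'; split; rewrite ler_wpDr.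
have hv (c : R) : `|c| <= 1 -> `|h * c| <= 1 by move=> c1; rewrite normrM mulr_ile1.
have [v1 v2] : `|v.1| <= 1 /\ `|v.2| <= 1.
  by case: av => ->; rewrite /e1 /e2 /= normr1 normr0.
have fh0 : f (h *: v + x) = 0.
  apply/eqP/negPn/negP => /bM[/= x1 x2]; apply: xb'; split.
    rewrite -(addKr (h * v.1) x.1) addrC (le_trans (ler_normD _ _))// normrN lerD// hv//.
  by rewrite -(addKr (h * v.2) x.2) addrC (le_trans (ler_normD _ _))// normrN lerD// hv.
have D0 : 'D_v f x = 0.
  apply: supp_derive => sx; apply: xb'.
  have : box M x by rewrite (closure_id (box M)).1//; [apply: closureS sx => y; exact: bM|exact: closed_box].
  by case=> ? ?; split; rewrite ler_wpDr.
by rewrite f0 fh0 D0 !(mulr0, subr0) normr0.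
Qed.

(** Difference quotients have integral 0 by translation invariance, and by
    [test_taylor_box] the derivative is their limit in L1. *)
Lemma int_D_test (v : R * R) f : axis v -> testT f -> (\int[lb2]_x ('D_v f x))%R = 0.
Proof.
move=> av tf; have tDf := axis_test av tf; have [C [M [C0 M0 HC]]] := test_taylor_box av tf.
set I := (X in X = 0).
pose K := C * (\int[lb2]_x (\1_(box M) x : R))%R.
have ib := int1_indic_box M.
have K0 : 0 <= K by rewrite mulr_ge0// Rintegral_ge0// => x _; rewrite indicE.
have key (h : R) : 0 < h <= 1 -> h * `|I| <= K * h ^+ 2.
  move=> /andP[h0 h1]; have h1' : `|h| <= 1 by rewrite gtr0_norm.
  have tfh : testT (fun x => f (h *: v + x)) by exact: test_transl.
  have E0 : (\int[lb2]_x f (h *: v + x))%R = (\int[lb2]_x f x)%R.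
    rewrite -(Rint_shift (h *: v) (int1_test tf)); apply: eq_Rintegral => x _.
    by rewrite addrC.
  have i1 := int1_test tfh; have i2 := int1_test tf; have i3 := int1Z h (int1_test tDf).
  have E1 : h * I = - (\int[lb2]_x (f (h *: v + x) - f x - h * 'D_v f x))%R.
    rewrite RintegralB//; last exact: int1B.
    rewrite RintegralB// E0 subrr sub0r opprK RintegralZl//; exact: int1_test.
  rewrite -[h in h * `|I|]gtr0_norm// -normrM E1 normrN.
  have -> : K * h ^+ 2 = (\int[lb2]_x (C * h ^+ 2 * \1_(box M) x))%R.
    by rewrite RintegralZl// /K mulrAC.
  apply: le_Rint; first exact: int1Z.
    exact: (int1_mf (int1B (int1B i1 i2) i3)).
  by move=> x; exact: HC.
have : `|I| <= 0.
  apply/ler_addgt0Pr => e e0; rewrite add0r.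
  pose h := Num.min 1 (e / (K + 1)).
  have K1 : 0 < K + 1 by lra.
  have h0 : 0 < h by rewrite lt_min ltr01 divr_gt0.
  have h1 : h <= 1 by rewrite ge_min lexx.
  have h2 : h * (K + 1) <= e by rewrite -ler_pdivlMr// ge_min lexx orbT.
  have := key h; rewrite h0 h1 => /(_ isT); rewrite expr2 mulrA (mulrC h) ler_pM2r// => H.
  by apply: le_trans H _; apply: le_trans h2; rewrite mulrC ler_wpM2l ?ltW//; lra.
by rewrite normr_le0 => /eqP.
Qed.

Lemma L1loc_test1 phi : testT phi -> L1loc phi.
Proof. by move=> tp; apply: L1loc_int1; exact: int1_test. Qed.

Lemma axis_DM w f g x : axis w -> smooth f -> smooth g ->
  'D_w (f \* g) x = f x * 'D_w g x + 'D_w f x * g x.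
Proof.
move=> aw sf sg; rewrite (deriveM (axis_derivable x aw sf) (axis_derivable x aw sg)).
by rewrite /GRing.scale /= (mulrC (g x)).
Qed.

Lemma weak_deriv_test w f : axis w -> testT f -> is_weak_deriv w f ('D_w f).
Proof.
move=> aw tf; have tDf := axis_test aw tf; split; first exact: L1loc_test1.
move=> phi tp; have tDp := axis_test aw tp.
have sf := test_smooth tf; have sp := test_smooth tp.
have i1 := L1loc_test (L1loc_test1 tf) tDp; have i2 := L1loc_test (L1loc_test1 tDf) tp.
apply/int_eq_int1 => //.
have tfp : testT (f \* phi) by exact: testM sp tf.
have := int_D_test aw tfp.
rewrite (_ : 'D_w (f \* phi) = fun x => f x * 'D_w phi x + 'D_w f x * phi x); last first.
  by apply/funext => x; exact: axis_DM.
by rewrite RintegralD// => /eqP; rewrite addr_eq0 => /eqP.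
Qed.

(** The Leibniz rule: test against z times a test function. *)
Lemma weak_derivM w u g (z : R * R -> R) : axis w -> testT z -> L1loc u -> is_weak_deriv w u g ->
  is_weak_deriv w (fun x => z x * u x) (fun x => z x * g x + 'D_w z x * u x).
Proof.
move=> aw tz lu [lg Hg]; have tDz := axis_test aw tz.
have com (k h : R * R -> R) : (fun x => k x * h x) = (fun x => h x * k x).
  by apply/funext => x; rewrite mulrC.
have izg : int1 (fun x => z x * g x) by rewrite com; exact: L1loc_test.
have iDu : int1 (fun x => 'D_w z x * u x) by rewrite com; exact: L1loc_test.
have izu : int1 (fun x => z x * u x) by rewrite com; exact: L1loc_test.
have lzg := L1loc_int1 izg; have lDu := L1loc_int1 iDu.
split; first by apply: L1loc_int1; exact: int1D.
move=> phi tp; have tDp := axis_test aw tp.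
have sz := test_smooth tz; have sp := test_smooth tp.
have tzp : testT (z \* phi) by exact: testM sp tz.
have i1 := L1loc_test (L1loc_int1 izu) tDp.
have i2 := L1loc_test lzg tp; have i3 := L1loc_test lDu tp.
have E : (fun x => (z x * g x + 'D_w z x * u x) * phi x) =
  (fun x => z x * g x * phi x + 'D_w z x * u x * phi x).
  by apply/funext => x; rewrite mulrDl.
apply/int_eq_int1 => //; first by rewrite E; exact: int1D.
have H := Hg _ tzp.
have j1 := L1loc_test lu (axis_test aw tzp); have j2 := L1loc_test lg tzp.
have {H} := (int_eq_int1 j1 j2).1 H.
rewrite E RintegralD// opprD => H.
rewrite (_ : (\int[lb2]_x (z x * g x * phi x))%R = (\int[lb2]_x (g x * (z \* phi) x))%R); last first.
  by apply: eq_Rintegral => x _ /=; ring.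
rewrite -H -RintegralB//; apply: eq_Rintegral => x _.
by rewrite axis_DM//; ring.
Qed.

(** Under the convolution the derivative falls on the reflected mollifier, which is a
    test function. *)
Lemma conv_weak_deriv w u g eta x : axis w -> int1 u -> int1 g -> is_weak_deriv w u g ->
  testT eta -> 'D_w (convol u eta) x = convol g eta x.
Proof.
move=> aw iu ig [lg Hg] te; have tDe := axis_test aw te; have se := test_smooth te.
have dc := conv_derive x iu te tDe (fun y => axis_derivable y aw se) (axis_norm aw).
rewrite (derive_val (is_derive := dc)).
have tr := test_refl x te.
have DR y : 'D_w (fun y => eta (x - y)) y = - 'D_w eta (x - y).
  have /is_derive_dir d1 := derivableP (axis_derivable (x - y) aw se).
  have d2 : is_derive (0 : R) 1 (fun h : R => - h) (- 1) by exact: is_deriveN.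
  rewrite -[(0 : R)]oppr0 in d1.
  have d3 := is_derive1_comp (f := fun h : R => eta (h *: w + (x - y))) (g := fun h : R => - h) (x := 0) d1 d2.
  have d4 : is_derive y w (fun y => eta (x - y)) (- 'D_w eta (x - y)).
    apply/is_derive_dir; apply: (is_derive_eq (f' := 'D_w eta (x - y) * - 1)); last by rewrite mulrN1.
    rewrite (_ : (fun h : R => _) = (fun h : R => eta (h *: w + (x - y))) \o (fun h : R => - h))//.
    by apply/funext => h /=; congr eta; rewrite scaleNr opprD addrCA.
  by rewrite (derive_val (is_derive := d4)).
have i1 := L1loc_test (L1loc_int1 iu) (axis_test aw tr); have i2 := L1loc_test lg tr.
have H := (int_eq_int1 i1 i2).1 (Hg _ tr).
rewrite /convol -[RHS]opprK -H.
rewrite -[RHS]mulN1r -RintegralZl//; apply: eq_Rintegral => y _.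
by rewrite DR; ring.
Qed.

End weak_derivatives.

(** * Sectors in polar coordinates *)

Section planar_geometry.
Context (R : realType).
Implicit Types (x y z : R * R) (s t r d e : R).
Local Notation mu := (@lebesgue_measure R).
Local Notation lb2 := (@leb2 R).

Lemma nsq_ge0 x : 0 <= nsq x.
Proof. by rewrite /nsq addr_ge0// sqr_ge0. Qed.

Lemma enorm_ge0 x : 0 <= enorm x.
Proof. exact: sqrtr_ge0. Qed.

Lemma enorm_sqr x : enorm x ^+ 2 = nsq x.
Proof. by rewrite sqr_sqrtr// nsq_ge0. Qed.

Lemma enorm_continuous : continuous (@enorm R).
Proof.
move=> x; apply: (@continuous_comp _ _ _ (@nsq R) (@Num.sqrt R)); last exact: sqrt_continuous.
exact: (Ck_cts (Ck_nsq R 0)).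
Qed.

Lemma measurable_enorm : measurable_fun [set: R * R] (@enorm R).
Proof. apply: continuous_measurable2; exact: enorm_continuous. Qed.

Lemma ray_den_gt0 t : 0 < Num.sqrt (1 + t ^+ 2).
Proof. by rewrite sqrtr_gt0 ltr_wpDr// sqr_ge0. Qed.

Lemma enorm_ray t r : enorm (ray t r) = `|r|.
Proof.
have q0 := ray_den_gt0 t.
rewrite /enorm /ray /= -sqrtr_sqr; congr Num.sqrt.
have : Num.sqrt (1 + t ^+ 2) ^+ 2 = 1 + t ^+ 2 by rewrite sqr_sqrtr// addr_ge0// sqr_ge0.
move: (Num.sqrt _) q0 => q q0 qE.
have -> : (r / q) ^+ 2 + (r / q * t) ^+ 2 = r ^+ 2 * (1 + t ^+ 2) / q ^+ 2.
  by rewrite !exprMn exprVn; ring.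
by rewrite -qE mulfK// sqrf_eq0 gt_eqF.
Qed.

(** For s = 1 and s = -1 these are the quadrants Q1 and Q3, see [sec1E] and [secN1E].
    Both are treated at once, as the images of the positive slopes under r > 0 and r <
    0. *)
Definition sec s : set (R * R) := [set x | 0 < s * x.1 /\ 0 <= s * x.2].

Definition ann s d e : set (R * R) := [set x | sec s x /\ d < enorm x < e].

Lemma measurable_coords (A B : set R) : measurable A -> measurable B ->
  measurable [set x : R * R | A x.1 /\ B x.2].
Proof.
move=> mA mB.
have m1 := @measurable_fst _ _ (measurableTypeR R) (measurableTypeR R).
have m2 := @measurable_snd _ _ (measurableTypeR R) (measurableTypeR R).
have h1 := m1 measurableT A mA; have h2 := m2 measurableT B mB.
rewrite setTI in h1; rewrite setTI in h2.
exact: (measurableI _ _ h1 h2).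
Qed.

Lemma measurable_sec s : measurable (sec s).
Proof.
have -> : sec s = [set x : R * R | ( *%R s @^-1` `]0, +oo[) x.1 /\ ( *%R s @^-1` `[0, +oo[) x.2].
  by apply/seteqP; split => x /=; rewrite !in_itv /= !andbT.
have ms : measurable_fun [set: R] ( *%R s) by exact: mulrl_measurable.
by apply: measurable_coords; rewrite -[X in measurable X]setTI; apply: ms.
Qed.

Lemma measurable_enorm_itv (i : interval R) : measurable [set x : R * R | enorm x \in i].
Proof.
have := measurable_enorm measurableT (measurable_itv i).
by rewrite setTI.
Qed.

Lemma measurable_ann s d e : measurable (ann s d e).
Proof.
have -> : ann s d e = sec s `&` [set x | enorm x \in `]d, e[].
  by apply/seteqP; split => x /=; rewrite in_itv.
apply: measurableI; [exact: measurable_sec|exact: measurable_enorm_itv].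
Qed.

Lemma annE s d e t r : s ^+ 2 = 1 -> 0 <= d ->
  ann s d e (ray t (s * r)) <-> 0 <= t /\ d < r < e.
Proof.
move=> s1 d0; have q0 := ray_den_gt0 t.
have ns : `|s| = 1 by apply/eqP; rewrite -sqr_norm_eq1 s1.
rewrite /ann /sec /= enorm_ray normrM ns mul1r /ray /=.
have -> : s * (s * r / Num.sqrt (1 + t ^+ 2)) = r / Num.sqrt (1 + t ^+ 2).
  by rewrite !mulrA -expr2 s1 mul1r.
have -> : s * (s * r / Num.sqrt (1 + t ^+ 2) * t) = r / Num.sqrt (1 + t ^+ 2) * t.
  by rewrite !mulrA -expr2 s1 mul1r.
split.
  move=> [[]]; rewrite pmulr_lgt0 ?invr_gt0// => r0.
  by rewrite gtr0_norm// pmulr_rge0// divr_gt0.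
move=> [t0 /andP[dr re]]; have r0 : 0 < r by exact: le_lt_trans dr.
by rewrite gtr0_norm// dr re divr_gt0// pmulr_rge0// divr_gt0.
Qed.

Local Open Scope ereal_scope.

Lemma measurable_polar_kernel t : measurable_fun [set: R] (fun r : R => (`|r| / (1 + t ^+ 2))%:E).
Proof.
apply/measurable_EFinP; apply: measurable_funM => //; exact: measurableT_comp.
Qed.

(** On the sector the coordinates t >= 0 and s r > 0 decouple, so the region of
    integration becomes a rectangle. *)
Lemma polar_ann s d e (F : R * R -> \bar R) : (s ^+ 2 = 1)%R -> (0 <= d)%R ->
  measurable_fun [set: R * R] F -> (forall x, 0 <= F x) ->
  \int[lb2]_(x in ann s d e) F x =
  \int[mu]_(t in `[0%R, +oo[) \int[mu]_(r in `]d, e[)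
     (F (ray t (s * r)) * (r / (1 + t ^+ 2))%:E).
Proof.
move=> s1 d0 mF F0.
have ns : `|s|%R = 1%R by apply/eqP; rewrite -sqr_norm_eq1 s1.
have sn0 : s != 0%R by rewrite -normr_eq0 ns oner_neq0.
rewrite integral_mkcond polar; last 2 first.
- by apply/(measurable_restrictT _ (measurable_ann s d e)); exact: measurable_funTS.
- by move=> x; rewrite patchE; case: ifP.
rewrite [RHS]integral_mkcond; apply: eq_integral => t _.
rewrite (@int1_affine R s 0)//; last 2 first.
- apply: emeasurable_funM; last exact: measurable_polar_kernel.
  apply: measurableT_comp (measurable_ray2 t).
  by apply/(measurable_restrictT _ (measurable_ann s d e)); exact: measurable_funTS.
- move=> r; rewrite patchE mule_ge0//; first by case: ifP.
  by rewrite lee_fin divr_ge0// addr_ge0// sqr_ge0.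
rewrite ns mul1e patchE.
case: ifPn => [|]; rewrite ?in_setE => ht; last first.
  rewrite integral0_eq// => r _; rewrite addr0 patchE memNset ?mul0e//.
  by rewrite annE// => -[t0 _]; move: ht; rewrite notin_setE /= in_itv /= t0.
rewrite [RHS]integral_mkcond; apply: eq_integral => r _.
rewrite addr0 !patchE.
move: ht; rewrite /= in_itv /= andbT => ht.
have [rde|rde] := boolP (r \in `]d, e[%classic).
  have := set_mem rde; rewrite /= in_itv /= => rde'.
  rewrite mem_set; last exact/annE.
  by rewrite normrM ns mul1r gtr0_norm//; case/andP: rde' => dr _; exact: le_lt_trans dr.
rewrite memNset ?mul0e// annE// => -[_ rde'].
by move/negP: rde; apply; rewrite inE /= in_itv.
Qed.

(** The opening of a quadrant in the measure dt / (1 + t^2). *)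
Definition kap : R := (pi / 2)%R.

Lemma kap_gt0 : (0 < kap)%R.
Proof. by rewrite divr_gt0// pi_gt0. Qed.

Lemma int_kap : \int[mu]_(t in `[0%R, +oo[) ((1 + t ^+ 2)^-1)%:E = kap%:E.
Proof. by rewrite -integral0y_oneDsqr. Qed.

Lemma int_kapT : \int[mu]_t ((1 + t ^+ 2)^-1)%:E = (2 * kap)%:E.
Proof.
rewrite ge0_symfun_integralT.
- by rewrite -set_itvcy int_kap.
- by move=> t; rewrite invr_ge0 addr_ge0// sqr_ge0.
- exact: (@continuous_oneDsqrV R).
- by move=> t /=; rewrite sqrrN.
Qed.

Lemma even_int (g : R -> \bar R) : measurable_fun [set: R] g -> (forall r, 0 <= g r) ->
  g 0%R = 0 -> \int[mu]_r g `|r|%R = 2%:E * \int[mu]_(r in `]0%R, +oo[) g r.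
Proof.
move=> mg g0 g00.
pose G := g \_ (`]0%R, +oo[%classic : set R).
have mG : measurable_fun [set: R] G.
  by apply/(measurable_restrictT _ (measurable_itv _)); exact: measurable_funTS.
have G0 r : 0 <= G r by rewrite /G patchE; case: ifP.
have mGN : measurable_fun [set: R] (fun r : R => G (- r)%R) by apply: measurableT_comp mG _.
rewrite [in RHS]integral_mkcond -/G.
have -> : 2%:E * \int[mu]_r G r = \int[mu]_r (G r + G (- r)%R).
  rewrite ge0_integralD// (_ : 2 = 1 + 1)%R// EFinD ge0_muleDl// mul1e; congr (_ + _).
  have n1 : (- 1 : R)%R != 0%R by rewrite oppr_eq0 oner_eq0.
  rewrite [LHS](int1_affine 0 n1 mG G0) normrN1 mul1e; apply: eq_integral => r _.
  by rewrite addr0 mulN1r.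
have mp (q : R) : (q \in (`]0%R, +oo[%classic : set R)) = (0 < q)%R.
  by apply/idP/idP => [/set_mem|q0]; [|rewrite inE]; rewrite /= in_itv /= andbT.
apply: eq_integral => r _; rewrite /G !patchE.
have [r0|r0|->] := ltgtP r 0%R.
- by rewrite !mp oppr_gt0 r0 (ltNge 0%R r) (ltW r0) /= ltr0_norm// add0e.
- by rewrite !mp oppr_gt0 r0 (ltNge r 0%R) (ltW r0) /= gtr0_norm// adde0.
by rewrite !mp oppr0 ltxx normr0 g00 adde0.
Qed.

Lemma radial e (h : R -> R) : (0 < e)%R -> measurable_fun [set: R] h -> (forall r, 0 <= h r)%R ->
  \int[lb2]_(x in [set x | enorm x < e]%R) (h (enorm x))%:E =
  (4 * kap)%:E * \int[mu]_(r in `]0%R, e[) (h r * r)%:E.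
Proof.
move=> e0 mh h0.
have mD : measurable [set x : R * R | enorm x < e]%R.
  by rewrite (_ : [set x | _] = [set x : R * R | enorm x \in `]-oo, e[]); [exact: measurable_enorm_itv|].
have mF : measurable_fun [set: R * R] (fun x => (h (enorm x))%:E).
  by apply/measurable_EFinP; apply: measurableT_comp => //; exact: measurable_enorm.
rewrite integral_mkcond polar; last 2 first.
- by apply/(measurable_restrictT _ mD); exact: measurable_funTS.
- by move=> x; rewrite patchE; case: ifP; rewrite ?lee_fin.
pose g (r : R) : \bar R := if (r < e)%R then (h r * `|r|)%:E else 0.
have mg : measurable_fun [set: R] g.
  apply: measurable_fun_ifT.
  - by apply: measurable_fun_ltr => //; exact: measurable_id.
  - by apply/measurable_EFinP; apply: measurable_funM => //; exact: measurableT_comp.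
  - exact: measurable_cst.
have mgn : measurable_fun [set: R] (fun r : R => g `|r|%R).
  have mn : measurable_fun [set: R] (fun r : R => `|r|%R) by exact: normr_measurable.
  exact: (measurableT_comp mg mn).
have g0 r : 0 <= g r by rewrite /g; case: ifP => // _; rewrite lee_fin mulr_ge0.
under eq_integral => t _.
  under eq_integral => r _.
    rewrite (_ : _ * _ = ((1 + t ^+ 2)^-1)%:E * g `|r|%R); last first.
      rewrite patchE /g normr_id; case: (ltP `|r|%R e) => re.
        by rewrite mem_set /= ?enorm_ray// -!EFinM mulrA mulrC.
      by rewrite memNset /= ?mul0e ?mule0// enorm_ray; apply/negP; rewrite -leNgt.
    over.
  rewrite ge0_integralZl; first over.
  - exact: measurableT.
  - exact: mgn.
  - by [].
  - by rewrite lee_fin invr_ge0 addr_ge0// sqr_ge0.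
rewrite /=.
have mk : measurable_fun [set: R] (fun t : R => ((1 + t ^+ 2)^-1)%:E : \bar R).
  by apply/measurable_EFinP; apply: continuous_measurable_fun; exact: (@continuous_oneDsqrV R).
rewrite ge0_integralZr//; last 2 first.
- by move=> t _; rewrite lee_fin invr_ge0 addr_ge0// sqr_ge0.
- exact: integral_ge0.
rewrite int_kapT even_int//; last by rewrite /g e0 normr0 mulr0.
rewrite muleA -EFinM (_ : 2 * kap * 2 = 4 * kap)%R; last by ring.
congr (_ * _).
rewrite integral_mkcond [RHS]integral_mkcond; apply: eq_integral => r _.
rewrite !patchE /g.
have [r0|r0] := ltP 0%R r; last first.
  by rewrite !memNset//= in_itv /= ?andbT; apply/negP; rewrite ?negb_and -?leNgt ?r0.
rewrite mem_set/=; last by rewrite in_itv /= r0.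
case: (ltP r e) => re; first by rewrite mem_set/= ?in_itv/= ?r0// gtr0_norm.
by rewrite memNset//= in_itv/= r0 /=; apply/negP; rewrite -leNgt.
Qed.

End planar_geometry.

(** * The weight and the energy *)

Section nonneg_integrals.
Local Open Scope ereal_scope.
Context d (T : measurableType d) (R : realType) (m : {measure set T -> \bar R}).
Implicit Types (D : set T) (f g : T -> R).

Lemma rint_ge0 D f : (forall x, 0 <= f x)%R -> 0 <= \int[m]_(x in D) (f x)%:E.
Proof. by move=> f0; apply: integral_ge0 => x _; rewrite lee_fin. Qed.

Lemma rintZ D f (c : R) : measurable D -> measurable_fun [set: T] f -> (forall x, 0 <= f x)%R ->
  (0 <= c)%R -> \int[m]_(x in D) (c * f x)%:E = c%:E * \int[m]_(x in D) (f x)%:E.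
Proof.
move=> mD mf f0 c0; under eq_integral do rewrite EFinM.
have mf' : measurable_fun D (EFin \o f) by apply: measurable_funTS; exact/measurable_EFinP.
by rewrite ge0_integralZl// => x _; rewrite lee_fin.
Qed.

Lemma rintD D f g : measurable D -> measurable_fun [set: T] f -> measurable_fun [set: T] g ->
  (forall x, 0 <= f x)%R -> (forall x, 0 <= g x)%R ->
  \int[m]_(x in D) (f x + g x)%:E = \int[m]_(x in D) (f x)%:E + \int[m]_(x in D) (g x)%:E.
Proof.
move=> mD mf mg f0 g0; under eq_integral do rewrite EFinD.
have mf' : measurable_fun D (EFin \o f) by apply: measurable_funTS; exact/measurable_EFinP.
have mg' : measurable_fun D (EFin \o g) by apply: measurable_funTS; exact/measurable_EFinP.
by rewrite ge0_integralD// => x _; rewrite lee_fin.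
Qed.

Lemma rint_le D f g : measurable D -> measurable_fun [set: T] f -> measurable_fun [set: T] g ->
  (forall x, 0 <= f x)%R -> (forall x, D x -> f x <= g x)%R ->
  \int[m]_(x in D) (f x)%:E <= \int[m]_(x in D) (g x)%:E.
Proof.
move=> mD mf mg f0 fg.
have mf' : measurable_fun D (EFin \o f) by apply: measurable_funTS; exact/measurable_EFinP.
have mg' : measurable_fun D (EFin \o g) by apply: measurable_funTS; exact/measurable_EFinP.
by apply: ge0_le_integral => // x Dx; rewrite lee_fin// fg.
Qed.

Lemma rint_sub D E f : measurable D -> measurable E -> measurable_fun [set: T] f ->
  (forall x, 0 <= f x)%R -> D `<=` E ->
  \int[m]_(x in D) (f x)%:E <= \int[m]_(x in E) (f x)%:E.
Proof.
move=> mD mE mf f0 DE.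
have mf' : measurable_fun E (EFin \o f) by apply: measurable_funTS; exact/measurable_EFinP.
by apply: ge0_subset_integral => // x _; rewrite lee_fin.
Qed.

Lemma aeI (P Q : T -> Prop) : {ae m, forall x, P x} -> {ae m, forall x, Q x} ->
  {ae m, forall x, P x /\ Q x}.
Proof.
move=> aP aQ; apply: negligibleS (negligibleU aP aQ) => x /= nPQ.
by have [Px|nPx] := pselect (P x); [right => Qx; apply: nPQ|left].
Qed.

End nonneg_integrals.

Section weight.
Context (R : realType).
Implicit Types (x y z : R * R) (u v f g h : R * R -> R) (s t r d e : R).
Local Notation mu := (@lebesgue_measure R).
Local Notation lb2 := (@leb2 R).
Local Notation testT := (test_function [set: R * R]).

Lemma measurable_inv : measurable_fun [set: R] (@GRing.inv R).
Proof.
have oD : open [set x : R | x != 0] by exact: open_neq.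
have mD : measurable [set x : R | x != 0] by exact: open_measurable.
have -> : @GRing.inv R = (@GRing.inv R) \_ [set x : R | x != 0].
  apply/funext => x; rewrite patchE; case: ifPn => // /negP xD.
  have -> : x = 0 by apply/eqP/negPn/negP => x0; apply: xD; rewrite inE.
  by rewrite invr0.
apply/(measurable_restrictT _ mD); apply: open_continuous_measurable_fun => // x.
by rewrite inE /=; exact: inv_continuous.
Qed.

(** What is used of the datum a: a positive real profile on the whole line, extended by
    1 outside (0, 1), with the integrability and Hardy conditions on open intervals. The
    positivity everywhere lets [wt] be a total real-valued weight. *)
Record admissible (al : R -> R) (K : R) : Prop := Admissible {
  al_gt0 : forall r, 0 < al r;
  al_meas : measurable_fun [set: R] al;
  al_bd : forall d, 0 < d -> exists2 c, 0 < c &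
    forall r, d < r -> c <= al r /\ c <= (al r)^-1;
  al_int : (\int[mu]_(r in `]0%R, 1%R[) (al r / r)%:E < +oo)%E;
  al_intV : (\int[mu]_(r in `]0%R, 1%R[) (r / al r)%:E < +oo)%E;
  al_hardy : forall e, 0 < e < 1 ->
    (\int[mu]_(r in `]0%R, e[)
       ((r / al r)%:E * \int[mu]_(s in `]0%R, r[) (al s / s)%:E) <= (K * e ^+ 2)%:E)%E }.

Variables (al : R -> R) (K : R).
Hypothesis adm : admissible al K.

Definition wt x : R := if x \in @Q1 R `|` @Q3 R then (al (enorm x))^-1 else al (enorm x).

Lemma wtE x : wt x = if x \in @Q1 R `|` @Q3 R then (al (enorm x))^-1 else al (enorm x).
Proof. by []. Qed.

Lemma al_ge0 r : 0 <= al r. Proof. exact: (ltW (al_gt0 adm r)). Qed.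

Lemma wt_gt0 x : 0 < wt x.
Proof. by rewrite /wt; case: ifP => _; rewrite ?invr_gt0; exact: (al_gt0 adm). Qed.

Lemma wt_ge0 x : 0 <= wt x. Proof. exact/ltW/wt_gt0. Qed.

Lemma sec1E : sec 1 = @Q1 R.
Proof. by apply/seteqP; split => x /=; rewrite /sec /= !mul1r. Qed.

Lemma secN1E : sec (-1) = @Q3 R.
Proof. by apply/seteqP; split => x /=; rewrite /sec /= !mulN1r oppr_gt0 oppr_ge0. Qed.

Lemma sqr1P s : s ^+ 2 = 1 -> s = 1 \/ s = -1.
Proof. by move=> /eqP; rewrite sqrf_eq1 => /orP[]/eqP->; [left|right]. Qed.

Lemma wt_sec s x : s ^+ 2 = 1 -> sec s x -> wt x = (al (enorm x))^-1.
Proof.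
move=> /sqr1P[->|->]; rewrite ?sec1E ?secN1E => xQ; rewrite /wt mem_set//; [by left|by right].
Qed.

Lemma measurable_alV : measurable_fun [set: R] (fun r => (al r)^-1).
Proof. exact: (measurableT_comp measurable_inv (al_meas adm)). Qed.

Lemma measurable_Q13 : measurable (@Q1 R `|` @Q3 R).
Proof. by rewrite -sec1E -secN1E; exact: (measurableU _ _ (measurable_sec 1) (measurable_sec (-1))). Qed.

Lemma measurable_wt : measurable_fun [set: R * R] wt.
Proof.
apply: measurable_fun_ifT.
- exact: measurable_mem measurable_Q13.
- exact: measurableT_comp measurable_alV (@measurable_enorm R).
- exact: measurableT_comp (al_meas adm) (@measurable_enorm R).
Qed.

Lemma wt_bd d : 0 < d -> exists2 c, 0 < c & forall x, d < enorm x -> c <= wt x /\ wt x <= c^-1.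
Proof.
move=> d0; have [c c0 Hc] := al_bd adm d0; exists c => // x /Hc[h1 h2].
have p := al_gt0 adm (enorm x).
rewrite /wt; case: ifP => _; split => //.
  by rewrite lef_pV2 ?posrE.
by rewrite -[al _]invrK lef_pV2 ?posrE ?invr_gt0.
Qed.

Lemma wt_le x : wt x <= al (enorm x) + (al (enorm x))^-1.
Proof.
have p := al_ge0 (enorm x).
by rewrite /wt; case: ifP => _; rewrite ?lerDl ?lerDr// invr_ge0.
Qed.

Local Open Scope ereal_scope.

Lemma measurable_al_r : measurable_fun [set: R] (fun r => al r / r)%R.
Proof.
apply: measurable_funM; first exact: (al_meas adm).
exact: measurable_inv.
Qed.

Lemma measurable_r_al : measurable_fun [set: R] (fun r => r / al r)%R.
Proof. by apply: measurable_funM => //; exact: measurable_alV. Qed.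

Lemma disc_radial_lt (h : R -> R) : measurable_fun [set: R] h -> (forall r, 0 <= h r)%R ->
  \int[mu]_(r in `]0%R, 1%R[) (h r * r)%:E < +oo ->
  \int[lb2]_(x in [set x | enorm x < 1]%R) (h (enorm x))%:E < +oo.
Proof. by move=> mh h0 H; rewrite radial// lte_mul_pinfty// lee_fin mulr_ge0// ltW// kap_gt0. Qed.

Lemma wt_disc : \int[lb2]_(x in [set x | enorm x < 1]%R) (wt x)%:E < +oo.
Proof.
have mD : measurable [set x : R * R | enorm x < 1]%R.
  exact: (@measurable_enorm_itv R `]-oo, 1%R[).
have m1 : measurable_fun [set: R * R] (fun x => (al (enorm x))%:E).
  by apply/measurable_EFinP; exact: measurableT_comp (al_meas adm) (@measurable_enorm R).
have m2 : measurable_fun [set: R * R] (fun x => ((al (enorm x))^-1)%:E).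
  by apply/measurable_EFinP; exact: measurableT_comp measurable_alV (@measurable_enorm R).
apply: (@le_lt_trans _ _ (\int[lb2]_(x in [set x | enorm x < 1]%R) ((al (enorm x))%:E + ((al (enorm x))^-1)%:E))).
  apply: ge0_le_integral => //.
  - by move=> x _; rewrite lee_fin wt_ge0.
  - by apply: measurable_funTS; apply/measurable_EFinP; exact: measurable_wt.
  - by apply: measurable_funTS; exact: emeasurable_funD.
  - by move=> x _; rewrite -EFinD lee_fin wt_le.
rewrite ge0_integralD//; last 4 first.
- by move=> x _; rewrite lee_fin al_ge0.
- exact: measurable_funTS.
- by move=> x _; rewrite lee_fin invr_ge0 al_ge0.
- exact: measurable_funTS.
apply: lte_add_pinfty.
  apply: disc_radial_lt; [exact: (al_meas adm)|exact: al_ge0|].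
  apply: le_lt_trans (al_int adm); apply: ge0_le_integral => //.
  - by move=> r; rewrite /= in_itv /= => /andP[r0 _]; rewrite lee_fin mulr_ge0// ?al_ge0// ltW.
  - by apply: measurable_funTS; apply/measurable_EFinP; apply: measurable_funM => //; exact: (al_meas adm).
  - by apply: measurable_funTS; apply/measurable_EFinP; exact: measurable_al_r.
  - move=> r; rewrite /= in_itv /= => /andP[r0 r1]; rewrite lee_fin ler_wpM2l ?al_ge0//.
    by rewrite (le_trans (ltW r1))// invf_ge1// ltW.
apply: (@disc_radial_lt (fun r => (al r)^-1)%R); [exact: measurable_alV|by move=> r; rewrite invr_ge0 al_ge0|].
by under eq_integral do rewrite mulrC; exact: (al_intV adm).
Qed.

Lemma wt_box (M : R) : \int[lb2]_(x in box M) (wt x)%:E < +oo.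
Proof.
have h2 : (0 < 2^-1 :> R)%R by [].
have [c c0 Hc] := wt_bd h2.
pose D1 : set (R * R) := [set x | enorm x < 1]%R.
have mD1 : measurable D1 by exact: (@measurable_enorm_itv R `]-oo, 1%R[).
have mb := @measurable_box R M.
have mw : measurable_fun [set: R * R] (fun x => (wt x)%:E).
  by apply/measurable_EFinP; exact: measurable_wt.
have w0 x : 0 <= (wt x)%:E by rewrite lee_fin wt_ge0.
apply: (@le_lt_trans _ _ (\int[lb2]_(x in D1 `|` (box M `\` D1)) (wt x)%:E)).
  apply: ge0_subset_integral => //.
  - by apply: measurableU => //; exact: measurableD.
  - exact: measurable_funTS.
  - by move=> x bx; have [xD|xD] := pselect (D1 x); [left|right].
have mB : measurable (box M `\` D1) by exact: measurableD.
rewrite ge0_integral_setU//; last first.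
- by apply/disj_setPS => x [xD [_ /(_ xD)]].
- exact: measurable_funTS.
apply: lte_add_pinfty; first exact: wt_disc.
apply: (@le_lt_trans _ _ (\int[lb2]_(x in box M `\` D1) (c^-1)%:E)).
  apply: ge0_le_integral => //.
  - exact: measurable_funTS.
  - move=> x [_ /negP]; rewrite -leNgt lee_fin => x1; apply: (Hc x _).2.
    apply: lt_le_trans x1; by rewrite invf_lt1 ?ltr1n.
rewrite (@integral_cst _ _ _ lb2 _ mB c^-1%:E) lte_mul_pinfty ?lee_fin ?invr_ge0 ?ltW//.
apply: (@le_lt_trans _ _ (lb2 (box `|M|))).
  apply: le_measure; rewrite ?inE//; first exact: measurable_box.
  by move=> x [[? ?] _]; split; apply: le_trans (ler_norm M).
by rewrite lb2_box// ltry.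
Qed.

(** Keeping the weak gradient as an explicit pair (g, h) makes it possible to work with
    the classical derivatives of a test function. *)
Definition grad_of u g h := [/\ L1loc u, is_weak_deriv (@e1 R) u g & is_weak_deriv (@e2 R) u h].

Definition dens g h u x : R := (g x ^+ 2 + h x ^+ 2 + u x ^+ 2)%R.

Definition energy (D : set (R * R)) g h u : \bar R := \int[lb2]_(x in D) (dens g h u x * wt x)%:E.

Lemma dens_ge0 g h u x : (0 <= dens g h u x)%R.
Proof. by rewrite /dens !addr_ge0// sqr_ge0. Qed.

Lemma grad_meas u g h : grad_of u g h ->
  [/\ measurable_fun [set: R * R] u, measurable_fun [set: R * R] g & measurable_fun [set: R * R] h].
Proof. by move=> [[? _] [[? _] _] [[? _] _]]. Qed.

Lemma measurable_dens u g h : measurable_fun [set: R * R] u -> measurable_fun [set: R * R] g ->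
  measurable_fun [set: R * R] h -> measurable_fun [set: R * R] (dens g h u).
Proof.
move=> mu_ mg mh; rewrite (_ : dens g h u = (fun x => g x ^+ 2 + h x ^+ 2 + u x ^+ 2)%R)//.
by apply: measurable_funD; [apply: measurable_funD|]; exact: measurable_funX.
Qed.

Lemma measurable_densw u g h : measurable_fun [set: R * R] u -> measurable_fun [set: R * R] g ->
  measurable_fun [set: R * R] h -> measurable_fun [set: R * R] (fun x => (dens g h u x * wt x)%:E).
Proof.
move=> ? ? ?; apply/measurable_EFinP; apply: measurable_funM; last exact: measurable_wt.
exact: measurable_dens.
Qed.

Lemma densw_ge0 u g h x : 0 <= (dens g h u x * wt x)%:E.
Proof. by rewrite lee_fin mulr_ge0 ?dens_ge0 ?wt_ge0. Qed.

Lemma grad_weak u : W11loc u -> grad_of u (weak_deriv (@e1 R) u) (weak_deriv (@e2 R) u).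
Proof. by move=> [lu h1 h2]; split => //; exact: weak_derivP. Qed.

Lemma grad_W11 u g h : grad_of u g h -> W11loc u.
Proof. by move=> [lu h1 h2]; split => //; [exists g|exists h]. Qed.

Lemma gradD u v gu hu gv hv (c : R) : grad_of u gu hu -> grad_of v gv hv ->
  grad_of (c *: u + v)%R (c *: gu + gv)%R (c *: hu + hv)%R.
Proof.
move=> [lu u1 u2] [lv v1 v2]; split; first exact: L1locD.
- by apply: is_weak_derivD => // phi; exact: axis_test (@axis1 R).
- by apply: is_weak_derivD => // phi; exact: axis_test (@axis2 R).
Qed.

Lemma grad_test f : testT f -> grad_of f ('D_(@e1 R) f) ('D_(@e2 R) f).
Proof.
by move=> tf; split; [exact: L1loc_test1|exact: weak_deriv_test (@axis1 R) tf|exact: weak_deriv_test (@axis2 R) tf].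
Qed.

Section form.
Variable a : R -> \bar R.
Hypothesis rhoE : forall x, rho a x = (wt x)%:E.

(** Two nonnegative extended integrals are combined into one with a real integrand. *)
Lemma form1_gen u g h : measurable_fun [set: R * R] u -> measurable_fun [set: R * R] g ->
  measurable_fun [set: R * R] h ->
  \int[lb2]_x ((g x * g x + h x * h x)%:E * rho a x) + \int[lb2]_x ((u x * u x)%:E * rho a x) =
  energy setT g h u.
Proof.
move=> mu_ mg mh; have mw := measurable_wt.
have -> : (fun x => (g x * g x + h x * h x)%:E * rho a x) =
    (fun x => ((g x ^+ 2 + h x ^+ 2) * wt x)%:E) by apply/funext => x; rewrite rhoE EFinM !expr2.
have -> : (fun x => (u x * u x)%:E * rho a x) = (fun x => (u x ^+ 2 * wt x)%:E).
  by apply/funext => x; rewrite rhoE EFinM expr2.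
have m1 : measurable_fun [set: R * R] (fun x => (g x ^+ 2 + h x ^+ 2) * wt x)%R.
  apply: measurable_funM => //.
  by apply: (@measurable_funD _ _ _ _ (fun x => g x ^+ 2)%R (fun x => h x ^+ 2)%R); exact: measurable_funX.
have m2 : measurable_fun [set: R * R] (fun x => u x ^+ 2 * wt x)%R.
  by apply: measurable_funM => //; exact: measurable_funX.
rewrite -rintD//.
- by apply: eq_integral => x _; congr (_%:E); rewrite /dens; ring.
- by move=> x; rewrite mulr_ge0 ?wt_ge0// addr_ge0// sqr_ge0.
- by move=> x; rewrite mulr_ge0 ?wt_ge0// sqr_ge0.
Qed.

Lemma form1_weak u : W11loc u -> form1 a u u =
  energy setT (weak_deriv (@e1 R) u) (weak_deriv (@e2 R) u) u.
Proof. by move=> /grad_weak/grad_meas[m1 m2 m3]; exact: form1_gen m1 m2 m3. Qed.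

Lemma form1E u g h : grad_of u g h -> form1 a u u = energy setT g h u.
Proof.
move=> G; have W := grad_W11 G; have GW := grad_weak W.
rewrite form1_weak//; have [mu_ mg mh] := grad_meas G; have [_ mg' mh'] := grad_meas GW.
have [_ H1 H2] := G.
have A1 := weak_derivE H1; have A2 := weak_derivE H2.
apply: ge0_ae_eq_integral => //.
- exact: measurable_densw.
- exact: measurable_densw.
- by move=> x _; exact: densw_ge0.
- by move=> x _; exact: densw_ge0.
have := aeI A1 A2; apply: aeS => x [E1 E2] _.
by rewrite /dens E1 E2.
Qed.

Lemma WspP u : Wsp a u <-> exists g h, grad_of u g h /\ energy setT g h u < +oo.
Proof.
split=> [[W fin]|[g [h [G fin]]]].
  by exists (weak_deriv (@e1 R) u), (weak_deriv (@e2 R) u); split; [exact: grad_weak|rewrite -form1_weak].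
by split; [exact: grad_W11 G|rewrite (form1E G)].
Qed.

End form.

(** (p + q)^2 <= 2 p^2 + 2 q^2, pointwise. *)
Lemma energy_comb (D : set (R * R)) u v gu hu gv hv (c : R) : measurable D ->
  grad_of u gu hu -> grad_of v gv hv ->
  energy D (c *: gu + gv)%R (c *: hu + hv)%R (c *: u + v)%R <=
    (2 * c ^+ 2)%:E * energy D gu hu u + 2%:E * energy D gv hv v.
Proof.
move=> mD Gu Gv.
have [m1 m2 m3] := grad_meas Gu; have [m4 m5 m6] := grad_meas Gv.
have [m7 m8 m9] := grad_meas (gradD c Gu Gv).
have mw := measurable_wt.
have mdu : measurable_fun [set: R * R] (fun x => dens gu hu u x * wt x)%R.
  by apply: measurable_funM => //; exact: measurable_dens.
have mdv : measurable_fun [set: R * R] (fun x => dens gv hv v x * wt x)%R.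
  by apply: measurable_funM => //; exact: measurable_dens.
have mdc : measurable_fun [set: R * R]
    (fun x => dens (c *: gu + gv) (c *: hu + hv) (c *: u + v) x * wt x)%R.
  by apply: measurable_funM => //; exact: measurable_dens.
have p g h k x : (0 <= dens g h k x * wt x)%R by rewrite mulr_ge0 ?dens_ge0 ?wt_ge0.
have c20 : (0 <= 2 * c ^+ 2)%R by rewrite mulr_ge0// sqr_ge0.
have mZu : measurable_fun [set: R * R] (fun x => 2 * c ^+ 2 * (dens gu hu u x * wt x))%R.
  exact: measurable_funM.
have mZv : measurable_fun [set: R * R] (fun x => 2 * (dens gv hv v x * wt x))%R.
  exact: measurable_funM.
rewrite /energy -rintZ// -(rintZ _ (c := 2%R))// -rintD//; last 2 first.
- by move=> x; rewrite mulr_ge0.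
- by move=> x; rewrite mulr_ge0.
apply: rint_le => //; first exact: measurable_funD.
move=> x _.
have sq (b q : R) : ((c * b + q) ^+ 2 <= 2 * c ^+ 2 * b ^+ 2 + 2 * q ^+ 2)%R.
  rewrite -subr_ge0 (_ : _ - _ = (c * b - q) ^+ 2)%R ?sqr_ge0//; ring.
have H : (dens (c *: gu + gv) (c *: hu + hv) (c *: u + v) x <=
    2 * c ^+ 2 * dens gu hu u x + 2 * dens gv hv v x)%R.
  have a1 := sq (gu x) (gv x); have a2 := sq (hu x) (hv x); have a3 := sq (u x) (v x).
  have F (k k' : R * R -> R) : (c *: k + k')%R x = (c * k x + k' x)%R by [].
  rewrite /dens !F; move: a1 a2 a3; rewrite !mulrDr.
  by move: (2 * c ^+ 2 * _)%R (2 * c ^+ 2 * _)%R (2 * c ^+ 2 * _)%R => *; lra.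
apply: le_trans (ler_wpM2r (wt_ge0 x) H) _.
by rewrite mulrDl -(mulrA (2 * c ^+ 2)%R) -(mulrA 2%R (dens gv hv v x)).
Qed.

Lemma energy_test f : testT f -> energy setT ('D_(@e1 R) f) ('D_(@e2 R) f) f < +oo.
Proof.
move=> tf; have [M M0 bM] := test_bsupp tf.
have t1 := test_D1 tf; have t2 := test_D2 tf.
have sb (v x : R * R) : ~ box M x -> 'D_v f x = 0%R.
  move=> xb; apply: supp_derive => sx; apply: xb.
  rewrite (closure_id (box M)).1; last exact: closed_box.
  by apply: closureS sx => y; exact: bM.
have [C1 C10 H1] := test_bounded t1; have [C2 C20 H2] := test_bounded t2.
have [C3 C30 H3] := test_bounded tf.
have mw : measurable_fun [set: R * R] (fun x => (wt x)%:E).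
  by apply/measurable_EFinP; exact: measurable_wt.
have mb := @measurable_box R M.
pose C := (C1 ^+ 2 + C2 ^+ 2 + C3 ^+ 2)%R.
have C0 : (0 <= C)%R by rewrite !addr_ge0// sqr_ge0.
apply: (@le_lt_trans _ _ (\int[lb2]_(x in box M) (C%:E * (wt x)%:E))).
  rewrite [leRHS]integral_mkcond; apply: ge0_le_integral => //.
  - by move=> x _; exact: densw_ge0.
  - by apply: measurable_densw; [exact: test_measurable tf|exact: test_measurable t1|exact: test_measurable t2].
  - apply/(measurable_restrictT _ mb); apply: measurable_funTS; exact: measurable_funeM.
  - move=> x _; rewrite patchE; case: ifPn => [_|].
      rewrite -EFinM lee_fin ler_wpM2r ?wt_ge0//.
      by rewrite /dens /C !lerD// -real_normK ?num_real// ler_sqr ?nnegrE.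
    rewrite notin_setE => xb; rewrite /dens !sb//.
    have -> : f x = 0%R by apply/eqP/negPn/negP => /bM.
    by rewrite !expr0n /= !addr0 mul0r.
rewrite ge0_integralZl//; last 2 first.
- exact: measurable_funTS.
- by move=> x _; rewrite lee_fin wt_ge0.
by apply: lte_mul_pinfty => //; exact: wt_box.
Qed.

End weight.

(** * The Hardy inequality for smooth functions on a sector *)

Section primitive.
Context (R : realType).
Local Notation mu := (@lebesgue_measure R).

(** Tonelli's theorem for the indicator of the region 0 < q < r. *)
Lemma measurable_primitive (f : R -> R) : measurable_fun [set: R] f -> (forall r, 0 <= f r) ->
  measurable_fun [set: R] (fun r : R => \int[mu]_(q in `]0%R, r[) (f q)%:E)%E.
Proof.
move=> mf f0; pose P (p : R * R) : \bar R := ((f p.2) * (0 < p.2)%R%:R * (p.2 < p.1)%R%:R)%:E.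
have m1 := @measurable_fst _ _ (measurableTypeR R) (measurableTypeR R).
have m2 := @measurable_snd _ _ (measurableTypeR R) (measurableTypeR R).
have mb (b : R * R -> bool) : measurable_fun [set: R * R] b -> measurable_fun [set: R * R] (fun p => (b p)%:R : R).
  move=> mb; rewrite (_ : (fun p => _) = (fun p => if b p then 1%R else 0%R)).
    exact: measurable_fun_ifT.
  by apply/funext => p; case: (b p).
have mP : measurable_fun [set: R * R] P.
  apply/measurable_EFinP; apply: measurable_funM; [apply: measurable_funM|].
  - exact: (measurableT_comp mf m2).
  - by apply: (mb (fun p => (0 < p.2)%R)); apply: measurable_fun_ltr => //; exact: measurable_cst.
  - by apply: (mb (fun p => (p.2 < p.1)%R)); exact: measurable_fun_ltr.
have P0 p : (0 <= P p)%E by rewrite /P lee_fin mulr_ge0// mulr_ge0.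
have := tonelli_m1 mP P0; congr (measurable_fun _ _); apply/funext => r.
rewrite [RHS]integral_mkcond; apply: eq_integral => q _.
rewrite patchE /P /=; case: ifPn => [|].
  by rewrite inE /= in_itv /= => /andP[-> ->]; rewrite !mulr1.
rewrite notin_setE /= in_itv /= => /negP; rewrite negb_and => /orP[]/negbTE->; by rewrite ?mulr0 ?mul0r ?mulr0 ?mul0r.
Qed.

End primitive.

Section hardy_lines.
Context (R : realType).
Implicit Types (x y z : R * R) (s t r d e : R).
Local Notation mu := (@lebesgue_measure R).
Local Notation lb2 := (@leb2 R).

(** The fundamental theorem of calculus bounds the increment by the integral of f g, to
    which Cauchy-Schwarz applies. Below, f^2 is 1/(weight) and g^2 is the weighted
    squared gradient along a curve. *)
Lemma ftc_cauchy_schwarz (F F' f g : R -> R) (a b A B : R) : a <= b ->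
  (forall x : R, is_derive x 1 F (F' x)) -> continuous F' ->
  measurable_fun [set: R] f -> measurable_fun [set: R] g ->
  (forall x : R, 0 <= f x) -> (forall x : R, 0 <= g x) ->
  (forall x : R, a < x < b -> `|F' x| <= f x * g x) ->
  (\int[mu]_(x in `]a, b[) (f x ^+ 2)%:E <= A%:E)%E ->
  (\int[mu]_(x in `]a, b[) (g x ^+ 2)%:E <= B%:E)%E ->
  (F b - F a) ^+ 2 <= A * B.
Proof.
move=> ab dF cF' mf mg f0 g0 bd hA hB.
have A0 : 0 <= A by rewrite -lee_fin; apply: le_trans hA; apply: rint_ge0 => x; exact: sqr_ge0.
have B0 : 0 <= B by rewrite -lee_fin; apply: le_trans hB; apply: rint_ge0 => x; exact: sqr_ge0.
move: ab; rewrite le_eqVlt => /predU1P[->|ab]; first by rewrite subrr expr0n mulr_ge0.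
have mF' : measurable_fun [set: R] F' by exact: continuous_measurable_fun.
have mab : measurable (`]a, b[%classic : set R) by [].
have cF : continuous F by move=> t; apply: differentiable_continuous; apply/derivable1_diffP; exact: (ex_derive (is_derive := dF t)).
have [c cE [c0 cAB]] : exists2 c : R, (\int[mu]_(x in `]a, b[) (f x * g x)%:E = c%:E)%E &
    (0 <= c /\ c ^+ 2 <= A * B).
  by apply: cauchy_schwarz => //; [exact: measurable_funTS|exact: measurable_funTS].
have ftc : (\int[mu]_(x in `[a, b]) (F' x)%:E = (F b)%:E - (F a)%:E)%E.
  apply: continuous_FTC2 => //.
  - by apply: continuous_subspaceT.
  - split.
    + by move=> x _; exact: (ex_derive (is_derive := dF x)).
    + by apply: cvg_at_right_filter; exact: cF.
    + by apply: cvg_at_left_filter; exact: cF.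
  - by move=> x _; rewrite derive1E (derive_val (is_derive := dF x)).
have mEF : measurable_fun [set: R] (EFin \o F') by apply/measurable_EFinP.
have ftc' : (\int[mu]_(x in `]a, b[) (F' x)%:E = (F b - F a)%:E)%E.
  rewrite EFinB -ftc integral_itv_obnd_cbnd ?integral_itv_bndo_bndc//; exact: measurable_funTS.
have le1 : (`|F b - F a|%:E <= c%:E)%E.
  rewrite -cE; apply: (@le_trans _ _ (\int[mu]_(x in `]a, b[) `|F' x|%:E)%E).
    have := le_abse_integral mu mab (measurable_funTS mEF).
    by rewrite /= ftc'.
  apply: rint_le => //.
  - exact: measurableT_comp.
  - exact: measurable_funM.
rewrite lee_fin in le1; apply: le_trans cAB.
by rewrite -real_normK ?num_real// ler_sqr ?nnegrE.
Qed.

Definition gsq (w : R * R -> R) x : R := 'D_(@e1 R) w x ^+ 2 + 'D_(@e2 R) w x ^+ 2.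

Lemma gsq_ge0 w x : 0 <= gsq w x.
Proof. by rewrite /gsq addr_ge0// sqr_ge0. Qed.

Lemma gsq_continuous w : smooth w -> continuous (gsq w).
Proof.
move=> sw x; rewrite (_ : gsq w = fun x => 'D_(@e1 R) w x * 'D_(@e1 R) w x + 'D_(@e2 R) w x * 'D_(@e2 R) w x); last first.
  by apply/funext => y; rewrite /gsq !expr2.
apply: cvgD; apply: cvgM.
- exact: (smooth_cts (smooth_D1 sw)).
- exact: (smooth_cts (smooth_D1 sw)).
- exact: (smooth_cts (smooth_D2 sw)).
- exact: (smooth_cts (smooth_D2 sw)).
Qed.

Lemma measurable_gsq w : smooth w -> measurable_fun [set: R * R] (gsq w).
Proof. by move=> sw; apply: continuous_measurable2; exact: gsq_continuous. Qed.

Lemma cs2 (p q a b : R) : (p * a + q * b) ^+ 2 <= (p ^+ 2 + q ^+ 2) * (a ^+ 2 + b ^+ 2).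
Proof.
rewrite -subr_ge0 (_ : _ - _ = (p * b - q * a) ^+ 2) ?sqr_ge0//; ring.
Qed.

Lemma continuous_curve (f : R * R -> R) (p1 p2 : R -> R) : continuous f -> continuous p1 -> continuous p2 ->
  continuous (fun t => f (p1 t, p2 t)).
Proof.
move=> cf c1 c2 t.
have cp : (fun t => (p1 t, p2 t)) @ t --> (p1 t, p2 t) by exact: (cvg_pair (c1 t) (c2 t)).
exact: (cvg_comp _ _ cp (cf (p1 t, p2 t))).
Qed.

Lemma ray_derive w s t : smooth w -> s ^+ 2 = 1 ->
  exists D : R -> R, [/\ forall r, is_derive r 1 (fun r => w (ray t (s * r))) (D r), continuous D &
    forall r, `|D r| <= Num.sqrt (gsq w (ray t (s * r)))].
Proof.
move=> sw s1; have q0 := ray_den_gt0 t; set q := Num.sqrt _ in q0.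
have qE : q ^+ 2 = 1 + t ^+ 2 by rewrite sqr_sqrtr// addr_ge0// sqr_ge0.
pose p1 r := s / q * r; pose p2 r := s / q * t * r.
have rE r' : ray t (s * r') = (p1 r', p2 r').
  by rewrite /ray -/q /p1 /p2; congr (_, _); ring.
have d1 r' : is_derive r' 1 p1 (s / q).
  by apply: is_derive_eq; rewrite /GRing.scale /= mulr1.
have d2 r' : is_derive r' 1 p2 (s / q * t).
  by apply: is_derive_eq; rewrite /GRing.scale /= mulr1.
pose D r := s / q * 'D_(@e1 R) w (p1 r, p2 r) + s / q * t * 'D_(@e2 R) w (p1 r, p2 r).
have cp1 : continuous p1 by move=> r'; apply: cvgM; [exact: cvg_cst|exact: cvg_id].
have cp2 : continuous p2 by move=> r'; apply: cvgM; [exact: cvg_cst|exact: cvg_id].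
exists D; split.
- move=> r'; under eq_fun do rewrite rE.
  exact: is_derive_curve (sw 1%N) (d1 r') (d2 r').
- move=> r'; apply: cvgD; (apply: cvgM; first exact: cvg_cst).
    exact: (continuous_curve (smooth_cts (smooth_D1 sw)) cp1 cp2).
  exact: (continuous_curve (smooth_cts (smooth_D2 sw)) cp1 cp2).
- move=> r'; rewrite rE -sqrtr_sqr ler_wsqrtr// /D (le_trans (cs2 _ _ _ _))//.
  rewrite -/(gsq w (p1 r', p2 r')) (_ : _ + _ = 1) ?mul1r//.
  rewrite !exprMn s1 exprVn !mul1r -[X in X + _]mulr1 -mulrDr -qE mulVf// sqrf_eq0.
  by rewrite gt_eqF.
Qed.

(** In the coordinates of [ray] the arcs are parametrised by the slope, with speed |r| /
    (1 + t^2). *)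
Lemma arc_derive w r : smooth w ->
  exists D : R -> R, [/\ forall t, is_derive t 1 (fun t => w (ray t r)) (D t), continuous D &
    forall t, `|D t| <= `|r| / (1 + t ^+ 2) * Num.sqrt (gsq w (ray t r))].
Proof.
move=> sw.
pose q t := Num.sqrt (1 + t ^+ 2).
have q0 t : 0 < q t by exact: ray_den_gt0.
have qE t : q t ^+ 2 = 1 + t ^+ 2 by rewrite sqr_sqrtr// addr_ge0// sqr_ge0.
have dq t : is_derive t 1 q (t / q t).
  have h1 : is_derive t 1 (fun t : R => 1 + t ^+ 2) (2 * t).
    by apply: is_derive_eq; rewrite /GRing.scale /=; ring.
  have h2 : is_derive (1 + t ^+ 2) 1 (@Num.sqrt R) (2 * Num.sqrt (1 + t ^+ 2))^-1.
    by apply: is_derive1_sqrt; rewrite -qE exprn_gt0.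
  have h := @is_derive_comp1 R R (@Num.sqrt R) (fun t => 1 + t ^+ 2) t 1 _ _ h2 h1.
  apply: (is_derive_eq (h)); rewrite -/(q t) invfM; have := q0 t; move: (q t) => k k0.
  by field; rewrite gt_eqF.
pose p1 t := r / q t; pose p2 t := r / q t * t.
have d1 t : is_derive t 1 p1 (- (r * t) / q t ^+ 3).
  have qn0 : q t != 0 by rewrite gt_eqF.
  apply: is_derive_eq; rewrite /GRing.scale /= ?invfM; by move: (q t) qn0 => k k0; field.
have d2 t : is_derive t 1 p2 (r / q t ^+ 3).
  have := d1 t => dd.
  have qn0 : q t != 0 by rewrite gt_eqF.
  apply: is_derive_eq; rewrite /GRing.scale /= /p1; have := qE t; move: (q t) qn0 => k k0 kE.
  rewrite (_ : r / k ^+ 3 = r * (k ^+ 2 - t ^+ 2) / k ^+ 3); last by rewrite kE; field.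
  by field.
pose D t := - (r * t) / q t ^+ 3 * 'D_(@e1 R) w (p1 t, p2 t) + r / q t ^+ 3 * 'D_(@e2 R) w (p1 t, p2 t).
have cq : continuous q.
  by move=> t; apply: differentiable_continuous; apply/derivable1_diffP; exact: (ex_derive (is_derive := dq t)).
have cqV : continuous (fun t => (q t)^-1).
  by move=> t; apply: cvgV; [rewrite gt_eqF|exact: cq].
have cp1 : continuous p1 by move=> t; apply: cvgM; [exact: cvg_cst|exact: cqV].
have cp2 : continuous p2 by move=> t; apply: cvgM; [exact: cp1|exact: cvg_id].
have c3 : continuous (fun t => (q t ^+ 3)^-1).
  rewrite (_ : (fun t => _) = (fun t => (q t)^-1 * (q t)^-1 * (q t)^-1)); last first.
    by apply/funext => t; rewrite -exprVn; ring.
  by move=> t; apply: cvgM; [apply: cvgM|]; exact: cqV.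
exists D; split.
- move=> t; exact: is_derive_curve (sw 1%N) (d1 t) (d2 t).
- move=> t; apply: cvgD; apply: cvgM.
  + apply: cvgM; last exact: c3.
    by apply: cvgN; apply: cvgM; [exact: cvg_cst|exact: cvg_id].
  + exact: (continuous_curve (smooth_cts (smooth_D1 sw)) cp1 cp2).
  + by apply: cvgM; [exact: cvg_cst|exact: c3].
  + exact: (continuous_curve (smooth_cts (smooth_D2 sw)) cp1 cp2).
- move=> t.
  have -> : `|r| / (1 + t ^+ 2) = Num.sqrt (r ^+ 2 / (1 + t ^+ 2) ^+ 2).
    rewrite -[_ ^+ 2 / _ ^+ 2]expr_div_n sqrtr_sqr normrM normfV; congr (_ / _).
    by rewrite ger0_norm// addr_ge0// sqr_ge0.
  rewrite -sqrtrM ?divr_ge0 ?sqr_ge0// -sqrtr_sqr ler_wsqrtr// (le_trans (cs2 _ _ _ _))//.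
  rewrite -/(gsq w (ray t r)) ler_wpM2r ?gsq_ge0// -qE.
  have := q0 t; have := qE t; move: (q t) => k kE k0.
  rewrite (_ : _ + _ = r ^+ 2 * (1 + t ^+ 2) / k ^+ 6); last by field; rewrite gt_eqF.
  rewrite -kE (_ : _ / _ = r ^+ 2 / (k ^+ 2) ^+ 2)//; by field; rewrite gt_eqF.
Qed.

End hardy_lines.

Section hardy.
Context (R : realType).
Implicit Types (x y z : R * R) (s t r d e : R).
Local Notation mu := (@lebesgue_measure R).
Local Notation lb2 := (@leb2 R).
Variables (al : R -> R) (K : R).
Hypothesis adm : admissible al K.
Local Notation wt := (wt al).

Local Open Scope ereal_scope.

Let mw := measurable_wt adm.
Let w0 := wt_ge0 adm.
Let al0 := al_gt0 adm.

Lemma measurable_ray_scale s : measurable_fun [set: R * R] (fun p : R * R => ray p.2 (s * p.1)).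
Proof.
have m : measurable_fun [set: R * R] (fun p : R * R => (p.2, s * p.1)%R).
  apply: measurable_fun_pair; first exact: measurable_snd.
  by apply: measurable_funM => //; exact: measurable_fst.
exact: (measurableT_comp (@measurable_ray R) m).
Qed.

Lemma tonelli_rect (F : R * R -> \bar R) (A B : set R) : measurable A -> measurable B ->
  measurable_fun [set: R * R] F -> (forall p, 0 <= F p) ->
  \int[mu]_(t in B) \int[mu]_(r in A) F (r, t) = \int[mu]_(r in A) \int[mu]_(t in B) F (r, t).
Proof.
move=> mA mB mF F0.
pose P := F \_ [set p : R * R | A p.1 /\ B p.2].
have mAB := measurable_coords mA mB.
have mP : measurable_fun [set: R * R] P.
  by apply/(measurable_restrictT _ mAB); exact: measurable_funTS.
have P0 p : 0 <= P p by rewrite /P patchE; case: ifP.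
have E1 := tonelli1 mP P0; rewrite (tonelli2 mP P0) in E1.
have PE r t : P (r, t) = if r \in A then if t \in B then F (r, t) else 0 else 0.
  rewrite /P patchE; case: (boolP (r \in A)) => [/set_mem rA|rA]; last first.
    by rewrite memNset// => -[/mem_set rA' _]; rewrite rA' in rA.
  case: (boolP (t \in B)) => [/set_mem tB|tB]; first by rewrite mem_set.
  by rewrite memNset// => -[_ /mem_set tB']; rewrite tB' in tB.
transitivity (\int[mu]_y \int[mu]_x P (x, y)).
  rewrite integral_mkcond; apply: eq_integral => t _; rewrite patchE.
  case: ifP => tB.
    by rewrite integral_mkcond; apply: eq_integral => r _; rewrite patchE PE tB.
  by rewrite integral0_eq// => r _; rewrite PE tB; case: ifP.
rewrite E1 [RHS]integral_mkcond; apply: eq_integral => r _; rewrite patchE.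
case: ifP => rA.
  by rewrite [RHS]integral_mkcond; apply: eq_integral => t _; rewrite patchE PE rA.
by rewrite integral0_eq// => t _; rewrite PE rA.
Qed.

Lemma measurable_inner2 (F : R * R -> \bar R) (A : set R) : measurable A ->
  measurable_fun [set: R * R] F -> (forall p, 0 <= F p) ->
  measurable_fun [set: R] (fun t => \int[mu]_(r in A) F (r, t)).
Proof.
move=> mA mF F0.
have mS : measurable [set p : R * R | A p.1 /\ [set: R] p.2] by exact: measurable_coords.
have mQ : measurable_fun [set: R * R] (F \_ [set p : R * R | A p.1 /\ [set: R] p.2]).
  by apply/(measurable_restrictT _ mS); exact: measurable_funTS.
have Q0 p : 0 <= (F \_ [set p : R * R | A p.1 /\ [set: R] p.2]) p by rewrite patchE; case: ifP.
have := tonelli_m2 mQ Q0; congr (measurable_fun _ _); apply/funext => t.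
rewrite [RHS]integral_mkcond; apply: eq_integral => r _; rewrite !patchE.
case: ifPn => [/set_mem[rA _]|tn]; first by rewrite mem_set.
by rewrite memNset// => rA; move: tn; rewrite mem_set.
Qed.

Lemma measurable_inner1 (F : R * R -> \bar R) (A : set R) : measurable A ->
  measurable_fun [set: R * R] F -> (forall p, 0 <= F p) ->
  measurable_fun [set: R] (fun r => \int[mu]_(t in A) F (r, t)).
Proof.
move=> mA mF F0.
have msw : measurable_fun [set: R * R] (fun p : R * R => (p.2, p.1)).
  by apply: measurable_fun_pair; [exact: measurable_snd|exact: measurable_fst].
exact: (measurable_inner2 mA (measurableT_comp mF msw) (fun=> F0 _)).
Qed.

(** The radial density of the weight in Q1 and Q3: the factor r of polar coordinates
    divided by [al]. *)
Definition ka r : R := (`|r| / al r)%R.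

Lemma ka_ge0 r : (0 <= ka r)%R.
Proof. by rewrite /ka divr_ge0// ltW. Qed.

Lemma measurable_ka : measurable_fun [set: R] ka.
Proof. by apply: measurable_funM; [exact: normr_measurable|exact: (measurable_alV adm)]. Qed.

Lemma measurable_ray_r s t : measurable_fun [set: R] (fun r => ray t (s * r)).
Proof.
have ms : measurable_fun [set: R] ( *%R s) by exact: mulrl_measurable.
exact: (measurableT_comp (measurable_ray2 t) ms).
Qed.

Lemma measurable_ray_t r : measurable_fun [set: R] (fun t => ray t r).
Proof.
have m : measurable_fun [set: R] (fun t : R => (t, r)) by exact: measurable_fun_pair.
exact: (measurableT_comp (@measurable_ray R) m).
Qed.

Lemma oneD_ge0 t : (0 <= (1 + t ^+ 2)^-1)%R.
Proof. by rewrite invr_ge0 addr_ge0// sqr_ge0. Qed.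

Lemma measurable_oneD : measurable_fun [set: R] (fun t : R => (1 + t ^+ 2)^-1)%R.
Proof. by apply: continuous_measurable_fun; exact: (@continuous_oneDsqrV R). Qed.

Section sector.
Variables (s d e : R) (f : R * R -> R).
Hypotheses (s1 : (s ^+ 2 = 1)%R) (d0 : (0 <= d)%R).
Hypotheses (mf : measurable_fun [set: R * R] f) (f0 : forall x, (0 <= f x)%R).

Let mfr t : measurable_fun [set: R] (fun r => f (ray t (s * r)) * ka r)%R.
Proof.
apply: measurable_funM; last exact: measurable_ka.
exact: (measurableT_comp mf (measurable_ray_r s t)).
Qed.

Let mft r : measurable_fun [set: R] (fun t => f (ray t r) / (1 + t ^+ 2))%R.
Proof.
apply: measurable_funM; last exact: measurable_oneD.
exact: (measurableT_comp mf (measurable_ray_t r)).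
Qed.

Lemma polar_annw :
  \int[lb2]_(x in ann s d e) (f x * wt x)%:E =
  \int[mu]_(t in `[0%R, +oo[) (((1 + t ^+ 2)^-1)%:E *
    \int[mu]_(r in `]d, e[) (f (ray t (s * r)) * ka r)%:E).
Proof.
have ns : `|s|%R = 1%R by apply/eqP; rewrite -sqr_norm_eq1 s1.
have mfw : measurable_fun [set: R * R] (fun x => (f x * wt x)%:E).
  by apply/measurable_EFinP; exact: measurable_funM.
rewrite (polar_ann _ s1 d0 mfw); last by move=> x; rewrite lee_fin mulr_ge0.
apply: eq_integral => t; rewrite inE /= in_itv /= andbT => t0.
have mt := mfr t.
rewrite -rintZ ?oneD_ge0//; last by move=> r; rewrite mulr_ge0 ?ka_ge0.
apply: eq_integral => r; rewrite inE /= in_itv /= => /andP[dr re].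
have r0 : (0 < r)%R by exact: le_lt_trans dr.
have [sr _] : ann s d e (ray t (s * r)) by apply/annE => //; rewrite t0 dr re.
rewrite -!EFinM; congr (_%:E).
by rewrite (wt_sec al s1 sr) enorm_ray normrM ns mul1r /ka gtr0_norm//; ring.
Qed.

Lemma polar_annw_swap :
  \int[lb2]_(x in ann s d e) (f x * wt x)%:E =
  \int[mu]_(r in `]d, e[) ((ka r)%:E *
    \int[mu]_(t in `[0%R, +oo[) (f (ray t (s * r)) / (1 + t ^+ 2))%:E).
Proof.
rewrite polar_annw.
pose F (p : R * R) : \bar R := (f (ray p.2 (s * p.1)) * ka p.1 / (1 + p.2 ^+ 2))%:E.
have m1 := @measurable_fst _ _ (measurableTypeR R) (measurableTypeR R).
have m2 := @measurable_snd _ _ (measurableTypeR R) (measurableTypeR R).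
have mF : measurable_fun [set: R * R] F.
  apply/measurable_EFinP; apply: measurable_funM.
    apply: measurable_funM; last exact: (measurableT_comp measurable_ka m1).
    exact: (measurableT_comp mf (measurable_ray_scale s)).
  exact: (measurableT_comp measurable_oneD m2).
have F0 p : 0 <= F p by rewrite /F lee_fin mulr_ge0 ?oneD_ge0// mulr_ge0 ?ka_ge0.
have mI (i : interval R) : measurable [set` i] by exact: measurable_itv.
transitivity (\int[mu]_(t in `[0%R, +oo[) \int[mu]_(r in `]d, e[) F (r, t)).
  apply: eq_integral => t _; have mt := mfr t; rewrite -rintZ ?oneD_ge0//; last by move=> r; rewrite mulr_ge0 ?ka_ge0.
  by apply: eq_integral => r _; rewrite /F /= mulrC.
rewrite (tonelli_rect (mI _) (mI _) mF F0); apply: eq_integral => r _.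
have mt := mft (s * r)%R; rewrite -rintZ ?ka_ge0//; last by move=> t; rewrite mulr_ge0 ?oneD_ge0.
by apply: eq_integral => t _; rewrite /F /=; congr (_%:E); ring.
Qed.

End sector.

(** [ja] is the reciprocal of the radial weight [ka]; its primitive [Af] measures how
    much a function may vary along a ray per unit of energy. [kb] is the radial weight
    for arcs, [ka] divided by r^2. *)
Definition ja r : R := (al r / `|r|)%R.
Definition kb r : R := (`|r|^-1 / al r)%R.

Lemma ja_ge0 r : (0 <= ja r)%R.
Proof. by rewrite /ja divr_ge0// ltW. Qed.

Lemma kb_ge0 r : (0 <= kb r)%R.
Proof. by rewrite /kb divr_ge0 ?invr_ge0// ltW. Qed.

Lemma measurable_normV : measurable_fun [set: R] (fun r => `|r|^-1)%R.
Proof.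
have mn : measurable_fun [set: R] (fun r : R => `|r|)%R by exact: normr_measurable.
exact: (measurableT_comp (@measurable_inv R) mn).
Qed.

Lemma measurable_ja : measurable_fun [set: R] ja.
Proof. by apply: measurable_funM; [exact: (al_meas adm)|exact: measurable_normV]. Qed.

Lemma measurable_kb : measurable_fun [set: R] kb.
Proof. by apply: measurable_funM; [exact: measurable_normV|exact: (measurable_alV adm)]. Qed.

Definition Af r : \bar R := \int[mu]_(q in `]0%R, r[) (ja q)%:E.

Lemma AfE r : Af r = \int[mu]_(q in `]0%R, r[) (al q / q)%:E.
Proof.
apply: eq_integral => q; rewrite inE /= in_itv /= => /andP[q0 _].
by rewrite /ja gtr0_norm.
Qed.

Lemma Af_ge0 r : 0 <= Af r.
Proof. by apply: rint_ge0 => q; exact: ja_ge0. Qed.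

Lemma Af_fin r : (r <= 1)%R -> Af r < +oo.
Proof.
move=> r1; apply: (@le_lt_trans _ _ (Af 1%R)).
  apply: rint_sub => //; [exact: measurable_ja|exact: ja_ge0|].
  by move=> q; rewrite /= !in_itv /= => /andP[-> qr] /=; exact: lt_le_trans r1.
by rewrite AfE; exact: (al_int adm).
Qed.

Lemma Af_fineK r : (r <= 1)%R -> (fine (Af r))%:E = Af r.
Proof. by move=> r1; rewrite fineK// ge0_fin_numE ?Af_ge0// Af_fin. Qed.

Lemma measurable_Af : measurable_fun [set: R] Af.
Proof. exact: measurable_primitive measurable_ja ja_ge0. Qed.

Lemma hardy_ka e : (0 < e < 1)%R ->
  \int[mu]_(r in `]0%R, e[) ((ka r)%:E * Af r) <= (K * e ^+ 2)%:E.
Proof.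
move=> e01; apply: le_trans (al_hardy adm e01); rewrite le_eqVlt; apply/orP; left; apply/eqP.
apply: eq_integral => q; rewrite inE /= in_itv /= => /andP[q0 _].
by rewrite AfE /ka gtr0_norm.
Qed.

Lemma ka_int : exists2 L : R, (0 <= L)%R & \int[mu]_(r in `]0%R, 1%R[) (ka r)%:E = L%:E.
Proof.
have : \int[mu]_(r in `]0%R, 1%R[) (ka r)%:E < +oo.
  apply: le_lt_trans (al_intV adm); rewrite le_eqVlt; apply/orP; left; apply/eqP.
  apply: eq_integral => q; rewrite inE /= in_itv /= => /andP[q0 _].
  by rewrite /ka gtr0_norm.
move=> fin; have g0 : 0 <= \int[mu]_(r in `]0%R, 1%R[) (ka r)%:E by apply: rint_ge0; exact: ka_ge0.
exists (fine (\int[mu]_(r in `]0%R, 1%R[) (ka r)%:E)); first exact: fine_ge0.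
by rewrite fineK// ge0_fin_numE.
Qed.

(** Either [al] or its inverse is at least 1, so 1/r <= [ja] + [kb]. As [ja] is
    integrable at the origin and 1/r is not, [kb] is not integrable either. This is what
    ties the values on different rays together. *)
Lemma kb_large d' (M : R) : (0 < d' <= 1)%R ->
  exists2 d, (0 < d < d')%R & M%:E <= \int[mu]_(r in `]d, d'[) (kb r)%:E.
Proof.
move=> /andP[d'0 d'1].
pose N := (`|M| + fine (Af 1%R) + 1)%R.
have N0 : (0 < N)%R by rewrite ltr_wpDl ?addr_ge0// fine_ge0// Af_ge0.
exists (d' * expR (- N))%R.
  by rewrite mulr_gt0 ?expR_gt0//= gtr_pMr// expR_lt1 oppr_lt0.
set d := (d' * _)%R; have d0 : (0 < d)%R by rewrite mulr_gt0 ?expR_gt0.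
have dd' : (d < d')%R by rewrite gtr_pMr// expR_lt1 oppr_lt0.
have mV := measurable_normV.
have ln_int : \int[mu]_(r in `]d, d'[) (`|r|^-1)%:E = N%:E.
  have mE : measurable_fun [set: R] (fun r => (`|r|^-1)%:E) by apply/measurable_EFinP.
  rewrite integral_itv_obnd_cbnd ?integral_itv_bndo_bndc//; try exact: measurable_funTS.
  rewrite (@continuous_FTC2 _ _ (@ln R))//.
  - rewrite -EFinB; congr (_%:E).
    by rewrite /d lnM ?posrE ?expR_gt0// expRK; ring.
  - apply: continuous_in_subspaceT => r; rewrite inE /= in_itv /= => /andP[dr _].
    have r0 : (0 < r)%R by exact: lt_le_trans dr.
    apply: (@continuous_comp _ _ _ (fun r : R => `|r|%R) (@GRing.inv R) r); first exact: norm_continuous.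
    by apply: inv_continuous; rewrite normr_eq0 gt_eqF.
  - split.
    + move=> r; rewrite in_itv /= => /andP[dr _].
      exact: (ex_derive (is_derive := is_derive1_ln (lt_trans d0 dr))).
    + by apply: cvg_at_right_filter; exact: continuous_ln.
    + by apply: cvg_at_left_filter; apply: continuous_ln.
  - move=> r; rewrite in_itv /= => /andP[dr _]; have r0 := lt_trans d0 dr.
    by rewrite derive1E (derive_val (is_derive := is_derive1_ln r0)) gtr0_norm.
have H : \int[mu]_(r in `]d, d'[) (`|r|^-1)%:E <=
    \int[mu]_(r in `]d, d'[) (ja r)%:E + \int[mu]_(r in `]d, d'[) (kb r)%:E.
  rewrite -rintD//; [|exact: measurable_ja|exact: measurable_kb|exact: ja_ge0|exact: kb_ge0].
  apply: rint_le => //.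
    by apply: measurable_funD; [exact: measurable_ja|exact: measurable_kb].
  move=> r _; rewrite /ja /kb [X in (_ <= _ + X)%R]mulrC -mulrDl -[leLHS]mul1r; apply: ler_wpM2r.
    by rewrite invr_ge0.
  have := al0 r; move: (al r) => k k0; have [k1|k1] := leP 1%R k.
    by rewrite ler_wpDr// invr_ge0 ltW.
  by rewrite ler_wpDl ?(ltW k0)// invf_ge1// ltW.
have J : \int[mu]_(r in `]d, d'[) (ja r)%:E <= (fine (Af 1%R))%:E.
  rewrite Af_fineK//; apply: rint_sub => //; [exact: measurable_ja|exact: ja_ge0|].
  move=> q; rewrite /= !in_itv /= => /andP[dq qd]; rewrite (lt_trans d0 dq) /=.
  exact: lt_le_trans d'1.
rewrite ln_int in H; have := le_trans H (leeD2r _ J).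
rewrite addeC -leeBlDr// -EFinB; apply: le_trans.
by rewrite lee_fin /N; have := ler_norm M; lra.
Qed.

Section smooth_sector.
Variables (s : R) (w : R * R -> R).
Hypotheses (s1 : (s ^+ 2 = 1)%R) (sw : smooth w).

Let V r t := w (ray t (s * r)).
Let G r t := gsq w (ray t (s * r)).

Let ns : `|s|%R = 1%R.
Proof. by apply/eqP; rewrite -sqr_norm_eq1 s1. Qed.

(** Otherwise the energy would be at least E + 1: multiply the reversed inequality by
    the radial weight and integrate. *)
Lemma good_radius d d' (B E : R) : (0 <= d)%R -> (0 < B)%R -> (0 <= E)%R ->
  B%:E <= \int[mu]_(r in `]d, d'[) (kb r)%:E ->
  \int[lb2]_(x in ann s d d') (gsq w x * wt x)%:E <= E%:E ->
  exists2 r, (d < r < d')%R &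
    \int[mu]_(t in `[0%R, +oo[) (G r t / (1 + t ^+ 2))%:E <= ((E + 1) / B / r ^+ 2)%:E.
Proof.
move=> d0 B0 E0 HB HE; apply: contrapT => Hn.
have mg := measurable_gsq sw.
suff : (E + 1)%:E <= \int[lb2]_(x in ann s d d') (gsq w x * wt x)%:E.
  by move=> /le_trans/(_ HE); rewrite lee_fin; lra.
rewrite polar_annw_swap//; last exact: gsq_ge0.
have q0 : (0 <= (E + 1) / B)%R by rewrite divr_ge0 ?addr_ge0 ?(ltW B0).
apply: (@le_trans _ _ (\int[mu]_(r in `]d, d'[) ((E + 1) / B * kb r)%:E)).
  rewrite rintZ//; [|exact: measurable_kb|exact: kb_ge0].
  apply: le_trans (lee_wpmul2l _ HB); last by rewrite lee_fin.
  by rewrite -EFinM divfK ?gt_eqF.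
have mJ : measurable_fun [set: R] (fun r => \int[mu]_(t in `[0%R, +oo[) (gsq w (ray t (s * r)) / (1 + t ^+ 2))%:E).
  pose P := fun p : R * R => (gsq w (ray p.2 (s * p.1)) / (1 + p.2 ^+ 2))%:E.
  have mP : measurable_fun [set: R * R] P.
    apply/measurable_EFinP; apply: measurable_funM; first exact: (measurableT_comp mg (measurable_ray_scale s)).
    exact: (measurableT_comp measurable_oneD (@measurable_snd _ _ (measurableTypeR R) (measurableTypeR R))).
  by apply: (measurable_inner1 _ mP) => // p; rewrite /P lee_fin mulr_ge0 ?gsq_ge0 ?oneD_ge0.
apply: ge0_le_integral => //.
- by move=> r _; rewrite lee_fin mulr_ge0 ?kb_ge0.
- apply: measurable_funTS; apply/measurable_EFinP; apply: measurable_funM => //; exact: measurable_kb.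
- apply: measurable_funTS; apply: emeasurable_funM => //; apply/measurable_EFinP; exact: measurable_ka.
- move=> r; rewrite /= in_itv /= => /andP[dr rd'].
  have r0 : (0 < r)%R by exact: le_lt_trans dr.
  have -> : ((E + 1) / B * kb r)%:E = (ka r)%:E * ((E + 1) / B / r ^+ 2)%:E.
    rewrite -EFinM; congr (_%:E); rewrite /kb /ka gtr0_norm//; have := al0 r; move: (al r) => k k0.
    by field; rewrite !gt_eqF.
  apply: lee_wpmul2l; first by rewrite lee_fin ka_ge0.
  by rewrite leNgt; apply/negP => H; apply: Hn; exists r; [rewrite dr|exact: ltW].
Qed.

(** Cauchy-Schwarz along the arc of radius r, whose angular length is [kap]. *)
Lemma arc_bound r (J t : R) : (0 <= t)%R ->
  \int[mu]_(t in `[0%R, +oo[) (G r t / (1 + t ^+ 2))%:E <= J%:E ->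
  ((V r t - V r 0) ^+ 2 <= kap R * (r ^+ 2 * J))%R.
Proof.
move=> t0 HJ.
have [D [dD cD bD]] := arc_derive (s * r) sw.
have mG : measurable_fun [set: R] (fun t => gsq w (ray t (s * r))).
  exact: (measurableT_comp (measurable_gsq sw) (measurable_ray_t (s * r))).
have mq : measurable_fun [set: R] (fun t => G r t / (1 + t ^+ 2))%R.
  by apply: measurable_funM; [exact: mG|exact: measurable_oneD].
have msq : measurable_fun [set: R] (@Num.sqrt R).
  by apply: continuous_measurable_fun; exact: sqrt_continuous.
have pG t' : (0 <= G r t' / (1 + t' ^+ 2))%R by rewrite mulr_ge0 ?gsq_ge0 ?oneD_ge0.
have mI (i : interval R) : measurable [set` i] by exact: measurable_itv.
have sub : (`]0%R, t[ : set R) `<=` `[0%R, +oo[.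
  by move=> q; rewrite /= !in_itv /= => /andP[/ltW-> _].
apply: (ftc_cauchy_schwarz (F' := D) (f := fun t => Num.sqrt (1 + t ^+ 2)^-1)
  (g := fun t => `|r| * Num.sqrt (G r t / (1 + t ^+ 2)))%R) => //.
- exact: (measurableT_comp msq measurable_oneD).
- by apply: measurable_funM => //; exact: (measurableT_comp msq mq).
- move=> t' _; apply: le_trans (bD t') _; rewrite normrM ns mul1r sqrtrM ?gsq_ge0//.
  have := sqr_sqrtr (oneD_ge0 t'); move: (Num.sqrt (1 + t' ^+ 2)^-1) => i <-.
  by rewrite /G le_eqVlt; apply/orP; left; apply/eqP; ring.
- under eq_integral do rewrite sqr_sqrtr ?oneD_ge0//.
  rewrite -int_kap; apply: rint_sub => //; [exact: measurable_oneD|exact: oneD_ge0].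
- under eq_integral do rewrite exprMn sqr_sqrtr// real_normK ?num_real//.
  rewrite rintZ ?sqr_ge0// [leRHS]EFinM; apply: lee_wpmul2l; first by rewrite lee_fin sqr_ge0.
  by apply: le_trans HJ; apply: rint_sub.
Qed.

(** Cauchy-Schwarz along the ray of slope t, with [ja] as the inverse weight. *)
Lemma ray_bound r0 r t (I : R) : (0 < r0 <= r)%R -> (r <= 1)%R ->
  \int[mu]_(q in `]r0, r[) (G q t * ka q)%:E <= I%:E ->
  ((V r t - V r0 t) ^+ 2 <= fine (Af r) * I)%R.
Proof.
move=> /andP[r00 r0r] r1 HI.
have [D [dD cD bD]] := ray_derive t sw s1.
have mG : measurable_fun [set: R] (fun q => gsq w (ray t (s * q))).
  exact: (measurableT_comp (measurable_gsq sw) (measurable_ray_r s t)).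
have msq : measurable_fun [set: R] (@Num.sqrt R).
  by apply: continuous_measurable_fun; exact: sqrt_continuous.
have mGk : measurable_fun [set: R] (fun q => G q t * ka q)%R.
  by apply: measurable_funM => //; exact: measurable_ka.
have pG q : (0 <= G q t * ka q)%R by rewrite mulr_ge0 ?gsq_ge0 ?ka_ge0.
have mI (i : interval R) : measurable [set` i] by exact: measurable_itv.
apply: (ftc_cauchy_schwarz (F' := D) (f := fun q => Num.sqrt (ja q))
  (g := fun q => Num.sqrt (G q t * ka q))%R) => //.
- exact: (measurableT_comp msq measurable_ja).
- exact: (measurableT_comp msq mGk).
- move=> q /andP[r0q qr]; apply: le_trans (bD q) _.
  rewrite -sqrtrM ?ja_ge0// ler_wsqrtr//.
  have q0 : (0 < q)%R by exact: lt_trans r0q.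
  rewrite /ja /ka gtr0_norm// le_eqVlt; apply/orP; left; apply/eqP.
  by rewrite /G; have := al0 q; move: (al q) (gsq _ _) => k g k0; field; rewrite !gt_eqF.
- under eq_integral do rewrite sqr_sqrtr ?ja_ge0//.
  rewrite Af_fineK//; apply: rint_sub => //; [exact: measurable_ja|exact: ja_ge0|].
  by move=> q; rewrite /= !in_itv /= => /andP[r0q ->]; rewrite (lt_trans r00 r0q).
- by under eq_integral do rewrite sqr_sqrtr//.
Qed.

(** The constant k is the value at one end of the good arc. A point of the sector is
    joined to it by its ray down to the good radius and by a piece of the good arc.
    Integrating the square of the first increment produces [hardy_ka]; the second one is
    small because B is large. *)
Lemma hardy_smooth d d' (B C E L : R) : (0 < d)%R -> (d < d' < 1)%R -> (0 < B)%R -> (0 <= E)%R ->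
  (forall x, gsq w x <= C)%R ->
  \int[mu]_(r in `]0%R, 1%R[) (ka r)%:E = L%:E ->
  B%:E <= \int[mu]_(r in `]d, d'[) (kb r)%:E ->
  \int[lb2]_(x in ann s d 1) (gsq w x * wt x)%:E <= E%:E ->
  exists k : R, forall e, (d' < e < 1)%R ->
    \int[lb2]_(x in ann s d' e) ((w x - k) ^+ 2 * wt x)%:E <=
    (2 * K * e ^+ 2)%:E * \int[lb2]_(x in ann s d e) (gsq w x * wt x)%:E +
    (2 * kap R ^+ 2 * ((E + 1) / B) * L)%:E.
Proof.
move=> d0 /andP[dd' d'1] B0 E0 bC HL HB HE.
have mg := measurable_gsq sw.
have mgw : measurable_fun [set: R * R] (fun x => gsq w x * wt x)%R by exact: measurable_funM.
have mI (i : interval R) : measurable [set` i] by exact: measurable_itv.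
have HE' : \int[lb2]_(x in ann s d d') (gsq w x * wt x)%:E <= E%:E.
  apply: le_trans HE; apply: rint_sub => //; [exact: measurable_ann|exact: measurable_ann| |].
    by move=> x; rewrite mulr_ge0 ?gsq_ge0.
  by move=> x [sx /andP[dx xd]]; split; rewrite ?dx ?(lt_trans xd).
have [r0 /andP[dr0 r0d'] HJ] := good_radius (ltW d0) B0 E0 HB HE'.
have r00 : (0 < r0)%R by exact: lt_trans dr0.
set J := ((E + 1) / B / r0 ^+ 2)%R in HJ.
exists (V r0 0) => e /andP[d'e e1]; set k := V r0 0.
pose eta := (kap R * ((E + 1) / B))%R.
have eta0 : (0 <= eta)%R.
  by rewrite mulr_ge0 ?(ltW (kap_gt0 R))// divr_ge0 ?addr_ge0 ?(ltW B0).
have Hk t : (0 <= t)%R -> ((V r0 t - k) ^+ 2 <= eta)%R.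
  move=> t0; apply: le_trans (arc_bound t0 HJ) _.
  rewrite /eta /J ler_wpM2l ?(ltW (kap_gt0 R))// mulrC divfK// expf_neq0//.
  by rewrite gt_eqF.
have e0 : (0 < e)%R by apply: lt_trans d'e; exact: lt_trans dd'.
have L0 : (0 <= L)%R by rewrite -lee_fin -HL; apply: rint_ge0; exact: ka_ge0.
have HK := @hardy_ka e; rewrite e0 e1 in HK; have {}HK := HK isT.
pose af r := fine (Af r).
have maf : measurable_fun [set: R] af.
  exact: (measurableT_comp (@fine_measurable R setT measurableT) measurable_Af).
have af0 r : (0 <= af r)%R by rewrite /af fine_ge0// Af_ge0.
have mka := measurable_ka.
have mkaf : measurable_fun [set: R] (fun r => ka r * af r)%R by exact: measurable_funM.
have HKr : \int[mu]_(r in `]0%R, e[) (ka r * af r)%:E <= (K * e ^+ 2)%:E.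
  apply: le_trans HK; rewrite le_eqVlt; apply/orP; left; apply/eqP; apply: eq_integral => r.
  by rewrite inE /= in_itv /= => /andP[_ re]; rewrite EFinM /af Af_fineK// ltW// (lt_trans re).
have K0 : (0 <= K * e ^+ 2)%R.
  by rewrite -lee_fin; apply: le_trans HKr; apply: rint_ge0 => r; rewrite mulr_ge0 ?ka_ge0.
have mf1 : measurable_fun [set: R * R] (fun x => (w x - k) ^+ 2)%R.
  apply: measurable_funX; apply: measurable_funB => //.
  by apply: continuous_measurable2; exact: smooth_cts.
have p1 x : (0 <= (w x - k) ^+ 2)%R by exact: sqr_ge0.
rewrite polar_annw//; last by rewrite ltW// (lt_trans d0).
rewrite polar_annw ?(ltW d0)//; last by move=> x; exact: gsq_ge0.
pose I (t : R) : \bar R := \int[mu]_(q in `]d, e[) (G q t * ka q)%:E.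
have mG t : measurable_fun [set: R] (fun q => G q t * ka q)%R.
  apply: measurable_funM => //.
  exact: (measurableT_comp mg (measurable_ray_r s t)).
have pG q t : (0 <= G q t * ka q)%R by rewrite mulr_ge0 ?gsq_ge0 ?ka_ge0.
have Ifin t : I t = (fine (I t))%:E.
  have mGt := mG t.
  rewrite fineK// ge0_fin_numE; last by apply: rint_ge0 => q.
  apply: (@le_lt_trans _ _ (\int[mu]_(q in `]0%R, 1%R[) (C * ka q)%:E)).
    apply: (@le_trans _ _ (\int[mu]_(q in `]0%R, 1%R[) (G q t * ka q)%:E)).
      rewrite /I; apply: (@rint_sub _ _ R) => //.
      move=> q; rewrite /= !in_itv /= => /andP[dq qe].
      by rewrite (lt_trans d0 dq) (lt_trans qe e1).
    apply: rint_le => //; first exact: measurable_funM.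
    by move=> q _; rewrite ler_wpM2r ?ka_ge0 //; exact: bC.
  have C0 : (0 <= C)%R by exact: le_trans (gsq_ge0 w (ray 0 0)) (bC _).
  by rewrite rintZ// ?HL -?EFinM ?ltry//; exact: ka_ge0.
have inner t : (0 <= t)%R ->
    \int[mu]_(r in `]d', e[) ((w (ray t (s * r)) - k) ^+ 2 * ka r)%:E <=
    (2 * K * e ^+ 2)%:E * I t + (2 * eta * L)%:E.
  move=> t0.
  have It0 : (0 <= fine (I t))%R by apply: fine_ge0; apply: rint_ge0.
  have mw' : measurable_fun [set: R] (fun r => (w (ray t (s * r)) - k) ^+ 2 * ka r)%R.
    apply: measurable_funM => //; exact: (measurableT_comp mf1 (measurable_ray_r s t)).
  have mA1 : measurable_fun [set: R] (fun r => 2 * fine (I t) * (ka r * af r))%R by exact: measurable_funM.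
  have mA2 : measurable_fun [set: R] (fun r => 2 * eta * ka r)%R by exact: measurable_funM.
  have pA1 r : (0 <= ka r * af r)%R by rewrite mulr_ge0 ?ka_ge0.
  apply: (@le_trans _ _ (\int[mu]_(r in `]d', e[)
     (2 * fine (I t) * (ka r * af r) + 2 * eta * ka r)%:E)).
    apply: rint_le => //.
    - exact: measurable_funD.
    - by move=> r; rewrite mulr_ge0 ?sqr_ge0 ?ka_ge0.
    - move=> r; rewrite /= in_itv /= => /andP[d'r re].
      have -> : (2 * fine (I t) * (ka r * af r) + 2 * eta * ka r = (2 * (af r * fine (I t)) + 2 * eta) * ka r)%R by ring.
      rewrite ler_wpM2r ?ka_ge0//.
      have r1 : (r <= 1)%R by rewrite ltW// (lt_trans re).
      have r0r : (r0 <= r)%R by rewrite ltW// (lt_trans r0d').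
      have b1 : ((V r t - V r0 t) ^+ 2 <= af r * fine (I t))%R.
        apply: ray_bound => //; first by rewrite r00.
        have mGt := mG t; rewrite -Ifin /I; apply: (@rint_sub _ _ R) => //.
        move=> q; rewrite /= !in_itv /= => /andP[r0q qr].
        by rewrite (lt_trans dr0 r0q) (lt_trans qr re).
      have b2 := Hk _ t0.
      have : ((V r t - k) ^+ 2 <= 2 * (V r t - V r0 t) ^+ 2 + 2 * (V r0 t - k) ^+ 2)%R.
        rewrite -subr_ge0 (_ : _ - _ = (V r t - V r0 t - (V r0 t - k)) ^+ 2)%R ?sqr_ge0//; ring.
      rewrite /V -/k; move: b1 b2; rewrite /V; move: (_ ^+ 2)%R (_ ^+ 2)%R (_ ^+ 2)%R => *; lra.
  rewrite rintD//; last 2 first.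
  - by move=> r; rewrite mulr_ge0// mulr_ge0.
  - by move=> r; rewrite mulr_ge0 ?ka_ge0// mulr_ge0.
  have cI : (0 <= 2 * fine (I t))%R by rewrite mulr_ge0.
  have cE : (0 <= 2 * eta)%R by rewrite mulr_ge0.
  have Z1 : \int[mu]_(r in `]d', e[) (2 * fine (I t) * (ka r * af r))%:E =
      (2 * fine (I t))%:E * \int[mu]_(r in `]d', e[) (ka r * af r)%:E by apply: rintZ.
  have Z2 : \int[mu]_(r in `]d', e[) (2 * eta * ka r)%:E =
      (2 * eta)%:E * \int[mu]_(r in `]d', e[) (ka r)%:E by apply: rintZ => //; exact: ka_ge0.
  rewrite Z1 Z2.
  apply: leeD.
    rewrite (_ : (2 * K * e ^+ 2)%:E * I t = (2 * fine (I t))%:E * (K * e ^+ 2)%:E); last first.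
      by rewrite Ifin -!EFinM; congr (_%:E); ring.
    apply: lee_wpmul2l; first by rewrite lee_fin mulr_ge0.
    apply: le_trans HKr; apply: rint_sub => // r; rewrite /= !in_itv /= => /andP[d'r ->].
    by rewrite andbT (lt_trans d0)// (lt_trans dd').
  rewrite [leRHS]EFinM; apply: lee_wpmul2l; first by rewrite lee_fin mulr_ge0.
  rewrite -HL; apply: rint_sub => //; first exact: ka_ge0.
  move=> r; rewrite /= !in_itv /= => /andP[d'r re].
  by rewrite (lt_trans re e1) andbT (lt_trans d0)// (lt_trans dd').
have c1 : (0 <= 2 * K * e ^+ 2)%R by rewrite -mulrA mulr_ge0.
have c2 : (0 <= 2 * eta * L)%R by do 2 apply: mulr_ge0 => //.
have I0 t : 0 <= I t by apply: rint_ge0.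
have mk1 : measurable_fun [set: R] (fun t : R => ((1 + t ^+ 2)^-1)%:E : \bar R).
  by apply/measurable_EFinP; exact: measurable_oneD.
have mII : measurable_fun [set: R] I.
  pose P := fun p : R * R => (gsq w (ray p.2 (s * p.1)) * ka p.1)%:E.
  have mP : measurable_fun [set: R * R] P.
    apply/measurable_EFinP; apply: measurable_funM; first exact: (measurableT_comp mg (measurable_ray_scale s)).
    exact: (measurableT_comp mka (@measurable_fst _ _ (measurableTypeR R) (measurableTypeR R))).
  by apply: (measurable_inner2 _ mP) => // p; rewrite /P lee_fin mulr_ge0 ?gsq_ge0 ?ka_ge0.
apply: (@le_trans _ _ (\int[mu]_(t in `[0%R, +oo[) ((2 * K * e ^+ 2)%:E * (((1 + t ^+ 2)^-1)%:E * I t) +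
   (2 * eta * L)%:E * ((1 + t ^+ 2)^-1)%:E))).
  apply: ge0_le_integral => //.
  - move=> t _; rewrite mule_ge0 ?lee_fin ?oneD_ge0//; apply: rint_ge0 => r.
    by rewrite mulr_ge0 ?sqr_ge0 ?ka_ge0.
  - apply: measurable_funTS; apply: emeasurable_funM => //.
    pose P := fun p : R * R => ((w (ray p.2 (s * p.1)) - k) ^+ 2 * ka p.1)%:E.
    have mP : measurable_fun [set: R * R] P.
      apply/measurable_EFinP; apply: measurable_funM; first exact: (measurableT_comp mf1 (measurable_ray_scale s)).
      exact: (measurableT_comp mka (@measurable_fst _ _ (measurableTypeR R) (measurableTypeR R))).
    by apply: (measurable_inner2 _ mP) => // p; rewrite /P lee_fin mulr_ge0 ?sqr_ge0 ?ka_ge0.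
  - apply: measurable_funTS; apply: emeasurable_funD; apply: measurable_funeM => //.
    exact: emeasurable_funM.
  - move=> t; rewrite /= in_itv /= andbT => /inner H.
    apply: le_trans (lee_wpmul2l _ H) _; first by rewrite lee_fin oneD_ge0.
    rewrite (Ifin t); move: (fine (I t)) => i.
    rewrite -!EFinM -!EFinD lee_fin.
    by rewrite le_eqVlt; apply/orP; left; apply/eqP; ring.
rewrite ge0_integralD//; last 4 first.
- by move=> t _; rewrite mule_ge0 ?lee_fin// mule_ge0 ?lee_fin ?oneD_ge0.
- by apply: measurable_funTS; apply: measurable_funeM; exact: emeasurable_funM.
- by move=> t _; rewrite mule_ge0 ?lee_fin ?oneD_ge0.
- by apply: measurable_funTS; exact: measurable_funeM.
have mkI : measurable_fun (`[0%R, +oo[%classic : set R) (fun t => ((1 + t ^+ 2)^-1)%:E * I t).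
  by apply: measurable_funTS; exact: emeasurable_funM.
have mk2 : measurable_fun (`[0%R, +oo[%classic : set R) (fun t : R => ((1 + t ^+ 2)^-1)%:E : \bar R).
  exact: measurable_funTS.
have kI0 (t : R) : `[0%R, +oo[%classic t -> 0 <= ((1 + t ^+ 2)^-1)%:E * I t.
  by move=> _; rewrite mule_ge0 ?lee_fin ?oneD_ge0.
have k20 (t : R) : `[0%R, +oo[%classic t -> 0 <= ((1 + t ^+ 2)^-1)%:E :> \bar R.
  by move=> _; rewrite lee_fin oneD_ge0.
have Z1 : \int[mu]_(t in `[0%R, +oo[) ((2 * K * e ^+ 2)%:E * (((1 + t ^+ 2)^-1)%:E * I t)) =
    (2 * K * e ^+ 2)%:E * \int[mu]_(t in `[0%R, +oo[) (((1 + t ^+ 2)^-1)%:E * I t).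
  by apply: ge0_integralZl.
have Z2 : \int[mu]_(t in `[0%R, +oo[) ((2 * eta * L)%:E * ((1 + t ^+ 2)^-1)%:E) =
    (2 * eta * L)%:E * \int[mu]_(t in `[0%R, +oo[) ((1 + t ^+ 2)^-1)%:E.
  by apply: ge0_integralZl.
rewrite Z1 Z2.
rewrite int_kap leeD2l// -EFinM lee_fin /eta.
by rewrite le_eqVlt; apply/orP; left; apply/eqP; ring.
Qed.

End smooth_sector.

End hardy.

(** * Cutoffs, and approximation away from the origin *)

Section shrinking.
Local Open Scope ereal_scope.
Context d (T : measurableType d) (R : realType) (m : {measure set T -> \bar R}).

(** Dominated convergence: the indicators of the sets tend to 0 almost everywhere. *)
Lemma int_shrink (f : T -> R) (A : nat -> set T) (e : R) :
  measurable_fun [set: T] f -> (forall x, 0 <= f x)%R -> \int[m]_x (f x)%:E < +oo ->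
  (forall n, measurable (A n)) -> {ae m, forall x, exists N, forall n, (N <= n)%N -> ~ A n x} -> (0 < e)%R ->
  exists N, forall n, (N <= n)%N -> \int[m]_(x in A n) (f x)%:E <= e%:E.
Proof.
move=> mf f0 fin mA HA e0.
have mE : measurable_fun [set: T] (EFin \o f) by apply/measurable_EFinP.
have ig : m.-integrable [set: T] (EFin \o f).
  by apply/integrableP; split => //; under eq_integral do rewrite /= ger0_norm//.
have [] := @dominated_convergence _ _ _ m setT measurableT (fun n => (EFin \o f) \_ (A n)) (cst 0) (EFin \o f).
- by move=> n; apply/(measurable_restrictT _ (mA n)); exact: measurable_funTS.
- exact: measurable_cst.
- apply: aeS HA => x [N HN] _; apply: cvg_near_cst.
  by exists N => // n /= Nn; rewrite patchE memNset//; exact: HN.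
- exact: ig.
- apply: aeW => x n _ /=; rewrite patchE; case: ifP => _; rewrite ?abse0 ?lee_fin ?f0//.
  by rewrite /= ger0_norm.
move=> _ _ cv; rewrite integral0 in cv.
have [N _ H] := cvg0_le cv e0; exists N => n Nn.
by have := H n Nn; rewrite /= -integral_mkcond.
Qed.

(** Monotone convergence. *)
Lemma int_exhaust (f : T -> R) (A : nat -> set T) (c : \bar R) :
  measurable_fun [set: T] f -> (forall x, 0 <= f x)%R ->
  (forall n, measurable (A n)) -> {homo A : n k / (n <= k)%N >-> (n <= k)%O} ->
  (forall n, \int[m]_(x in A n) (f x)%:E <= c) ->
  \int[m]_(x in \bigcup_n A n) (f x)%:E <= c.
Proof.
move=> mf f0 mA homoA H.
have mE D : measurable_fun D (EFin \o f) by apply: measurable_funTS; apply/measurable_EFinP.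
have cv := @ge0_nondecreasing_set_cvg_integral _ _ _ A (EFin \o f) m homoA mA (fun=> mE _) (fun n x _ => f0 x).
rewrite -(cvg_lim (@ereal_hausdorff R) cv); apply: lime_le; first by apply/cvg_ex; exists (\int[m]_(x in \bigcup_n A n) (f x)%:E).
exact: nearW.
Qed.

Lemma rint_sum3 (D : set T) (p q r : T -> R) (c e : R) : measurable D ->
  measurable_fun [set: T] p -> measurable_fun [set: T] q -> measurable_fun [set: T] r ->
  (forall x, 0 <= p x)%R -> (forall x, 0 <= q x)%R -> (forall x, 0 <= r x)%R -> (0 <= c)%R ->
  \int[m]_x (p x)%:E <= e%:E -> \int[m]_x (q x)%:E <= e%:E -> \int[m]_x (r x)%:E <= e%:E ->
  \int[m]_(x in D) (c * (p x + q x + r x))%:E <= (c * (3 * e))%:E.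
Proof.
move=> mD mp mq mr p0 q0 r0 c0 Ip Iq Ir.
have mpq : measurable_fun [set: T] (fun x => p x + q x)%R by exact: measurable_funD.
have mpqr : measurable_fun [set: T] (fun x => p x + q x + r x)%R by exact: measurable_funD.
have pq0 x : (0 <= p x + q x)%R by exact: addr_ge0.
have pqr0 x : (0 <= p x + q x + r x)%R by exact: addr_ge0.
rewrite rintZ// EFinM; apply: lee_wpmul2l; first by rewrite lee_fin.
apply: (le_trans (rint_sub _ mD measurableT mpqr pqr0 _)) => //.
rewrite rintD// rintD// (_ : 3 * e = e + e + e)%R; last by ring.
by rewrite !EFinD; apply: leeD => //; exact: leeD.
Qed.

End shrinking.

Section cutoff.
Context (R : realType).
Implicit Types (f : R * R -> R) (x y v : R * R).

Lemma is_derive_dilate f (c : R) x v : derivable f (c *: x) v ->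
  is_derive x v (fun x => f (c *: x)) (c * 'D_v f (c *: x)).
Proof.
move=> df; have /is_derive_dir D := derivableP df; apply/is_derive_dir.
rewrite mulrC; pose F (h : R) := f (h *: v + c *: x).
rewrite [X in is_derive _ _ X](_ : _ = F \o (fun h : R => c * h)); last first.
  by apply/funext => h; rewrite /F /= scalerDr scalerA.
apply: is_derive1_comp; first by rewrite mulr0.
by have := is_deriveZ c (is_derive_id (0 : R) (1 : R)); rewrite [c *: 1]mulr1.
Qed.

Lemma derive_locally_cst f (c : R) x v : (\forall y \near x, f y = c) -> 'D_v f x = 0.
Proof.
move=> H; rewrite (@near_eq_derive _ _ _ f (cst c)) ?derive_cst//.
Qed.

Definition rstep x : R := step (nsq x).

Lemma smooth_rstep : smooth rstep.
Proof. by move=> k; exact: Ck_step (Ck_nsq R k). Qed.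

Lemma nsq_le x (d : R) : 0 <= d -> (nsq x <= d ^+ 2) = (enorm x <= d).
Proof. by move=> d0; rewrite -enorm_sqr ler_sqr ?nnegrE ?enorm_ge0. Qed.

Lemma rstep0 x : enorm x <= 1 -> rstep x = 0.
Proof. by move=> x1; apply: step0; have := nsq_le x (@ler01 R); rewrite x1 expr1n. Qed.

Lemma rstep1 x : 2 <= enorm x -> rstep x = 1.
Proof.
move=> x2; apply: step1; rewrite -enorm_sqr; apply: (@le_trans _ _ (2 ^+ 2)).
  by rewrite expr2; lra.
by rewrite ler_sqr ?nnegrE ?enorm_ge0.
Qed.

Lemma enormZ (c : R) x : enorm (c *: x) = `|c| * enorm x.
Proof.
rewrite /enorm /= -sqrtr_sqr -sqrtrM ?sqr_ge0//; congr Num.sqrt.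
by rewrite /GRing.scale /=; ring.
Qed.

Lemma norm_le_enorm x : `|x.1| <= enorm x /\ `|x.2| <= enorm x.
Proof. by rewrite /enorm -!sqrtr_sqr !ler_wsqrtr// ?lerDl ?lerDr sqr_ge0. Qed.

Lemma near_enorm_lt x (c : R) : enorm x < c -> \forall y \near x, enorm y < c.
Proof. exact: (cvgr_lt (enorm x) (@enorm_continuous R x)). Qed.

Lemma near_enorm_gt x (c : R) : c < enorm x -> \forall y \near x, c < enorm y.
Proof. exact: (cvgr_gt (enorm x) (@enorm_continuous R x)). Qed.

Lemma rstep_D0 v x : enorm x < 1 \/ 2 < enorm x -> 'D_v rstep x = 0.
Proof.
move=> [x1|x2].
  apply: (@derive_locally_cst _ 0); have := near_enorm_lt x1; apply: filterS => y /ltW; exact: rstep0.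
apply: (@derive_locally_cst _ 1); have := near_enorm_gt x2; apply: filterS => y /ltW; exact: rstep1.
Qed.

Lemma rstep_test : test_function setT (fun x => 1 - rstep x).
Proof.
have sb : smooth (fun x => 1 - rstep x).
  move=> k; rewrite (_ : (fun x => 1 - rstep x) = (cst 1 \+ (fun x => (-1) * rstep x))).
    by apply: CkD; [exact: Ck_cst|apply: CkZ; exact: smooth_rstep].
  by apply/funext => x /=; rewrite mulN1r.
apply: (@testTP _ _ 2) => // x; have [x2|x2] := leP 2 (enorm x); first by rewrite rstep1// subrr eqxx.
move=> _; have [h1 h2] := norm_le_enorm x.
by split; apply: ltW; [apply: le_lt_trans h1 _|apply: le_lt_trans h2 _].
Qed.

Lemma rstep_D_bounded w : axis w -> exists2 C : R, 0 <= C & forall x, `|'D_w rstep x| <= C.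
Proof.
move=> aw; have [C C0 HC] := test_bounded (axis_test aw rstep_test).
exists C => // x; apply: le_trans (HC x); rewrite le_eqVlt; apply/orP; left; apply/eqP.
have db : derivable rstep x w by apply: axis_derivable => //; exact: smooth_rstep.
have -> : 'D_w (fun x => 1 - rstep x) x = - 'D_w rstep x.
  have D := is_deriveB (is_derive_cst (1 : R) x w) (derivableP db).
  by rewrite (derive_val (is_derive := D)) sub0r.
by rewrite normrN.
Qed.

Definition cutr (d : R) x : R := rstep (d^-1 *: x).

Lemma smooth_cut d : smooth (cutr d).
Proof.
move=> k; rewrite (_ : cutr d = (fun x => rstep (d^-1 *: x + 0))).
  by apply: Ck_affine; exact: smooth_rstep.
by apply/funext => x; rewrite addr0.
Qed.

Lemma cut_ge0 d x : 0 <= cutr d x. Proof. exact: step_ge0. Qed.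
Lemma cut_le1 d x : cutr d x <= 1. Proof. exact: step_le1. Qed.

Lemma enorm_dilate d x : 0 < d -> enorm (d^-1 *: x) = enorm x / d.
Proof. by move=> d0; rewrite enormZ gtr0_norm ?invr_gt0// mulrC. Qed.

Lemma cut0 d x : 0 < d -> enorm x <= d -> cutr d x = 0.
Proof. by move=> d0 xd; apply: rstep0; rewrite enorm_dilate// ler_pdivrMr// mul1r. Qed.

Lemma cut1 d x : 0 < d -> 2 * d <= enorm x -> cutr d x = 1.
Proof. by move=> d0 xd; apply: rstep1; rewrite enorm_dilate// ler_pdivlMr. Qed.

Lemma cut_D w d x : axis w -> 'D_w (cutr d) x = d^-1 * 'D_w rstep (d^-1 *: x).
Proof.
move=> aw; have D := is_derive_dilate (@axis_derivable R w _ (d^-1 *: x) aw smooth_rstep).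
by rewrite (derive_val (is_derive := D)).
Qed.

Lemma cut_D0 w d x : axis w -> 0 < d -> enorm x < d \/ 2 * d < enorm x -> 'D_w (cutr d) x = 0.
Proof.
move=> aw d0 H; rewrite cut_D// rstep_D0 ?mulr0// enorm_dilate//.
by rewrite ltr_pdivrMr// ltr_pdivlMr// mul1r.
Qed.

(** By scaling; only the power of d matters later. *)
Lemma cut_D_sqr : exists2 C : R, 0 <= C & forall w d x, axis w -> 0 < d ->
  'D_w (cutr d) x ^+ 2 <= C / d ^+ 2.
Proof.
have [C1 C10 H1] := rstep_D_bounded (@axis1 R); have [C2 C20 H2] := rstep_D_bounded (@axis2 R).
exists ((C1 + C2) ^+ 2); first exact: sqr_ge0.
move=> w d x aw d0; rewrite cut_D// exprMn exprVn mulrC ler_wpM2r ?invr_ge0 ?sqr_ge0//.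
rewrite -real_normK ?num_real// ler_sqr ?nnegrE ?addr_ge0//.
case: aw => ->; [apply: le_trans (H1 _) _|apply: le_trans (H2 _) _]; by rewrite ?lerDl ?lerDr.
Qed.

(** Vanishes near the origin and near infinity, so that multiplication by it moves
    functions to where the weight is bounded above and below. *)
Definition zeta (d M : R) x : R := cutr d x * (1 - cutr M x).

Section zeta.
Variables (d M : R).
Hypotheses (d0 : 0 < d) (M0 : 0 < M).

Lemma zeta_ge0 x : 0 <= zeta d M x.
Proof. by rewrite mulr_ge0 ?cut_ge0// subr_ge0 cut_le1. Qed.

Lemma zeta_le1 x : zeta d M x <= 1.
Proof. by rewrite mulr_ile1 ?cut_ge0 ?cut_le1 ?subr_ge0 ?cut_le1// gerBl cut_ge0. Qed.

Lemma zeta_in x : enorm x <= d -> zeta d M x = 0.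
Proof. by move=> xd; rewrite /zeta cut0// mul0r. Qed.

Lemma zeta_out x : 2 * M <= enorm x -> zeta d M x = 0.
Proof. by move=> xM; rewrite /zeta (cut1 M0 xM) subrr mulr0. Qed.

Lemma zeta_mid x : 2 * d <= enorm x -> enorm x <= M -> zeta d M x = 1.
Proof. by move=> xd xM; rewrite /zeta (cut1 d0 xd) (cut0 M0 xM) subr0 mulr1. Qed.

Lemma smooth_cutC : smooth (fun x => 1 - cutr M x).
Proof.
move=> k; rewrite (_ : (fun x => 1 - cutr M x) = (cst 1 \+ (fun x => (-1) * cutr M x))).
  by apply: CkD; [exact: Ck_cst|apply: CkZ; exact: smooth_cut].
by apply/funext => x /=; rewrite mulN1r.
Qed.

Lemma smooth_zeta : smooth (zeta d M).
Proof. by move=> k; exact: CkM (smooth_cut d k) (smooth_cutC k). Qed.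

Lemma zeta_test : test_function setT (zeta d M).
Proof.
apply: (@testTP _ _ (2 * M)); first exact: smooth_zeta.
move=> x; have [x2|x2] := leP (2 * M) (enorm x); first by rewrite zeta_out// eqxx.
move=> _; have [h1 h2] := norm_le_enorm x.
by split; apply: ltW; [apply: le_lt_trans h1 _|apply: le_lt_trans h2 _].
Qed.

Lemma zeta_test0 : test_function (~` [set 0]) (zeta d M).
Proof.
have [h1 h2 _] := zeta_test; split => // x sx /= x0.
have x0d : enorm x < d by rewrite x0 /enorm /= expr0n /= addr0 sqrtr0.
have [y [/= zy yd]] := sx _ (near_enorm_lt x0d).
by move: zy; rewrite zeta_in ?eqxx// ltW.
Qed.

Lemma zeta_D w x : axis w -> 'D_w (zeta d M) x = 'D_w (cutr d) x * (1 - cutr M x) - cutr d x * 'D_w (cutr M) x.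
Proof.
move=> aw; rewrite (axis_DM x aw (smooth_cut d) smooth_cutC).
have -> : 'D_w (fun x => 1 - cutr M x) x = - 'D_w (cutr M) x.
  have D := is_deriveB (is_derive_cst (1 : R) x w) (derivableP (@axis_derivable R w _ x aw (smooth_cut M))).
  by rewrite (derive_val (is_derive := D)) sub0r.
by rewrite mulrN addrC.
Qed.

Lemma zeta_D_mid w x : axis w -> 2 * d < enorm x -> enorm x < M -> 'D_w (zeta d M) x = 0.
Proof. by move=> aw xd xM; rewrite zeta_D// (@cut_D0 _ d)//; [rewrite (@cut_D0 _ M)//; [rewrite mul0r mulr0 subr0|left]|right]. Qed.

Lemma zeta_D_in w x : axis w -> enorm x < d -> d <= M -> 'D_w (zeta d M) x = 0.
Proof. by move=> aw xd dM; rewrite zeta_D// (@cut_D0 _ d)//; [rewrite (@cut_D0 _ M)//; [rewrite mul0r mulr0 subr0|left; exact: lt_le_trans dM]|left]. Qed.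

End zeta.
End cutoff.

Section approximation.
Context (R : realType).
Implicit Types (x y : R * R) (u g h : R * R -> R).
Local Notation mu := (@lebesgue_measure R).
Local Notation lb2 := (@leb2 R).
Local Notation testT := (test_function [set: R * R]).
Variables (al : R -> R) (K : R).
Hypothesis adm : admissible al K.
Local Notation wt := (wt al).

Definition shell (p q : R) : set (R * R) := [set x | p < enorm x < q].

Lemma measurable_shell p q : measurable (shell p q).
Proof.
rewrite (_ : shell p q = [set x | enorm x \in `]p, q[]); first exact: measurable_enorm_itv.
by apply/seteqP; split => x; rewrite /shell /= in_itv.
Qed.

Lemma int2_dom (f F : R * R -> R) (C : R) : measurable_fun [set: R * R] f ->
  measurable_fun [set: R * R] F -> (forall x, 0 <= F x) -> 0 <= C ->
  (forall x, f x ^+ 2 <= C * F x) -> (\int[lb2]_x (F x)%:E < +oo)%E -> int2 f.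
Proof.
move=> mf mF F0 C0 H fin.
have mf2 : measurable_fun [set: R * R] (fun x => f x ^+ 2) by exact: measurable_funX.
apply/integrableP; split; first by apply/measurable_EFinP.
under eq_integral do rewrite /= ger0_norm ?sqr_ge0//.
apply: (@le_lt_trans _ _ (\int[lb2]_x (C * F x)%:E)%E).
  by apply: rint_le => //; [exact: measurable_funM|move=> x; exact: sqr_ge0].
by rewrite rintZ// lte_mul_pinfty.
Qed.

(** On the support of the cutoff the weight is bounded and bounded away from 0, so there
    the weighted and the ordinary L2 norms are equivalent and the L2 theory of
    mollifiers applies to u times the cutoff. *)
Lemma approx_test u g h (d M eps : R) : grad_of u g h -> (energy al setT g h u < +oo)%E ->
  0 < d -> 2 * d < M -> 0 < eps ->
  exists2 w, testT w &
    (energy al (shell (2 * d) M) (fun x => g x - 'D_(@e1 R) w x)%R (fun x => h x - 'D_(@e2 R) w x)%R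
       (fun x => u x - w x)%R <= eps%:E)%E.
Proof.
move=> G fin d0 dM eps0; have M0 : 0 < M by move: d0 dM; lra.
have dM' : d <= M by move: d0 dM; lra.
have [mu_ mg mh] := grad_meas G; have [lu wg wh] := G.
pose z := zeta d M; have tz : testT z := zeta_test d M0.
have a1 := @axis1 R; have a2 := @axis2 R.
have d2 : 0 < d / 2 by rewrite divr_gt0.
have [c c0 Hc] := wt_bd adm d2.
have ci0 : 0 <= c^-1 by rewrite invr_ge0 ltW.
have wg' := weak_derivM a1 tz lu wg; have wh' := weak_derivM a2 tz lu wh.
set g' := fun x => z x * g x + _ in wg'; set h' := fun x => z x * h x + _ in wh'.
pose u' x := z x * u x.
have [tD1 tD2] := (axis_test a1 tz, axis_test a2 tz).
have com (k l : R * R -> R) : (fun x => k x * l x) = (fun x => l x * k x).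
  by apply/funext => x; rewrite mulrC.
have iu' : int1 u' by rewrite /u' com; exact: L1loc_test.
have ig' : int1 g'.
  by apply: int1D; rewrite com; apply: L1loc_test => //; case: wg.
have ih' : int1 h'.
  by apply: int1D; rewrite com; apply: L1loc_test => //; case: wh.
have [C1 C10 H1] := test_bounded tD1; have [C2 C20 H2] := test_bounded tD2.
have mF : measurable_fun [set: R * R] (fun x => dens g h u x * wt x).
  by apply: measurable_funM; [exact: measurable_dens|exact: (measurable_wt adm)].
have F0 x : 0 <= dens g h u x * wt x by rewrite mulr_ge0 ?dens_ge0// (wt_ge0 adm).
have z01 x : z x ^+ 2 <= 1 by rewrite expr_le1// ?zeta_le1// zeta_ge0.
have densw x : d <= enorm x -> dens g h u x <= c^-1 * (dens g h u x * wt x).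
  move=> dx; rewrite mulrCA -[leLHS]mulr1; apply: ler_wpM2l; first exact: dens_ge0.
  rewrite -(mulVf (lt0r_neq0 c0)) ler_wpM2l//; apply: (Hc x _).1.
  by apply: lt_le_trans dx; rewrite ltr_pdivrMr//; move: d0; lra.
have iu2 : int2 u'.
  apply: (int2_dom (int1_mf iu') mF F0 ci0) => // x; have [xd|xd] := leP (enorm x) d.
    by rewrite /u' /z zeta_in// mul0r expr0n /= mulr_ge0.
  apply: le_trans (densw x (ltW xd)); rewrite /u' exprMn.
  apply: (@le_trans _ _ (1 * u x ^+ 2)); first by rewrite ler_wpM2r ?sqr_ge0.
  by rewrite mul1r /dens lerDr addr_ge0// sqr_ge0.
have i2 w (k k' : R * R -> R) (C : R) : axis w -> 0 <= C -> (forall x, `|'D_w z x| <= C) ->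
    measurable_fun [set: R * R] k' -> (forall x, k' x = z x * k x + 'D_w z x * u x) ->
    (forall x, k x ^+ 2 + u x ^+ 2 <= dens g h u x) -> int2 k'.
  move=> aw C0 HC mk kE kd.
  have CC : 0 <= 2 + 2 * C ^+ 2 by rewrite addr_ge0// mulr_ge0// sqr_ge0.
  apply: (int2_dom mk mF F0 (mulr_ge0 CC ci0)) => // x; rewrite kE.
  have [xd|xd] := ltP (enorm x) d.
    rewrite /z zeta_in ?(ltW xd)// mul0r add0r zeta_D_in// mul0r expr0n /= mulr_ge0//.
    exact: mulr_ge0.
  rewrite -(mulrA (2 + 2 * C ^+ 2)); apply: le_trans (ler_wpM2l CC (densw x xd)).
  apply: le_trans (ler_wpM2l CC (kd x)).
  have HC2 : 'D_w z x ^+ 2 <= C ^+ 2 by rewrite -real_normK ?num_real// ler_sqr ?nnegrE.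
  apply: le_trans (cs2 _ _ _ _) _; apply: ler_wpM2r; first by rewrite addr_ge0// sqr_ge0.
  by have := z01 x; have := sqr_ge0 C; move: (z x ^+ 2) ('D_w z x ^+ 2) (C ^+ 2) HC2 => *; lra.
have ig2 : int2 g'.
  apply: (i2 _ g _ C1 a1) => //; first exact: int1_mf ig'.
  by move=> x; rewrite /dens; have := sqr_ge0 (h x); lra.
have ih2 : int2 h'.
  apply: (i2 _ h _ C2 a2) => //; first exact: int1_mf ih'.
  by move=> x; rewrite /dens; have := sqr_ge0 (g x); lra.
pose e := c * eps / 3; have e0 : 0 < e by rewrite divr_gt0// mulr_gt0.
have [k1 k10 Hk1] := mollify_L2 iu' iu2 e0.
have [k2 k20 Hk2] := mollify_L2 ig' ig2 e0.
have [k3 k30 Hk3] := mollify_L2 ih' ih2 e0.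
pose k := Num.min k1 (Num.min k2 k3).
have k0 : 0 < k by rewrite !lt_min k10 k20.
have [eta me] := mollifier_ex k0; have [te _ _ be] := me.
have kk1 : k <= k1 by rewrite ge_min lexx.
have kk2 : k <= k2 by rewrite !ge_min lexx orbT.
have kk3 : k <= k3 by rewrite !ge_min lexx !orbT.
pose w := convol u' eta.
have bz : bsupp (2 * M) u'.
  move=> x; have [xM|xM] := leP (2 * M) (enorm x); first by rewrite /u' /z zeta_out// mul0r eqxx.
  move=> _; have [h1 h2] := norm_le_enorm x.
  by split; apply: ltW; [apply: le_lt_trans h1 _|apply: le_lt_trans h2 _].
have tw : testT w by exact: testTP (conv_smooth iu' te) (conv_bsupp bz be).
exists w => //.
have mw := measurable_wt adm.
have [m1 m2 m3] : [/\ measurable_fun [set: R * R] w, measurable_fun [set: R * R] ('D_(@e1 R) w)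
   & measurable_fun [set: R * R] ('D_(@e2 R) w)].
  by split; [exact: test_measurable tw|exact: test_measurable (axis_test a1 tw)|exact: test_measurable (axis_test a2 tw)].
have D1 x : 'D_(@e1 R) w x = convol g' eta x by exact: (conv_weak_deriv x a1 iu' ig' wg' te).
have D2 x : 'D_(@e2 R) w x = convol h' eta x by exact: (conv_weak_deriv x a2 iu' ih' wh' te).
have mc f : int1 f -> measurable_fun [set: R * R] (fun x => (convol f eta x - f x) ^+ 2).
  move=> if_; apply: measurable_funX; apply: measurable_funB; last exact: int1_mf if_.
  by apply: continuous_measurable2; exact: conv_continuous.
have n1 := mc _ ig'; have n2 := mc _ ih'; have n3 := mc _ iu'.
have ms := measurable_shell (2 * d) M.
have p1 x : 0 <= (convol g' eta x - g' x) ^+ 2 by exact: sqr_ge0.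
have p2 x : 0 <= (convol h' eta x - h' x) ^+ 2 by exact: sqr_ge0.
have p3 x : 0 <= (convol u' eta x - u' x) ^+ 2 by exact: sqr_ge0.
have : (\int[lb2]_(x in shell (2 * d) M) (c^-1 * ((convol g' eta x - g' x) ^+ 2 +
   (convol h' eta x - h' x) ^+ 2 + (convol u' eta x - u' x) ^+ 2))%:E <= (c^-1 * (3 * e))%:E)%E.
  have I1 := Hk2 _ _ kk2 me; have I2 := Hk3 _ _ kk3 me; have I3 := Hk1 _ _ kk1 me.
  apply: rint_sum3; [exact: ms|exact: n1|exact: n2|exact: n3|exact: p1|exact: p2|exact: p3|exact: ci0|exact: I1|exact: I2|exact: I3].
rewrite (_ : c^-1 * (3 * e) = eps); last by rewrite /e; field; rewrite gt_eqF.
apply: le_trans.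
have mdw := measurable_funM (measurable_dens (measurable_funB mu_ m1) (measurable_funB mg m2) (measurable_funB mh m3)) mw.
have mS := measurable_funM (measurable_cst c^-1) (measurable_funD (measurable_funD n1 n2) n3).
apply: rint_le; [exact: ms|exact: mdw|exact: mS| |].
  by move=> x; rewrite mulr_ge0 ?dens_ge0// (wt_ge0 adm).
move=> x /andP[x1 x2].
have zx : z x = 1 by apply: zeta_mid => //; exact: ltW.
have gE : g' x = g x by rewrite /g' zx zeta_D_mid// mul1r mul0r addr0.
have hE : h' x = h x by rewrite /h' zx zeta_D_mid// mul1r mul0r addr0.
have uE : u' x = u x by rewrite /u' zx mul1r.
have sqC (p q : R) : (p - q) ^+ 2 = (q - p) ^+ 2 by rewrite -sqrrN opprB.
have wb : wt x <= c^-1 by apply: (Hc x _).2; apply: lt_trans x1; rewrite ltr_pdivrMr//; move: d0; lra.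
have E1 : (g x - 'D_(@e1 R) w x) ^+ 2 = (convol g' eta x - g' x) ^+ 2 by rewrite D1 gE sqC.
have E2 : (h x - 'D_(@e2 R) w x) ^+ 2 = (convol h' eta x - h' x) ^+ 2 by rewrite D2 hE sqC.
have E3 : (u x - w x) ^+ 2 = (convol u' eta x - u' x) ^+ 2 by rewrite uE sqC.
have E := f_equal2 +%R (f_equal2 +%R E1 E2) E3.
apply: le_trans (ler_wpM2l (dens_ge0 _ _ _ x) wb) _.
by rewrite mulrC /dens le_eqVlt; apply/orP; left; apply/eqP; exact: (f_equal ( *%R c^-1) E).
Qed.

End approximation.

(** * Traces at the origin *)

Section combination.
Local Open Scope ereal_scope.
Context d (T : measurableType d) (R : realType) (m : {measure set T -> \bar R}).

Lemma rint_comb2 (D : set T) (F A B : T -> R) (a b : R) : measurable D ->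
  measurable_fun [set: T] F -> measurable_fun [set: T] A -> measurable_fun [set: T] B ->
  (forall x, 0 <= F x)%R -> (forall x, 0 <= A x)%R -> (forall x, 0 <= B x)%R ->
  (0 <= a)%R -> (0 <= b)%R -> (forall x, D x -> F x <= a * A x + b * B x)%R ->
  \int[m]_(x in D) (F x)%:E <= a%:E * \int[m]_(x in D) (A x)%:E + b%:E * \int[m]_(x in D) (B x)%:E.
Proof.
move=> mD mF mA mB F0 A0 B0 a0 b0 H.
have maA : measurable_fun [set: T] (fun x => a * A x)%R by exact: measurable_funM.
have mbB : measurable_fun [set: T] (fun x => b * B x)%R by exact: measurable_funM.
rewrite -rintZ// -rintZ// -rintD//; last 2 first.
- by move=> x; rewrite mulr_ge0.
- by move=> x; rewrite mulr_ge0.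
by apply: rint_le => //; exact: measurable_funD.
Qed.

End combination.

Section trace.
Context (R : realType).
Implicit Types (x y : R * R) (u v f g h : R * R -> R) (s e k : R).
Local Notation mu := (@lebesgue_measure R).
Local Notation lb2 := (@leb2 R).
Local Notation testT := (test_function [set: R * R]).
Variables (al : R -> R) (K : R).
Hypothesis adm : admissible al K.
Local Notation wt := (wt al).
Local Notation ka := (ka al).
Local Notation Af := (Af al).

Local Open Scope ereal_scope.

Let mw := measurable_wt adm.
Let w0 := wt_ge0 adm.

(** k is the trace of u at the origin along the sector s. The rate e^2 is meaningful
    since the mass of the weight near the origin is of larger order, see [lim_unique].
    *)
Definition lim_at s u k := exists2 C : R, (0 <= C)%R &
  forall e, (0 < e < 1)%R -> \int[lb2]_(x in ann s 0 e) ((u x - k) ^+ 2 * wt x)%:E <= (C * e ^+ 2)%:E.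

Definition mka (p q : R) : R := fine (\int[mu]_(r in `]p, q[) (ka r)%:E).

Lemma mkaE (p q : R) : (0 <= p)%R -> (q <= 1)%R -> \int[mu]_(r in `]p, q[) (ka r)%:E = (mka p q)%:E.
Proof.
move=> p0 q1; rewrite fineK// ge0_fin_numE; last by apply: rint_ge0; exact: (ka_ge0 adm).
have [L L0 LE] := ka_int adm; apply: (@le_lt_trans _ _ (L%:E)); last exact: ltry.
rewrite -LE; apply: rint_sub; [exact: measurable_itv|exact: measurable_itv|exact: (measurable_ka adm)|exact: (ka_ge0 adm)|].
move=> r; rewrite /= !in_itv /= => /andP[pr rq]; rewrite (le_lt_trans p0 pr) /=.
exact: lt_le_trans q1.
Qed.

Lemma mka_ge0 (p q : R) : (0 <= mka p q)%R.
Proof. by apply: fine_ge0; apply: rint_ge0; exact: (ka_ge0 adm). Qed.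

Lemma wt_ann s (p q : R) : (s ^+ 2 = 1)%R -> (0 <= p)%R -> (q <= 1)%R ->
  \int[lb2]_(x in ann s p q) (wt x)%:E = (kap R * mka p q)%:E.
Proof.
move=> s1 p0 q1.
have -> : \int[lb2]_(x in ann s p q) (wt x)%:E = \int[lb2]_(x in ann s p q) (1 * wt x)%:E.
  by apply: eq_integral => x _; rewrite mul1r.
rewrite (polar_annw adm _ s1 p0 (f := cst 1%R))//.
have -> : \int[mu]_(t in `[0%R, +oo[) (((1 + t ^+ 2)^-1)%:E *
    \int[mu]_(r in `]p, q[) (1 * ka r)%:E) = \int[mu]_(t in `[0%R, +oo[) (mka p q * (1 + t ^+ 2)^-1)%:E.
  apply: eq_integral => t _; rewrite mulrC EFinM -(mkaE p0 q1); congr (_ * _).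
  by apply: eq_integral => r _; rewrite mul1r.
have := @rintZ _ _ R mu `[0%R, +oo[%classic (fun t : R => (1 + t ^+ 2)^-1)%R (mka p q) (measurable_itv _)
  (@measurable_oneD R) (@oneD_ge0 R) (mka_ge0 _ _).
by rewrite int_kap -EFinM mulrC => <-.
Qed.

(** Cauchy-Schwarz for 1 = sqrt [ja] sqrt [ka]. *)
Lemma mka_lower (p q : R) : (0 <= p < q)%R -> (q <= 1)%R ->
  ((q - p) ^+ 2 <= fine (Af q) * mka p q)%R.
Proof.
move=> /andP[p0 pq] q1.
have mI (i : interval R) : measurable [set` i] by exact: measurable_itv.
have msq : measurable_fun [set: R] (@Num.sqrt R).
  by apply: continuous_measurable_fun; exact: sqrt_continuous.
have HA : \int[mu]_(r in `]p, q[) (Num.sqrt (ja al r) ^+ 2)%:E <= (fine (Af q))%:E.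
  under eq_integral do rewrite sqr_sqrtr ?(ja_ge0 adm)//.
  rewrite (Af_fineK adm q1); apply: rint_sub => //; [exact: (measurable_ja adm)|exact: (ja_ge0 adm)|].
  by move=> r; rewrite /= !in_itv /= => /andP[pr ->]; rewrite (le_lt_trans p0 pr).
have HB : \int[mu]_(r in `]p, q[) (Num.sqrt (ka r) ^+ 2)%:E <= (mka p q)%:E.
  under eq_integral do rewrite sqr_sqrtr ?(ka_ge0 adm)//.
  by rewrite mkaE.
have [c cE [c0 cAB]] : exists2 c : R, \int[mu]_(r in `]p, q[) (Num.sqrt (ja al r) * Num.sqrt (ka r))%:E = c%:E &
    (0 <= c /\ c ^+ 2 <= fine (Af q) * mka p q)%R.
  apply: cauchy_schwarz => //; apply: measurable_funTS.
    exact: (measurableT_comp msq (measurable_ja adm)).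
  exact: (measurableT_comp msq (measurable_ka adm)).
suff -> : (q - p = c)%R by [].
apply: EFin_inj; rewrite -cE.
transitivity (\int[mu]_(r in `]p, q[) (cst 1%E r : \bar R)).
  rewrite integral_cst// mul1e; have := @lebesgue_measure_itv R `]p, q[.
  by rewrite /= lte_fin pq -EFinB.
apply: eq_integral => r; rewrite inE /= in_itv /= => /andP[pr rq].
have r0 : (0 < r)%R by exact: le_lt_trans pr.
rewrite -sqrtrM ?(ja_ge0 adm)// /ja /ka gtr0_norm//.
have := al_gt0 adm r; move: (al r) => a a0.
by rewrite (_ : _ * _ = 1)%R ?sqrtr1//; field; rewrite !gt_eqF.
Qed.

Lemma mka_gt0 (p q : R) : (0 <= p < q)%R -> (q <= 1)%R -> (0 < mka p q)%R.
Proof.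
move=> pq q1; have H := mka_lower pq q1; case/andP: pq => p0 pq.
have : (0 < (q - p) ^+ 2)%R by rewrite exprn_gt0// subr_gt0.
move=> /lt_le_trans/(_ H) H'; rewrite lt_neqAle mka_ge0 andbT; apply/eqP => E.
by move: H'; rewrite -E mulr0 ltxx.
Qed.

Lemma Af_small (eps : R) : (0 < eps)%R -> exists2 e, (0 < e < 1)%R & (fine (Af e) <= eps)%R.
Proof.
move=> eps0.
have mI (i : interval R) : measurable [set` i] by exact: measurable_itv.
have mj := measurable_ja adm; have j0 := ja_ge0 adm.
pose f r := (ja al r * \1_(`]0%R, 1%R[) r)%R.
have mf : measurable_fun [set: R] f by apply: measurable_funM => //; exact: measurable_indic.
have f0 r : (0 <= f r)%R by rewrite mulr_ge0.
have fin : \int[mu]_r (f r)%:E < +oo.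
  apply: le_lt_trans (Af_fin adm (lexx 1%R)); rewrite /Af [leRHS]integral_mkcond.
  rewrite le_eqVlt; apply/orP; left; apply/eqP; apply: eq_integral => r _.
  by rewrite patchE /f indicE; case: ifP => _; rewrite ?mulr1 ?mulr0.
have [N HN] : exists N : nat, forall n, (N <= n)%N ->
    \int[mu]_(r in `]0%R, (n.+2%:R^-1)%R[) (f r)%:E <= eps%:E.
  apply: int_shrink => //; apply: aeW => r; have [r0|r0] := leP r 0%R.
    by exists 0%N => n _; rewrite /= in_itv /= ltNge r0.
  exists (Num.truncn r^-1).+1 => n Nn; rewrite /= in_itv /= r0 /= => H.
  have : (r^-1 < n.+2%:R)%R.
    by apply: lt_le_trans (truncnS_gt _) _; rewrite ler_nat; apply: leq_trans Nn _; rewrite -addn2 leq_addr.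
  by rewrite -ltf_pV2 ?posrE ?invr_gt0// invrK => /(lt_trans H); rewrite ltxx.
exists (N.+2%:R^-1)%R; first by rewrite invr_gt0 ltr0n invf_lt1 ?ltr0n// ltr1n.
have e1 : (N.+2%:R^-1 <= 1 :> R)%R by rewrite invf_le1 ?ltr0n// ler1n.
rewrite -lee_fin (Af_fineK adm e1); apply: le_trans (HN N (leqnn N)).
rewrite le_eqVlt; apply/orP; left; apply/eqP; apply: eq_integral => r; rewrite inE /= in_itv /= => /andP[r0 re].
by rewrite /f indicE mem_set ?mulr1//= in_itv /= r0; exact: lt_le_trans e1.
Qed.

Lemma measurable_sqdev u k : measurable_fun [set: R * R] u ->
  measurable_fun [set: R * R] (fun x => (u x - k) ^+ 2 * wt x)%R.
Proof. by move=> mu_; apply: measurable_funM => //; apply: measurable_funX; exact: measurable_funB. Qed.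

Lemma sqdev_ge0 u k x : (0 <= (u x - k) ^+ 2 * wt x)%R.
Proof. by rewrite mulr_ge0 ?sqr_ge0. Qed.

Lemma sqr_split (a b : R) : ((a + b) ^+ 2 <= 2 * a ^+ 2 + 2 * b ^+ 2)%R.
Proof. by rewrite -subr_ge0 (_ : _ - _ = (a - b) ^+ 2)%R ?sqr_ge0//; ring. Qed.

Lemma sqr_split3 (a b p q : R) : (0 <= a)%R -> (0 <= b)%R ->
  ((p + q) ^+ 2 <= 2 * (a + b + p ^+ 2) + 2 * q ^+ 2)%R.
Proof. by move=> a0 b0; apply: le_trans (sqr_split p q) _; rewrite lerD2r ler_wpM2l// lerDr addr_ge0. Qed.

Lemma grad_split (p q a b c : R) : (0 <= c)%R ->
  (p ^+ 2 + q ^+ 2 <= 2 * (a ^+ 2 + b ^+ 2) + 2 * ((a - p) ^+ 2 + (b - q) ^+ 2 + c))%R.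
Proof.
move=> c0; rewrite -subr_ge0 (_ : _ - _ = (2 * a - p) ^+ 2 + (2 * b - q) ^+ 2 + 2 * c)%R; last by ring.
by rewrite !addr_ge0 ?sqr_ge0// mulr_ge0.
Qed.

(** Two traces k, l satisfy (k - l)^2 m(e) <= C e^2, where m(e) is the mass of the
    sector of radius e. By [mka_lower], e^2 / m(e) is at most a multiple of [Af e],
    which tends to 0. *)
Lemma lim_unique s u k l : (s ^+ 2 = 1)%R -> measurable_fun [set: R * R] u ->
  lim_at s u k -> lim_at s u l -> k = l.
Proof.
move=> s1 mu_ [C C0 HC] [D D0 HD].
have kap0 := kap_gt0 R.
have key e : (0 < e < 1)%R -> ((k - l) ^+ 2 * kap R <= 2 * (C + D) * fine (Af e))%R.
  move=> e01; have := e01 => /andP[e0 e1].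
  have e1' := ltW e1.
  have m0 : (0 < mka 0 e)%R by apply: mka_gt0; rewrite ?lexx.
  have ma := measurable_ann s 0 e.
  have H : \int[lb2]_(x in ann s 0 e) ((k - l) ^+ 2 * wt x)%:E <= (2 * (C + D) * e ^+ 2)%:E.
    apply: (@le_trans _ _ (2%:E * (C * e ^+ 2)%:E + 2%:E * (D * e ^+ 2)%:E)); last first.
      by rewrite -!EFinM -EFinD lee_fin le_eqVlt; apply/orP; left; apply/eqP; ring.
    apply: le_trans (leeD (lee_wpmul2l _ (HC _ e01)) (lee_wpmul2l _ (HD _ e01))); rewrite ?lee_fin//.
    apply: rint_comb2 => //.
    - exact: measurable_funM.
    - exact: measurable_sqdev.
    - exact: measurable_sqdev.
    - by move=> x; rewrite mulr_ge0 ?sqr_ge0.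
    - by move=> x; exact: sqdev_ge0.
    - by move=> x; exact: sqdev_ge0.
    - move=> x _; rewrite !mulrA -mulrDl; apply: ler_wpM2r => //.
      rewrite (_ : k - l = - (u x - k) + (u x - l))%R; last by ring.
      by apply: le_trans (sqr_split _ _) _; rewrite sqrrN !expr2 !mulrA.
  rewrite rintZ// in H; last exact: sqr_ge0.
  rewrite wt_ann// -EFinM lee_fin in H.
  rewrite -(ler_pM2r m0) -(mulrA _ (kap R)); apply: le_trans H _.
  rewrite -(mulrA (2 * (C + D))%R); apply: ler_wpM2l; first by rewrite mulr_ge0 ?addr_ge0.
  by have := @mka_lower 0%R e; rewrite subr0; apply; rewrite ?lexx.
apply/eqP; rewrite -subr_eq0 -sqrf_eq0; apply/eqP/le_anti; rewrite sqr_ge0 andbT.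
suff H : ((k - l) ^+ 2 * kap R <= 0)%R by rewrite pmulr_lle0 in H.
apply/ler_addgt0Pr => eps eps0; rewrite add0r.
have Q0 : (0 < 2 * (C + D) + 1)%R by rewrite ltr_wpDl// mulr_ge0// addr_ge0.
have [e e01 He] := Af_small (divr_gt0 eps0 Q0).
apply: le_trans (key e e01) _.
have A0 : (0 <= fine (Af e))%R by apply: fine_ge0; exact: (Af_ge0 adm).
rewrite ler_pdivlMr// in He; apply: le_trans He; rewrite mulrC ler_wpM2l//; lra.
Qed.

Lemma lim_comb s u v k l (c : R) : measurable_fun [set: R * R] u -> measurable_fun [set: R * R] v ->
  lim_at s u k -> lim_at s v l -> lim_at s (c *: u + v)%R (c * k + l)%R.
Proof.
move=> mu_ mv [C C0 HC] [D D0 HD].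
have c2 : (0 <= 2 * c ^+ 2)%R by rewrite mulr_ge0// sqr_ge0.
exists (2 * c ^+ 2 * C + 2 * D)%R; first by apply: addr_ge0; apply: mulr_ge0.
move=> e e01; have ma := measurable_ann s 0 e.
apply: (@le_trans _ _ ((2 * c ^+ 2)%:E * (C * e ^+ 2)%:E + 2%:E * (D * e ^+ 2)%:E)); last first.
  by rewrite -!EFinM -EFinD lee_fin le_eqVlt; apply/orP; left; apply/eqP; ring.
apply: le_trans (leeD (lee_wpmul2l _ (HC _ e01)) (lee_wpmul2l _ (HD _ e01))); rewrite ?lee_fin//.
apply: rint_comb2 => //.
- apply: measurable_sqdev; apply: measurable_funD => //; exact: measurable_funM.
- exact: measurable_sqdev.
- exact: measurable_sqdev.
- by move=> x; exact: sqdev_ge0.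
- by move=> x; exact: sqdev_ge0.
- by move=> x; exact: sqdev_ge0.
- move=> x _.
  have H : (((c *: u + v)%R x - (c * k + l)) ^+ 2 <= 2 * c ^+ 2 * (u x - k) ^+ 2 + 2 * (v x - l) ^+ 2)%R.
    have -> : ((c *: u + v)%R x - (c * k + l) = c * (u x - k) + (v x - l))%R.
      by change (c * u x + v x - (c * k + l) = c * (u x - k) + (v x - l))%R; ring.
    apply: le_trans (sqr_split _ _) _; rewrite exprMn le_eqVlt; apply/orP; left; apply/eqP; ring.
  apply: le_trans (ler_wpM2r (w0 x) H) _.
  by rewrite mulrDl -(mulrA (2 * c ^+ 2)%R) -(mulrA 2%R ((v x - l) ^+ 2)%R).
Qed.

(** |f x - f 0| <= C |x|. *)
Lemma lim_test s f : (s ^+ 2 = 1)%R -> testT f -> lim_at s f (f 0%R).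
Proof.
move=> s1 tf; have [C C0 HC] := test_lip tf.
exists (4 * C ^+ 2 * (kap R * mka 0 1))%R.
  by apply: mulr_ge0; apply: mulr_ge0 => //; [exact: sqr_ge0|exact/ltW/kap_gt0|exact: mka_ge0].
move=> e /andP[e0 e1].
have ma := measurable_ann s 0 e.
have c0 : (0 <= 4 * C ^+ 2 * e ^+ 2)%R.
  by apply: mulr_ge0; [apply: mulr_ge0 => //|]; exact: sqr_ge0.
apply: (@le_trans _ _ (\int[lb2]_(x in ann s 0 e) (4 * C ^+ 2 * e ^+ 2 * wt x)%:E)).
  apply: rint_le => //.
  - by apply: measurable_sqdev; exact: test_measurable tf.
  - exact: measurable_funM.
  - by move=> x; exact: sqdev_ge0.
  - move=> x [_ /andP[x0 xe]]; apply: ler_wpM2r => //.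
    have := HC 0%R x; rewrite addr0 => H.
    have [n1 n2] := norm_le_enorm x.
    have H2 : (`|f x - f 0%R| <= 2 * C * e)%R.
      apply: le_trans H _; rewrite (_ : 2 * C * e = C * (2 * e))%R; last by ring.
      by apply: ler_wpM2l => //; move: n1 n2 xe; move: `|x.1|%R `|x.2|%R (enorm x) => *; lra.
    rewrite -real_normK ?num_real// (_ : 4 * C ^+ 2 * e ^+ 2 = (2 * C * e) ^+ 2)%R; last by ring.
    by rewrite ler_sqr ?nnegrE// !mulr_ge0// ltW.
rewrite rintZ//; apply: (@le_trans _ _ ((4 * C ^+ 2 * e ^+ 2)%:E * (kap R * mka 0 1)%:E)).
  apply: lee_wpmul2l; first by rewrite lee_fin.
  rewrite -(wt_ann s1 (lexx 0%R) (lexx 1%R)); apply: rint_sub => //; first exact: measurable_ann.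
  by move=> x [sx /andP[x0 xe]]; split => //; rewrite x0 /= (lt_trans xe).
by rewrite -EFinM lee_fin le_eqVlt; apply/orP; left; apply/eqP; ring.
Qed.

Definition gdens g h x : R := (g x ^+ 2 + h x ^+ 2)%R.

Lemma gdens_ge0 g h x : (0 <= gdens g h x)%R.
Proof. by rewrite addr_ge0// sqr_ge0. Qed.

Lemma measurable_gdensw g h : measurable_fun [set: R * R] g -> measurable_fun [set: R * R] h ->
  measurable_fun [set: R * R] (fun x => gdens g h x * wt x)%R.
Proof.
move=> mg mh; apply: measurable_funM => //; rewrite (_ : gdens g h = (fun x => g x ^+ 2 + h x ^+ 2)%R)//.
by apply: measurable_funD; exact: measurable_funX.
Qed.

(** The Hardy condition bounds a nonnegative integral by K / 4. *)
Lemma K_ge0 : (0 <= K)%R.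
Proof.
have h : (0 < (2^-1 : R) < 1)%R by rewrite invr_gt0 ltr0n invf_lt1 ?ltr1n.
have := hardy_ka adm h; move/(le_trans (y := \int[mu]_(r in `]0%R, 2^-1%R[) ((ka r)%:E * Af r)))=> H.
have : 0 <= (K * 2^-1 ^+ 2)%:E.
  apply: H; apply: integral_ge0 => r _; rewrite mule_ge0 ?(Af_ge0 adm)// lee_fin; exact: (ka_ge0 adm).
by rewrite lee_fin pmulr_lge0// exprn_gt0// invr_gt0.
Qed.

Section hardy_weak.
Variables (s : R) (u g h : R * R -> R).
Hypotheses (s1 : (s ^+ 2 = 1)%R) (G : grad_of u g h) (fin : energy al setT g h u < +oo).

Let mu_ : measurable_fun [set: R * R] u. Proof. by have [] := grad_meas G. Qed.
Let mg : measurable_fun [set: R * R] g. Proof. by have [] := grad_meas G. Qed.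
Let mh : measurable_fun [set: R * R] h. Proof. by have [] := grad_meas G. Qed.
Let Er := fine (energy al setT g h u).

Let ErE : energy al setT g h u = Er%:E.
Proof.
by rewrite fineK// ge0_fin_numE//; apply: rint_ge0 => x; rewrite mulr_ge0 ?dens_ge0.
Qed.

Let Er0 : (0 <= Er)%R.
Proof. by apply: fine_ge0; apply: rint_ge0 => x; rewrite mulr_ge0 ?dens_ge0. Qed.

Let mgd := measurable_gdensw mg mh.
Let gd0 x : (0 <= gdens g h x * wt x)%R.
Proof. by rewrite mulr_ge0 ?gdens_ge0. Qed.

Definition sE e : \bar R := \int[lb2]_(x in ann s 0 e) (gdens g h x * wt x)%:E.

Lemma sE_le e : sE e <= Er%:E.
Proof.
rewrite -ErE; apply: (@le_trans _ _ (\int[lb2]_x (gdens g h x * wt x)%:E)).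
  by apply: rint_sub => //; exact: measurable_ann.
apply: rint_le => //; first by apply: measurable_funM => //; exact: measurable_dens.
by move=> x _; apply: ler_wpM2r => //; rewrite /dens /gdens lerDl sqr_ge0.
Qed.

Lemma sE_ge0 e : 0 <= sE e. Proof. exact: rint_ge0. Qed.

Lemma sEE e : sE e = (fine (sE e))%:E.
Proof.
by rewrite fineK// ge0_fin_numE ?sE_ge0//; apply: le_lt_trans (sE_le e) _; rewrite ltry.
Qed.

(** [hardy_smooth] for a smooth approximation of u outside a disc. The good arc is
    sought below the radius 1/(n + 2), and [kb_large] tells how far inwards one has to
    go for the choice of the arc to cost only O(1/n). *)
Lemma hardy_stage : exists2 C : R, (0 <= C)%R & forall n : nat, exists k : R,
  forall e, (n.+2%:R^-1 < e < 1)%R ->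
    \int[lb2]_(x in ann s n.+2%:R^-1 e) ((u x - k) ^+ 2 * wt x)%:E <=
      (8 * K * e ^+ 2 * fine (sE e) + C / n.+1%:R)%:E.
Proof.
have [L L0 LE] := ka_int adm.
pose E := (2 * Er + 2)%R; have E0 : (0 <= E)%R by rewrite addr_ge0// mulr_ge0.
have kap0 := kap_gt0 R; have K0 := K_ge0.
pose C0 := (2 * kap R ^+ 2 * (E + 1) * L)%R.
have C00 : (0 <= C0)%R by rewrite /C0 mulr_ge0// mulr_ge0 ?addr_ge0// mulr_ge0// sqr_ge0.
exists (2 + 8 * K + 2 * C0)%R; first by rewrite !addr_ge0// mulr_ge0.
move=> n; set d' := (n.+2%:R^-1)%R; set eta := (n.+1%:R^-1)%R.
have d'0 : (0 < d')%R by rewrite invr_gt0 ltr0n.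
have d'1 : (d' < 1)%R by rewrite invf_lt1 ?ltr0n// ltr1n.
have eta0 : (0 < eta)%R by rewrite invr_gt0 ltr0n.
have eta1 : (eta <= 1)%R by rewrite invf_le1 ?ltr0n// ler1n.
have B0 : (0 < n.+1%:R :> R)%R by rewrite ltr0n.
have d'01 : (0 < d' <= 1)%R by rewrite d'0 ltW.
have [d /andP[d0 dd'] HB] := kb_large adm n.+1%:R d'01.
have d20 : (0 < d / 2)%R by rewrite divr_gt0.
have d2d : (2 * (d / 2) = d)%R by field.
have d21 : (2 * (d / 2) < 1)%R by rewrite d2d (lt_trans dd').
have [w tw Hw] := approx_test adm G fin d20 d21 eta0; rewrite d2d in Hw.
have sw := test_smooth tw.
have [t1 t2] := (test_D1 tw, test_D2 tw).
have m1 := test_measurable tw; have m2 := test_measurable t1; have m3 := test_measurable t2.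
set g' := fun x => (g x - 'D_(@e1 R) w x)%R in Hw; set h' := fun x => (h x - 'D_(@e2 R) w x)%R in Hw.
set u' := fun x => (u x - w x)%R in Hw.
have mg' : measurable_fun [set: R * R] g' by exact: (measurable_funB mg m2).
have mh' : measurable_fun [set: R * R] h' by exact: (measurable_funB mh m3).
have mu' : measurable_fun [set: R * R] u' by exact: (measurable_funB mu_ m1).
have mdw : measurable_fun [set: R * R] (fun x => dens g' h' u' x * wt x)%R.
  by apply: measurable_funM => //; exact: measurable_dens.
have dw0 x : (0 <= dens g' h' u' x * wt x)%R by rewrite mulr_ge0 ?dens_ge0.
have msh := measurable_shell (R := R) d 1.
have ann_shell p e : (d <= p)%R -> (e <= 1)%R -> ann s p e `<=` @shell R d 1.
  move=> dp e1 x [_ /andP[px xe]]; rewrite /shell /= (le_lt_trans dp px) /=.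
  exact: lt_le_trans e1.
have Hann p e : (d <= p)%R -> (e <= 1)%R -> \int[lb2]_(x in ann s p e) (dens g' h' u' x * wt x)%:E <= eta%:E.
  move=> dp e1; apply: le_trans Hw; apply: rint_sub => //; first exact: measurable_ann.
  exact: ann_shell.
have gE x : (gsq w x <= 2 * gdens g h x + 2 * dens g' h' u' x)%R.
  exact: grad_split (sqr_ge0 (u' x)).
have mgs := measurable_gsq sw.
have Egs e : (0 < e <= 1)%R ->
    \int[lb2]_(x in ann s d e) (gsq w x * wt x)%:E <= (2 * fine (sE e) + 2 * eta)%:E.
  move=> /andP[e0 e1].
  apply: (@le_trans _ _ (2%:E * \int[lb2]_(x in ann s d e) (gdens g h x * wt x)%:E +
     2%:E * \int[lb2]_(x in ann s d e) (dens g' h' u' x * wt x)%:E)).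
    apply: rint_comb2 => //; first exact: measurable_ann.
    - exact: measurable_funM.
    - by move=> x; rewrite mulr_ge0 ?gsq_ge0.
    - move=> x _; apply: le_trans (ler_wpM2r (w0 x) (gE x)) _.
      by rewrite mulrDl -(mulrA 2%R (gdens g h x)) -(mulrA 2%R (dens g' h' u' x)).
  rewrite [leRHS]EFinD; apply: leeD; rewrite [leRHS]EFinM; apply: lee_wpmul2l => //; last exact: Hann.
  rewrite -sEE; apply: rint_sub => //; [exact: measurable_ann|exact: measurable_ann|].
  by move=> x [sx /andP[dx xe]]; split => //; rewrite xe andbT (lt_trans d0).
have HE : \int[lb2]_(x in ann s d 1) (gsq w x * wt x)%:E <= E%:E.
  apply: le_trans (Egs 1%R _) _; first by rewrite ltr01 lexx.
  rewrite lee_fin /E lerD//; last by move: eta1; lra.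
  by rewrite ler_wpM2l// -lee_fin -sEE; exact: sE_le.
have [C1 C10 H1] := test_bounded t1; have [C2 C20 H2] := test_bounded t2.
have bC x : (gsq w x <= C1 ^+ 2 + C2 ^+ 2)%R.
  by rewrite /gsq lerD// -real_normK ?num_real// ler_sqr ?nnegrE.
have dd'1 : (d < d' < 1)%R by rewrite dd'.
have [k Hk] := hardy_smooth adm s1 sw d0 dd'1 B0 E0 bC LE HB HE.
exists k => e e01; have /andP[d'e e1] := e01; have e0 : (0 < e)%R by exact: lt_trans d'e.
have Hk' := Hk e e01.
apply: (@le_trans _ _ (2%:E * \int[lb2]_(x in ann s d' e) (dens g' h' u' x * wt x)%:E +
   2%:E * \int[lb2]_(x in ann s d' e) ((w x - k) ^+ 2 * wt x)%:E)).
  apply: rint_comb2 => //.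
  - exact: measurable_ann.
  - exact: measurable_sqdev.
  - exact: measurable_sqdev.
  - by move=> x; exact: sqdev_ge0.
  - by move=> x; exact: sqdev_ge0.
  - move=> x _.
    have H : ((u x - k) ^+ 2 <= 2 * dens g' h' u' x + 2 * (w x - k) ^+ 2)%R.
      have := sqr_split3 (u' x) (w x - k)%R (sqr_ge0 (g' x)) (sqr_ge0 (h' x)).
      by rewrite {1}/u' addrA subrK.
    apply: le_trans (ler_wpM2r (w0 x) H) _.
    by rewrite mulrDl -(mulrA 2%R (dens g' h' u' x)) -(mulrA 2%R ((w x - k) ^+ 2)%R).
have F0 : (0 <= fine (sE e))%R by apply: fine_ge0; exact: sE_ge0.
have Ke0 : (0 <= 2 * K * e ^+ 2)%R by rewrite mulr_ge0 ?sqr_ge0// mulr_ge0.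
apply: (@le_trans _ _ (2%:E * eta%:E + 2%:E * ((2 * K * e ^+ 2)%:E * (2 * fine (sE e) + 2 * eta)%:E +
   (2 * kap R ^+ 2 * ((E + 1) / n.+1%:R) * L)%:E))).
  apply: leeD; apply: lee_wpmul2l => //; first by apply: Hann; exact: ltW.
  apply: le_trans Hk' _; apply: leeD2r; apply: lee_wpmul2l; first by rewrite lee_fin.
  by apply: Egs; rewrite e0 ltW.
change ((2 * eta + 2 * (2 * K * e ^+ 2 * (2 * fine (sE e) + 2 * eta) +
   2 * kap R ^+ 2 * ((E + 1) / n.+1%:R) * L))%:E <=
  (8 * K * e ^+ 2 * fine (sE e) + (2 + 8 * K + 2 * C0) * eta)%:E).
rewrite lee_fin.
have ee1 : (e ^+ 2 <= 1)%R by rewrite expr_le1 ?ltW.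
have Kee : (K * e ^+ 2 * eta <= K * eta)%R.
  apply: ler_wpM2r; first exact: ltW.
  by rewrite -[leRHS]mulr1; exact: ler_wpM2l.
rewrite (_ : 2 * kap R ^+ 2 * ((E + 1) / n.+1%:R) * L = C0 * eta)%R; last by rewrite /C0 /eta; ring.
rewrite -/eta.
have -> : (2 * eta + 2 * (2 * K * e ^+ 2 * (2 * fine (sE e) + 2 * eta) + C0 * eta) =
  8 * K * e ^+ 2 * fine (sE e) + (2 * eta + 8 * (K * e ^+ 2 * eta) + 2 * (C0 * eta)))%R by ring.
rewrite lerD2l (_ : (2 + 8 * K + 2 * C0) * eta = 2 * eta + 8 * (K * eta) + 2 * (C0 * eta))%R; last by ring.
by rewrite lerD2r lerD2l ler_wpM2l.
Qed.

Lemma large_index (p C : R) : (0 < p)%R -> exists N : nat, forall n, (N <= n)%N -> (C / n.+1%:R <= p)%R.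
Proof.
move=> p0; exists (Num.truncn (`|C| / p)).+1 => n Nn.
rewrite ler_pdivrMr ?ltr0n// mulrC -ler_pdivrMr//; apply: (@le_trans _ _ (`|C| / p)%R).
  by apply: ler_wpM2r; [rewrite invr_ge0 ltW|exact: ler_norm].
by apply: (le_trans (ltW (truncnS_gt _))); rewrite ler_nat; apply: leq_trans Nn (leqnSn _).
Qed.

(** Bolzano-Weierstrass. *)
Lemma cluster_point (kk : nat -> R) (M : R) : (forall n, `|kk n| <= M)%R ->
  exists k, forall eps : R, (0 < eps)%R -> forall N, exists2 n, (N <= n)%N & (`|kk n - k| < eps)%R.
Proof.
move=> HM; have cS := @segment_compact R (- M)%R M.
have FM : (kk @ \oo) (`[(- M)%R, M]%classic : set R).
  by exists 0%N => // n _ /=; rewrite in_itv /= -ler_norml.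
have [k [_ ck]] := cS (kk @ \oo) _ FM.
exists k => eps eps0 N.
have F1 : (kk @ \oo) (kk @` [set n | (N <= n)%N]) by exists N => // n /= Nn; exists n.
have [_ [[n /= Nn <-] B]] := ck _ _ F1 (nbhsx_ballx k _ eps0).
by exists n => //; rewrite distrC.
Qed.

(** The constants of [hardy_stage] are bounded, because on the fixed annulus 1/2 < |x| <
    3/4 the mass of the weight is positive and both u and u - k are controlled there.
    Any cluster point k works. *)
Lemma hardy_weak : exists k, forall e, (0 < e < 1)%R ->
  \int[lb2]_(x in ann s 0 e) ((u x - k) ^+ 2 * wt x)%:E <= (16 * K * e ^+ 2 * fine (sE e))%:E.
Proof.
have [C C0 HC] := hardy_stage.
have [kk Hkk] := choice HC.
have K0 := K_ge0; have kap0 := kap_gt0 R.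
have F0 e : (0 <= fine (sE e))%R by apply: fine_ge0; exact: sE_ge0.
have mD k := measurable_sqdev k mu_.
pose e0 : R := (3 / 4)%R; pose p0 : R := (2^-1)%R.
have p00 : (0 <= p0)%R by rewrite invr_ge0.
have pe : (0 <= p0 < e0)%R by rewrite p00 /= /p0 /e0; lra.
have e01 : (e0 < 1)%R by rewrite /e0; lra.
pose m0 := (kap R * mka p0 e0)%R.
have m00 : (0 < m0)%R by rewrite mulr_gt0// mka_gt0// ltW.
pose C2 := (8 * K * e0 ^+ 2 * fine (sE e0) + C)%R.
have ma := measurable_ann s p0 e0.
have mu2 : measurable_fun [set: R * R] (fun x => u x ^+ 2 * wt x)%R.
  by apply: measurable_funM => //; exact: measurable_funX.
have u20 (x : R * R) : (0 <= u x ^+ 2 * wt x)%R by rewrite mulr_ge0 ?sqr_ge0.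
have mdu : measurable_fun [set: R * R] (fun x => dens g h u x * wt x)%R.
  by apply: measurable_funM => //; exact: measurable_dens.
have bd n : (kk n ^+ 2 * m0 <= 2 * Er + 2 * C2)%R.
  have p1 : (n.+2%:R^-1 <= p0)%R by rewrite lef_pV2 ?posrE ?ltr0n// ler_nat.
  have H1 := Hkk n e0; rewrite (le_lt_trans p1) ?e01//= in H1; last by case/andP: pe.
  have {}H1 := H1 isT.
  rewrite -lee_fin EFinM -(wt_ann s1 p00 (ltW e01)) -rintZ ?sqr_ge0//.
  apply: (@le_trans _ _ (2%:E * \int[lb2]_(x in ann s p0 e0) (u x ^+ 2 * wt x)%:E +
     2%:E * \int[lb2]_(x in ann s p0 e0) ((u x - kk n) ^+ 2 * wt x)%:E)).
    have z1 (x : R * R) : (0 <= kk n ^+ 2 * wt x)%R by rewrite mulr_ge0 ?sqr_ge0.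
    have z2 (x : R * R) : (0 <= (u x - kk n) ^+ 2 * wt x)%R by exact: sqdev_ge0.
    have z3 : measurable_fun [set: R * R] (fun x => kk n ^+ 2 * wt x)%R by exact: measurable_funM.
    apply: rint_comb2; [exact: ma|exact: z3|exact: mu2|exact: mD|exact: z1|exact: u20|exact: z2| | |]; [by []|by []|].
      move=> x _.
      have H : (kk n ^+ 2 <= 2 * u x ^+ 2 + 2 * (u x - kk n) ^+ 2)%R.
        have := sqr_split (u x) (- (u x - kk n)); rewrite sqrrN.
        by rewrite (_ : u x + - (u x - kk n) = kk n)%R//; ring.
      apply: le_trans (ler_wpM2r (w0 x) H) _.
      by rewrite mulrDl -(mulrA 2%R (u x ^+ 2)%R) -(mulrA 2%R ((u x - kk n) ^+ 2)%R).
  rewrite [leRHS]EFinD; apply: leeD; rewrite [leRHS]EFinM; apply: lee_wpmul2l => //.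
    rewrite -ErE; apply: (@le_trans _ _ (\int[lb2]_x (u x ^+ 2 * wt x)%:E)).
      by apply: rint_sub; [exact: ma|exact: measurableT|exact: mu2|exact: u20|].
    apply: rint_le; [exact: measurableT|exact: mu2|exact: mdu|exact: u20|].
    by move=> x _; apply: ler_wpM2r => //; rewrite /dens lerDr addr_ge0 ?sqr_ge0.
  apply: (@le_trans _ _ (\int[lb2]_(x in ann s n.+2%:R^-1 e0) ((u x - kk n) ^+ 2 * wt x)%:E)).
    apply: rint_sub; [exact: ma|exact: measurable_ann|exact: mD|by move=> x; exact: sqdev_ge0|].
    by move=> x [sx /andP[px xe]]; split => //; rewrite xe andbT (le_lt_trans p1).
  apply: le_trans H1 _; rewrite lee_fin /C2 lerD2l ler_pdivrMr ?ltr0n//.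
  by rewrite ler_peMr// ler1n.
have bd2 n : (`|kk n| <= (2 * Er + 2 * C2) / m0 + 1)%R.
  have H : (kk n ^+ 2 <= (2 * Er + 2 * C2) / m0)%R by rewrite ler_pdivlMr.
  apply: le_trans (lerD H (lexx 1%R)); rewrite -real_normK ?num_real//.
  have := sqr_ge0 (`|kk n| - 2^-1)%R; move: `|kk n|%R => q; rewrite sqrrB; lra.
have [k Hk] := cluster_point bd2.
exists k => e e1; have /andP[ee0 ee1] := e1.
have [W0 W1] : (0 <= kap R * mka 0 1)%R /\ \int[lb2]_(x in ann s 0 1) (wt x)%:E = (kap R * mka 0 1)%:E.
  by split; [rewrite mulr_ge0 ?mka_ge0// ltW|exact: wt_ann].
set W := (kap R * mka 0 1)%R in W0 W1.
have main p : (0 < p)%R ->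
    \int[lb2]_(x in ann s p e) ((u x - k) ^+ 2 * wt x)%:E <= (16 * K * e ^+ 2 * fine (sE e))%:E.
  move=> pp0; apply/lee_addgt0Pr => eps eps0.
  pose r := Num.min p e.
  have r0 : (0 < r)%R by rewrite lt_min pp0.
  have [N1 HN1] := large_index 1 r0.
  have eps4 : (0 < eps / 4)%R by rewrite divr_gt0.
  have [N2 HN2] := large_index C eps4.
  pose q := Num.min 1%R (eps / (4 * (W + 1)))%R.
  have W10 : (0 < 4 * (W + 1))%R by rewrite mulr_gt0// ltr_wpDl.
  have q0 : (0 < q)%R by rewrite lt_min ltr01 divr_gt0.
  have [n Nn Hn] := Hk q q0 (maxn N1 N2).
  have n1 : (n.+2%:R^-1 < r)%R.
    apply: lt_le_trans (HN1 n (leq_trans (leq_maxl _ _) Nn)).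
    by rewrite mul1r ltf_pV2 ?posrE ?ltr0n// ltr_nat.
  have n2 := HN2 n (leq_trans (leq_maxr _ _) Nn).
  have ne : (n.+2%:R^-1 < e < 1)%R by rewrite ee1 andbT (lt_le_trans n1)// ge_min lexx orbT.
  have np : (n.+2%:R^-1 <= p)%R by rewrite ltW// (lt_le_trans n1)// ge_min lexx.
  have mp := measurable_ann s p e.
  apply: (@le_trans _ _ (2%:E * \int[lb2]_(x in ann s p e) ((u x - kk n) ^+ 2 * wt x)%:E +
     (2 * (kk n - k) ^+ 2)%:E * \int[lb2]_(x in ann s p e) (wt x)%:E)).
    have z2 k' (x : R * R) : (0 <= (u x - k') ^+ 2 * wt x)%R by exact: sqdev_ge0.
    have q20 : (0 <= 2 * (kk n - k) ^+ 2)%R by rewrite mulr_ge0// sqr_ge0.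
    apply: rint_comb2; [exact: mp|exact: mD|exact: mD|exact: mw|exact: z2|exact: z2|exact: w0| by []|exact: q20|].
      move=> x _.
      have H : ((u x - k) ^+ 2 <= 2 * (u x - kk n) ^+ 2 + 2 * (kk n - k) ^+ 2)%R.
        have := sqr_split (u x - kk n) (kk n - k).
        by rewrite addrA subrK.
      apply: le_trans (ler_wpM2r (w0 x) H) _.
      by rewrite mulrDl -(mulrA 2%R ((u x - kk n) ^+ 2)%R).
  have h1 : \int[lb2]_(x in ann s p e) ((u x - kk n) ^+ 2 * wt x)%:E <=
      (8 * K * e ^+ 2 * fine (sE e) + eps / 4)%:E.
    apply: (@le_trans _ _ (\int[lb2]_(x in ann s n.+2%:R^-1 e) ((u x - kk n) ^+ 2 * wt x)%:E)).
      apply: rint_sub; [exact: mp|exact: measurable_ann|exact: mD|by move=> x; exact: sqdev_ge0|].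
      by move=> x [sx /andP[px xe]]; split => //; rewrite xe andbT (le_lt_trans np).
    by apply: le_trans (Hkk n e ne) _; rewrite lee_fin lerD2l.
  have h2 : \int[lb2]_(x in ann s p e) (wt x)%:E <= W%:E.
    rewrite -W1; apply: rint_sub => //; first exact: measurable_ann.
    by move=> x [sx /andP[px xe]]; split => //; rewrite (lt_trans pp0)//= (lt_trans xe).
  have q20 : (0 <= 2 * (kk n - k) ^+ 2)%R by rewrite mulr_ge0// sqr_ge0.
  apply: le_trans (leeD (lee_wpmul2l _ h1) (lee_wpmul2l _ h2)) _; rewrite ?lee_fin//.
  change ((2 * (8 * K * e ^+ 2 * fine (sE e) + eps / 4) + 2 * (kk n - k) ^+ 2 * W)%:E <=
    (16 * K * e ^+ 2 * fine (sE e) + eps)%:E).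
  rewrite lee_fin.
  have h3 : ((kk n - k) ^+ 2 * W <= eps / 4)%R.
    have a1 : ((kk n - k) ^+ 2 <= q)%R.
      rewrite -real_normK ?num_real// expr2 (le_trans (ler_wpM2l _ (ltW Hn)))// -[leRHS]mul1r.
      by rewrite ler_wpM2r ?(ltW q0)// (le_trans (ltW Hn))// ge_min lexx.
    have a2 : (q * (4 * (W + 1)) <= eps)%R by rewrite -ler_pdivlMr// ge_min lexx orbT.
    have a3 : ((kk n - k) ^+ 2 * W <= q * W)%R by rewrite ler_wpM2r.
    move: a2 a3 q0; rewrite mulrCA mulrDr mulr1; move: ((kk n - k) ^+ 2 * W)%R (q * W)%R => *; lra.
  have -> : (2 * (8 * K * e ^+ 2 * fine (sE e) + eps / 4) + 2 * (kk n - k) ^+ 2 * W =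
    16 * K * e ^+ 2 * fine (sE e) + (eps / 2 + 2 * ((kk n - k) ^+ 2 * W)))%R by field.
  rewrite lerD2l; move: h3; move: ((kk n - k) ^+ 2 * W)%R => *; lra.
have -> : ann s 0 e = \bigcup_(j : nat) ann s j.+1%:R^-1 e.
  apply/seteqP; split => x [].
    move=> sx /andP[x0 xe]; have [N HN] := large_index 1 x0.
    exists N.+1 => //; split => //; rewrite xe andbT.
    apply: lt_le_trans (HN N (leqnn N)); rewrite mul1r ltf_pV2 ?posrE ?ltr0n// ltr_nat.
    by [].
  move=> j _ [sx /andP[xj xe]]; split => //; rewrite xe andbT.
  by apply: lt_trans xj; rewrite invr_gt0 ltr0n.
apply: int_exhaust.
- exact: mD.
- by move=> x; exact: sqdev_ge0.
- by move=> n; exact: measurable_ann.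
- move=> n m nm; rewrite subsetEset => x [sx /andP[xn xe]]; split => //; rewrite xe andbT.
  by apply: le_lt_trans xn; rewrite lef_pV2 ?posrE ?ltr0n// ler_nat.
- by move=> n; apply: main; rewrite invr_gt0 ltr0n.
Qed.

Lemma lim_exists : exists k, lim_at s u k.
Proof.
have [k Hk] := hardy_weak; exists k; have K0 := K_ge0.
exists (16 * K * Er)%R; first by rewrite mulr_ge0// mulr_ge0.
move=> e e01; apply: le_trans (Hk e e01) _; rewrite lee_fin.
rewrite (mulrAC _ Er) ler_wpM2l//; first by rewrite mulr_ge0 ?sqr_ge0// mulr_ge0.
by rewrite -lee_fin -sEE sE_le.
Qed.

Lemma hardy_lim k : lim_at s u k -> forall e, (0 < e < 1)%R ->
  \int[lb2]_(x in ann s 0 e) ((u x - k) ^+ 2 * wt x)%:E <= (16 * K * e ^+ 2 * fine (sE e))%:E.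
Proof.
move=> Lk; have [l Hl] := hardy_weak; have K0 := K_ge0.
have Ll : lim_at s u l.
  exists (16 * K * Er)%R; first by rewrite mulr_ge0// mulr_ge0.
  move=> e e01; apply: le_trans (Hl e e01) _; rewrite lee_fin.
  rewrite (mulrAC _ Er) ler_wpM2l//; first by rewrite mulr_ge0 ?sqr_ge0// mulr_ge0.
  by rewrite -lee_fin -sEE sE_le.
by rewrite (lim_unique s1 mu_ Lk Ll).
Qed.

(** Integrate k^2 <= 2 u^2 + 2 (u - k)^2 over the sector of radius 1/2, where the Hardy
    inequality controls the last term. So the traces are continuous for the norm of W.
    *)
Lemma lim_bound k : lim_at s u k ->
  (k ^+ 2 * (kap R * mka 0 2^-1) <= (2 + 8 * K) * Er)%R.
Proof.
move=> Lk; have K0 := K_ge0.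
have h2 : (0 < (2^-1 : R) < 1)%R by rewrite invr_gt0 ltr0n invf_lt1 ?ltr1n.
have h1 : (2^-1 <= 1 :> R)%R by case/andP: h2 => _ /ltW.
have H := hardy_lim Lk h2.
have ma := measurable_ann s 0%R (2^-1)%R.
have mu2 : measurable_fun [set: R * R] (fun x => u x ^+ 2 * wt x)%R.
  by apply: measurable_funM => //; exact: measurable_funX.
have u20 (x : R * R) : (0 <= u x ^+ 2 * wt x)%R by rewrite mulr_ge0 ?sqr_ge0.
have mdu : measurable_fun [set: R * R] (fun x => dens g h u x * wt x)%R.
  by apply: measurable_funM => //; exact: measurable_dens.
have z1 (x : R * R) : (0 <= k ^+ 2 * wt x)%R by rewrite mulr_ge0 ?sqr_ge0.
have z2 (x : R * R) : (0 <= (u x - k) ^+ 2 * wt x)%R by exact: sqdev_ge0.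
have z3 : measurable_fun [set: R * R] (fun x => k ^+ 2 * wt x)%R by exact: measurable_funM.
have mD := measurable_sqdev k mu_.
rewrite -lee_fin EFinM -(wt_ann s1 (lexx 0%R) h1) -rintZ ?sqr_ge0//.
apply: (@le_trans _ _ (2%:E * \int[lb2]_(x in ann s 0 2^-1) (u x ^+ 2 * wt x)%:E +
   2%:E * \int[lb2]_(x in ann s 0 2^-1) ((u x - k) ^+ 2 * wt x)%:E)).
  apply: rint_comb2; [exact: ma|exact: z3|exact: mu2|exact: mD|exact: z1|exact: u20|exact: z2| | |]; [by []|by []|].
  move=> x _.
  have Q : (k ^+ 2 <= 2 * u x ^+ 2 + 2 * (u x - k) ^+ 2)%R.
    have := sqr_split (u x) (- (u x - k)); rewrite sqrrN.
    by rewrite (_ : u x + - (u x - k) = k)%R//; ring.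
  apply: le_trans (ler_wpM2r (w0 x) Q) _.
  by rewrite mulrDl -(mulrA 2%R (u x ^+ 2)%R) -(mulrA 2%R ((u x - k) ^+ 2)%R).
rewrite (_ : (2 + 8 * K) * Er = 2 * Er + 2 * (16 * K * 2^-1 ^+ 2 * Er))%R; last by field.
rewrite [leRHS]EFinD; apply: leeD; rewrite [leRHS]EFinM; apply: lee_wpmul2l => //.
  rewrite -ErE; apply: (@le_trans _ _ (\int[lb2]_x (u x ^+ 2 * wt x)%:E)).
    by apply: rint_sub; [exact: ma|exact: measurableT|exact: mu2|exact: u20|].
  apply: rint_le; [exact: measurableT|exact: mu2|exact: mdu|exact: u20|].
  by move=> x _; apply: ler_wpM2r => //; rewrite /dens lerDr addr_ge0 ?sqr_ge0.
apply: le_trans H _; rewrite lee_fin ler_wpM2l//.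
  by rewrite mulr_ge0 ?sqr_ge0// mulr_ge0.
by rewrite -lee_fin -sEE sE_le.
Qed.

End hardy_weak.

End trace.

(** * Functions with zero traces are limits of test functions *)

Section small.
Context d (T : measurableType d) (R : realType) (m : {measure set T -> \bar R}).
Implicit Types (F G : T -> R).

(** Bookkeeping for bounds of integrals of nonnegative functions, so that the estimate
    of a sum with many terms follows the shape of the sum. *)
Definition small F (b : R) := [/\ measurable_fun [set: T] F, forall x, 0 <= F x &
  (\int[m]_x (F x)%:E <= b%:E)%E].

Lemma smallD F G a b : small F a -> small G b -> small (fun x => F x + G x) (a + b).
Proof.
move=> [mF F0 Fa] [mG G0 Gb]; split; first exact: measurable_funD.
  by move=> x; exact: addr_ge0.
by rewrite rintD// EFinD; exact: leeD.
Qed.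

Lemma smallZ F a (c : R) : 0 <= c -> small F a -> small (fun x => c * F x) (c * a).
Proof.
move=> c0 [mF F0 Fa]; split; first exact: measurable_funM.
  by move=> x; exact: mulr_ge0.
by rewrite rintZ// EFinM; exact: lee_wpmul2l.
Qed.

Lemma small_le F G a : measurable_fun [set: T] F -> (forall x, 0 <= F x) ->
  (forall x, F x <= G x) -> small G a -> (\int[m]_x (F x)%:E <= a%:E)%E.
Proof. by move=> mF F0 FG [mG G0 Ga]; apply: le_trans Ga; apply: rint_le. Qed.

Lemma small_indic F (D : set T) b : measurable D -> measurable_fun [set: T] F -> (forall x, 0 <= F x) ->
  (\int[m]_(x in D) (F x)%:E <= b%:E)%E -> small (fun x => F x * \1_D x) b.
Proof.
move=> mD mF F0 H; split.
- by apply: measurable_funM => //; exact: measurable_indic.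
- by move=> x; rewrite mulr_ge0.
apply: le_trans H; rewrite [leRHS]integral_mkcond le_eqVlt; apply/orP; left; apply/eqP.
by apply: eq_integral => x _; rewrite patchE indicE; case: ifP; rewrite ?mulr1 ?mulr0.
Qed.

End small.

Section truncation.
Context (R : realType).
Implicit Types (w z : R * R -> R) (x y : R * R) (l s : R).

(** A bounded truncation with derivative [dtrn] of absolute value at most 1;
    [cutoff_frac] is the fraction of s that it removes. It is smooth, so that the
    truncation of a test function is one. *)
Definition trn l s : R := s / (1 + l * s ^+ 2).
Definition dtrn l s : R := (1 - l * s ^+ 2) / (1 + l * s ^+ 2) ^+ 2.
Definition cutoff_frac l s : R := l * s ^+ 2 / (1 + l * s ^+ 2).

Section bounds.
Variables (l s : R).
Hypothesis l0 : 0 < l.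

Let q0 : 0 < 1 + l * s ^+ 2.
Proof. by rewrite ltr_pwDl// mulr_ge0 ?sqr_ge0// ltW. Qed.
Let a0 : 0 <= l * s ^+ 2.
Proof. by rewrite mulr_ge0 ?sqr_ge0// ltW. Qed.

Lemma frac_ge0 : 0 <= cutoff_frac l s.
Proof. by rewrite divr_ge0// ltW. Qed.

Lemma frac_le1 : cutoff_frac l s <= 1.
Proof. by rewrite ler_pdivrMr// mul1r lerDr. Qed.

Lemma frac_le : cutoff_frac l s <= l * s ^+ 2.
Proof. by rewrite ler_pdivrMr// ler_peMr// lerDl. Qed.

Lemma trn_frac : s - trn l s = cutoff_frac l s * s.
Proof. by rewrite /trn /cutoff_frac; field; rewrite gt_eqF. Qed.

Lemma dtrn_sqr_le1 : dtrn l s ^+ 2 <= 1.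
Proof.
rewrite /dtrn expr_div_n ler_pdivrMr ?exprn_gt0// mul1r.
apply: (@le_trans _ _ ((1 + l * s ^+ 2) ^+ 2)).
  rewrite -subr_ge0 (_ : _ - _ = 4 * (l * s ^+ 2)); last by ring.
  by rewrite mulr_ge0.
by rewrite [leRHS]expr2 ler_peMr ?sqr_ge0// exprn_ege1// lerDl.
Qed.

Lemma dtrn_frac : (1 - dtrn l s) ^+ 2 <= 9 * cutoff_frac l s ^+ 2.
Proof.
have -> : 1 - dtrn l s = cutoff_frac l s * ((3 + l * s ^+ 2) / (1 + l * s ^+ 2)).
  by rewrite /dtrn /cutoff_frac; field; rewrite gt_eqF.
rewrite exprMn mulrC ler_wpM2r ?sqr_ge0// (_ : 9 = 3 ^+ 2 :> R); last by ring.
have h0 : 0 <= (3 + l * s ^+ 2) / (1 + l * s ^+ 2) by rewrite divr_ge0 ?(ltW q0)// addr_ge0.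
rewrite ler_sqr ?nnegrE// ler_pdivrMr//; move: a0; lra.
Qed.

Lemma trn_sqr_le : trn l s ^+ 2 <= s ^+ 2.
Proof.
rewrite /trn expr_div_n ler_pdivrMr ?exprn_gt0// ler_peMr ?sqr_ge0//.
by rewrite exprn_ege1// lerDl.
Qed.

Lemma trn_sqr_bd : trn l s ^+ 2 <= l^-1.
Proof.
rewrite /trn expr_div_n ler_pdivrMr ?exprn_gt0// -ler_pdivrMl ?invr_gt0// invrK.
rewrite -subr_ge0 (_ : _ - _ = 1 + l * s ^+ 2 + (l * s ^+ 2) ^+ 2); last by ring.
by rewrite !addr_ge0// sqr_ge0.
Qed.

End bounds.

Lemma smooth_trn l w : 0 < l -> smooth w -> smooth (fun x => trn l (w x)).
Proof.
move=> l0 sw k.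
have C1 : Ck k (cst 1 \+ (fun x => l * (w x * w x)) : R * R -> R).
  by apply: CkD; [exact: Ck_cst|apply: CkZ; exact: CkM (sw k) (sw k)].
have C2 : Ck k (fun x => ((cst 1 \+ (fun x => l * (w x * w x))) x)^-1 : R).
  by apply: CkV C1 => x /=; rewrite -expr2 ltr_pwDl// mulr_ge0 ?sqr_ge0// ltW.
rewrite (_ : (fun x => _) = w \* (fun x => ((cst 1 \+ (fun x => l * (w x * w x))) x)^-1)).
  exact: CkM (sw k) C2.
by apply/funext => x /=; rewrite /trn expr2.
Qed.

Lemma trn_D l w v x : 0 < l -> axis v -> smooth w ->
  'D_v (fun x => trn l (w x)) x = dtrn l (w x) * 'D_v w x.
Proof.
move=> l0 av sw.
have dw : is_derive x v w ('D_v w x) by apply: derivableP; exact: axis_derivable.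
have q0 : 0 < 1 + l * (w x) ^+ 2 by rewrite ltr_pwDl// mulr_ge0 ?sqr_ge0// ltW.
have dt : is_derive (w x) 1 (trn l) (dtrn l (w x)).
  have d1 : is_derive (w x) 1 (fun s : R => 1 + l * s ^+ 2) (2 * l * w x).
    by apply: is_derive_eq; rewrite /GRing.scale /=; ring.
  have qn0 : 1 + l * (w x) ^+ 2 != 0 by rewrite gt_eqF.
  rewrite /trn; apply: is_derive_eq.
  rewrite /GRing.scale /= /dtrn; move: (w x) qn0 => s qn0.
  by field.
have D := is_derive_comp1 dt dw.
by rewrite (derive_val (is_derive := D)).
Qed.

End truncation.

Section density.
Context (R : realType).
Implicit Types (x y : R * R) (u g h : R * R -> R) (s : R).
Local Notation mu := (@lebesgue_measure R).
Local Notation lb2 := (@leb2 R).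
Local Notation testT := (test_function [set: R * R]).
Variables (al : R -> R) (K : R).
Hypothesis adm : admissible al K.
Local Notation wt := (wt al).

Let mw := measurable_wt adm.
Let w0 := wt_ge0 adm.

Lemma null_origin : {ae lb2, forall x, 0 < enorm x}.
Proof.
exists (box 0); split; first exact: measurable_box.
  by rewrite lb2_box// mulr0 expr0n.
move=> x /= /negP; rewrite -leNgt => x0.
have e0 : enorm x = 0 by apply/eqP; rewrite eq_le x0 enorm_ge0.
by have [n1 n2] := norm_le_enorm x; rewrite e0 in n1 n2.
Qed.

Definition ball (r : R) : set (R * R) := [set x | enorm x < r].

Lemma measurable_ball r : measurable (ball r).
Proof.
rewrite (_ : ball r = [set x | enorm x \in `]-oo, r[]); first exact: measurable_enorm_itv.
by apply/seteqP; split => x; rewrite /ball /= in_itv.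
Qed.

Definition far (M : R) : set (R * R) := [set x | M < enorm x].

Lemma measurable_far M : measurable (far M).
Proof.
rewrite (_ : far M = [set x | enorm x \in `]M, +oo[]); first exact: measurable_enorm_itv.
by apply/seteqP; split => x; rewrite /far /= in_itv /= andbT.
Qed.

Lemma split4 (a b c d : R) : (a + b + c + d) ^+ 2 <= 4 * (a ^+ 2 + b ^+ 2 + c ^+ 2 + d ^+ 2).
Proof.
rewrite -subr_ge0.
rewrite (_ : _ - _ = (a - b) ^+ 2 + (a - c) ^+ 2 + (a - d) ^+ 2 + (b - c) ^+ 2 + (b - d) ^+ 2 + (c - d) ^+ 2); last by ring.
by rewrite !addr_ge0 ?sqr_ge0.
Qed.

(** The gradient of u - Z T(w) splits into four parts: what the cutoff Z removes, the
    error of the approximation w, what the truncation removes, and the gradient p of the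
    cutoff times the truncated value T. Here t' stands for the derivative of the
    truncation and H for [cutoff_frac]. *)
Lemma density_pointwise (Z p1 p2 g h u w1 w2 w t' H T : R) :
  0 <= Z <= 1 -> t' ^+ 2 <= 1 -> (1 - t') ^+ 2 <= 9 * H ^+ 2 -> w - T = H * w -> 0 <= H <= 1 ->
  (g - (Z * (t' * w1) + p1 * T)) ^+ 2 + (h - (Z * (t' * w2) + p2 * T)) ^+ 2 + (u - Z * T) ^+ 2 <=
  4 * ((1 - Z) ^+ 2 * (g ^+ 2 + h ^+ 2 + u ^+ 2) +
       Z ^+ 2 * ((g - w1) ^+ 2 + (h - w2) ^+ 2 + (u - w) ^+ 2) +
       9 * (Z ^+ 2 * H ^+ 2 * (g ^+ 2 + h ^+ 2 + u ^+ 2)) + (p1 ^+ 2 + p2 ^+ 2) * T ^+ 2).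
Proof.
move=> /andP[Z0 Z1] t1 tH wT /andP[H0 H1].
have TE : T = (1 - H) * w by rewrite mulrBl mul1r -wT opprB addrC subrK.
have key (a b p : R) : (a - (Z * (t' * b) + p * T)) ^+ 2 <=
    4 * ((1 - Z) ^+ 2 * a ^+ 2 + Z ^+ 2 * (a - b) ^+ 2 + 9 * (Z ^+ 2 * H ^+ 2 * a ^+ 2) + p ^+ 2 * T ^+ 2).
  have -> : a - (Z * (t' * b) + p * T) = (1 - Z) * a + Z * (t' * (a - b)) + Z * ((1 - t') * a) + - (p * T) by ring.
  apply: le_trans (split4 _ _ _ _) _; rewrite ler_wpM2l// !sqrrN !exprMn.
  rewrite !lerD//.
    by rewrite ler_wpM2l ?sqr_ge0// -[leRHS]mul1r ler_wpM2r ?sqr_ge0.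
  have -> : 9 * (Z ^+ 2 * H ^+ 2 * a ^+ 2) = Z ^+ 2 * (9 * H ^+ 2 * a ^+ 2) by ring.
  by rewrite ler_wpM2l ?sqr_ge0// ler_wpM2r ?sqr_ge0.
have k3 : (u - Z * T) ^+ 2 <= 4 * ((1 - Z) ^+ 2 * u ^+ 2 + Z ^+ 2 * (u - w) ^+ 2 + 9 * (Z ^+ 2 * H ^+ 2 * u ^+ 2)).
  have -> : u - Z * T = (1 - Z) * u + Z * ((1 - H) * (u - w)) + Z * (H * u) + 0 by rewrite TE; ring.
  apply: le_trans (split4 _ _ _ _) _; rewrite ler_wpM2l// expr0n /= addr0 !exprMn !lerD//.
    rewrite ler_wpM2l ?sqr_ge0// -[leRHS]mul1r ler_wpM2r ?sqr_ge0//.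
    by rewrite expr_le1// ?subr_ge0// gerBl.
  by rewrite mulrA -!exprMn ler_peMl ?sqr_ge0 ?ler1n.
apply: (le_trans (lerD (lerD (key g w1 p1) (key h w2 p2)) k3)).
by rewrite le_eqVlt; apply/orP; left; apply/eqP; ring.
Qed.

Lemma combine4 (z1 z2 a1 a2 b1 b2 t ww p P q Q : R) : 0 <= t * ww ->
  z1 <= 2 * a1 + 2 * b1 -> z2 <= 2 * a2 + 2 * b2 ->
  a1 * (t * ww) <= p * P -> a2 * (t * ww) <= p * P ->
  b1 * (t * ww) <= q * Q -> b2 * (t * ww) <= q * Q ->
  (z1 + z2) * t * ww <= 4 * p * P + 4 * q * Q.
Proof.
move=> T0 h1 h2 i1 i2 o1 o2; rewrite -(mulrA _ t).
apply: (le_trans (ler_wpM2r T0 (lerD h1 h2))).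
rewrite (_ : _ * (t * ww) = 2 * (a1 * (t * ww)) + 2 * (a2 * (t * ww)) + 2 * (b1 * (t * ww)) + 2 * (b2 * (t * ww))); last by ring.
rewrite -(mulrA 4 p) -(mulrA 4 q).
by move: i1 i2 o1 o2; move: (a1 * _) (a2 * _) (b1 * _) (b2 * _) (p * P) (q * Q) => *; lra.
Qed.

Section step.
Variables (u g h w : R * R -> R) (d M l N C : R).
Hypotheses (d0 : 0 < d) (dM : 2 * d <= M) (l0 : 0 < l) (N0 : 0 <= N) (lN : 2 * l * N <= 1).
Hypotheses (tw : testT w) (C0 : 0 <= C).
Hypothesis HC : forall (v : R * R) (r : R) x, axis v -> 0 < r -> 'D_v (cutr r) x ^+ 2 <= C / r ^+ 2.

Let M0 : 0 < M.
Proof. by apply: lt_le_trans dM; rewrite mulr_gt0. Qed.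

Let sw : smooth w := test_smooth tw.

Definition appr x : R := zeta d M x * trn l (w x).

Lemma appr_test : test_function (~` [set 0]) appr.
Proof.
exact: (testM (smooth_trn l0 sw) (zeta_test0 d0 M0)).
Qed.

Lemma appr_D (v x : R * R) : axis v -> 'D_v appr x =
  zeta d M x * (dtrn l (w x) * 'D_v w x) + 'D_v (zeta d M) x * trn l (w x).
Proof.
move=> av; rewrite (axis_DM x av (smooth_zeta d M) (smooth_trn l0 sw)).
by rewrite trn_D.
Qed.

Let D x := dens g h u x.
Let Dd x := dens (fun x => g x - 'D_(@e1 R) w x) (fun x => h x - 'D_(@e2 R) w x) (fun x => u x - w x) x.

Let D0 x : 0 <= D x. Proof. exact: dens_ge0. Qed.
Let Dd0 x : 0 <= Dd x. Proof. exact: dens_ge0. Qed.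

(** Bounds for the energy of u - [appr]: S0 comes from the regions that the cutoff
    removes, S1 from the error of w, S2 and S3 from the truncation, split according to
    the size of the energy density D, S4 from the slope of the cutoff near the origin in
    Q1 and Q3, where Hardy's inequality controls u, and S5 from the same slope in Q2 and
    Q4, where only the bound on the truncation is available. *)
Definition S0 x := D x * wt x * \1_(ball (3 * d) `|` far M) x.
Definition S1 x := Dd x * wt x * \1_(shell (d / 2) (3 * M)) x.
Definition S2 x := D x * wt x * (N < D x)%R%:R.
Definition S3 x := D x * wt x.
Definition S4 s x := u x ^+ 2 * wt x * \1_(ann s 0 (3 * d)) x.
Definition S5 x := al (enorm x) * \1_(ball (3 * d)) x.

Let S00 x : 0 <= S0 x. Proof. by rewrite mulr_ge0// mulr_ge0. Qed.
Let S10 x : 0 <= S1 x. Proof. by rewrite mulr_ge0// mulr_ge0. Qed.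
Let S20 x : 0 <= S2 x. Proof. by rewrite mulr_ge0// mulr_ge0. Qed.
Let S30 x : 0 <= S3 x. Proof. by rewrite mulr_ge0. Qed.
Let S40 s x : 0 <= S4 s x. Proof. by rewrite mulr_ge0// mulr_ge0// sqr_ge0. Qed.
Let S50 x : 0 <= S5 x. Proof. by rewrite mulr_ge0// (al_ge0 adm). Qed.

Let Z01 x : 0 <= zeta d M x <= 1. Proof. by rewrite zeta_ge0 zeta_le1. Qed.

Let Zsq x : zeta d M x ^+ 2 <= 1.
Proof. by have /andP[a b] := Z01 x; rewrite expr_le1. Qed.

Let in_shell x : d <= enorm x -> enorm x <= 2 * M -> S1 x = Dd x * wt x.
Proof.
move=> xd xM; rewrite /S1 indicE mem_set ?mulr1//; rewrite /shell /=; apply/andP; split.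
  by apply: lt_le_trans xd; rewrite ltr_pdivrMr// ltr_pMr// ltr1n.
by apply: le_lt_trans xM _; rewrite ltr_pM2r// ltr_nat.
Qed.

Let t1 x : (1 - zeta d M x) ^+ 2 * D x * wt x <= S0 x.
Proof.
have [xd|xd] := ltP (enorm x) (3 * d).
  rewrite /S0 indicE mem_set ?mulr1; last by left.
  rewrite -mulrA ler_piMl ?mulr_ge0//; have /andP[a b] := Z01 x.
  by rewrite expr_le1// ?subr_ge0// gerBl.
have [xM|xM] := ltP M (enorm x).
  rewrite /S0 indicE mem_set ?mulr1; last by right.
  rewrite -mulrA ler_piMl ?mulr_ge0//; have /andP[a b] := Z01 x.
  by rewrite expr_le1// ?subr_ge0// gerBl.
rewrite zeta_mid//; first by rewrite subrr expr0n /= !mul0r.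
by apply: le_trans xd; rewrite ler_wpM2r ?(ltW d0)// ler_nat.
Qed.

Let Zcase x : zeta d M x = 0 \/ (d <= enorm x /\ enorm x <= 2 * M).
Proof.
have [xd|xd] := leP (enorm x) d; first by left; exact: zeta_in.
have [xM|xM] := leP (2 * M) (enorm x); first by left; exact: zeta_out.
by right; rewrite !ltW.
Qed.

Let t2 x : zeta d M x ^+ 2 * Dd x * wt x <= S1 x.
Proof.
have [->|[xd xM]] := Zcase x; first by rewrite expr0n /= !mul0r.
by rewrite in_shell// -mulrA ler_piMl ?mulr_ge0.
Qed.

Let uD x : u x ^+ 2 <= D x.
Proof. by rewrite /D /dens lerDr addr_ge0// sqr_ge0. Qed.

Let uwD x : (u x - w x) ^+ 2 <= Dd x.
Proof. by rewrite /Dd /dens lerDr addr_ge0// sqr_ge0. Qed.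

Let wle x : w x ^+ 2 <= 2 * u x ^+ 2 + 2 * (u x - w x) ^+ 2.
Proof.
by have := sqr_split (u x) (- (u x - w x)); rewrite sqrrN opprB addrC subrK.
Qed.

(** Where the density exceeds N this is part of S2. Elsewhere H <= l w^2, and w^2 is
    bounded by 2 u^2 + 2 (u - w)^2, where u^2 <= D <= N. *)
Let t3 x : zeta d M x ^+ 2 * cutoff_frac l (w x) ^+ 2 * D x * wt x <= S2 x + 2 * l * N * S3 x + S1 x.
Proof.
have lN0 : 0 <= 2 * l * N by rewrite !mulr_ge0// ltW.
have r0 : 0 <= S2 x + 2 * l * N * S3 x + S1 x by rewrite !addr_ge0// mulr_ge0.
have [Z0|[xd xM]] := Zcase x; first by rewrite Z0 expr0n /= !mul0r.
have H0 := frac_ge0 (w x) l0; have H1 := frac_le1 (w x) l0; have H2 := frac_le (w x) l0.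
set H := cutoff_frac l (w x) in H0 H1 H2 *.
have HH : H ^+ 2 <= H by rewrite expr2 ler_piMl.
have ZH : zeta d M x ^+ 2 * H ^+ 2 <= H.
  by apply: le_trans HH; rewrite ler_piMl ?sqr_ge0.
rewrite -mulrA; apply: (@le_trans _ _ (H * (D x * wt x))); first by rewrite ler_wpM2r ?mulr_ge0.
have [ND|DN] := ltP N (D x).
  apply: (@le_trans _ _ (S2 x)); last by rewrite -addrA lerDl addr_ge0// mulr_ge0.
  by rewrite /S2 ND mulr1 ler_piMl ?mulr_ge0.
apply: (@le_trans _ _ (2 * l * N * S3 x + S1 x)); last by rewrite -addrA lerDr.
rewrite in_shell// /S3 (mulrA H) (mulrA (2 * l * N)) -mulrDl ler_wpM2r//.
have HD : H * D x <= l * (2 * u x ^+ 2 + 2 * (u x - w x) ^+ 2) * D x.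
  by rewrite ler_wpM2r//; apply: le_trans H2 _; rewrite ler_wpM2l// ltW.
apply: le_trans HD _.
have -> : l * (2 * u x ^+ 2 + 2 * (u x - w x) ^+ 2) * D x =
  2 * l * (u x ^+ 2 * D x) + 2 * l * ((u x - w x) ^+ 2 * D x) by ring.
have l2 : 0 <= 2 * l by rewrite mulr_ge0// ltW.
apply: lerD.
  rewrite -(mulrA (2 * l) N); apply: ler_wpM2l => //; apply: ler_wpM2r => //; exact: le_trans (uD x) DN.
apply: (@le_trans _ _ (2 * l * (Dd x * N))).
  by rewrite ler_wpM2l// ler_pM// sqr_ge0.
by rewrite mulrCA -[leRHS]mulr1 ler_wpM2l.
Qed.

Let trn_wt x : d <= enorm x -> enorm x <= 2 * M -> trn l (w x) ^+ 2 * wt x <= 2 * (u x ^+ 2 * wt x) + 2 * S1 x.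
Proof.
move=> xd xM; rewrite in_shell// (mulrA 2) (mulrA 2 (Dd x)) -mulrDl ler_wpM2r//.
apply: le_trans (trn_sqr_le (w x) l0) _; apply: le_trans (wle x) _.
by rewrite lerD2l ler_wpM2l.
Qed.

(** In Q1 and Q3 the truncated value is bounded by |w|, in Q2 and Q4 its square is
    bounded by 1/l. *)
Let t4_inner (v x : R * R) : axis v -> 'D_v (cutr d) x ^+ 2 * (trn l (w x) ^+ 2 * wt x) <=
  C / d ^+ 2 * (2 * S4 1 x + 2 * S4 (-1) x + 2 * S1 x + l^-1 * S5 x).
Proof.
move=> av.
have r1 : 0 <= l^-1 * S5 x by rewrite mulr_ge0 ?invr_ge0 ?(ltW l0).
have r2 s : 0 <= 2 * S4 s x by rewrite mulr_ge0.
have r3 : 0 <= 2 * S1 x by rewrite mulr_ge0.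
have r0 : 0 <= C / d ^+ 2 * (2 * S4 1 x + 2 * S4 (-1) x + 2 * S1 x + l^-1 * S5 x).
  by rewrite mulr_ge0 ?divr_ge0 ?sqr_ge0// !addr_ge0.
have [xd|xd] := ltP (enorm x) d; first by rewrite cut_D0 ?expr0n ?mul0r//; left.
have [xd2|xd2] := ltP (2 * d) (enorm x); first by rewrite cut_D0 ?expr0n ?mul0r//; right.
have xM : enorm x <= 2 * M.
  by apply: le_trans xd2 _; apply: le_trans dM _; rewrite ler_peMl ?ler1n// ltW.
have x3 : enorm x < 3 * d by apply: le_lt_trans xd2 _; rewrite ltr_pM2r// ltr_nat.
have x0 : 0 < enorm x by exact: lt_le_trans xd.
apply: ler_pM; [exact: sqr_ge0|by rewrite mulr_ge0 ?sqr_ge0|exact: HC|].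
have tb := trn_wt xd xM.
have S4E s : sec s x -> S4 s x = u x ^+ 2 * wt x.
  by move=> sx; rewrite /S4 indicE mem_set ?mulr1//; split; rewrite ?x0.
have [Q|Q] := boolP (x \in @Q1 R `|` @Q3 R); last first.
  apply: (@le_trans _ _ (l^-1 * S5 x)); last by rewrite lerDr !addr_ge0.
  rewrite /S5 indicE mem_set ?mulr1; last exact: x3.
  rewrite wtE (negbTE Q) ler_wpM2r ?(al_ge0 adm)//; exact: trn_sqr_bd.
apply: (@le_trans _ _ (2 * S4 1 x + 2 * S4 (-1) x + 2 * S1 x)); last by rewrite lerDl.
apply: le_trans tb _; rewrite lerD2r.
by case/set_mem: Q => Q; [rewrite -(@S4E 1) ?sec1E// lerDl|rewrite -(@S4E (-1)) ?secN1E// lerDr].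
Qed.

Let t4_outer (v x : R * R) : axis v -> 'D_v (cutr M) x ^+ 2 * (trn l (w x) ^+ 2 * wt x) <=
  C / M ^+ 2 * (2 * S3 x + 2 * S1 x).
Proof.
move=> av.
have r0 : 0 <= C / M ^+ 2 * (2 * S3 x + 2 * S1 x).
  by rewrite mulr_ge0 ?divr_ge0 ?sqr_ge0// addr_ge0// mulr_ge0.
have [xM|xM] := ltP (enorm x) M; first by rewrite cut_D0 ?expr0n ?mul0r//; left.
have [xM2|xM2] := ltP (2 * M) (enorm x); first by rewrite cut_D0 ?expr0n ?mul0r//; right.
have xd : d <= enorm x.
  by apply: le_trans xM; apply: le_trans dM; rewrite ler_peMl ?ler1n// ltW.
apply: ler_pM; [exact: sqr_ge0|by rewrite mulr_ge0 ?sqr_ge0|exact: HC|].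
apply: le_trans (trn_wt xd xM2) _; rewrite lerD2r ler_wpM2l// /S3 ler_wpM2r//.
Qed.

Let zD (v x : R * R) : axis v -> 'D_v (zeta d M) x ^+ 2 <= 2 * 'D_v (cutr d) x ^+ 2 + 2 * 'D_v (cutr M) x ^+ 2.
Proof.
move=> av; rewrite zeta_D//.
have key (a b c e : R) : (1 - b) ^+ 2 <= 1 -> c ^+ 2 <= 1 -> (a * (1 - b) - c * e) ^+ 2 <= 2 * a ^+ 2 + 2 * e ^+ 2.
  move=> b1 c1; apply: le_trans (sqr_split _ _) _; rewrite sqrrN !exprMn.
  by rewrite lerD// ler_wpM2l//; [rewrite ler_piMr ?sqr_ge0|rewrite ler_piMl ?sqr_ge0].
have c1 : (1 - cutr M x) ^+ 2 <= 1 by rewrite expr_le1 ?subr_ge0 ?cut_le1// gerBl cut_ge0.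
have c2 : cutr d x ^+ 2 <= 1 by rewrite expr_le1 ?cut_le1// cut_ge0.
exact: key.
Qed.

Lemma appr_dens x :
  dens (fun x => g x - 'D_(@e1 R) appr x) (fun x => h x - 'D_(@e2 R) appr x) (fun x => u x - appr x) x * wt x <=
  4 * (S0 x + S1 x + 9 * (S2 x + 2 * l * N * S3 x + S1 x) +
    (4 * (C / d ^+ 2) * (2 * S4 1 x + 2 * S4 (-1) x + 2 * S1 x + l^-1 * S5 x) +
     4 * (C / M ^+ 2) * (2 * S3 x + 2 * S1 x))).
Proof.
have H0 := frac_ge0 (w x) l0; have H1 := frac_le1 (w x) l0.
have H01 : 0 <= cutoff_frac l (w x) <= 1 by rewrite H0.
have := density_pointwise ('D_(@e1 R) (zeta d M) x) ('D_(@e2 R) (zeta d M) x) (g x) (h x) (u x)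
  ('D_(@e1 R) w x) ('D_(@e2 R) w x) (Z01 x) (dtrn_sqr_le1 (w x) l0) (dtrn_frac (w x) l0) (trn_frac (w x) l0) H01.
have E1 := appr_D x (@axis1 R); have E2 := appr_D x (@axis2 R).
have {E1} E1 : (g x - 'D_(@e1 R) appr x) ^+ 2 = _ := f_equal (fun q => (g x - q) ^+ 2) E1.
have {E2} E2 : (h x - 'D_(@e2 R) appr x) ^+ 2 = _ := f_equal (fun q => (h x - q) ^+ 2) E2.
have E := f_equal2 +%R (f_equal2 +%R E1 E2) (erefl ((u x - appr x) ^+ 2)).
move=> P; apply: (@le_trans _ _ (4 * ((1 - zeta d M x) ^+ 2 * D x +
  zeta d M x ^+ 2 * Dd x + 9 * (zeta d M x ^+ 2 * cutoff_frac l (w x) ^+ 2 * D x) +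
  ('D_(@e1 R) (zeta d M) x ^+ 2 + 'D_(@e2 R) (zeta d M) x ^+ 2) * trn l (w x) ^+ 2) * wt x)).
  rewrite ler_wpM2r//; apply: le_trans P; rewrite le_eqVlt; apply/orP; left; apply/eqP; exact: E.
rewrite -mulrA ler_wpM2l// mulrDl mulrDl mulrDl; apply: lerD; [apply: lerD; [apply: lerD|]|].
- exact: t1.
- exact: t2.
- by rewrite -(mulrA 9); apply: ler_wpM2l => //; exact: t3.
have z1 := zD x (@axis1 R); have z2 := zD x (@axis2 R).
have i1 := t4_inner x (@axis1 R); have i2 := t4_inner x (@axis2 R).
have o1 := t4_outer x (@axis1 R); have o2 := t4_outer x (@axis2 R).
have T0 : 0 <= trn l (w x) ^+ 2 * wt x by rewrite mulr_ge0 ?sqr_ge0.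
exact: combine4 T0 z1 z2 i1 i2 o1 o2.
Qed.

End step.

(** In Q2 and Q4 the cost of the cutoff at radius e is e^-2 times this integral, and
    [Af] tends to 0. *)
Lemma Af_ball e : 0 < e <= 1 ->
  (\int[lb2]_(x in ball e) (al (enorm x))%:E <= (4 * kap R * (e ^+ 2 * fine (Af al e)))%:E)%E.
Proof.
move=> /andP[e0 e1]; rewrite (radial e0 (al_meas adm) (al_ge0 adm)) [leRHS]EFinM.
apply: lee_wpmul2l; first by rewrite lee_fin mulr_ge0// ltW// kap_gt0.
have mj := measurable_ja adm; have j0 := ja_ge0 adm.
have mI (i : interval R) : measurable [set` i] by exact: measurable_itv.
rewrite EFinM (Af_fineK adm e1) /Af -rintZ ?sqr_ge0//.
have me : measurable_fun [set: R] (fun r => e ^+ 2 * ja al r) by exact: measurable_funM.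
have m1 : measurable_fun [set: R] (fun r => e ^+ 2 * ja al r * \1_(`]0%R, e[) r).
  by apply: measurable_funM => //; exact: measurable_indic.
apply: ge0_le_integral => //.
- by move=> r; rewrite /= in_itv /= => /andP[r0 _]; rewrite lee_fin mulr_ge0 ?(al_ge0 adm)// ltW.
- by apply: measurable_funTS; apply/measurable_EFinP; apply: measurable_funM => //; exact: (al_meas adm).
- by apply: measurable_funTS; apply/measurable_EFinP.
- move=> r; rewrite /= in_itv /= => /andP[r0 re]; rewrite lee_fin /ja gtr0_norm//.
  rewrite mulrCA ler_wpM2l ?(al_ge0 adm)// ler_pdivlMr// -expr2.
  by rewrite ler_sqr ?nnegrE ltW.
Qed.

Lemma choose_pos (c t : R) : 0 <= c -> 0 < t -> exists2 e, 0 < e & c * e <= t.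
Proof.
move=> c0 t0; have c1 : 0 < c + 1 by rewrite ltr_wpDl.
exists (t / (c + 1)); first by rewrite divr_gt0.
by rewrite mulrCA ler_piMr ?(ltW t0)// ler_pdivrMr// mul1r lerDl.
Qed.

Lemma Af_le (p q : R) : p <= q -> (Af al p <= Af al q)%E.
Proof.
move=> pq; have mI (i : interval R) : measurable [set` i] by exact: measurable_itv.
apply: rint_sub; [exact: mI|exact: mI|exact: (measurable_ja adm)|exact: (ja_ge0 adm)|].
by apply: subset_itvl; rewrite bnd_simp.
Qed.

(** The six hypotheses correspond to the six sources of error, each of which is allowed
    the same amount t. *)
Lemma density_budget (e0 eta e2 l N Er C d M kp A t : R) : 0 < d -> 0 < M -> 0 < l ->
  9 * e2 <= t -> 18 * l * N * Er <= t -> (1 + 16 * (16 * (9 * (C * K)))) * e0 <= t ->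
  16 * (9 * C) * kp / l * A <= t -> 8 * C * Er / M ^+ 2 <= t ->
  (10 + 8 * (C / d ^+ 2) + 8 * (C / M ^+ 2)) * eta <= t ->
  4 * (e0 + eta + 9 * (e2 + 2 * l * N * Er + eta) +
    (4 * (C / d ^+ 2) * (2 * (16 * K * (3 * d) ^+ 2 * e0) + 2 * (16 * K * (3 * d) ^+ 2 * e0) + 2 * eta +
       l^-1 * (4 * kp * ((3 * d) ^+ 2 * A))) +
     4 * (C / M ^+ 2) * (2 * Er + 2 * eta))) <= 24 * t.
Proof.
move=> d0 M0 l0 h1 h2 h3 h4 h5 h6.
rewrite (_ : 4 * _ = 4 * (9 * e2 + 18 * l * N * Er + (1 + 16 * (16 * (9 * (C * K)))) * e0 + 16 * (9 * C) * kp / l * A +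
  8 * C * Er / M ^+ 2 + (10 + 8 * (C / d ^+ 2) + 8 * (C / M ^+ 2)) * eta)); last first.
  by field; rewrite !gt_eqF.
move: h1 h2 h3 h4 h5 h6.
move: (9 * e2) (18 * l * N * Er) (_ * e0) (_ * A) (_ / M ^+ 2) (_ * eta) => *; lra.
Qed.

(** u is approximated by cutoff times truncation of a mollification. The delicate region
    is d < |x| < 2 d, where the slope of the cutoff is 1/d. In Q1 and Q3 the Hardy
    inequality with k = 0 bounds the integral of d^-2 u^2 by the energy near the origin.
    No such inequality holds in Q2 and Q4, but there the weight is small, and the
    truncation makes the function bounded by a constant that does not depend on d. The
    parameters are chosen in the order N, l, d and M, w. *)
Lemma density u g h (eps : R) : grad_of u g h -> (energy al setT g h u < +oo)%E ->
  lim_at al 1 u 0 -> lim_at al (-1) u 0 -> 0 < eps ->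
  exists2 f, test_function (~` [set 0]) f &
    (energy al setT (fun x => g x - 'D_(@e1 R) f x)%R (fun x => h x - 'D_(@e2 R) f x)%R
       (fun x => u x - f x)%R <= eps%:E)%E.
Proof.
move=> G fin L1 L3 eps0.
have [mu_ mg mh] := grad_meas G.
have K0 := K_ge0 adm; have kap0 := kap_gt0 R.
have [C C0 HC] := @cut_D_sqr R.
pose Er := fine (energy al setT g h u).
have mD : measurable_fun [set: R * R] (dens g h u) by exact: measurable_dens.
have mDw : measurable_fun [set: R * R] (fun x => dens g h u x * wt x) by exact: measurable_funM.
have Dw0 x : 0 <= dens g h u x * wt x by rewrite mulr_ge0 ?dens_ge0.
have ErE : energy al setT g h u = Er%:E.
  by rewrite fineK// ge0_fin_numE//; apply: rint_ge0.
have Er0 : 0 <= Er by apply: fine_ge0; apply: rint_ge0.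
pose t := eps / 24; have t0 : 0 < t by rewrite divr_gt0.
(* [2 l N <= 1] is needed below, so N comes first: the level above which the
   energy density contributes at most eN *)
have h9 : 0 <= 9 :> R by [].
have [eN eN0 HeN] := choose_pos h9 t0.
have iD : lb2.-integrable [set: R * R] (EFin \o (fun x => dens g h u x * wt x)).
  apply/integrableP; split; first by apply/measurable_EFinP.
  by under eq_integral do rewrite /= ger0_norm//.
have [Nn HN] := @int_tail_sqr R _ _ lb2 _ _ _ mD iD eN0.
pose N : R := Nn%:R; have N0 : 0 <= N by exact: ler0n.
(* l is small against N only, and stays fixed while the radii shrink *)
have cl : 0 <= 2 * N + 18 * N * Er by rewrite addr_ge0// !mulr_ge0.
have m1t : 0 < Num.min 1 t by rewrite lt_min ltr01 t0.
have [l l0 Hl] := choose_pos cl m1t.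
have Hl1 : 2 * l * N <= 1.
  apply: (@le_trans _ _ ((2 * N + 18 * N * Er) * l)); last by apply: le_trans Hl _; rewrite ge_min lexx.
  by rewrite mulrAC ler_wpM2r ?(ltW l0)// lerDl !mulr_ge0.
have Hl2 : 18 * l * N * Er <= t.
  apply: (@le_trans _ _ ((2 * N + 18 * N * Er) * l)); last by apply: le_trans Hl _; rewrite ge_min lexx orbT.
  have -> : 18 * l * N * Er = 18 * N * Er * l by ring.
  by rewrite ler_wpM2r ?(ltW l0)// lerDr mulr_ge0.
(* the cutoffs act at the radii d = 1/M and M = n + 1, with n large in terms of l *)
have c0' : 0 <= 1 + 16 * (16 * (9 * (C * K))) by rewrite addr_ge0// !mulr_ge0.
have [e0 e00 He0] := choose_pos c0' t0.
pose A n := ball (3 / n.+1%:R) `|` far n.+1%:R.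
have mA n : measurable (A n) by apply: measurableU; [exact: measurable_ball|exact: measurable_far].
have [n1 Hn1] : exists N, forall n, (N <= n)%N -> (\int[lb2]_(x in A n) (dens g h u x * wt x)%:E <= e0%:E)%E.
  apply: int_shrink; [exact: mDw|exact: Dw0|exact: fin|exact: mA| |exact: e00].
  apply: aeS null_origin => x x0.
  have [N1 HN1] := large_index 3 x0; have [N2 HN2] := large_index (enorm x ^+ 2) x0.
  exists (maxn N1 N2) => n nN [xn|xn].
    by have := HN1 n (leq_trans (leq_maxl _ _) nN); rewrite leNgt xn.
  have := HN2 n (leq_trans (leq_maxr _ _) nN); rewrite ler_pdivrMr ?ltr0n// expr2 ler_pM2l// leNgt.
  by move/negP; apply.
have [e5 /andP[e50 e51] He5] : exists2 e, 0 < e < 1 & 16 * (9 * C) * kap R / l * fine (Af al e) <= t.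
  have c5 : 0 <= 16 * (9 * C) * kap R / l by rewrite divr_ge0 ?(ltW l0)// mulr_ge0 ?(ltW kap0)// !mulr_ge0.
  have [q q0 Hq] := choose_pos c5 t0; have [e e01 He] := Af_small adm q0.
  by exists e => //; apply: le_trans Hq; rewrite ler_wpM2l.
have [n2 Hn2] := large_index 3 e50.
have tC : 0 < t / (8 * C * (Er + 1) + 1) by rewrite divr_gt0// ltr_wpDl// !mulr_ge0 ?addr_ge0.
have [n3 Hn3] := large_index 1 tC.
pose n := maxn 1 (maxn n1 (maxn n2 n3)).
have nn1 : (n1 <= n)%N by rewrite /n !leq_max leqnn !orbT.
have nn2 : (n2 <= n)%N by rewrite /n !leq_max leqnn !orbT.
have nn3 : (n3 <= n)%N by rewrite /n !leq_max leqnn !orbT.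
have nn0 : (1 <= n)%N by rewrite /n !leq_max leqnn.
pose M : R := n.+1%:R; pose d : R := M^-1.
have M1 : 1 < M by rewrite ltr1n.
have M2 : 2 <= M by rewrite ler_nat.
have M0 : 0 < M by exact: lt_trans M1.
have d0 : 0 < d by rewrite invr_gt0.
have dM : 2 * d <= M.
  by rewrite /d ler_pdivrMr// (le_trans M2)// ler_peMl ?ltW.
have d3 : 3 * d <= e5 by exact: (Hn2 n nn2).
have d31 : 0 < 3 * d < 1 by rewrite mulr_gt0// (le_lt_trans d3).
(* w is chosen last: its error is multiplied by the slope 1/d of the cutoff *)
have ceta : 0 <= 10 + 8 * (C / d ^+ 2) + 8 * (C / M ^+ 2).
  have c1 : 0 <= C / d ^+ 2 by rewrite divr_ge0 ?sqr_ge0.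
  have c2 : 0 <= C / M ^+ 2 by rewrite divr_ge0 ?sqr_ge0.
  by rewrite addr_ge0 ?addr_ge0// mulr_ge0.
have [eta eta0 Heta] := choose_pos ceta t0.
have d40 : 0 < d / 4 by rewrite divr_gt0.
have sh : 2 * (d / 4) < 3 * M by move: d0 dM M0; lra.
have [w tw Hw] := approx_test adm G fin d40 sh eta0.
rewrite (_ : 2 * (d / 4) = d / 2) in Hw; last by field.
exists (appr w d M l); first exact: appr_test d0 dM l0 tw.
have m3 : 0 < M by [].
have e5R : fine (Af al (3 * d)) <= fine (Af al e5).
  have r1 : 3 * d <= 1 by case/andP : d31 => _ /ltW.
  by rewrite -lee_fin (Af_fineK adm r1) (Af_fineK adm (ltW e51)) Af_le.
have H4 : 16 * (9 * C) * kap R / l * fine (Af al (3 * d)) <= t.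
  by apply: le_trans He5; rewrite ler_wpM2l// divr_ge0 ?(ltW l0)// mulr_ge0 ?(ltW kap0)// !mulr_ge0.
have H5 : 8 * C * Er / M ^+ 2 <= t.
  have Md : M^-1 <= t / (8 * C * (Er + 1) + 1).
    by have := Hn3 n nn3; rewrite mul1r.
  have q0 : 0 < 8 * C * (Er + 1) + 1 by rewrite ltr_wpDl// !mulr_ge0 ?addr_ge0.
  apply: (@le_trans _ _ (8 * C * Er * M^-1)).
    rewrite ler_wpM2l ?mulr_ge0// lef_pV2 ?posrE ?exprn_gt0// expr2 ler_peMl// ltW//.
  apply: (@le_trans _ _ (8 * C * Er * (t / (8 * C * (Er + 1) + 1)))); first by rewrite ler_wpM2l// !mulr_ge0.
  rewrite mulrCA ler_piMr ?(ltW t0)// ler_pdivrMr// mul1r.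
  have : 0 <= 8 * C by rewrite mulr_ge0.
  by move=> C8; rewrite mulrDr mulr1 -addrA lerDl addr_ge0.
have d301 : 0 < 3 * d <= 1 by case/andP : d31 => -> /ltW ->.
have bA : ball (3 * d) `<=` A n by move=> x xd; left.
have mball : measurable (ball (3 * d)) by exact: measurable_ball.
have s0 : small lb2 (S0 u g h d M) e0.
  apply: small_indic; [exact: mA n|exact: mDw|exact: Dw0|exact: Hn1].
pose Dd := dens (fun x => g x - 'D_(@e1 R) w x) (fun x => h x - 'D_(@e2 R) w x) (fun x => u x - w x).
have mg' : measurable_fun [set: R * R] (fun x => g x - 'D_(@e1 R) w x).
  by apply: measurable_funB => //; exact: test_measurable (test_D1 tw).
have mh' : measurable_fun [set: R * R] (fun x => h x - 'D_(@e2 R) w x).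
  by apply: measurable_funB => //; exact: test_measurable (test_D2 tw).
have mu' : measurable_fun [set: R * R] (fun x => u x - w x).
  by apply: measurable_funB => //; exact: test_measurable tw.
have mDd : measurable_fun [set: R * R] (fun x => Dd x * wt x).
  by apply: measurable_funM => //; exact: measurable_dens.
have Dd0 x : 0 <= Dd x * wt x by rewrite mulr_ge0 ?dens_ge0.
have s1 : small lb2 (S1 u g h w d M) eta.
  by apply: small_indic; [exact: measurable_shell|exact: mDd|exact: Dd0|exact: Hw].
have s2 : small lb2 (S2 u g h N) eN.
  have m2 : measurable_fun [set: R * R] (S2 u g h N).
    apply: measurable_funM => //.
    rewrite (_ : (fun x : R * R => (N < dens g h u x)%R%:R) = (fun x : R * R => if (N < dens g h u x)%R then 1 else 0)); last first.
      by apply/funext => x; case: ifP.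
    by apply: measurable_fun_ifT => //; exact: measurable_fun_ltr.
  split; [exact: m2|by move=> x; rewrite mulr_ge0|].
  apply: le_trans HN; rewrite le_eqVlt; apply/orP; left; apply/eqP; apply: eq_integral => x _.
  by rewrite /S2 ger0_norm// ger0_norm// dens_ge0.
have s3 : small lb2 (S3 u g h) Er.
  by split; [exact: mDw|exact: Dw0|rewrite -ErE].
have s4 s : s ^+ 2 = 1 -> lim_at al s u 0 -> small lb2 (S4 u d s) (16 * K * (3 * d) ^+ 2 * e0).
  move=> ss L; apply: small_indic.
  - exact: measurable_ann.
  - by apply: measurable_funM => //; exact: measurable_funX.
  - by move=> x; rewrite mulr_ge0 ?sqr_ge0.
  have := hardy_lim adm ss G fin L d31.
  rewrite (_ : (\int[lb2]_(x in _) _)%E = (\int[lb2]_(x in ann s 0 (3 * d)) (u x ^+ 2 * wt x)%:E)%E); last first.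
    by apply: eq_integral => x _; rewrite subr0.
  move=> H; apply: le_trans H _; rewrite lee_fin ler_wpM2l//.
    by rewrite mulr_ge0 ?sqr_ge0// mulr_ge0.
  rewrite -lee_fin -(sEE adm s G fin); apply: le_trans (Hn1 n nn1).
  apply: (@le_trans _ _ (\int[lb2]_(x in ann s 0 (3 * d)) (dens g h u x * wt x)%:E)%E).
    apply: rint_le; [exact: measurable_ann|exact: (measurable_gdensw adm mg mh)|exact: mDw| | ].
    - by move=> x; rewrite mulr_ge0 ?gdens_ge0.
    - by move=> x _; rewrite ler_wpM2r// /gdens /dens lerDl sqr_ge0.
  apply: rint_sub; [exact: measurable_ann|exact: mA n|exact: mDw|exact: Dw0|].
  by move=> x [_ /andP[_ xd]]; exact: bA.
have s5 : small lb2 (S5 d) (4 * kap R * ((3 * d) ^+ 2 * fine (Af al (3 * d)))).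
  apply: small_indic; [exact: mball|exact: measurableT_comp (al_meas adm) (@measurable_enorm R)|
    by move=> x; exact: (al_ge0 adm)|exact: Af_ball].
have one1 : 1 ^+ 2 = 1 :> R by rewrite expr1n.
have oneN : (-1) ^+ 2 = 1 :> R by rewrite sqrrN expr1n.
have cd0 : 0 <= 4 * (C / d ^+ 2) by rewrite mulr_ge0// divr_ge0 ?sqr_ge0.
have cM0 : 0 <= 4 * (C / M ^+ 2) by rewrite mulr_ge0// divr_ge0 ?sqr_ge0.
have cl0 : 0 <= 2 * l * N by rewrite !mulr_ge0// ltW.
have h2 : 0 <= 2 :> R by [].
have h4 : 0 <= 4 :> R by [].
have il0 : 0 <= l^-1 by rewrite invr_ge0 ltW.
have a3 := smallZ h9 (smallD (smallD s2 (smallZ cl0 s3)) s1).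
have a4 := smallZ cd0 (smallD (smallD (smallD (smallZ h2 (s4 _ one1 L1)) (smallZ h2 (s4 _ oneN L3))) (smallZ h2 s1)) (smallZ il0 s5)).
have a5 := smallZ cM0 (smallD (smallZ h2 s3) (smallZ h2 s1)).
have tot := smallZ h4 (smallD (smallD (smallD s0 s1) a3) (smallD a4 a5)).
have ta0 := appr_test d0 dM l0 tw.
have ta : testT (appr w d M l) by case: ta0 => sf cf _; split.
have ma : measurable_fun [set: R * R] (appr w d M l) := test_measurable ta.
have mE : measurable_fun [set: R * R] (fun x => dens (fun x => g x - 'D_(@e1 R) (appr w d M l) x)
   (fun x => h x - 'D_(@e2 R) (appr w d M l) x) (fun x => u x - appr w d M l x) x * wt x).
  apply: measurable_funM => //; apply: measurable_dens.
  - exact: measurable_funB mu_ ma.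
  - exact: measurable_funB mg (test_measurable (test_D1 ta)).
  - exact: measurable_funB mh (test_measurable (test_D2 ta)).
have pw := @appr_dens u g h w d M l N C d0 dM l0 N0 Hl1 tw C0 HC.
have E0 x : 0 <= dens (fun x => g x - 'D_(@e1 R) (appr w d M l) x)
   (fun x => h x - 'D_(@e2 R) (appr w d M l) x) (fun x => u x - appr w d M l x) x * wt x.
  by rewrite mulr_ge0 ?dens_ge0.
have tE : 24 * t = eps by rewrite /t mulrC divfK.
have bud := density_budget d0 M0 l0 HeN Hl2 He0 H4 H5 Heta.
rewrite -lee_fin tE in bud; apply: le_trans bud.
by apply: small_le tot; [exact: mE|exact: E0|exact: pw].
Qed.

End density.

(** * Weak derivatives from difference quotients *)

Section difference_quotient.
Context (R : realType).
Implicit Types (x y : R * R) (s : R).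
Local Notation mu := (@lebesgue_measure R).
Local Notation lb2 := (@leb2 R).

Lemma Rint_dct (F : nat -> R * R -> R) (f G : R * R -> R) :
  (forall n, measurable_fun [set: R * R] (F n)) -> int1 f -> int1 G ->
  {ae lb2, forall x, F ^~ x @ \oo --> f x} -> {ae lb2, forall x, forall n, `|F n x| <= G x} ->
  (fun n => (\int[lb2]_x F n x)%R) @ \oo --> (\int[lb2]_x f x)%R.
Proof.
move=> mF if_ iG cF dF.
have mf := int1_mf if_.
have [] := @dominated_convergence _ _ _ lb2 setT measurableT (fun n => EFin \o F n) (EFin \o f) (EFin \o G).
- by move=> n; apply/measurable_EFinP; exact: mF n.
- by apply/measurable_EFinP; exact: mf.
- by apply: aeS cF => x Fx _; apply: cvg_EFin => //; exact: nearW.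
- exact: iG.
- by apply: aeS dF => x H n _ /=; rewrite lee_fin.
move=> _ _; rewrite -[X in _ --> X]fineK; last exact: integrable_fin_num.
exact: fine_cvg.
Qed.

Lemma derive_seq (v x : R * R) (u : R * R -> R) : derivable u x v ->
  (fun n : nat => n.+1%:R * (u (n.+1%:R^-1 *: v + x) - u x)) @ \oo --> 'D_v u x.
Proof.
move=> du; have /cvgr_dnbhsP/(_ (fun n => n.+1%:R^-1)) : (fun h : R => h^-1 *: (u (h *: v + x) - u x)) @ 0^' --> 'D_v u x by exact: du.
have -> : (fun n : nat => n.+1%:R * (u (n.+1%:R^-1 *: v + x) - u x)) =
  (fun n : nat => (n.+1%:R^-1)^-1 *: (u (n.+1%:R^-1 *: v + x) - u x)).
  by apply/funext => n; rewrite invrK.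
by apply; split => [n|]; [rewrite invr_eq0 pnatr_eq0|exact: cvg_harmonic].
Qed.

Lemma derive_bound (v x : R * R) (u : R * R -> R) (c : R) : derivable u x v ->
  (\forall n \near \oo, n.+1%:R * `|u (n.+1%:R^-1 *: v + x) - u x| <= c) -> `|'D_v u x| <= c.
Proof.
move=> du H; apply: (cvgr_to_le (cvg_norm (derive_seq du))).
by apply: filterS H => n; rewrite normrM normr_nat.
Qed.

Section weak.
Variables (v : R * R) (u G : R * R -> R) (D : set (R * R)) (B : R).
Hypotheses (av : axis v) (mu_ : measurable_fun [set: R * R] u) (uB : forall x, `|u x| <= B).
Hypotheses (mD : measurable D) (nD : {ae lb2, forall x, D x}) (dD : forall x, D x -> derivable u x v).
Hypotheses (mG : measurable_fun [set: R * R] G) (iG : forall M : R, int1 (fun x => G x * \1_(box M) x)).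
Hypothesis HG : forall x (h : R), D x -> 0 < h <= 1 -> `|u (h *: v + x) - u x| <= h * G x.

(** The classical directional derivative where it is known to exist. *)
Definition ae_derive x : R := if x \in D then 'D_v u x else 0.

Let dq (n : nat) x := n.+1%:R * (u (n.+1%:R^-1 *: v + x) - u x).

Let mush (z : R * R) : measurable_fun [set: R * R] (fun x => u (z + x)).
Proof.
rewrite (_ : (fun x => _) = u \o (fun x => x + z)); last by apply/funext => x /=; rewrite addrC.
exact: measurableT_comp (measurable_shift z).
Qed.

Let mdq n : measurable_fun [set: R * R] (dq n).
Proof. by apply: measurable_funM => //; exact: measurable_funB (mush _) mu_. Qed.

Let dqG n x : D x -> `|dq n x| <= G x.
Proof.
move=> Dx; have h01 : 0 < (n.+1%:R^-1 : R) <= 1.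
  by rewrite invr_gt0 ltr0n/= invf_le1 ?ltr0n// ler1n.
have := HG Dx h01; rewrite /dq normrM normr_nat => H.
by rewrite -ler_pdivlMl// ltr0n.
Qed.

Lemma measurable_ae_derive : measurable_fun [set: R * R] ae_derive.
Proof.
rewrite (_ : ae_derive = ('D_v u) \_ D); last by apply/funext => x; rewrite patchE.
apply/(measurable_restrictT _ mD); apply: (@measurable_fun_cvg _ _ _ D dq).
  by move=> n; exact: measurable_funTS.
by move=> x Dx; exact: derive_seq (dD Dx).
Qed.

Lemma ae_derive_le x : `|ae_derive x| <= `|G x|.
Proof.
rewrite /ae_derive; case: ifP => [/set_mem Dx|_]; last by rewrite normr0.
by apply: (derive_bound (dD Dx)); apply: nearW => n; have := dqG n Dx; rewrite /dq normrM normr_nat => H; apply: le_trans H (ler_norm _).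
Qed.

Lemma L1loc_ae_derive : L1loc ae_derive.
Proof.
split; first exact: measurable_ae_derive.
move=> K cK; have [M [_ HM]] := compact_bounded cK.
have sK : K `<=` box (`|M| + 1).
  move=> x Kx; have /HM/(_ x Kx) : (`|M| + 1 > M) by rewrite (le_lt_trans (ler_norm _))// ltrDl.
  by rewrite /= prod_normE ge_max => /andP[].
have iGK : lb2.-integrable K (EFin \o (fun x => G x * \1_(box (`|M| + 1)) x)).
  by apply: integrableS (iG _) => //; exact: compact_measurable2.
apply: le_integrable iGK.
- exact: compact_measurable2.
- by apply: measurable_funTS; apply/measurable_EFinP; exact: measurable_ae_derive.
by move=> x Kx /=; rewrite lee_fin indicE mem_set ?mulr1; [exact: ae_derive_le|exact: sK].
Qed.

(** Move the difference quotient from the test function to u by translation, and pass to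
    the limit on both sides: uniformly for the test function, and by dominated
    convergence, with the majorant G, for u. *)
Lemma weak_deriv_ae : is_weak_deriv v u ae_derive.
Proof.
split; first exact: L1loc_ae_derive.
move=> phi tp; have tDp := axis_test av tp.
have B0 : 0 <= B := le_trans (normr_ge0 _) (uB 0).
have ub (f : R * R -> R) : int1 f -> int1 (fun x => u x * f x).
  by move=> if_; under eq_fun do rewrite mulrC; exact: int1Mb if_ mu_ uB.
have ub' (z : R * R) (f : R * R -> R) : int1 f -> int1 (fun x => u (z + x) * f x).
  by move=> if_; under eq_fun do rewrite mulrC; exact: int1Mb if_ (mush z) (fun x => uB _).
have i1 : int1 (fun x => u x * 'D_v phi x) by apply: ub; exact: int1_test.
have i2 : int1 (fun x => ae_derive x * phi x) by apply: L1loc_test => //; exact: L1loc_ae_derive.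
apply/int_eq_int1 => //.
have [M M0 bM] := test_bsupp tp; have [C C0 HC] := test_bounded tp.
have iGp : int1 (fun x => G x * \1_(box M) x * `|phi x|).
  by apply: (@int1Mb _ _ _ C) => // [|x]; [apply: measurableT_comp => //; exact: test_measurable tp|rewrite normr_id].
have cJ : (fun n => (\int[lb2]_x (dq n x * phi x))%R) @ \oo --> (\int[lb2]_x (ae_derive x * phi x))%R.
  apply: Rint_dct i2 iGp _ _.
  - by move=> n; apply: measurable_funM (mdq n) (test_measurable tp).
  - apply: aeS nD => x Dx; apply: cvgMl; rewrite /ae_derive mem_set//; exact: derive_seq (dD Dx).
  - apply: aeS nD => x Dx n; rewrite normrM indicE.
    have [->|px] := eqVneq (phi x) 0; first by rewrite normr0 !mulr0.
    by rewrite mem_set ?mulr1; [rewrite ler_wpM2r// dqG|exact: bM].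
have [T [L [T0 L0 HT]]] := test_taylor_box av tp.
have iL := int1_indic_box L.
pose I := (\int[lb2]_x (u x * 'D_v phi x))%R.
have key (n : nat) : `|I + (\int[lb2]_x (dq n x * phi x))%R| <= B * T * (\int[lb2]_x (\1_(box L) x : R))%R * n.+1%:R^-1.
  pose s : R := n.+1%:R^-1; pose N : R := n.+1%:R.
  have N0 : 0 < N by rewrite ltr0n.
  have sN : N * s = 1 by rewrite divff// gt_eqF.
  have s0 : 0 < s by rewrite invr_gt0.
  have s1 : `|- s| <= 1 by rewrite normrN gtr0_norm// invf_le1// ler1n.
  have tps : test_function [set: R * R] (fun x => phi (- s *: v + x)) by exact: test_transl.
  have j1 := ub _ (int1_test tp); have j2 := ub _ (int1_test tps).
  have j3 := ub' (s *: v) _ (int1_test tp).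
  have E0 : (\int[lb2]_x (u (s *: v + x) * phi x))%R = (\int[lb2]_x (u x * phi (- s *: v + x)))%R.
    rewrite -(Rint_shift (s *: v) j2); apply: eq_Rintegral => x _; rewrite (addrC x).
    by rewrite scaleNr addKr.
  have E1 : (\int[lb2]_x (dq n x * phi x))%R = N * ((\int[lb2]_x (u x * phi (- s *: v + x)))%R - (\int[lb2]_x (u x * phi x))%R).
    rewrite -E0 -RintegralB// -RintegralZl//; last exact: int1B.
    by apply: eq_Rintegral => x _; rewrite /dq -mulrBl mulrA.
  have j4 := int1Z N (int1B j2 j1).
  have E2 : I + (\int[lb2]_x (dq n x * phi x))%R = (\int[lb2]_x (u x * 'D_v phi x + N * (u x * phi (- s *: v + x) - u x * phi x)))%R.
    by rewrite RintegralD// RintegralZl ?RintegralB// ?E1//; exact: int1B.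
  rewrite E2 mulrAC -RintegralZl//; apply: le_Rint; first exact: int1Z.
    exact: (int1_mf (int1D i1 j4)).
  have alg (m r a b p q : R) : m * r = 1 -> a * b + m * (a * p - a * q) = m * a * (p - q - - r * b).
    move=> mr; have -> : m * a * (p - q - - r * b) = m * r * (a * b) + m * (a * p - a * q) by ring.
    by rewrite mr mul1r.
  have alg2 (m r b : R) : m * r = 1 -> m * B * (T * (r * r) * b) = B * T * r * b.
    by move=> mr; have -> : m * B * (T * (r * r) * b) = B * T * (m * r) * r * b; [ring|rewrite mr mulr1].
  move=> x; have := HT x (- s) s1.
  rewrite (_ : u x * _ + _ = N * u x * (phi (- s *: v + x) - phi x - - s * 'D_v phi x)); last first.
    exact: alg.
  move=> H; rewrite normrM normrM gtr0_norm//.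
  apply: (@le_trans _ _ (N * B * (T * (- s) ^+ 2 * \1_(box L) x))).
    by apply: ler_pM => //; [rewrite mulr_ge0// ltW|rewrite ler_wpM2l// ltW].
  rewrite le_eqVlt; apply/orP; left; apply/eqP; rewrite sqrrN expr2.
  exact: alg2.
have c0 : (fun n => I + (\int[lb2]_x (dq n x * phi x))%R) @ \oo --> 0.
  apply: norm_cvg0; apply: (@squeeze_cvgr _ _ _ _ (cst 0) (fun n => B * T * (\int[lb2]_x (\1_(box L) x : R))%R * n.+1%:R^-1)).
  - by apply: nearW => n; rewrite normr_ge0/= key.
  - exact: cvg_cst.
  - by rewrite -[X in _ --> X](mulr0 (B * T * (\int[lb2]_x (\1_(box L) x : R))%R)); apply: cvgMr; exact: cvg_harmonic.
have c1 : (fun n => I + (\int[lb2]_x (dq n x * phi x))%R) @ \oo --> I + (\int[lb2]_x (ae_derive x * phi x))%R.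
  by apply: cvgD cJ; exact: cvg_cst.
by apply/eqP; rewrite -addr_eq0; apply/eqP; exact: (cvg_unique (@norm_hausdorff _ _) c1 c0).
Qed.

End weak.
End difference_quotient.

(** * Lipschitz bounds for psi0 *)

Section psi0_geometry.
Context (R : realType).
Implicit Types (x y v : R * R) (h : R).
Local Notation lb2 := (@leb2 R).

(** The l1 norm of the positive part of x: then psi = min (1, quad / |x|), a formula
    without cases, see [psiE]. *)
Definition quad x : R := Num.max x.1 0 + Num.max x.2 0.
Definition cone x : R := Num.max (1 - enorm x ^+ 2) 0.

Lemma enorm_axis v h x : axis v -> `|enorm (h *: v + x) - enorm x| <= `|h|.
Proof.
move=> av; have tri y k : enorm (k *: v + y) <= enorm y + `|k|.
  rewrite -ler_sqr ?nnegrE ?addr_ge0 ?enorm_ge0// sqrrD !enorm_sqr real_normK ?num_real//.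
  have [y1 y2] := norm_le_enorm y.
  have key (a : R) : `|a| <= enorm y -> k * a <= enorm y * `|k|.
    by move=> ay; apply: (le_trans (ler_norm _)); rewrite normrM mulrC ler_wpM2r.
  have := key _ y1; have := key _ y2; rewrite /nsq.
  by case: av => -> /=; rewrite /e1 /e2 /GRing.scale /= ?mulr0 ?mulr1 ?add0r !sqrrD;
    move: (enorm y * _) (y.1 ^+ 2) (y.2 ^+ 2) (k ^+ 2) => *; lra.
rewrite ler_norml; apply/andP; split.
  have := tri (h *: v + x) (- h); rewrite scaleNr addKr normrN.
  by move: (enorm (h *: v + x)) (enorm x) `|h| => *; lra.
by rewrite lerBlDl; exact: tri.
Qed.

Lemma quad_axis v h x : axis v -> `|quad (h *: v + x) - quad x| <= `|h|.
Proof.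
have key (a b : R) : `|Num.max (a + b) 0 - Num.max b 0| <= `|a|.
  rewrite ler_norml; have := ler_norm a; have := ler_norm (- a); rewrite normrN.
  by move=> ? ?; apply/andP; split; case: (leP (a + b) 0) => ?; case: (leP b 0) => ?; lra.
move=> [->|->]; rewrite /quad /e1 /e2 /= ?scaler0 ?[_%:A]mulr1 ?add0r opprD addrACA subrr.
  by rewrite addr0.
by rewrite add0r.
Qed.

Lemma quad_ge0 x : 0 <= quad x.
Proof. by rewrite addr_ge0// le_max lexx orbT. Qed.

Lemma quad_le x : quad x <= 2 * enorm x.
Proof.
have [x1 x2] := norm_le_enorm x; have := enorm_ge0 x.
have := ler_norm x.1; have := ler_norm x.2; rewrite /quad.
by move=> ? ? ?; case: (leP x.1 0) => ?; case: (leP x.2 0) => ?; lra.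
Qed.

Lemma psiE x : psi x = Num.min 1 (quad x / enorm x).
Proof.
have [x1 x2] := norm_le_enorm x; have x0 := enorm_ge0 x.
rewrite /psi /quad; case: ifPn => [/set_mem[p1 p2]|n1].
  have p : 0 < enorm x by apply: lt_le_trans x1; rewrite normr_gt0 gt_eqF.
  apply/esym/min_idPl; rewrite ler_pdivlMr// mul1r (max_idPl (ltW p1)) (max_idPl p2).
  rewrite -ler_sqr ?nnegrE ?addr_ge0 ?(ltW p1)// enorm_sqr /nsq sqrrD.
  have : 0 <= x.1 * x.2 by rewrite mulr_ge0// ltW.
  by move: (x.1 * _) (_ ^+ 2) (_ ^+ 2) => *; lra.
case: ifPn => [/set_mem[p1 p2]|n2].
  have p : 0 < enorm x by apply: lt_le_trans x2; rewrite normr_gt0 gt_eqF.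
  rewrite (max_idPr p1) (max_idPl (ltW p2)) add0r; apply/esym/min_idPr.
  by rewrite ler_pdivrMr// mul1r (le_trans (ler_norm _)).
case: ifPn => [/set_mem[p1 p2]|n3].
  have p : 0 < enorm x by apply: lt_le_trans x2; rewrite normr_gt0 lt_eqF.
  rewrite (max_idPr (ltW p2)) (max_idPl p1) addr0; apply/esym/min_idPr.
  by rewrite ler_pdivrMr// mul1r (le_trans (ler_norm _)).
have [q1 q2] : x.1 <= 0 /\ x.2 <= 0.
  split; rewrite leNgt; apply/negP => p.
    have [r|r] := leP 0 x.2; first by move/negP: n1; apply; exact/mem_set.
    by move/negP: n3; apply; apply/mem_set; split => //; exact: ltW.
  have [r|r] := ltP 0 x.1; first by move/negP: n1; apply; apply/mem_set; split => //; exact: ltW.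
  by move/negP: n2; apply; exact/mem_set.
by rewrite (max_idPr q1) (max_idPr q2) addr0 mul0r; apply/esym/min_idPr.
Qed.

Lemma psi_ge0 x : 0 <= psi x.
Proof. by rewrite psiE le_min ler01 divr_ge0 ?quad_ge0 ?enorm_ge0. Qed.

Lemma psi_le1 x : psi x <= 1.
Proof. by rewrite psiE ge_min lexx. Qed.

(** psi is homogeneous of degree 0, which accounts for the factor 1/|x|. The minimum is
    1-Lipschitz, and the quotient is compared with a common denominator. *)
Lemma psi_axis v h x : axis v -> 0 < enorm x -> `|psi (h *: v + x) - psi x| <= `|h| * (3 / enorm x).
Proof.
move=> av x0; set y := h *: v + x.
have yx := enorm_axis h x av; have qyx := quad_axis h x av; rewrite -/y in yx qyx.
have y0 := enorm_ge0 y; have q0 := quad_ge0 y; have q2 := quad_le y.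
rewrite mulrA ler_pdivlMr//; have [yE|yp] := eqVneq (enorm y) 0.
  have hx : enorm x <= `|h| by move: yx; rewrite yE sub0r normrN gtr0_norm.
  have px : `|psi y - psi x| <= 1.
    have := psi_ge0 x; have := psi_le1 x; have := psi_ge0 y; have := psi_le1 y.
    by rewrite ler_norml => *; apply/andP; split; lra.
  have h0 : 0 <= `|h| by [].
  by apply: (@le_trans _ _ (1 * enorm x)); [rewrite ler_wpM2r// ltW|rewrite mul1r; move: hx h0; move: `|h| => *; lra].
have y1 : 0 < enorm y by rewrite lt_neqAle eq_sym yp.
have mn (a b : R) : `|Num.min 1 a - Num.min 1 b| <= `|a - b|.
  rewrite ler_norml; have := ler_norm (a - b); have := ler_norm (- (a - b)); rewrite normrN.
  by move=> ? ?; apply/andP; split; case: (leP 1 a) => ?; case: (leP 1 b) => ?; lra.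
rewrite !psiE; apply: (@le_trans _ _ (`|quad y / enorm y - quad x / enorm x| * enorm x)).
  by rewrite ler_wpM2r// ltW.
rewrite -[X in _ * X]gtr0_norm// -normrM.
have -> : (quad y / enorm y - quad x / enorm x) * enorm x =
    (quad y - quad x) - (quad y / enorm y) * (enorm y - enorm x).
  by field; rewrite !gt_eqF.
apply: (le_trans (ler_normB _ _)); rewrite (_ : `|h| * 3 = `|h| + 2 * `|h|); last by ring.
apply: lerD => //; rewrite normrM; apply: ler_pM => //.
by rewrite ger0_norm ?divr_ge0// ler_pdivrMr.
Qed.

Lemma cone_ge0 x : 0 <= cone x. Proof. by rewrite le_max lexx orbT. Qed.

Lemma cone_le1 x : cone x <= 1.
Proof. by rewrite ge_max ler01 andbT gerBl sqr_ge0. Qed.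

Lemma cone_out x : 1 <= enorm x -> cone x = 0.
Proof. by move=> x1; apply/max_idPr; rewrite subr_le0 exprn_ege1. Qed.

Lemma cone_in x : enorm x < 1 -> cone x = 1 - enorm x ^+ 2.
Proof. by move=> x1; apply/max_idPl; rewrite subr_ge0 expr_le1 ?enorm_ge0// ltW. Qed.

(** As a function of |x| the profile is 2-Lipschitz. *)
Lemma cone_axis v h x : axis v -> `|cone (h *: v + x) - cone x| <= `|h| * 2.
Proof.
move=> av; have := enorm_axis h x av; have := enorm_ge0 x; have := enorm_ge0 (h *: v + x).
rewrite /cone; move: (enorm _) (enorm x) => b a b0 a0 ab.
apply: (@le_trans _ _ (`|b - a| * 2)); last by rewrite ler_wpM2r.
wlog le_ab : a b b0 a0 {ab} / a <= b.
  move=> W; have [ab'|/ltW ba'] := leP a b; first exact: W.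
  by rewrite distrC [in leRHS]distrC; exact: W.
rewrite [in leRHS]ger0_norm ?subr_ge0// distrC.
have [a1|a1] := leP 1 a.
  rewrite !(max_idPr _) ?subrr ?normr0 ?mulr_ge0 ?subr_ge0// subr_le0 exprn_ege1//.
  exact: le_trans le_ab.
rewrite (max_idPl (_ : 0 <= 1 - a ^+ 2)); last by rewrite subr_ge0 expr_le1// ltW.
have [b1|b1] := leP 1 b.
  rewrite (max_idPr (_ : 1 - b ^+ 2 <= 0)); last by rewrite subr_le0 exprn_ege1.
  rewrite subr0 ger0_norm ?subr_ge0 ?expr_le1 ?(ltW a1)//.
  by apply: (@le_trans _ _ ((1 - a) * 2)); [nra|lra].
rewrite (max_idPl (_ : 0 <= 1 - b ^+ 2)); last by rewrite subr_ge0 expr_le1// ltW.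
have -> : 1 - a ^+ 2 - (1 - b ^+ 2) = (b - a) * (b + a) by ring.
by rewrite normrM ger0_norm ?subr_ge0// ler_wpM2l ?subr_ge0// ger0_norm ?addr_ge0//; lra.
Qed.

Lemma psi0_mul x : psi0 x = cone x * psi x. Proof. by []. Qed.

Lemma psi0_bd x : `|psi0 x| <= 1.
Proof.
by rewrite psi0_mul ger0_norm ?mulr_ge0 ?cone_ge0 ?psi_ge0// mulr_ile1 ?cone_ge0 ?psi_ge0 ?cone_le1 ?psi_le1.
Qed.

Lemma psi0_axis v h x : axis v -> 0 < enorm x ->
  `|psi0 (h *: v + x) - psi0 x| <= `|h| * (3 / enorm x + 2).
Proof.
move=> av x0; rewrite !psi0_mul; set y := h *: v + x.
have -> : cone y * psi y - cone x * psi x = cone y * (psi y - psi x) + (cone y - cone x) * psi x by ring.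
rewrite (le_trans (ler_normD _ _))// !normrM mulrDr; apply: lerD.
  apply: le_trans (psi_axis h av x0); rewrite ler_piMl// ger0_norm ?cone_ge0//; exact: cone_le1.
apply: le_trans (cone_axis h x av); rewrite ler_piMr// ger0_norm ?psi_ge0//; exact: psi_le1.
Qed.

Lemma psi_measurable : measurable_fun [set: R * R] (@psi R).
Proof.
rewrite (_ : @psi R = (fun x => Num.min 1 (quad x * (enorm x)^-1))); last by apply/funext => x; rewrite psiE.
apply: measurable_minr; first exact: measurable_cst.
apply: measurable_funM; last exact: measurableT_comp (@measurable_inv R) (@measurable_enorm R).
by apply: measurable_funD; apply: measurable_maxr; rewrite ?(measurable_fst, measurable_snd).
Qed.

Lemma cone_measurable : measurable_fun [set: R * R] cone.
Proof.
apply: measurable_maxr; last exact: measurable_cst.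
apply: measurable_funB; first exact: measurable_cst.
by apply: measurable_funX; exact: measurable_enorm.
Qed.

Lemma psi0_measurable : measurable_fun [set: R * R] (@psi0 R).
Proof. exact: measurable_funM cone_measurable psi_measurable. Qed.

End psi0_geometry.

(** * The gradient of psi0 *)

Section psi0_gradient.
Context (R : realType).
Implicit Types (x y v : R * R) (h : R).
Local Notation lb2 := (@leb2 R).
Local Notation mu := (@lebesgue_measure R).

(** The points where psi0 is classically differentiable for an evident reason. *)
Definition regular : set (R * R) := [set x | [/\ x.1 != 0, x.2 != 0 & enorm x != 1]].

Lemma regular_pos x : regular x -> 0 < enorm x.
Proof.
move=> [x1 _ _]; have [n1 _] := norm_le_enorm x; apply: lt_le_trans n1; by rewrite normr_gt0.
Qed.

Lemma measurable_regular : measurable regular.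
Proof.
have m0 : measurable [set~ (0 : R)] by exact: measurableC.
have mn : measurable [set x : R * R | enorm x \in `[1, 1]] by exact: measurable_enorm_itv.
rewrite (_ : regular = [set x | [set~ 0] x.1 /\ [set~ 0] x.2] `\` [set x : R * R | enorm x \in `[1, 1]]).
  by apply: measurableD => //; exact: measurable_coords.
apply/seteqP; split => x /=; rewrite /regular /= in_itv /= -eq_le.
  by move=> [/eqP x1 /eqP x2 xn]; split => //; apply/negP; rewrite eq_sym.
by move=> [[/eqP x1 /eqP x2] /negP xn]; split => //; rewrite eq_sym.
Qed.

Lemma ae_regular : {ae lb2, forall x, regular x}.
Proof.
have a1 : {ae lb2, forall x, x.1 != 0}.
  exists ([set 0] `*` [set: R]); split; first exact: measurableX.
    by rewrite /leb2 product_measure1E//= lebesgue_measure_set1 mul0e.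
  by move=> x /= /negP; rewrite negbK => /eqP x1; split.
have a2 : {ae lb2, forall x, x.2 != 0}.
  exists ([set: R] `*` [set 0]); split; first exact: measurableX.
    by rewrite /leb2 product_measure1E//= lebesgue_measure_set1 mule0.
  by move=> x /= /negP; rewrite negbK => /eqP x1; split.
suff a3 : {ae lb2, forall x, enorm x != 1} by apply: aeS (aeI a1 (aeI a2 a3)) => x [x1 [x2 x3]].
  pose S1 : set (R * R) := [set x | enorm x \in `[1, 1]].
  have mS : measurable S1 by exact: measurable_enorm_itv.
  exists S1; split => //; last first.
    by move=> x /= /negP; rewrite negbK => /eqP x1; rewrite /S1 /= x1 in_itv /= lexx.
  have i2 : 0 < 2 :> R by [].
  pose f (r : R) : R := \1_([set 1] : set R) r.
  have mf : measurable_fun [set: R] f by exact: measurable_indic.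
  have f0 r : 0 <= f r by [].
  have := radial i2 mf f0.
  rewrite [in X in _ = X](_ : (\int[mu]_(r in _) _)%E = 0%E); last first.
    rewrite (ae_eq_integral (cst 0%E)) ?integral0//.
    - by apply: measurable_funTS; apply/measurable_EFinP; apply: measurable_funM.
    - exists [set 1]; split => //; first exact: lebesgue_measure_set1.
      move=> r /= H; apply: contrapT => r1; apply: H => _; rewrite /f indicE memNset ?mul0r//.
  rewrite mule0 => E; apply/eqP; rewrite eq_le measure_ge0 andbT -E.
  have S12 : S1 `&` [set x | enorm x < 2] = S1.
  apply/seteqP; split => [x [] //|x x1]; split => //.
  by move: x1; rewrite /S1 /= in_itv /= => /andP[_ x1]; apply: le_lt_trans x1 _; rewrite ltr1n.
have mb : measurable [set x : R * R | enorm x < 2] by exact: (@measurable_enorm_itv R `]-oo, 2[).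
have E1 : (\int[lb2]_(x in [set x : R * R | (enorm x < 2)%R]) (\1_S1 x)%:E)%E = lb2 S1 by rewrite integral_indic// S12.
rewrite -E1 le_eqVlt; apply/orP; left; apply/eqP; apply: eq_integral => x _.
rewrite /f !indicE; congr (_%:R%:E); congr nat_of_bool; apply/idP/idP => /set_mem x1; apply/mem_set.
  by move: x1; rewrite /S1 /= in_itv /= -eq_le => /eqP.
by rewrite /S1 /= in_itv /= x1 lexx.
Qed.

Lemma derivable_enorm v x : axis v -> 0 < enorm x -> derivable (@enorm R) x v.
Proof.
move=> av x0.
have dn : is_derive x v (@nsq R) ('D_v (@nsq R) x).
  by apply: derivableP; apply: axis_derivable => // k; exact: Ck_nsq.
have s0 : 0 < nsq x by rewrite -enorm_sqr exprn_gt0.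
have D := is_derive_comp1 (is_derive1_sqrt s0) dn.
exact: (@ex_derive _ _ _ _ _ _ _ D).
Qed.

Lemma derivable_ratio v x (f : R * R -> R) : axis v -> 0 < enorm x -> smooth f ->
  derivable (fun y => f y / enorm y) x v.
Proof.
move=> av x0 sf; apply: derivableM; first exact: axis_derivable.
by apply: derivableV; [rewrite gt_eqF|exact: derivable_enorm].
Qed.

Lemma derivable_coneE v x : axis v -> derivable (fun y : R * R => 1 - nsq y) x v.
Proof.
move=> av; apply: derivableB; first exact: derivable_cst.
by apply: axis_derivable => // k; exact: Ck_nsq.
Qed.

Lemma derivable_cone v x : axis v -> enorm x != 1 -> derivable (@cone R) x v.
Proof.
move=> av x1; have [xl|xg|xE] := ltgtP (enorm x) 1.
- apply: (@near_eq_derivable _ _ _ (fun y : R * R => 1 - nsq y)); last exact: derivable_coneE.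
  by apply: filterS (near_enorm_lt xl) => y y1; rewrite cone_in// enorm_sqr.
- apply: near_eq_derivable (derivable_cst (0 : R) x v).
  by apply: filterS (near_enorm_gt xg) => y y1; rewrite cone_out// ltW.
- by rewrite xE eqxx in x1.
Qed.

Let near_fst_gt x (c : R) : c < x.1 -> \forall y \near x, c < y.1.
Proof.
have H : (fun y : R * R => y.1) @ x --> x.1 := @Ck_cts R 0 fst (@Ck_fst R 0) x.
exact: (cvgr_gt x.1 H). Qed.
Let near_fst_lt x (c : R) : x.1 < c -> \forall y \near x, y.1 < c.
Proof.
have H : (fun y : R * R => y.1) @ x --> x.1 := @Ck_cts R 0 fst (@Ck_fst R 0) x.
exact: (cvgr_lt x.1 H). Qed.
Let near_snd_gt x (c : R) : c < x.2 -> \forall y \near x, c < y.2.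
Proof.
have H : (fun y : R * R => y.2) @ x --> x.2 := @Ck_cts R 0 snd (@Ck_snd R 0) x.
exact: (cvgr_gt x.2 H). Qed.
Let near_snd_lt x (c : R) : x.2 < c -> \forall y \near x, y.2 < c.
Proof.
have H : (fun y : R * R => y.2) @ x --> x.2 := @Ck_cts R 0 snd (@Ck_snd R 0) x.
exact: (cvgr_lt x.2 H). Qed.

Lemma psi_Q1 x : 0 < x.1 -> 0 <= x.2 -> psi x = 1.
Proof. by move=> x1 x2; rewrite /psi mem_set. Qed.

Lemma psi_Q3 x : x.1 <= 0 -> x.2 <= 0 -> psi x = 0.
Proof.
move=> x1 x2; rewrite psiE /quad (max_idPr x1) (max_idPr x2) addr0 mul0r.
by apply/min_idPr.
Qed.

Lemma psi_Q2 x : x.1 <= 0 -> 0 < x.2 -> psi x = x.2 / enorm x.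
Proof.
move=> x1 x2; rewrite /psi memNset; last by move=> [y1 _]; rewrite ltNge x1 in y1.
by rewrite mem_set.
Qed.

Lemma psi_Q4 x : 0 <= x.1 -> x.2 < 0 -> psi x = x.1 / enorm x.
Proof.
move=> x1 x2; rewrite /psi memNset; last by move=> [_ y1]; rewrite leNgt x2 in y1.
by rewrite memNset ?mem_set//; move=> [_ y1]; rewrite ltNge (ltW x2) in y1.
Qed.

Lemma derivable_psi v x : axis v -> x.1 != 0 -> x.2 != 0 -> derivable (@psi R) x v.
Proof.
move=> av x1 x2.
have x0 : 0 < enorm x by have [n1 _] := norm_le_enorm x; apply: lt_le_trans n1; rewrite normr_gt0.
have [p1|p1|/eqP] := ltgtP x.1 0; last by rewrite (negbTE x1).
  have [p2|p2|/eqP] := ltgtP x.2 0; last by rewrite (negbTE x2).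
    apply: near_eq_derivable (derivable_cst (0 : R) x v).
    by apply: filterS2 (near_fst_lt p1) (near_snd_lt p2) => y y1 y2; rewrite psi_Q3// ltW.
  apply: near_eq_derivable (derivable_ratio av x0 (fun k => @Ck_snd R k)).
  by apply: filterS2 (near_fst_lt p1) (near_snd_gt p2) => y y1 y2; rewrite psi_Q2// ltW.
have [p2|p2|/eqP] := ltgtP x.2 0; last by rewrite (negbTE x2).
  apply: near_eq_derivable (derivable_ratio av x0 (fun k => @Ck_fst R k)).
  by apply: filterS2 (near_fst_gt p1) (near_snd_lt p2) => y y1 y2; rewrite psi_Q4// ltW.
apply: near_eq_derivable (derivable_cst (1 : R) x v).
by apply: filterS2 (near_fst_gt p1) (near_snd_gt p2) => y y1 y2; rewrite psi_Q1// ltW.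
Qed.

Lemma derivable_psi0 v x : axis v -> regular x -> derivable (@psi0 R) x v.
Proof.
by move=> av [x1 x2 xn]; apply: derivableM; [exact: derivable_cone|exact: derivable_psi].
Qed.

Lemma psi0_D_out v x : 1 < enorm x -> 'D_v (@psi0 R) x = 0.
Proof.
move=> x1; apply: (@derive_locally_cst _ _ 0).
by apply: filterS (near_enorm_gt x1) => y y1; rewrite psi0_mul cone_out ?mul0r// ltW.
Qed.

Lemma psi0_D_bd v x : axis v -> regular x -> `|'D_v (@psi0 R) x| <= 3 / enorm x + 2.
Proof.
move=> av rx; apply: (derive_bound (derivable_psi0 av rx)); apply: nearW => n.
rewrite -ler_pdivlMl ?ltr0n//; have := psi0_axis n.+1%:R^-1 av (regular_pos rx).
by rewrite [`|_^-1|]ger0_norm ?invr_ge0.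
Qed.

(** In the interior of Q1 psi is constant and only the profile varies; in Q3 psi0
    vanishes. This is where the finiteness of the energy needs the special shape of psi:
    the weight of Q1 and Q3 admits no gradient of order 1/|x|. *)
Lemma psi0_D_cone v x : axis v -> regular x -> x \in @Q1 R `|` @Q3 R -> `|'D_v (@psi0 R) x| <= 2.
Proof.
move=> av rx; rewrite inE => -[[x1 x2]|[x1 x2]]; have [n1 n2 n3] := rx; last first.
  rewrite (@derive_locally_cst _ _ 0) ?normr0//.
  have x2' : x.2 < 0 by rewrite lt_neqAle n2.
  by apply: filterS2 (near_fst_lt x1) (near_snd_lt x2') => y y1 y2; rewrite psi0_mul psi_Q3 ?mulr0// ltW.
have x2' : 0 < x.2 by rewrite lt_neqAle eq_sym n2.
rewrite (@near_eq_derive _ _ _ (@psi0 R) (@cone R)); last first.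
  by apply: filterS2 (near_fst_gt x1) (near_snd_gt x2') => y y1 y2; rewrite psi0_mul psi_Q1 ?mulr1// ltW.
apply: (derive_bound (derivable_cone av n3)); apply: nearW => n.
rewrite -ler_pdivlMl ?ltr0n//; have := cone_axis n.+1%:R^-1 x av.
by rewrite [`|_^-1|]ger0_norm ?invr_ge0.
Qed.

End psi0_gradient.

(** * The energy and the traces of psi0 *)

Section psi0_energy.
Context (R : realType).
Implicit Types (x y v : R * R) (s r : R).
Local Notation lb2 := (@leb2 R).
Local Notation mu := (@lebesgue_measure R).

Lemma sum3_le (p q r : R) : p <= 4 -> q <= 4 -> r <= 1 -> p + q + r <= 9.
Proof. by move=> *; lra. Qed.

Lemma sum3_le2 (p q r t : R) : p <= 25 * t -> q <= 25 * t -> r <= 1 -> 1 <= t -> p + q + r <= 51 * t.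
Proof. by move=> *; lra. Qed.

Let slope x : R := 3 / enorm x + 2.

Let mslope : measurable_fun [set: R * R] slope.
Proof.
apply: measurable_funD; last exact: measurable_cst.
by apply: measurable_funM => //; exact: measurableT_comp (@measurable_inv R) (@measurable_enorm R).
Qed.

Let slope0 x : 0 <= slope x.
Proof. by rewrite addr_ge0// divr_ge0 ?enorm_ge0. Qed.

(** 1/|x| is integrable in the plane near the origin, by polar coordinates. *)
Lemma slope_box (M : R) : int1 (fun x => (3 / enorm x + 2) * \1_(box M) x).
Proof.
pose e : R := 2 * `|M| + 1; have e0 : 0 < e by rewrite ltr_wpDl// mulr_ge0.
have mb := @measurable_box R M.
have mi : measurable_fun [set: R * R] (fun x => slope x * \1_(box M) x).
  by apply: measurable_funM => //; exact: measurable_indic.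
have i0 x : 0 <= slope x * \1_(box M) x by rewrite mulr_ge0.
apply/integrableP; split; first by apply/measurable_EFinP; exact: mi.
have mB : measurable [set x : R * R | enorm x < e] by exact: (@measurable_enorm_itv R `]-oo, e[).
apply: (@le_lt_trans _ _ (\int[lb2]_(x in [set x : R * R | (enorm x < e)%R]) (slope x)%:E)%E).
  rewrite [leRHS]integral_mkcond; apply: ge0_le_integral => //.
  - by apply/measurable_EFinP; apply: measurableT_comp => //; exact: mi.
  - by apply/(measurable_restrictT _ mB); apply: measurable_funTS; apply/measurable_EFinP; exact: mslope.
  move=> x _; rewrite /= (ger0_norm (i0 x)) patchE indicE; case: (boolP (x \in box M)) => [/set_mem xM|_]; last first.
    by rewrite mulr0; case: ifP; rewrite ?lee_fin.
  rewrite mem_set ?mulr1//=; case: xM => x1 x2; rewrite /e.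
  rewrite -ltr_sqr ?nnegrE ?enorm_ge0 ?(ltW e0)// enorm_sqr /nsq.
  have q1 : x.1 ^+ 2 <= M ^+ 2 by rewrite -real_normK ?num_real// -[leRHS]real_normK ?num_real// ler_sqr ?nnegrE// (le_trans x1) ?ler_norm.
  have q2 : x.2 ^+ 2 <= M ^+ 2 by rewrite -real_normK ?num_real// -[leRHS]real_normK ?num_real// ler_sqr ?nnegrE// (le_trans x2) ?ler_norm.
  have M0 : 0 <= `|M| by [].
  by rewrite sqrrD1 exprMn real_normK ?num_real//; nra.
have mh : measurable_fun [set: R] (fun r : R => 3 / `|r| + 2).
  apply: measurable_funD; last exact: measurable_cst.
  by apply: measurable_funM => //; exact: measurableT_comp (@measurable_inv R) (@normr_measurable R setT).
have h0 (r : R) : 0 <= 3 / `|r| + 2 by rewrite addr_ge0// divr_ge0.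
rewrite (_ : (\int[lb2]_(x in _) _)%E = (\int[lb2]_(x in [set x : R * R | (enorm x < e)%R]) (3 / `|enorm x| + 2)%:E)%E); last first.
  by apply: eq_integral => x _; rewrite ger0_norm ?enorm_ge0.
have k0 : (0 <= (4 * kap R)%:E)%E by rewrite lee_fin mulr_ge0// ltW// kap_gt0.
rewrite (radial e0 mh h0); apply: lte_mul_pinfty => //.
apply: (@le_lt_trans _ _ (\int[mu]_(r in `]0%R, e[) (cst (3 + 2 * e)%:E r))%E).
  apply: ge0_le_integral => //.
  - by move=> r; rewrite /= in_itv /= => /andP[r0 _]; rewrite lee_fin mulr_ge0// ltW.
  - by apply: measurable_funTS; apply/measurable_EFinP; exact: measurable_funM.
  - move=> r; rewrite /= in_itv /= => /andP[r0 re]; rewrite lee_fin gtr0_norm// mulrDl divfK ?gt_eqF//.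
    by rewrite lerD2l ler_wpM2l// ltW.
rewrite integral_cst//= lebesgue_measure_itv /= lte_fin e0 -EFinD -EFinM ltry.
by [].
Qed.

Definition psi0_d v : R * R -> R := ae_derive v (@psi0 R) (@regular R).

Lemma psi0_weak v : axis v -> is_weak_deriv v (@psi0 R) (psi0_d v).
Proof.
move=> av; apply: (@weak_deriv_ae R v (@psi0 R) slope (@regular R) 1) => //.
- exact: psi0_measurable.
- exact: psi0_bd.
- exact: measurable_regular.
- exact: ae_regular.
- by move=> x; exact: derivable_psi0.
- exact: slope_box.
- move=> x h rx /andP[h0 h1]; have := psi0_axis h av (regular_pos rx).
  by rewrite [`|h|]gtr0_norm.
Qed.

Lemma psi0_out x : 1 <= enorm x -> psi0 x = 0.
Proof. by move=> x1; rewrite psi0_mul cone_out ?mul0r. Qed.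

Lemma psi0_L1loc : L1loc (@psi0 R).
Proof.
apply: L1loc_int1; apply: (int1_le (@psi0_measurable R) _ (int1_indic_box 1)) => x.
have [x1|x1] := leP 1 (enorm x); first by rewrite psi0_out ?normr0.
rewrite indicE mem_set ?normr1 ?psi0_bd//.
by have [n1 n2] := norm_le_enorm x; split; [apply: le_trans n1 _|apply: le_trans n2 _]; exact: ltW.
Qed.

Lemma psi0_grad : grad_of (@psi0 R) (psi0_d (@e1 R)) (psi0_d (@e2 R)).
Proof.
by split; [exact: psi0_L1loc|exact: psi0_weak (@axis1 R)|exact: psi0_weak (@axis2 R)].
Qed.

Lemma psi0_d_out v x : 1 <= enorm x -> psi0_d v x = 0.
Proof.
move=> x1; rewrite /psi0_d /ae_derive; case: ifP => // /set_mem[_ _ xn].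
by apply: psi0_D_out; rewrite lt_neqAle eq_sym xn.
Qed.

Lemma psi0_d_cone v x : axis v -> x \in @Q1 R `|` @Q3 R -> psi0_d v x ^+ 2 <= 4.
Proof.
move=> av xQ; rewrite /psi0_d /ae_derive; case: ifP => [/set_mem rx|_]; last by rewrite expr0n.
rewrite -real_normK ?num_real// (_ : 4 = 2 ^+ 2 :> R); last by ring.
by rewrite ler_sqr ?nnegrE// psi0_D_cone.
Qed.

Lemma psi0_d_bd v x : axis v -> 0 < enorm x < 1 -> psi0_d v x ^+ 2 <= 25 / enorm x ^+ 2.
Proof.
move=> av /andP[x0 x1]; rewrite /psi0_d /ae_derive; case: ifP => [/set_mem rx|_]; last first.
  by rewrite expr0n divr_ge0 ?sqr_ge0.
rewrite -real_normK ?num_real// (_ : 25 = 5 ^+ 2 :> R); last by ring.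
rewrite -expr_div_n ler_sqr ?nnegrE ?divr_ge0 ?(ltW x0)//.
apply: le_trans (psi0_D_bd av rx) _; rewrite -lerBDl (_ : 5 / _ - _ = 2 / enorm x); last by field; rewrite gt_eqF.
by rewrite ler_peMr// invf_ge1// ltW.
Qed.

Variables (al : R -> R) (K : R).
Hypothesis adm : admissible al K.
Local Notation wt := (wt al).

(** Only the values of a on the open interval enter the weight: on the unit circle rho
    is 1. *)
Let profile r : R := 9 * (al r)^-1 + 51 * (al r / r ^+ 2).

Let profile0 r : 0 <= profile r.
Proof. by rewrite addr_ge0// mulr_ge0 ?invr_ge0 ?divr_ge0 ?sqr_ge0 ?(al_ge0 adm). Qed.

Let mprofile : measurable_fun [set: R] profile.
Proof.
apply: measurable_funD; apply: measurable_funM => //; first exact: (measurable_alV adm).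
apply: measurable_funM; first exact: (al_meas adm).
by apply: measurableT_comp (@measurable_inv R) _; exact: measurable_funX.
Qed.

Let g1 := psi0_d (@e1 R).
Let g2 := psi0_d (@e2 R).

Let psi0_dens x : dens g1 g2 (@psi0 R) x * wt x <= profile (enorm x) * (enorm x < 1)%R%:R.
Proof.
have w0 := wt_ge0 adm x; have a0 := al_gt0 adm (enorm x).
have [x1|x1] := ltP (enorm x) 1; last first.
  by rewrite /dens /g1 /g2 !psi0_d_out// psi0_out// expr0n /= !add0r mul0r mulr0.
rewrite mulr1; have [x0|x0] := eqVneq (enorm x) 0.
  have nr : (x \in @regular R) = false.
    by apply/negbTE/negP => /set_mem/regular_pos; rewrite x0 ltxx.
  rewrite /dens /g1 /g2 /psi0_d /ae_derive nr psi0_mul psiE x0 invr0 mulr0 (min_idPr ler01) mulr0.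
  by rewrite expr0n /= !add0r mul0r.
have xp : 0 < enorm x by rewrite lt_neqAle eq_sym x0 enorm_ge0.
have p1 : psi0 x ^+ 2 <= 1 by rewrite -real_normK ?num_real// expr_le1// psi0_bd.
have x01 : 0 < enorm x < 1 by rewrite xp.
rewrite /profile wtE; case: ifPn => xQ.
  apply: (@le_trans _ _ (9 * (al (enorm x))^-1)); last by rewrite lerDl mulr_ge0// divr_ge0 ?sqr_ge0// ltW.
  rewrite ler_wpM2r ?invr_ge0 ?(ltW a0)//.
  have q1 := psi0_d_cone (@axis1 R) xQ; have q2 := psi0_d_cone (@axis2 R) xQ.
  exact: sum3_le q1 q2 p1.
apply: (@le_trans _ _ (51 * (al (enorm x) / enorm x ^+ 2))); last by rewrite lerDr mulr_ge0// invr_ge0 ltW.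
have -> : 51 * (al (enorm x) / enorm x ^+ 2) = 51 * (enorm x ^+ 2)^-1 * al (enorm x) by rewrite mulrA mulrAC.
apply: ler_wpM2r; first exact: ltW.
have p2 : 1 <= (enorm x ^+ 2)^-1 by rewrite invf_ge1 ?exprn_gt0// expr_le1// ltW.
have q1 := psi0_d_bd (@axis1 R) x01; have q2 := psi0_d_bd (@axis2 R) x01.
exact: sum3_le2 q1 q2 p1 p2.
Qed.

(** In Q1 and Q3 the density is bounded, in Q2 and Q4 it is of order 1/|x|^2. In polar
    coordinates the two bounds become the integrals of r/al and al/r. *)
Lemma psi0_energy : (energy al setT g1 g2 (@psi0 R) < +oo)%E.
Proof.
have [mp m1 m2] := grad_meas psi0_grad.
have mi : measurable_fun [set: R * R] (fun x => profile (enorm x) * (enorm x < 1)%R%:R).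
  apply: measurable_funM; first exact: measurableT_comp mprofile (@measurable_enorm R).
  rewrite (_ : (fun x : R * R => (enorm x < 1)%R%:R) = (fun x : R * R => if enorm x < 1 then 1 else 0)); last first.
    by apply/funext => x; case: ifP.
  by apply: measurable_fun_ifT => //; apply: measurable_fun_ltr => //; exact: measurable_enorm.
have mB : measurable [set x : R * R | enorm x < 1] by exact: (@measurable_enorm_itv R `]-oo, 1[).
apply: (@le_lt_trans _ _ (\int[lb2]_x (profile (enorm x) * (enorm x < 1)%R%:R)%:E)%E).
  apply: rint_le; [exact: measurableT| |exact: mi| |by move=> x _; exact: psi0_dens].
    exact: (measurable_funM (measurable_dens mp m1 m2) (measurable_wt adm)).
  by move=> x; rewrite mulr_ge0 ?dens_ge0 ?(wt_ge0 adm).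
rewrite (_ : (\int[lb2]_x _)%E = (\int[lb2]_(x in [set x : R * R | (enorm x < 1)%R]) (profile (enorm x))%:E)%E); last first.
  rewrite [RHS]integral_mkcond; apply: eq_integral => x _; rewrite patchE; case: ifPn => [/set_mem /= ->|/negP xn].
    by rewrite mulr1.
  by case: ltP => [x1|_]; [case: xn; exact/mem_set|rewrite mulr0].
apply: disc_radial_lt; [exact: mprofile|exact: profile0|].
have mI : measurable (`]0%R, 1%R[ : set R) by exact: measurable_itv.
pose q r : R := 9 * (r / al r) + 51 * (al r / r).
have mra := measurable_r_al adm; have mar := measurable_al_r adm.
rewrite (_ : (\int[mu]_(r in _) _)%E = (\int[mu]_(r in `]0%R, 1%R[) ((9 * (r / al r))%:E + (51 * (al r / r))%:E))%E); last first.
  apply: eq_integral => r; rewrite inE /= in_itv /= => /andP[r0 r1]; rewrite -EFinD; congr (_%:E).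
  by rewrite /profile; field; rewrite !gt_eqF// (al_gt0 adm).
have rI r : `]0%R, 1%R[%classic r -> 0 < r by rewrite /= in_itv /= => /andP[].
rewrite ge0_integralD//; last 4 first.
- by move=> r /rI r0; rewrite lee_fin mulr_ge0// divr_ge0 ?(ltW r0) ?(al_ge0 adm).
- by apply: measurable_funTS; apply/measurable_EFinP; exact: measurable_funM.
- by move=> r /rI r0; rewrite lee_fin mulr_ge0// divr_ge0 ?(ltW r0) ?(al_ge0 adm).
- by apply: measurable_funTS; apply/measurable_EFinP; exact: measurable_funM.
have Z (c : R) (f : R -> R) : 0 <= c -> measurable_fun [set: R] f -> (forall r, 0 < r -> 0 <= f r) ->
    (\int[mu]_(r in `]0%R, 1%R[) (f r)%:E < +oo)%E -> (\int[mu]_(r in `]0%R, 1%R[) (c * f r)%:E < +oo)%E.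
  move=> c0 mf f0 H; under eq_integral do rewrite EFinM; rewrite ge0_integralZl//.
  - by rewrite lte_mul_pinfty// lee_fin.
  - by apply: measurable_funTS; exact/measurable_EFinP.
  - by move=> r /rI r0; rewrite lee_fin f0.
apply: lte_add_pinfty.
  apply: Z => //; last exact: (al_intV adm).
  by move=> r r0; rewrite divr_ge0 ?(ltW r0) ?(al_ge0 adm).
apply: Z => //; last exact: (al_int adm).
by move=> r r0; rewrite divr_ge0 ?(ltW r0) ?(al_ge0 adm).
Qed.

(** psi0 is 1 - |x|^2 in Q1. *)
Lemma psi0_lim1 : lim_at al 1 (@psi0 R) 1.
Proof.
have fw := wt_disc adm; set W := (X in (X < _)%E) in fw.
have W0 : (0 <= W)%E by apply: rint_ge0; exact: (wt_ge0 adm).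
exists (fine W); first exact: fine_ge0.
move=> e /andP[e0 e1]; have mB : measurable [set x : R * R | enorm x < 1] by exact: (@measurable_enorm_itv R `]-oo, 1[).
have mw := measurable_wt adm; have w0 := wt_ge0 adm.
apply: (@le_trans _ _ (\int[lb2]_(x in ann 1 0 e) (e ^+ 2 * wt x)%:E)%E).
  apply: rint_le; [exact: measurable_ann|exact: (measurable_sqdev adm 1 (@psi0_measurable R))|exact: measurable_funM| | ].
  - by move=> x; exact: (sqdev_ge0 adm).
  move=> x [sx /andP[x0 xe]]; rewrite ler_wpM2r//.
  have x1 : enorm x < 1 by exact: lt_trans e1.
  move: sx; rewrite sec1E => -[p1 p2]; rewrite psi0_mul psi_Q1// cone_in// mulr1.
  rewrite addrAC subrr sub0r sqrrN ler_sqr ?nnegrE ?sqr_ge0 ?(ltW e0)//.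
  by apply: le_trans (ltW xe); rewrite expr2 ler_piMl ?enorm_ge0// ltW.
rewrite rintZ ?sqr_ge0//; last exact: measurable_ann.
rewrite (mulrC (fine W)) [leRHS]EFinM; apply: lee_wpmul2l; first by rewrite lee_fin sqr_ge0.
rewrite fineK ?ge0_fin_numE//; apply: rint_sub => //; first exact: measurable_ann.
by move=> x [_ /andP[_ xe]]; exact: lt_trans e1.
Qed.

Lemma psi0_limN1 : lim_at al (-1) (@psi0 R) 0.
Proof.
exists 0 => // e _; rewrite mul0r le_eqVlt; apply/orP; left; apply/eqP.
apply: integral0_eq => x [sx _]; move: sx; rewrite secN1E => -[p1 p2].
by rewrite psi0_mul psi_Q3 ?(ltW p1)// mulr0 subr0 expr0n /= mul0r.
Qed.

End psi0_energy.

(** * The three spaces in terms of traces *)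

Section traces.
Context (R : realType).
Implicit Types (x y : R * R) (u v f g h : R * R -> R) (s k l c : R).
Local Notation lb2 := (@leb2 R).
Variables (a : R -> \bar R) (al : R -> R) (K : R).
Hypotheses (adm : admissible al K) (rhoE : forall x : R * R, rho a x = (wt al x)%:E).

Let sq1 : 1 ^+ 2 = 1 :> R. Proof. exact: expr1n. Qed.
Let sqN1 : (-1) ^+ 2 = 1 :> R. Proof. by rewrite sqrrN expr1n. Qed.

Lemma Wsp_meas u : Wsp a u -> measurable_fun [set: R * R] u.
Proof. by case=> [[[mu_ _] _ _] _]. Qed.

(** Every function of finite energy has both traces. *)
Lemma Wsp_lim s u : s ^+ 2 = 1 -> Wsp a u -> exists k, lim_at al s u k.
Proof. by move=> s1 /(WspP adm rhoE)[g [h [G fin]]]; exact: (lim_exists adm s1 G fin). Qed.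

Lemma Wsp_comb u v c : Wsp a u -> Wsp a v -> Wsp a (c *: u + v).
Proof.
move=> /(WspP adm rhoE)[g [h [G fin]]] /(WspP adm rhoE)[g' [h' [G' fin']]]; apply/(WspP adm rhoE).
exists (c *: g + g'), (c *: h + h'); split; first exact: gradD.
apply: (le_lt_trans (energy_comb adm c measurableT G G')).
have e0 (p q r : R * R -> R) : (0 <= energy al setT p q r)%E.
  by apply: integral_ge0 => x _; rewrite lee_fin mulr_ge0 ?dens_ge0 ?(wt_ge0 adm).
have h2 : (0 <= (2 * c ^+ 2)%:E)%E by rewrite lee_fin mulr_ge0 ?sqr_ge0.
by apply: lte_add_pinfty; rewrite lte_mul_pinfty.
Qed.

Lemma Wsp_test f : test_function setT f -> Wsp a f.
Proof.
move=> tf; apply/(WspP adm rhoE); exists ('D_(@e1 R) f), ('D_(@e2 R) f).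
split; first exact: grad_test.
exact: (energy_test adm tf).
Qed.

Lemma Wsp_psi0 : Wsp a (@psi0 R).
Proof.
apply/(WspP adm rhoE); exists (psi0_d (@e1 R)), (psi0_d (@e2 R)).
by split; [exact: psi0_grad|exact: psi0_energy adm].
Qed.

Lemma scale1N u v : -1 *: v + u = u - v.
Proof. by rewrite scaleN1r addrC. Qed.

Lemma Wsp_sub u v : Wsp a u -> Wsp a v -> Wsp a (u - v).
Proof. by move=> Wu Wv; rewrite -scale1N; exact: Wsp_comb. Qed.

Lemma lim_sub s u v k l : Wsp a u -> Wsp a v -> lim_at al s u k -> lim_at al s v l -> lim_at al s (u - v) (k - l).
Proof.
move=> Wu Wv Lu Lv; rewrite -scale1N (_ : k - l = -1 * l + k); last by rewrite mulN1r addrC.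
exact: (lim_comb adm (-1) (Wsp_meas Wv) (Wsp_meas Wu) Lv Lu).
Qed.

(** The continuity of the traces, with respect to the norm in which the closures are
    taken. *)
Lemma lim_form_bound s : s ^+ 2 = 1 -> exists2 C : R, 0 <= C & forall (w : R * R -> R) (l e : R), Wsp a w -> lim_at al s w l ->
    (form1 a w w < (e ^+ 2)%:E)%E -> l ^+ 2 <= C * e ^+ 2.
Proof.
move=> s1; have m0 : 0 < kap R * mka al 0 2^-1.
  rewrite mulr_gt0 ?kap_gt0// (mka_gt0 adm)//.
    by rewrite lexx /= invr_gt0.
  by rewrite invf_le1// ler1n.
have K0 := K_ge0 adm.
exists ((2 + 8 * K) / (kap R * mka al 0 2^-1)); first by rewrite divr_ge0 ?(ltW m0)// addr_ge0// mulr_ge0.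
move=> w l e /(WspP adm rhoE)[g [h [G fin]]] L F; have B := lim_bound adm s1 G fin L.
rewrite mulrAC ler_pdivlMr//; apply: le_trans B _; rewrite ler_wpM2l ?addr_ge0 ?mulr_ge0//.
rewrite -lee_fin fineK; first by rewrite -(form1E adm rhoE G) ltW.
rewrite ge0_fin_numE//; apply: integral_ge0 => x _.
by rewrite lee_fin mulr_ge0 ?dens_ge0 ?(wt_ge0 adm).
Qed.

Lemma sqr_small (x C : R) : 0 <= C -> (forall e : R, 0 < e -> x ^+ 2 <= C * e ^+ 2) -> x = 0.
Proof.
move=> C0 H; apply/eqP; rewrite -sqrf_eq0 eq_le sqr_ge0 andbT.
apply/ler_addgt0Pr => d d0; rewrite add0r.
have q0 : 0 < d / (C + 1) by rewrite divr_gt0// ltr_wpDl.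
apply: le_trans (H (Num.sqrt (d / (C + 1))) _) _; first by rewrite sqrtr_gt0.
have -> : Num.sqrt (d / (C + 1)) ^+ 2 = d / (C + 1) := sqr_sqrtr (ltW q0).
by rewrite mulrCA ler_piMr ?(ltW d0)// ler_pdivrMr ?ltr_wpDl// mul1r lerDl.
Qed.

(** Traces are continuous, and vanish for test functions that vanish near the origin;
    conversely [density]. *)
Lemma H0P u : H0sp a u <-> [/\ Wsp a u, lim_at al 1 u 0 & lim_at al (-1) u 0].
Proof.
split=> [[Wu H]|[Wu L1 L3]].
  have H0 s : s ^+ 2 = 1 -> lim_at al s u 0.
    move=> s1; have [k Lk] := Wsp_lim s1 Wu; have [C C0 HC] := lim_form_bound s1.
    rewrite -(_ : k = 0)//; apply: (@sqr_small _ C) => // e e0.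
    have [f tf F] := H e e0.
    have tf' : test_function setT f by case: tf => sf cf _; split.
    have f0 : f 0 = 0 by apply: notsupp0 => s0; case: tf => _ _ /(_ _ s0); apply.
    have L := lim_sub Wu (Wsp_test tf') Lk (lim_test adm s1 tf').
    by have := HC _ _ _ (Wsp_sub Wu (Wsp_test tf')) L F; rewrite f0 subr0.
  by split => //; exact: H0.
split => // e e0; have /(WspP adm rhoE)[g [h [G fin]]] := Wu.
have e20 : 0 < e ^+ 2 / 2 by rewrite divr_gt0// exprn_gt0.
have [f tf F] := density adm G fin L1 L3 e20; exists f => //.
have tf' : test_function setT f by case: tf => sf cf _; split.
have G' := gradD (-1) (grad_test tf') G; rewrite !scale1N in G'.
rewrite (form1E adm rhoE G'); apply: le_lt_trans F _.
by rewrite lte_fin ltr_pdivrMr// ltr_pMr ?exprn_gt0// ltr1n.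
Qed.

Definition plateau : R * R -> R := fun x => 1 - rstep x.

Lemma plateau_test : test_function setT plateau.
Proof.
apply: (@testTP _ _ 2) => [k|x].
  rewrite (_ : plateau = (cst 1 \+ (fun x => -1 * rstep x))); last first.
    by apply/funext => x; rewrite /plateau /= mulN1r.
  by apply: CkD; [exact: Ck_cst|apply: CkZ; exact: smooth_rstep].
have [x2|x2] := leP 2 (enorm x); first by rewrite /plateau rstep1// subrr eqxx.
by have [n1 n2] := norm_le_enorm x; move=> _; split; [exact: le_trans n1 (ltW x2)|exact: le_trans n2 (ltW x2)].
Qed.

Lemma plateau0 : plateau 0 = 1.
Proof. by rewrite /plateau rstep0 ?subr0// /enorm /= expr0n addr0 sqrtr0. Qed.

Lemma plateau_lim s : s ^+ 2 = 1 -> lim_at al s plateau 1.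
Proof. by move=> s1; have := lim_test adm s1 plateau_test; rewrite plateau0. Qed.

Let Wplateau : Wsp a plateau := Wsp_test plateau_test.

(** Test functions have equal traces, and equality is a closed condition. Conversely,
    subtracting a multiple of a test function with value 1 at the origin makes both
    traces 0. *)
Lemma HP u : Hsp a u <-> Wsp a u /\ exists2 k, lim_at al 1 u k & lim_at al (-1) u k.
Proof.
split=> [[Wu H]|[Wu [k L1 L3]]].
  split => //; have [k Lk] := Wsp_lim sq1 Wu; have [l Ll] := Wsp_lim sqN1 Wu; exists k => //.
  rewrite (_ : k = l)//; apply/eqP; rewrite -subr_eq0; apply/eqP.
  have [C C0 HC] := lim_form_bound sq1; have [D D0 HD] := lim_form_bound sqN1.
  apply: (@sqr_small _ (2 * C + 2 * D)) => [|e e0]; first by rewrite addr_ge0// mulr_ge0.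
  have [f tf F] := H e e0; have Wf := Wsp_test tf.
  have B1 := HC _ _ _ (Wsp_sub Wu Wf) (lim_sub Wu Wf Lk (lim_test adm sq1 tf)) F.
  have B3 := HD _ _ _ (Wsp_sub Wu Wf) (lim_sub Wu Wf Ll (lim_test adm sqN1 tf)) F.
  have := sqr_split (k - f 0) (- (l - f 0)); rewrite sqrrN.
  rewrite (_ : k - f 0 - (l - f 0) = k - l); last by ring.
  have -> : (2 * C + 2 * D) * e ^+ 2 = 2 * (C * e ^+ 2) + 2 * (D * e ^+ 2) by ring.
  move=> S; apply: le_trans S _.
  by apply: lerD; rewrite ler_wpM2l.
split => // e e0; have Wk : Wsp a (k *: plateau) by have := Wsp_comb k Wplateau (Wsp_sub Wu Wu); rewrite subrr addr0.
have Lk s : s ^+ 2 = 1 -> lim_at al s (k *: plateau) k.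
  move=> s1; have [l Ll] := Wsp_lim s1 Wu.
  have := lim_comb adm k (Wsp_meas Wplateau) (Wsp_meas (Wsp_sub Wu Wu)) (plateau_lim s1) (lim_sub Wu Wu Ll Ll).
  by rewrite !subrr !addr0 mulr1.
have [_ /(_ e e0)[f tf F]] : H0sp a (u - k *: plateau).
  apply/H0P; split; [exact: Wsp_sub|..].
    by have := lim_sub Wu Wk L1 (Lk _ sq1); rewrite subrr.
  by have := lim_sub Wu Wk L3 (Lk _ sqN1); rewrite subrr.
have tkf : test_function setT (k *: plateau + f).
  have tf' : test_function setT f by case: tf => sf cf _; split.
  have [M1 _ b1] := test_bsupp plateau_test; have [M2 _ b2] := test_bsupp tf'.
  apply: (@testTP _ _ (Num.max M1 M2)) => [j|x].
    exact: CkD (CkZ k (test_smooth plateau_test j)) (test_smooth tf' j).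
  have [p0|/b1[x1 x2] _] := eqVneq (plateau x) 0; last by rewrite !le_max x1 x2.
  have -> : (k *: plateau + f) x = f x by change (k * plateau x + f x = f x); rewrite p0 mulr0 add0r.
  by move=> /b2[x1 x2]; rewrite !le_max x1 x2 !orbT.
by exists (k *: plateau + f) => //; rewrite opprD addrA.
Qed.

Lemma Wsp0 : Wsp a 0.
Proof. by have := Wsp_sub Wplateau Wplateau; rewrite subrr. Qed.

Lemma lim0 s : s ^+ 2 = 1 -> lim_at al s 0 0.
Proof.
by move=> s1; have := lim_sub Wplateau Wplateau (plateau_lim s1) (plateau_lim s1); rewrite !subrr.
Qed.

Lemma Wsp_subspace : is_subspace (Wsp a).
Proof. by split; [exact: Wsp0|move=> c u v; exact: Wsp_comb]. Qed.

Lemma lim_combW s u v k l c : Wsp a u -> Wsp a v -> lim_at al s u k -> lim_at al s v l ->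
  lim_at al s (c *: u + v) (c * k + l).
Proof. by move=> Wu Wv; exact: (lim_comb adm c (Wsp_meas Wu) (Wsp_meas Wv)). Qed.

Lemma Hsp_subspace : is_subspace (Hsp a).
Proof.
split; first by apply/HP; split; [exact: Wsp0|exists 0; exact: lim0].
move=> c u v /HP[Wu [k L1 L3]] /HP[Wv [l M1 M3]]; apply/HP; split; first exact: Wsp_comb.
by exists (c * k + l); exact: lim_combW.
Qed.

Lemma H0sp_subspace : is_subspace (H0sp a).
Proof.
split; first by apply/H0P; split; [exact: Wsp0|exact: lim0..].
move=> c u v /H0P[Wu L1 L3] /H0P[Wv M1 M3]; apply/H0P; split; first exact: Wsp_comb.
  by have := lim_combW c Wu Wv L1 M1; rewrite mulr0 addr0.
by have := lim_combW c Wu Wv L3 M3; rewrite mulr0 addr0.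
Qed.

Lemma Wsp_scale u c : Wsp a u -> Wsp a (c *: u).
Proof. by move=> Wu; have := Wsp_comb c Wu Wsp0; rewrite addr0. Qed.

Lemma lim_scale s u k c : s ^+ 2 = 1 -> Wsp a u -> lim_at al s u k -> lim_at al s (c *: u) (c * k).
Proof. by move=> s1 Wu L; have := lim_combW c Wu Wsp0 L (lim0 s1); rewrite !addr0. Qed.

(** Codimension one from a real-valued defect k: subtracting c e removes it for exactly
    one c. *)
Lemma codim1 (U V : set (R * R -> R)) (e : R * R -> R) :
  is_subspace U -> is_subspace V -> U `<=` V -> V e ->
  (forall v, V v -> exists k, forall c, U (v - c *: e) <-> c = k) -> has_codim U V 1.
Proof.
move=> sU sV UV Ve H; split => //; exists (fun=> e); split => // v Vv.
have [k Hk] := H v Vv; exists (const_mx k); split; first by rewrite big_ord1 mxE; exact/Hk.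
by move=> c; rewrite big_ord1 => /Hk E; apply/rowP => i; rewrite mxE ord1 E.
Qed.

Lemma codim_H0_H : has_codim (H0sp a) (Hsp a) 1.
Proof.
have Hp : Hsp a plateau by apply/HP; split => //; exists 1; exact: plateau_lim.
apply: (codim1 H0sp_subspace Hsp_subspace _ Hp) => [u /H0P[Wu L1 L3]|v].
  by apply/HP; split => //; exists 0.
move=> /HP[Wv [k L1 L3]]; exists k => c.
have Wc := Wsp_scale c Wplateau.
have S s : s ^+ 2 = 1 -> lim_at al s v k -> lim_at al s (v - c *: plateau) (k - c).
  by move=> s1 L; have := lim_sub Wv Wc L (lim_scale c s1 Wplateau (plateau_lim s1)); rewrite mulr1.
split=> [/H0P[Wd M1 _]|->].
  by apply/esym/eqP; rewrite -subr_eq0; apply/eqP; exact: (lim_unique adm sq1 (Wsp_meas Wd) (S _ sq1 L1) M1).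
have Wk := Wsp_scale k Wplateau.
apply/H0P; split; first exact: (Wsp_sub Wv Wk).
  by have := lim_sub Wv (Wsp_scale k Wplateau) L1 (lim_scale k sq1 Wplateau (plateau_lim sq1)); rewrite mulr1 subrr.
by have := lim_sub Wv (Wsp_scale k Wplateau) L3 (lim_scale k sqN1 Wplateau (plateau_lim sqN1)); rewrite mulr1 subrr.
Qed.

(** c must be the difference of the two traces of v, since the traces of psi0 are 1 and
    0. *)
Lemma jump_psi0 v : Wsp a v -> exists k, forall c, Hsp a (v - c *: @psi0 R) <-> c = k.
Proof.
move=> Wv; have [k Lk] := Wsp_lim sq1 Wv; have [l Ll] := Wsp_lim sqN1 Wv.
exists (k - l) => c; have Wc := Wsp_scale c Wsp_psi0.
have S1 := lim_sub Wv Wc Lk (lim_scale c sq1 Wsp_psi0 (psi0_lim1 adm)).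
have S3 := lim_sub Wv Wc Ll (lim_scale c sqN1 Wsp_psi0 (psi0_limN1 al)).
rewrite mulr1 in S1; rewrite mulr0 subr0 in S3.
split=> [/HP[Wd [m M1 M3]]|E].
  have := lim_unique adm sq1 (Wsp_meas Wd) S1 M1; have := lim_unique adm sqN1 (Wsp_meas Wd) S3 M3.
  by move=> -> <-; ring.
apply/HP; split; first exact: Wsp_sub.
exists l => //; rewrite (_ : l = k - c)//; rewrite E; ring.
Qed.

Lemma codim_H_W : has_codim (Hsp a) (Wsp a) 1.
Proof.
apply: (codim1 Hsp_subspace Wsp_subspace _ Wsp_psi0) => [u /HP[]//|v].
exact: jump_psi0.
Qed.

Lemma Wsp_decomp : Wsp a = [set h + c *: @psi0 R | h in Hsp a & c in [set: R]].
Proof.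
apply/seteqP; split=> [v Wv|_ [h /HP[Wh _] [c _ <-]]].
  have [k Hk] := jump_psi0 Wv; exists (v - k *: @psi0 R); first exact/Hk.
  by exists k => //; rewrite subrK.
by rewrite addrC; exact: Wsp_comb Wsp_psi0 Wh.
Qed.

End traces.

(** * Replacing a by a real-valued profile *)

Section reduction.
Context (R : realType).
Local Notation mu := (@lebesgue_measure R).
Variables (a : R -> \bar R).
Hypothesis a_meas : measurable_fun (`]0, 1]%classic : set R) a.
Hypothesis cond_i : forall eps : R, 0 < eps -> exists2 c : R, 0 < c &
     forall r : R, eps < r <= 1 -> (c%:E <= a r)%E /\ (c%:E <= (a r)^-1)%E.

Definition profile (r : R) : R := if r \in `]0, 1[%classic then fine (a r) else 1.

(** [cond_i] at a level below r makes a finite and positive at r. *)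
Lemma profileE r : 0 < r < 1 -> a r = (profile r)%:E /\ 0 < profile r.
Proof.
move=> /andP[r0 r1]; have r2 : r / 2 < r <= 1 by rewrite ltr_pdivrMr// ltr_pMr// ltr1n ltW.
have [c c0 /(_ r r2)[H1 H2]] := cond_i (divr_gt0 r0 (ltr0Sn R 1)).
rewrite /profile mem_set /= ?in_itv /= ?r0//.
move: H1 H2; case: (a r) => [x| |] /=; [|by move=> _; rewrite lee_fin leNgt c0|by []].
by rewrite lee_fin => cx _; split => //; exact: lt_le_trans cx.
Qed.

Lemma profile_out r : ~ (0 < r < 1) -> profile r = 1.
Proof. by move=> H; rewrite /profile memNset //= in_itv. Qed.

Lemma quadrants (x : R * R) : 0 < enorm x -> (@Q1 R `|` @Q3 R) x \/ (@Q2 R `|` @Q4 R) x.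
Proof.
move=> x0; have [p1|p1|p1] := ltgtP x.1 0; have [p2|p2|p2] := ltgtP x.2 0.
- by left; right; split => //; exact: ltW.
- by right; left; split => //; exact: ltW.
- by left; right; split => //; rewrite p2.
- by right; right; split => //; exact: ltW.
- by left; left; split => //; exact: ltW.
- by left; left; split => //; rewrite p2.
- by right; right; split => //; rewrite p1.
- by right; left; split => //; rewrite p1.
- by move: x0; rewrite /enorm p1 p2 expr0n /= addr0 sqrtr0 ltxx.
Qed.

Lemma Q24_notin (x : R * R) : (@Q2 R `|` @Q4 R) x -> (x \in @Q1 R `|` @Q3 R) = false.
Proof.
by move=> H; apply/negbTE/negP => /set_mem; case: H => -[p1 p2] [] [q1 q2]; move: p1 p2 q1 q2 => *; lra.
Qed.

Lemma Q24_pos (x : R * R) : (@Q2 R `|` @Q4 R) x -> 0 < enorm x.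
Proof.
have [_ n2] := norm_le_enorm x; case=> -[_ p2]; apply: lt_le_trans n2; rewrite normr_gt0; [exact: lt0r_neq0|exact: ltr0_neq0].
Qed.

Lemma Q13_pos (x : R * R) : (@Q1 R `|` @Q3 R) x -> 0 < enorm x.
Proof.
have [n1 _] := norm_le_enorm x; case=> -[p1 _]; apply: lt_le_trans n1; rewrite normr_gt0; [exact: lt0r_neq0|exact: ltr0_neq0].
Qed.

Lemma rho_profile (x : R * R) : rho a x = (wt profile x)%:E.
Proof.
rewrite /rho /wt; case: ifPn => [/set_mem[xQ xd]|/negP n13].
  have x0 := Q13_pos xQ; have [-> p0] : a (enorm x) = (profile (enorm x))%:E /\ 0 < profile (enorm x).
    by apply: profileE; rewrite x0.
  by rewrite inver gt_eqF// mem_set.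
case: ifPn => [/set_mem[xQ xd]|/negP n24].
  have x0 := Q24_pos xQ; have [-> p0] : a (enorm x) = (profile (enorm x))%:E /\ 0 < profile (enorm x).
    by apply: profileE; rewrite x0.
  by rewrite Q24_notin.
rewrite profile_out; first by rewrite invr1; case: ifP.
move=> /andP[x0 x1]; have [xQ|xQ] := quadrants x0.
  by apply: n13; apply/mem_set.
by apply: n24; apply/mem_set.
Qed.

Let mI : measurable (`]0%R, 1%R[%classic : set R). Proof. exact: measurable_itv. Qed.

Lemma measurable_profile : measurable_fun [set: R] profile.
Proof.
rewrite -(setvU (`]0%R, 1%R[%classic : set R)); apply/measurable_funU => //; first exact: measurableC.
split.
  have mc : measurable_fun (~` (`]0%R, 1%R[%classic : set R)) (cst 1 : R -> R) by exact: measurable_cst.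
  by apply: eq_measurable_fun mc => r; rewrite inE => nr; rewrite /profile memNset.
have mf : measurable_fun (`]0%R, 1%R[%classic : set R) (fun r => fine (a r)).
  apply: (measurableT_comp (@fine_measurable R setT measurableT)).
  apply: measurable_funS a_meas => //.
  by move=> r; rewrite /= !in_itv /= => /andP[-> /ltW ->].
by apply: eq_measurable_fun mf => r rI; rewrite /profile rI.
Qed.

Let mp : measurable_fun [set: R] (fun r => profile r / r).
Proof. by apply: measurable_funM; [exact: measurable_profile|exact: measurable_inv]. Qed.

Let mpV : measurable_fun [set: R] (fun r => r / profile r).
Proof. by apply: measurable_funM => //; exact: measurableT_comp (@measurable_inv R) measurable_profile. Qed.

Let apE r : 0 < r < 1 -> (a r / r%:E)%E = (profile r / r)%:E.
Proof.
move=> r01; have [-> _] := profileE r01; case/andP: r01 => r0 _.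
by rewrite inver gt_eqF// EFinM.
Qed.

Let apVE r : 0 < r < 1 -> (r%:E / a r)%E = (r / profile r)%:E.
Proof.
by move=> r01; have [-> p0] := profileE r01; rewrite inver gt_eqF// EFinM.
Qed.

(** The end point has measure 0, so the integrals over half-open intervals in the
    hypotheses become integrals of real functions over open ones. *)
Let closed_end (e : R) (f : R -> \bar R) (g : R -> R) : e <= 1 -> measurable_fun [set: R] g ->
  (forall r, 0 < r < 1 -> f r = (g r)%:E) ->
  (\int[mu]_(r in `]0%R, e]) f r = \int[mu]_(r in `]0%R, e[) (g r)%:E)%E.
Proof.
move=> e1 mg fg; have E r : r \in (`]0%R, e[%classic : set R) -> (g r)%:E = f r.
  rewrite inE /= in_itv /= => /andP[r0 re]; rewrite fg// r0 /=; exact: lt_le_trans e1.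
rewrite -integral_itv_bndo_bndc.
  by apply: eq_integral => r rI; rewrite E.
apply: (eq_measurable_fun (EFin \o g)) => //.
by apply: measurable_funTS; apply/measurable_EFinP.
Qed.

Lemma profile_admissible (K : R) :
  (\int[lebesgue_measure]_(r in `]0%R, 1%R]) (a r / r%:E) < +oo)%E ->
  (\int[lebesgue_measure]_(r in `]0%R, 1%R]) (r%:E / a r) < +oo)%E ->
  (forall eps : R, 0 < eps < 1 ->
     ((eps ^- 2)%:E *
        \int[lebesgue_measure]_(r in `]0%R, eps])
          (r%:E / a r * \int[lebesgue_measure]_(s in `]0%R, r]) (a s / s%:E))
      < K%:E)%E) -> admissible profile K.
Proof.
move=> c1 c2 c3; split.
- move=> r; have [/profileE[]//|/negP r01] := boolP (0 < r < 1).
  by rewrite profile_out.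
- exact: measurable_profile.
- move=> d d0; have [c c0 Hc] := cond_i d0; exists (Num.min c 1); first by rewrite lt_min c0 ltr01.
  move=> r dr; have [r01|/negP r01] := boolP (0 < r < 1).
    have [E p0] := profileE r01; case/andP: (r01) => r0 r1.
    have [|H1 H2] := Hc r; first by rewrite dr ltW.
    move: H1 H2; rewrite E inver gt_eqF// !lee_fin => H1 H2.
    by split; rewrite ge_min ?H1 ?H2.
  by rewrite profile_out// invr1 ge_min lexx orbT.
- by rewrite -(closed_end (lexx 1) mp apE).
- by rewrite -(closed_end (lexx 1) mpV apVE).
- move=> e /andP[e0 e1]; have := c3 e; rewrite e0 e1 => /(_ isT) H.
  have p0 r : 0 < profile r.
    by have [/profileE[]//|/negP r01] := boolP (0 < r < 1); rewrite profile_out.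
  have rI r : r \in (`]0%R, e[%classic : set R) -> 0 < r < 1.
    by rewrite inE /= in_itv /= => /andP[-> re]; exact: lt_trans e1.
  pose Z (r : R) := (\int[mu]_(s in `]0%R, r[) (profile s / s)%:E)%E.
  have ZE r : 0 < r < 1 -> (\int[mu]_(s in `]0%R, r]) (a s / s%:E) = Z r)%E.
    by move=> /andP[_ r1]; exact: closed_end (ltW r1) mp apE.
  have mZ : measurable_fun [set: R] Z.
    have mq : measurable_fun [set: R] (fun r => profile r / `|r|).
      apply: measurable_funM; first exact: measurable_profile.
      exact: measurableT_comp (@measurable_inv R) (@normr_measurable R setT).
    have q0 r : 0 <= profile r / `|r| by rewrite divr_ge0// ltW.
    rewrite (_ : Z = (fun r => \int[mu]_(q in `]0%R, r[) (profile q / `|q|)%:E)%E); first exact: measurable_primitive.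
    apply/funext => r; apply: eq_integral => q; rewrite inE /= in_itv /= => /andP[q0' _].
    by rewrite gtr0_norm.
  pose h (r : R) : \bar R := ((r / profile r)%:E * Z r)%E.
  have mh : measurable_fun [set: R] h.
    by apply: emeasurable_funM => //; exact/measurable_EFinP.
  have E : (\int[mu]_(r in `]0%R, e]) (r%:E / a r * \int[mu]_(s in `]0%R, r]) (a s / s%:E)) = \int[mu]_(r in `]0%R, e[) h r)%E.
    rewrite -integral_itv_bndo_bndc.
      by apply: eq_integral => r /rI r01; rewrite /h -(apVE r01) (ZE _ r01).
    apply: (eq_measurable_fun h); last exact: measurable_funTS.
    by move=> r /rI r01; rewrite /h -(apVE r01) (ZE _ r01).
  move: H; rewrite E => H; have e20 : 0 < e ^+ 2 by rewrite exprn_gt0.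
  have := lee_wpmul2l (ltW e20 : (0 <= (e ^+ 2)%:E)%E) (ltW H).
  by rewrite muleA -EFinM divff ?gt_eqF// mul1e -EFinM mulrC.
Qed.

End reduction.

Theorem corollary3p8 (R : realType) (a : R -> \bar R)
  (a_meas : measurable_fun (`]0, 1]%classic : set R) a)
  (a_ge0 : forall r : R, 0 < r <= 1 -> (0 <= a r)%E)
  (cond_i : forall eps : R, 0 < eps -> exists2 c : R, 0 < c &
     forall r : R, eps < r <= 1 -> (c%:E <= a r)%E /\ (c%:E <= (a r)^-1)%E)
  (cond_ii1 : (\int[lebesgue_measure]_(r in `]0%R, 1%R]) (a r / r%:E) < +oo)%E)
  (cond_ii2 : (\int[lebesgue_measure]_(r in `]0%R, 1%R]) (r%:E / a r) < +oo)%E)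
  (cond_iii : exists2 K : R, 0 < K & forall eps : R, 0 < eps < 1 ->
     ((eps ^- 2)%:E *
        \int[lebesgue_measure]_(r in `]0%R, eps])
          (r%:E / a r * \int[lebesgue_measure]_(s in `]0%R, r]) (a s / s%:E))
      < K%:E)%E) :
  [/\ has_codim (H0sp a) (Hsp a) 1,
      has_codim (Hsp a) (Wsp a) 1 &
      Wsp a = [set h + c *: @psi0 R | h in Hsp a & c in [set: R]]].
Proof.
have [K _ hK] := cond_iii.
have adm := profile_admissible a_meas cond_i cond_ii1 cond_ii2 hK.
have rE := rho_profile cond_i.
by split; [exact: codim_H0_H adm rE|exact: codim_H_W adm rE|exact: Wsp_decomp adm rE].
Qed.
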